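(* Let $m_1,m_2,m_3\in\mathbb{R}\setminus\{0\}$ and $\lambda_1,\lambda_2,\lambda_3,\mu_1,\mu_2,\mu_3\in\mathbb{C}\setminus\{0\}$ satisfy $$m_1+m_2=m_3,\qquad \operatorname{Im}\lambda_j<0\ \ (j=1,2,3),$$ $$\kappa_1\mu_1+\kappa_2\mu_2=\kappa_3\overline{\mu_3}\quad\text{for some } \kappa_1,\kappa_2,\kappa_3>0,$$ and let $1<s<2$. Then there exists $\varepsilon_0>0$ such that for every $\varphi=(\varphi_1,\varphi_2,\varphi_3)\in H^{s,0}(\mathbb{R}^2)\cap H^{0,s}(\mathbb{R}^2)$ ($\mathbb{C}^3$-valued) with $\|\varphi\|_{H^{s,0}}+\|\varphi\|_{H^{0,s}}\le\varepsilon_0$, the initial value problem $$\begin{cases} i\partial_t u_1+\frac{1}{2m_1}\Delta u_1=\lambda_1|u_1|u_1+\mu_1\overline{u_2}u_3,\\ i\partial_t u_2+\frac{1}{2m_2}\Delta u_2=\lambda_2|u_2|u_2+\mu_2\overline{u_1}u_3,\\ i\partial_t u_3+\frac{1}{2m_3}\Delta u_3=\lambda_3|u_3|u_3+\mu_3u_1u_2,\end{cases}\quad t>0,\ x\in\mathbb{R}^2,$$ $$u_j(0,x)=\varphi_j(x),\quad x\in\mathbb{R}^2,\ j=1,2,3,$$ admits a unique global solution $u=(u_1,u_2,u_3)\in C\bigl([0,\infty);H^{s,0}(\mathbb{R}^2)\cap H^{0,s}(\mathbb{R}^2)\bigr)$, and there exists a positive constant $C_1$ such that $$\|u(t,\cdot)\|_{L^\infty}\le\frac{C_1}{(1+t)\log(2+t)}\qquad\text{for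 all } t\ge0.$$
   Context: For $s,\sigma\ge0$, $H^{s,\sigma}(\mathbb{R}^2)$ is the weighted Sobolev space of $f\in L^2(\mathbb{R}^2)$ with $(1+|x|^2)^{\sigma/2}(1-\Delta)^{s/2}f\in L^2(\mathbb{R}^2)$, with norm $\|f\|_{H^{s,\sigma}}=\|(1+|x|^2)^{\sigma/2}(1-\Delta)^{s/2}f\|_{L^2}$. The same notation is used for $\mathbb{C}^3$-valued functions, $\mathbb{C}^3$ carrying its standard Euclidean norm. $\Delta$ is the Laplacian in $x\in\mathbb{R}^2$. Solutions are understood in the usual sense of the Duhamel integral equation $u_j(t)=e^{\frac{it}{2m_j}\Delta}\varphi_j-i\int_0^te^{\frac{i(t-\tau)}{2m_j}\Delta}F_j(u(\tau))\,d\tau$, where $F_j(u)$ is the right-hand side of the $j$-th equation. *)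

(* Defs.v *)
From mathcomp Require Export all_boot all_order all_algebra.
From mathcomp Require Export all_classical all_reals all_analysis.
From mathcomp Require Export complex.

Export Order.TTheory GRing.Theory Num.Theory.
Export numFieldNormedType.Exports.

Set Implicit Arguments.
Unset Strict Implicit.
Unset Printing Implicit Defensive.

Local Open Scope classical_set_scope.
Local Open Scope ring_scope.
Local Open Scope complex_scope.

Notation plane R := (measurableTypeR R * measurableTypeR R)%type.

Definition i1 : 'I_3 := @Ordinal 3 0 isT.
Definition i2 : 'I_3 := @Ordinal 3 1 isT.
Definition i3 : 'I_3 := @Ordinal 3 2 isT.

Section Schroedinger.
Context {R : realType}.

Definition leb2 : {measure set (plane R) -> \bar R} :=
  (@lebesgue_measure R \x @lebesgue_measure R)%E.

Definition dot (x y : R * R) : R := x.1 * y.1 + x.2 * y.2.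

Definition modulus (z : R[i]) : R := ComplexField.Normc.normc z.

Definition cis (a : R) : R[i] := cos a +i* sin a.

Definition cint (D : set (plane R)) (f : plane R -> R[i]) : R[i] :=
  (\int[leb2]_(x in D) complex.Re (f x)) +i*
  (\int[leb2]_(x in D) complex.Im (f x)).

Definition L2norm (f : plane R -> R[i]) : \bar R :=
  ('N[leb2]_2%:E[EFin \o (fun x => modulus (f x))])%E.

(* Elements of L^2 are represented by Borel functions; equality in L^2 is
   equality leb2-almost everywhere. *)
Definition L2 (f : plane R -> R[i]) : Prop :=
  [/\ measurable_fun setT (fun x => complex.Re (f x)),
      measurable_fun setT (fun x => complex.Im (f x)) &
      (L2norm f < +oo)%E].

(* (2 pi)^-1 int_(|x| <= n) e^(i c x.xi) f(x) dx; the sign c is -1 for the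
   Fourier transform and 1 for its inverse. *)
Definition fourier_trunc (c : R) (f : plane R -> R[i]) (n : nat)
    (xi : plane R) : R[i] :=
  ((2 * pi)^-1)%:C *
  cint [set x | dot x x <= n%:R ^+ 2] (fun x => cis (c * dot x xi) * f x).

Definition is_fourier (c : R) (f g : plane R -> R[i]) : Prop :=
  [/\ L2 f, L2 g &
      (fun n => L2norm (fun xi => fourier_trunc c f n xi - g xi)) @ \oo
        --> 0%E].

(* The unitary Fourier transform on L^2 (Plancherel) and its inverse; they
   take the value 0 at functions that are not in L^2. *)
Definition fourier (f : plane R -> R[i]) : plane R -> R[i] :=
  xget (fun=> 0) [set g | is_fourier (-1) f g].

Definition inv_fourier (f : plane R -> R[i]) : plane R -> R[i] :=
  xget (fun=> 0) [set g | is_fourier 1 f g].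

Definition fourier_mult (a f : plane R -> R[i]) : plane R -> R[i] :=
  inv_fourier (fun xi => a xi * fourier f xi).

(* (1 + |x|^2)^(r/2) *)
Definition bracket (r : R) (x : plane R) : R := (1 + dot x x) `^ (r / 2).

(* (1 - Delta)^(s/2) *)
Definition bessel (s : R) (f : plane R -> R[i]) : plane R -> R[i] :=
  fourier_mult (fun xi => (bracket s xi)%:C) f.

(* exp((i t / (2 m)) Delta) *)
Definition propagator (m t : R) (f : plane R -> R[i]) : plane R -> R[i] :=
  fourier_mult (fun xi => cis (- (t / (2 * m) * dot xi xi))) f.

Definition C3 := 'rV[R[i]]_3.

Definition entry (f : plane R -> C3) (j : 'I_3) : plane R -> R[i] :=
  fun x => f x 0 j.

(* The Euclidean norm of C^3; the library norm on row vectors is the max. *)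
Definition enorm (v : C3) : R := Num.sqrt (\sum_j modulus (v 0 j) ^+ 2).

Definition Linfnorm (f : plane R -> C3) : \bar R :=
  ('N[leb2]_+oo[EFin \o (fun x => enorm (f x))])%E.

(* The second condition says that (1 - Delta)^(s/2) f is in L^2, so that
   [bessel s] in the third one is applied inside its domain. *)
Definition in_H (s sigma : R) (f : plane R -> C3) : Prop :=
  forall j,
    [/\ L2 (entry f j),
        L2 (fun xi => (bracket s xi)%:C * fourier (entry f j) xi) &
        L2 (fun x => (bracket sigma x)%:C * bessel s (entry f j) x)].

Definition Hnorm (s sigma : R) (f : plane R -> C3) : \bar R :=
  ('N[leb2]_2%:E[EFin \o (fun x =>
    bracket sigma x * enorm (\row_j bessel s (entry f j) x))%R])%E.

Definition in_X (s : R) (f : plane R -> C3) : Prop :=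
  in_H s 0 f /\ in_H 0 s f.

Definition Xnorm (s : R) (f : plane R -> C3) : \bar R :=
  (Hnorm s 0 f + Hnorm 0 s f)%E.

(* C([0, oo); H^(s,0) /\ H^(0,s)) *)
Definition continuous_X (s : R) (u : R -> plane R -> C3) : Prop :=
  (forall t : R, 0 <= t -> in_X s (u t)) /\
  (forall t0 : R, 0 <= t0 ->
    (fun t => Xnorm s (fun x => u t x - u t0 x))
      @ within [set t | 0 <= t] (nbhs t0) --> 0%E).

(* h is the L^2-valued Riemann integral of G over [a, b], as the limit in L^2
   of the sums over tagged partitions of mesh tending to 0.  For a continuous
   integrand this is the Bochner integral. *)
Definition is_L2_integral (a b : R) (G : R -> plane R -> R[i])
    (h : plane R -> R[i]) : Prop :=
  L2 h /\
  forall eps : R, 0 < eps -> exists2 delta : R, 0 < delta &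
    forall (n : nat) (p c : nat -> R),
      p 0%N = a -> p n = b ->
      (forall k, (k < n)%N ->
        [/\ p k <= c k, c k <= p k.+1 & p k.+1 - p k < delta]) ->
      (L2norm (fun x => (\sum_(k < n) (p k.+1 - p k)%:C * G (c k) x) - h x)%R
        < eps%:E)%E.

Definition nonlin (lambda mu : 'I_3 -> R[i]) (v : C3) (j : 'I_3) : R[i] :=
  let v1 := v 0 i1 in let v2 := v 0 i2 in let v3 := v 0 i3 in
  [:: lambda i1 * (modulus v1)%:C * v1 + mu i1 * conjc v2 * v3;
      lambda i2 * (modulus v2)%:C * v2 + mu i2 * conjc v1 * v3;
      lambda i3 * (modulus v3)%:C * v3 + mu i3 * v1 * v2]`_j.

(* For u t in H^(s,0) with s > 1, u t is bounded, so the nonlinearity is in L^2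
   and the propagator is only applied to L^2 functions.  At t = 0 the equation
   gives u 0 = phi. *)
Definition duhamel (m : 'I_3 -> R) (lambda mu : 'I_3 -> R[i])
    (phi : plane R -> C3) (u : R -> plane R -> C3) : Prop :=
  forall t : R, 0 <= t -> forall j, exists2 h : plane R -> R[i],
    is_L2_integral 0 t
      (fun tau => propagator (m j) (t - tau)
                    (fun x => nonlin lambda mu (u tau x) j)) h &
    {ae leb2, forall x,
      entry (u t) j x = propagator (m j) t (entry phi j) x - 'i%C * h x}.

Definition global_solution (s : R) (m : 'I_3 -> R) (lambda mu : 'I_3 -> R[i])
    (phi : plane R -> C3) (u : R -> plane R -> C3) : Prop :=
  continuous_X s u /\ duhamel m lambda mu phi u.

End Schroedinger.

(* Main.v *)
(* In terms of the profile g(t) = U(-t) u(t) the system reads g' = -i N(t, g).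
Mass resonance makes the nonlinearity commute with the gauge-compatible
translations in position and in frequency, so the second differences of N(t, g)
are controlled by those of g through a Gagliardo-Nirenberg inequality, and dyadic
sums of second differences give the H^(s,0) and H^(0,s) norms of g. Euler's
scheme for g inherits these bounds: every seminorm grows at most like a small
power of t. By U(t) = M D F M the solution is asymptotic to (1/t) alpha(t, x/t),
alpha being the Fourier transform of the profile, and alpha obeys
i alpha' = F(alpha)/t up to an integrable error. In the energy
sum_j kappa_j |alpha_j|^2 the coupling terms cancel while Im lambda_j < 0
dissipates |alpha|^3/t, which forces |alpha| <= C/log t. The Euler polygons with
dyadic steps are Cauchy in L^2; their limit solves the Duhamel equation, and
uniqueness is a Gronwall argument. *)

From HB Require Import structures.
Require Import Defs.
From mathcomp Require Import measurable_realfun ring lra.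

Set Implicit Arguments.
Unset Strict Implicit.
Unset Printing Implicit Defensive.

Local Open Scope classical_set_scope.
Local Open Scope ring_scope.
Local Open Scope complex_scope.

Local Notation Re := complex.Re.
Local Notation Im := complex.Im.
Local Notation sqrt := Num.sqrt.
Local Notation mfun := (measurable_fun setT).

#[local] Hint Resolve sqr_ge0 powR_ge0 expR_ge0 sqrtr_ge0 pi_ge0 ler0n ler01 : core.

Ltac pos_leaf := first [ by [] | match goal with H : is_true (0 < ?x) |- is_true (0 <= ?x) => exact (ltW H) end
  | by apply: ltW | by apply: ltW; rewrite exprn_gt0
  (* hint search does not see that the zero of the goal, reached through another
    structure, is the canonical one *)
  | match goal with |- is_true (Order.le _ ?x) => let H := fresh in assert (H : is_true (0 <= x)%R) by done; exact H end | lra ].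

Ltac pos := intros; lazymatch goal with
  | |- is_true (@Order.le _ _ _ (EFin _)) => rewrite lee_fin; pos
  | |- is_true (0 <= _ ^+ 2) => exact: sqr_ge0
  | |- is_true (0 <= _ * _) => first [by [] | apply: mulr_ge0; pos]
  | |- is_true (0 <= _ + _) => first [by [] | apply: addr_ge0; pos]
  | |- is_true (0 <= _ ^-1) => rewrite invr_ge0; pos
  | |- is_true (0 <= _ ^+ _) => apply: exprn_ge0; pos
  | |- is_true (0 <= \sum_(_ <- _ | _) _) => apply: sumr_ge0; pos
  | |- is_true (0 < _ * _) => first [by [] | apply: mulr_gt0; pos]
  | |- is_true (0 < _ ^-1) => rewrite invr_gt0; pos
  | |- is_true (0 < _ ^+ _) => apply: exprn_gt0; pos
  | |- _ => pos_leaf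
  end.

Ltac ml := apply: ler_wpM2l; [by pos|].
Ltac mr := apply: ler_wpM2r; [by pos|].

Local Notation cmod := modulus.
Local Notation letr := le_trans.
Local Notation via x := (@le_trans _ _ x).
Local Notation mu := (@leb2 _).

(** The map z -> |z|z is only C^{1,1}, and symmetric second differences fit exactly this regularity.
    The square of their symbol 2 - 2 cos vanishes to fourth order at 0, so dyadic sums with weights
    4^(ks) are available for s < 2, while s > 1 embeds the weighted space into L^1, that is, H^s
    into L^oo. Keeping only the leading term of the factorised evolution costs a relative error
    t^(-a) with a = (s - 1)/4; small data keep the growth of all seminorms below (1 + t)^(a/2),
    which leaves the integrable error t^(-1 - a/2). All bounds are proved on the Euler scheme
    itself: the bootstrap is an induction on the step, and no local existence theory is needed. Two
    points require their own arguments. Bounds on the profile do not yet localise u(t), for which a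
    Weyl commutation splits a Galilean shift into its position and frequency parts. Continuity in
    the weighted norms rests on a majorant of the dyadic pieces common to a whole time interval. The
    Fourier transform on L^2 is built from Gaussian integrals with complex parameters, which also
    yield the kernel of the free evolution. *)

Lemma eq_ler d (T : porderType d) (x y : T) : x = y -> (x <= y)%O. Proof. by move=> ->. Qed.
Lemma sqr_normr {R : realType} (x : R) : `|x| ^+ 2 = x ^+ 2. Proof. exact: real_normK (num_real x). Qed.

(** * Modulus, unimodular phases and exponential of complex numbers *)

Section ComplexNumbers.
Context {R : realType}.
Implicit Types (a b : R) (z w : R[i]).

Lemma sqr_le2 (a b : R) : 0 <= a -> a <= b -> a ^+ 2 <= b ^+ 2.
by move=> a0 ab; rewrite ler_sqr ?nnegrE// (letr a0 ab). Qed.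

Lemma le_sqr2 (a b : R) : 0 <= b -> a ^+ 2 <= b ^+ 2 -> a <= b.
move=> b0 h; rewrite (letr (ler_norm a))// -(ger0_norm b0) -!sqrtr_sqr.
by rewrite ler_wsqrtr.
Qed.

Lemma cmod_sqr z : cmod z ^+ 2 = Re z ^+ 2 + Im z ^+ 2.
by case: z => a b; rewrite /modulus /= sqr_sqrtr ?addr_ge0 ?sqr_ge0. Qed.

Lemma cmod_ge0 z : 0 <= cmod z.
by case: z => a b; rewrite /modulus /= sqrtr_ge0. Qed.
Hint Resolve cmod_ge0 : core.

Lemma cmodM z w : cmod (z * w) = cmod z * cmod w.
exact: ComplexField.Normc.normcM. Qed.
Lemma cmodD z w : cmod (z + w) <= cmod z + cmod w.
exact: le_normcD. Qed.
Lemma cmodN z : cmod (- z) = cmod z.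
exact: normcN. Qed.
Lemma cmodB z w : cmod (z - w) <= cmod z + cmod w.
by rewrite -(cmodN w) cmodD. Qed.
Lemma cmod0 : cmod (0 : R[i]) = 0.
exact: ComplexField.Normc.normc0. Qed.
Lemma cmod1 : cmod (1 : R[i]) = 1.
exact: ComplexField.Normc.normc1. Qed.
Lemma cmod_eq0 z : cmod z = 0 -> z = 0.
exact: ComplexField.Normc.eq0_normc. Qed.
Lemma cmodV z : cmod z^-1 = (cmod z)^-1.
exact: ComplexField.Normc.normcV. Qed.
Lemma cmod_conj z : cmod (conjc z) = cmod z.
by case: z => a b; rewrite /modulus /= sqrrN. Qed.
Lemma cmod_real a : cmod a%:C = `|a|.
by rewrite /modulus /= expr0n /= addr0 sqrtr_sqr. Qed.
Lemma cmod_im (c : R) : cmod (0 +i* c) = `|c|.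
by rewrite /modulus /= expr0n /= add0r sqrtr_sqr. Qed.
Lemma cisD a b : cis (a + b) = cis a * cis b.
by rewrite /cis cosD sinD [sin a * _ + _]addrC. Qed.
Lemma cis0 : cis (0 : R) = 1.
by rewrite /cis cos0 sin0. Qed.
Lemma conj_cis a : conjc (cis a) = cis (- a).
by rewrite /cis cosN sinN. Qed.
Lemma cmod_cis a : cmod (cis a) = 1.
by rewrite /modulus /= cos2Dsin2 sqrtr1. Qed.
Lemma cisNK a : cis a * cis (- a) = 1.
by rewrite -cisD subrr cis0. Qed.
Lemma cisKN a : cis (- a) * cis a = 1.
by rewrite mulrC cisNK. Qed.
Lemma ReD z w : Re (z + w) = Re z + Re w.
by case: z w => a b [c d]. Qed.
Lemma ImD z w : Im (z + w) = Im z + Im w.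
by case: z w => a b [c d]. Qed.
Lemma ReN z : Re (- z) = - Re z.
by case: z. Qed.
Lemma ImN z : Im (- z) = - Im z.
by case: z. Qed.

Lemma ReM z w :
 Re (z * w) = Re z * Re w - Im z * Im w.
by case: z w => a b [c d]. Qed.

Lemma ImM z w :
 Im (z * w) = Re z * Im w + Im z * Re w.
by case: z w => a b [c d]. Qed.

Lemma Re_conj z : Re (conjc z) = Re z.
by case: z. Qed.
Lemma Im_conj z : Im (conjc z) = - Im z.
by case: z. Qed.

Lemma Re_le_cmod z : `|Re z| <= cmod z.
rewrite -(@ler_sqr _ _ _) ?nnegrE ?cmod_ge0// cmod_sqr sqr_normr.
by rewrite lerDl sqr_ge0.
Qed.

Lemma Im_le_cmod z : `|Im z| <= cmod z.
rewrite -(@ler_sqr _ _ _) ?nnegrE ?cmod_ge0// cmod_sqr sqr_normr.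
by rewrite lerDr sqr_ge0.
Qed.

Lemma cmod_le_ReIm z : cmod z <= `|Re z| + `|Im z|.
rewrite -(@ler_sqr _ _ _) ?nnegrE ?cmod_ge0 ?addr_ge0// cmod_sqr sqrrD.
by rewrite !sqr_normr lerD2r lerDl mulrn_wge0// mulr_ge0.
Qed.

Lemma ler_cmod_dist z w : `|cmod z - cmod w| <= cmod (z - w).
rewrite ler_norml; apply/andP; split.
 by rewrite lerNl opprB lerBlDr -(cmodN (z - w)) opprB (letr _ (cmodD _ _))// subrK.
by rewrite lerBlDr (letr _ (cmodD _ _))// subrK.
Qed.

Lemma conjcD z w : conjc (z + w) = conjc z + conjc w.
exact: rmorphD. Qed.
Lemma conjcM z w : conjc (z * w) = conjc z * conjc w.
exact: rmorphM. Qed.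
Lemma complex_eq z w : Re z = Re w -> Im z = Im w -> z = w.
by case: z w => a b [c d] /= -> ->. Qed.
Lemma realcD a b : (a + b)%:C = a%:C + b%:C.
exact: rmorphD. Qed.
Lemma realcM a b : (a * b)%:C = a%:C * b%:C.
exact: rmorphM. Qed.
Definition cexp z : R[i] := (expR (Re z))%:C * cis (Im z).
Lemma cexpD z w : cexp (z + w) = cexp z * cexp w.
by rewrite /cexp ReD ImD expRD cisD realcM mulrACA. Qed.
Lemma cmod_cexp z : cmod (cexp z) = expR (Re z).
by rewrite /cexp cmodM cmod_cis mulr1 cmod_real ger0_norm ?expR_ge0. Qed.

End ComplexNumbers.
#[local] Hint Resolve cmod_ge0 : core.

(** * Measurability and integration of complex-valued functions *)

Section ComplexIntegral.
Context {d : measure_display} {T : measurableType d} {R : realType}.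
Variable mu : {measure set T -> \bar R}.
Implicit Types (f g : T -> R[i]).

Definition cmeas f := mfun (fun x => Re (f x)) /\
 mfun (fun x => Im (f x)).

Lemma cmeasD f g : cmeas f -> cmeas g -> cmeas (fun x => f x + g x).
move=> [f1 f2] [g1 g2]; split.
 by under eq_fun do rewrite ReD; apply: measurable_funD.
by under eq_fun do rewrite ImD; apply: measurable_funD.
Qed.

Lemma cmeasN f : cmeas f -> cmeas (fun x => - f x).
move=> [f1 f2]; split.
 by under eq_fun do rewrite ReN; apply: measurable_funN.
by under eq_fun do rewrite ImN; apply: measurable_funN.
Qed.

Lemma cmeasB f g : cmeas f -> cmeas g -> cmeas (fun x => f x - g x).
by move=> mf mg; apply: cmeasD => //; apply: cmeasN. Qed.

Lemma cmeasM f g : cmeas f -> cmeas g -> cmeas (fun x => f x * g x).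
move=> [f1 f2] [g1 g2]; split.
 by under eq_fun do rewrite ReM; apply: measurable_funB; apply: measurable_funM.
by under eq_fun do rewrite ImM; apply: measurable_funD; apply: measurable_funM.
Qed.

Lemma cmeas_conj f : cmeas f -> cmeas (fun x => conjc (f x)).
move=> [f1 f2]; split.
 by under eq_fun do rewrite Re_conj.
by under eq_fun do rewrite Im_conj; apply: measurable_funN.
Qed.

Lemma cmeas_cst (c : R[i]) : cmeas (fun=> c).
by split; apply: measurable_cst. Qed.
Lemma cmeas_real (h : T -> R) : mfun h -> cmeas (fun x => (h x)%:C).
by move=> mh; split => //=; apply: measurable_cst. Qed.

Lemma cmeas_cis (h : T -> R) : mfun h -> cmeas (fun x => cis (h x)).
move=> mh; split => /=; apply: measurableT_comp => //.
 by apply: continuous_measurable_fun; exact: continuous_cos.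
by apply: continuous_measurable_fun; exact: continuous_sin.
Qed.

Lemma measurable_cmod f : cmeas f -> mfun (fun x => cmod (f x)).
move=> [f1 f2].
have -> : (fun x => cmod (f x)) =
 sqrt \o (fun x => Re (f x) ^+ 2 + Im (f x) ^+ 2).
 by apply/funext => x /=; case: (f x).
apply: measurableT_comp.
 exact: continuous_measurable_fun (@sqrt_continuous R).
by apply: measurable_funD; apply: measurable_funX.
Qed.

Lemma cmeas_cexp f : cmeas f -> cmeas (fun x => cexp (f x)).
move=> [f1 f2]; apply: cmeasM; last exact: cmeas_cis.
by apply: cmeas_real; apply: measurableT_comp.
Qed.

Definition CI f : R[i] :=
 (\int[mu]_x Re (f x))%R +i* (\int[mu]_x Im (f x))%R.
Definition cint1 f := mu.-integrable setT (fun x => (Re (f x))%:E) /\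
 mu.-integrable setT (fun x => (Im (f x))%:E).
Lemma cint1_cmeas f : cint1 f -> cmeas f.
by move=> [/measurable_int/measurable_EFinP h1 /measurable_int/measurable_EFinP h2]. Qed.

Lemma cint1_cmod f : cint1 f -> mu.-integrable setT (fun x => (cmod (f x))%:E).
move=> h; have mf := cint1_cmeas h; case: h => h1 h2.
have h3 := integrableD measurableT (integrable_abse h1) (integrable_abse h2).
apply: (le_integrable measurableT _ _ h3).
 exact/measurable_EFinP/measurable_cmod.
move=> x _ /=; rewrite lee_fin ger0_norm ?cmod_ge0//.
by rewrite (ger0_norm (addr_ge0 _ _))// cmod_le_ReIm.
Qed.

Lemma cint1_le f (h : T -> R) : cmeas f -> mu.-integrable setT (fun x => (h x)%:E) ->
 (forall x, cmod (f x) <= h x) -> cint1 f.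
move=> [mf1 mf2] ih le; split; apply: (le_integrable measurableT _ _ ih).
- exact/measurable_EFinP.
- move=> x _ /=; rewrite lee_fin (letr (Re_le_cmod _))//.
 by rewrite (letr (le x))// ler_norm.
- exact/measurable_EFinP.
- move=> x _ /=; rewrite lee_fin (letr (Im_le_cmod _))//.
 by rewrite (letr (le x))// ler_norm.
Qed.

Lemma cint1D f g : cint1 f -> cint1 g -> cint1 (fun x => f x + g x).
move=> [f1 f2] [g1 g2]; split.
 under eq_fun do rewrite ReD EFinD; exact: integrableD.
under eq_fun do rewrite ImD EFinD; exact: integrableD.
Qed.

Lemma cint1N f : cint1 f -> cint1 (fun x => - f x).
move=> [f1 f2]; split.
 under eq_fun do rewrite ReN EFinN; exact: integrableN.
under eq_fun do rewrite ImN EFinN; exact: integrableN.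
Qed.

Lemma cint1Z (c : R[i]) f : cint1 f -> cint1 (fun x => c * f x).
move=> [f1 f2]; split.
 under eq_fun do rewrite ReM EFinB !EFinM.
 by apply: integrableB => //; apply: integrableZl.
under eq_fun do rewrite ImM EFinD !EFinM.
by apply: integrableD => //; apply: integrableZl.
Qed.

Lemma CID f g : cint1 f -> cint1 g -> CI (fun x => f x + g x) = CI f + CI g.
move=> [f1 f2] [g1 g2]; rewrite /CI; congr (_ +i* _).
 by under eq_Rintegral do rewrite ReD; rewrite RintegralD.
by under eq_Rintegral do rewrite ImD; rewrite RintegralD.
Qed.

Lemma CIZ (c : R[i]) f : cint1 f -> CI (fun x => c * f x) = c * CI f.
move=> [f1 f2]; case: c => a b.
have i1 k : mu.-integrable setT (EFin \o (fun x => k * Re (f x))).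
 by rewrite /comp; under eq_fun do rewrite EFinM; apply: integrableZl.
have i2 k : mu.-integrable setT (EFin \o (fun x => k * Im (f x))).
 by rewrite /comp; under eq_fun do rewrite EFinM; apply: integrableZl.
apply: complex_eq => /=.
 by under eq_Rintegral do rewrite ReM /=; rewrite RintegralB// !RintegralZl.
by under eq_Rintegral do rewrite ImM /=; rewrite RintegralD// !RintegralZl.
Qed.

Lemma CIN f : cint1 f -> CI (fun x => - f x) = - CI f.
by move=> h; under [in LHS]eq_fun do rewrite -mulN1r; rewrite CIZ// mulN1r. Qed.
Lemma CIB f g : cint1 f -> cint1 g -> CI (fun x => f x - g x) = CI f - CI g.
by move=> hf hg; rewrite CID ?CIN//; apply: cint1N. Qed.
Lemma eq_CI f g : f =1 g -> CI f = CI g.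
by move=> /funext ->. Qed.

Lemma cint1_conj f : cint1 f -> cint1 (fun x => conjc (f x)).
move=> [f1 f2]; split; first by under eq_fun do rewrite Re_conj.
by under eq_fun do rewrite Im_conj EFinN; apply: integrableN.
Qed.

Lemma CI_conj f : cint1 f -> CI (fun x => conjc (f x)) = conjc (CI f).
move=> [f1 f2]; apply: complex_eq => /=.
 by under eq_Rintegral do rewrite Re_conj.
under eq_Rintegral do rewrite Im_conj -mulN1r.
by rewrite RintegralZl// mulN1r.
Qed.

Lemma CI_ae f g : {ae mu, forall x, f x = g x} -> cmeas f -> cmeas g -> CI f = CI g.
move=> fg [f1 f2] [g1 g2]; apply: complex_eq => /=; rewrite /Rintegral; congr fine.
 apply: ae_eq_integral => //; [exact/measurable_EFinP..|].
 by apply: filterS fg => x -> _.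
apply: ae_eq_integral => //; [exact/measurable_EFinP..|].
by apply: filterS fg => x -> _.
Qed.

Lemma cmod_CI f : cint1 f -> cmod (CI f) <= \int[mu]_x cmod (f x).
move=> h; pose z := CI f.
have [zz|z0] := eqVneq z 0; first by rewrite -/z zz cmod0; apply: Rintegral_ge0 => x _; apply: cmod_ge0.
have m0 : 0 < cmod z.
 by rewrite lt_neqAle cmod_ge0 andbT eq_sym; apply/eqP => /cmod_eq0 zz; rewrite zz eqxx in z0.
(* The unimodular factor [c] rotates the integral onto its own modulus, so that only real parts have
   to be compared. *)
pose c := conjc z / (cmod z)%:C.
have mc : cmod c = 1.
 by rewrite /c cmodM cmod_conj cmodV cmod_real ger0_norm ?cmod_ge0// divff// gt_eqF.
have e : cmod z = Re (CI (fun x => c * f x)).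
 rewrite CIZ// -/z /c mulrAC.
 have -> : conjc z * z = (cmod z ^+ 2)%:C.
  by rewrite cmod_sqr; case: (z) => a b; apply: complex_eq => /=; ring.
 by rewrite expr2 realcM mulfK//= eq_complex /= eqxx andbT gt_eqF.
rewrite e /=; apply: le_Rintegral => //.
- by have [] := cint1Z c h.
- exact: cint1_cmod.
- move=> x _; rewrite (letr (ler_norm _))// (letr (Re_le_cmod _))//.
 by rewrite cmodM mc mul1r.
Qed.

Lemma Rintegral_dct0 (g_ : nat -> T -> R) (h : T -> R) :
 (forall n, mfun (g_ n)) ->
 {ae mu, forall x, (fun n => g_ n x) @ \oo --> (0 : R)} ->
 mu.-integrable setT (fun x => (h x)%:E) ->
 (forall n x, `|g_ n x| <= h x) ->
 (fun n => \int[mu]_x g_ n x)%R @ \oo --> (0 : R).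
move=> mg cg ih gh.
have [] := @dominated_convergence _ T R mu setT measurableT
 (fun n x => (g_ n x)%:E) (fun=> 0%E) (fun x => (h x)%:E).
- by move=> n; exact/measurable_EFinP.
- exact: measurable_cst.
- by apply: filterS cg => x cx _; apply/fine_cvgP; split => //=; exact: nearW.
- exact: ih.
- by apply: aeW => x n _ /=; rewrite lee_fin.
move=> _ _; rewrite integral0 => /fine_cvgP[_]; exact.
Qed.

Lemma CI_dct (f_ : nat -> T -> R[i]) f (h : T -> R) :
 (forall n, cmeas (f_ n)) -> cmeas f ->
 {ae mu, forall x, (fun n => cmod (f_ n x - f x)) @ \oo --> (0 : R)} ->
 mu.-integrable setT (fun x => (h x)%:E) ->
 (forall n x, cmod (f_ n x) <= h x) -> (forall x, cmod (f x) <= h x) ->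
 (fun n => cmod (CI (f_ n) - CI f)) @ \oo --> (0 : R).
move=> mf_ mf cf ih le_ le.
have if_ n : cint1 (f_ n) by exact: cint1_le ih (le_ n).
have if0 : cint1 f by exact: cint1_le ih le.
have ih2 : mu.-integrable setT (fun x => (2 * h x)%:E).
 by under eq_fun do rewrite EFinM; apply: integrableZl.
have := @Rintegral_dct0 (fun n x => cmod (f_ n x - f x)) (fun x => 2 * h x) _ cf ih2 _.
move=> H; apply: (@squeeze_cvgr _ _ _ _ (cst 0) (fun n => \int[mu]_x cmod (f_ n x - f x))%R).
- apply: nearW => n; apply/andP; split; [exact: cmod_ge0|rewrite -CIB//].
 by apply: cmod_CI; apply: cint1D => //; apply: cint1N.
- exact: cvg_cst.
- apply: H => [n|n x]; first by apply: measurable_cmod; apply: cmeasB.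
 rewrite ger0_norm ?cmod_ge0// (letr (cmodB _ _))// mulrDl mul1r.
 by rewrite lerD.
Qed.

End ComplexIntegral.

Lemma cmeas_comp {d1 d2 : measure_display} {T1 : measurableType d1} {T2 : measurableType d2}
  {R : realType} (f : T2 -> R[i]) (h : T1 -> T2) :
 cmeas f -> mfun h -> cmeas (fun x => f (h x)).
by move=> [a b] mh; split; [exact: measurableT_comp a mh|exact: measurableT_comp b mh].
Qed.

(** * Fubini for complex integrands *)

Section ComplexFubini.
Context {d1 d2 : measure_display} {T1 : measurableType d1} {T2 : measurableType d2}
 {R : realType}.
Variables (m1 : {sigma_finite_measure set T1 -> \bar R})
 (m2 : {sigma_finite_measure set T2 -> \bar R}).

Lemma cint1_prod (f : T1 -> R[i]) (g : T2 -> R[i]) :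
 cint1 m1 f -> cint1 m2 g -> forall k : T1 * T2 -> R[i], cmeas k ->
 (forall z, cmod (k z) <= 1) ->
 cint1 (m1 \x m2)%E (fun z => f z.1 * g z.2 * k z).
move=> f1 g1 k mk k1.
have mf : cmeas (fun z : T1 * T2 => f z.1).
 by apply: (cmeas_comp (cint1_cmeas f1)); exact: measurable_fst.
have mg : cmeas (fun z : T1 * T2 => g z.2).
 by apply: (cmeas_comp (cint1_cmeas g1)); exact: measurable_snd.
apply: (@cint1_le _ _ _ _ _ (fun z => cmod (f z.1) * cmod (g z.2))).
- by apply: cmeasM => //; apply: cmeasM.
- have fi := cint1_cmod f1; have gi := cint1_cmod g1.
 apply/integrable12ltyP.
  by apply/measurable_EFinP; apply: measurable_funM; apply: measurable_cmod.
 have e x : (\int[m2]_y `|(cmod (f (x, y).1) * cmod (g (x, y).2))%:E| =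
  (cmod (f x))%:E * \int[m2]_y (cmod (g y))%:E)%E.
  rewrite -ge0_integralZl//=.
  + by apply: eq_integral => y _; rewrite ger0_norm ?mulr_ge0 ?cmod_ge0.
  + by apply/measurable_EFinP/measurable_cmod/(cint1_cmeas g1).
  + by pos.
  + by pos.
 under eq_integral do rewrite e.
 rewrite ge0_integralZr//=.
 + have /integrableP[_] := fi; have /integrableP[_] := gi.
  under eq_integral do rewrite /= ger0_norm ?cmod_ge0//.
  under [in X in _ -> X -> _]eq_integral do rewrite /= ger0_norm ?cmod_ge0//.
  move=> a b; apply: lte_mul_pinfty => //.
   by apply: integral_ge0 => y _; rewrite lee_fin cmod_ge0.
  by rewrite ge0_fin_numE//; apply: integral_ge0 => y _; rewrite lee_fin cmod_ge0.
 + by apply/measurable_EFinP/measurable_cmod/(cint1_cmeas f1).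
 + by pos.
 + by apply: integral_ge0 => y _; rewrite lee_fin cmod_ge0.
- move=> z; rewrite !cmodM ler_piMr// mulr_ge0 ?cmod_ge0//.
Qed.

(** The bounded factor [k] will be an oscillating exponential; integrability comes from [f] and [g]
    alone, which justifies both orders of integration. *)
Lemma CI_fubini (f : T1 -> R[i]) (g : T2 -> R[i]) (k : T1 * T2 -> R[i]) :
 cint1 m1 f -> cint1 m2 g -> cmeas k -> (forall z, cmod (k z) <= 1) ->
 CI m1 (fun x => f x * CI m2 (fun y => g y * k (x, y))) =
 CI m2 (fun y => g y * CI m1 (fun x => f x * k (x, y))).
move=> f1 g1 mk k1; have [iR iI] := cint1_prod f1 g1 mk k1.
have mkx x : cmeas (fun y => k (x, y)).
 by apply: (cmeas_comp mk); exact: pair1_measurable.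
have mky y : cmeas (fun x => k (x, y)).
 by apply: (cmeas_comp mk); exact: pair2_measurable.
have gk x : cint1 m2 (fun y => g y * k (x, y)).
 apply: (cint1_le _ (cint1_cmod g1)).
  exact: (cmeasM (cint1_cmeas g1) (mkx x)).
 by move=> y; rewrite cmodM ler_piMr ?cmod_ge0.
have fk y : cint1 m1 (fun x => f x * k (x, y)).
 apply: (cint1_le _ (cint1_cmod f1)).
  exact: (cmeasM (cint1_cmeas f1) (mky y)).
 by move=> x; rewrite cmodM ler_piMr ?cmod_ge0.
have e1 x : f x * CI m2 (fun y => g y * k (x, y)) = CI m2 (fun y => f x * g y * k (x, y)).
 by rewrite -CIZ//; apply: eq_CI => y; rewrite mulrA.
have e2 y : g y * CI m1 (fun x => f x * k (x, y)) = CI m1 (fun x => f x * g y * k (x, y)).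
 by rewrite -CIZ//; apply: eq_CI => x; rewrite mulrA [g y * _]mulrC.
under [in LHS]eq_CI do rewrite e1.
under [in RHS]eq_CI do rewrite e2.
have gfk x : cint1 m2 (fun y => f x * g y * k (x, y)).
 by have := cint1Z (f x) (gk x); under [X in cint1 _ X -> _]eq_fun do rewrite mulrA.
have ffk y : cint1 m1 (fun x => f x * g y * k (x, y)).
 have := cint1Z (g y) (fk y).
 by under [X in cint1 _ X -> _]eq_fun do rewrite mulrA [g y * _]mulrC.
have swap (F : T1 * T2 -> R) : (m1 \x m2)%E.-integrable setT (fun z => (F z)%:E) ->
  (forall x, m2.-integrable setT (fun y => (F (x, y))%:E)) ->
  (forall y, m1.-integrable setT (fun x => (F (x, y))%:E)) ->
  (\int[m1]_x \int[m2]_y F (x, y) = \int[m2]_y \int[m1]_x F (x, y))%R.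
 move=> iF i1 i2; rewrite /Rintegral; congr fine.
 rewrite (eq_integral (fun x => \int[m2]_y (F (x, y))%:E)%E); last first.
  by move=> x _; rewrite fineK//; apply: integrable_fin_num.
 rewrite [RHS](eq_integral (fun y => \int[m1]_x (F (x, y))%:E)%E); last first.
  by move=> y _; rewrite fineK//; apply: integrable_fin_num.
 exact: (Fubini iF).
apply: complex_eq => /=.
 apply: (swap (fun z => Re (f z.1 * g z.2 * k z))) => //= [x|y].
  by have [] := gfk x.
 by have [] := ffk y.
apply: (swap (fun z => Im (f z.1 * g z.2 * k z))) => //= [x|y].
 by have [] := gfk x.
by have [] := ffk y.
Qed.

Lemma CI_prod (f : T1 -> R[i]) (g : T2 -> R[i]) : cint1 m1 f -> cint1 m2 g ->
 cint1 (m1 \x m2)%E (fun z => f z.1 * g z.2) /\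
 CI (m1 \x m2)%E (fun z => f z.1 * g z.2) = CI m1 f * CI m2 g.
move=> f1 g1.
have i12 : cint1 (m1 \x m2)%E (fun z => f z.1 * g z.2).
 have m1' : cmeas (fun _ : T1 * T2 => 1 : R[i]) by exact: cmeas_cst.
 have h := @cint1_prod _ _ f1 g1 _ m1'.
 by under eq_fun do rewrite -[_ * _]mulr1; apply: h => z; rewrite cmod1.
split=> //.
have e x : f x * CI m2 g = CI m2 (fun y => f x * g y) by rewrite CIZ.
have -> : CI m1 f * CI m2 g = CI m1 (fun x => CI m2 (fun y => f x * g y)).
 rewrite mulrC -CIZ//; apply: eq_CI => x; by rewrite mulrC CIZ.
have gi x : cint1 m2 (fun y => f x * g y) by exact: cint1Z.
have key (F : T1 * T2 -> R) : (m1 \x m2)%E.-integrable setT (fun z => (F z)%:E) ->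
  (forall x, m2.-integrable setT (fun y => (F (x, y))%:E)) ->
  (\int[(m1 \x m2)%E]_z F z = \int[m1]_x \int[m2]_y F (x, y))%R.
 move=> iF i1; rewrite /Rintegral; congr fine.
 rewrite -(integral12_prod_meas1 iF); apply: eq_integral => x _.
 by rewrite fineK//; apply: integrable_fin_num.
case: i12 => iR iI; apply: complex_eq => /=.
 by apply: (key _ iR) => x; have [] := gi x.
by apply: (key _ iI) => x; have [] := gi x.
Qed.

End ComplexFubini.

Create HintDb meas.

Ltac meas := intros; lazymatch goal with
 | |- measurable_fun _ (fun x => (_)%:E) => apply/measurable_EFinP; meas
 | |- measurable_fun _ (fun x => _ * _) => apply: measurable_funM; meas
 | |- measurable_fun _ (fun x => _ + _) => first [apply: measurable_funD; meas | apply: measurable_funB; meas]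
 | |- measurable_fun _ (fun x => - _) => apply: measurable_funN; meas
 | |- measurable_fun _ (fun x => _ ^+ _) => apply: measurable_funX; meas
 | |- measurable_fun _ (fun x => \sum_(_ <- _ | _) _) => apply: measurable_sum; meas
 | |- measurable_fun _ (fun x => cmod _) => apply: measurable_cmod; meas
 | |- cmeas (fun x => _ * _) => first [done | apply: cmeasM; meas]
 | |- cmeas (fun x => _ + _) => first [apply: cmeasD; meas | apply: cmeasB; meas]
 | |- cmeas (fun x => - _) => apply: cmeasN; meas
 | |- cmeas (fun x => (_)%:C) => apply: cmeas_real; meas
 | |- cmeas (fun x => cis _) => apply: cmeas_cis; meas
 | |- cmeas (fun x => conjc _) => apply: cmeas_conj; meas
 | |- cmeas (fun x => cexp _) => apply: cmeas_cexp; meas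
 | |- _ => first [by [] | exact: cmeas_cst | solve [auto with meas]]
 end.

(** * Square-integrable functions *)

Section SquareIntegrable.
Context {R : realType}.
Implicit Types (f g : plane R -> R[i]).

Lemma Lnorm2E (h : plane R -> R) :
 ('N[mu]_2%:E[EFin \o h] = (\int[mu]_x (h x ^+ 2)%:E) `^ 2^-1)%E.
rewrite unlock; congr (_ `^ _)%E; apply: eq_integral => x _ /=.
by rewrite powR_mulrn// sqr_normr.
Qed.

Lemma measurable_cmod_sqr f : cmeas f ->
 mfun (fun x => (cmod (f x) ^+ 2)%:E).
by move=> mf; apply/measurable_EFinP/measurable_funX/measurable_cmod. Qed.
Hint Resolve measurable_cmod_sqr : meas.

Lemma integrable_sqrP f : cmeas f ->
 mu.-integrable setT (fun x => (cmod (f x) ^+ 2)%:E) <->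
 (\int[mu]_x (cmod (f x) ^+ 2)%:E < +oo)%E.
move=> mf; split=> [/integrableP[_]|h].
 by under eq_integral do rewrite /= ger0_norm ?sqr_ge0//.
apply/integrableP; split; first exact: measurable_cmod_sqr.
by under eq_integral do rewrite /= ger0_norm ?sqr_ge0//.
Qed.

Lemma L2P f : L2 f <-> cmeas f /\ mu.-integrable setT (fun x => (cmod (f x) ^+ 2)%:E).
rewrite /L2 /L2norm Lnorm2E; split=> [[m1 m2 lt]|[[m1 m2] h]].
 split=> //; apply/integrable_sqrP => //.
 by move: lt; apply: lty_poweRy; rewrite invr_eq0.
split=> //; apply: poweR_lty; exact/integrable_sqrP.
Qed.

Lemma L2_cmeas f : L2 f -> cmeas f. Proof. by case/L2P. Qed.

Lemma L2_le f (h : plane R -> R) : cmeas f -> mu.-integrable setT (fun x => (h x)%:E) ->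
 (forall x, cmod (f x) ^+ 2 <= h x) -> L2 f.
move=> mf ih le; apply/L2P; split=> //.
apply: (le_integrable measurableT _ _ ih); first exact: measurable_cmod_sqr.
by move=> x _; rewrite lee_fin ger0_norm ?sqr_ge0// (letr (le x))// ler_norm.
Qed.

Lemma sqint_le f g : cmeas f -> cmeas g -> {ae mu, forall x, cmod (f x) <= cmod (g x)} ->
 (\int[mu]_x (cmod (f x) ^+ 2)%:E <= \int[mu]_x (cmod (g x) ^+ 2)%:E)%E.
move=> mf mg h; apply: ae_ge0_le_integral; try by [pos|meas].
by apply: filterS h => x h _; rewrite lee_fin ler_sqr ?nnegrE ?cmod_ge0.
Qed.

Lemma L2_ae f g : {ae mu, forall x, f x = g x} -> cmeas g -> L2 f -> L2 g.
move=> fg mg /L2P[mf /(integrable_sqrP mf) h]; apply/L2P; split=> //; apply/integrable_sqrP => //.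
by apply: le_lt_trans h; apply: sqint_le => //; apply: filterS fg => x ->.
Qed.

Lemma L2D f g : L2 f -> L2 g -> L2 (fun x => f x + g x).
move=> /L2P[mf hf] /L2P[mg hg].
have hf2 : mu.-integrable setT (fun x => (2 * cmod (f x) ^+ 2)%:E).
 by under eq_fun do rewrite EFinM; apply: integrableZl.
have hg2 : mu.-integrable setT (fun x => (2 * cmod (g x) ^+ 2)%:E).
 by under eq_fun do rewrite EFinM; apply: integrableZl.
apply: (@L2_le _ (fun x => 2 * cmod (f x) ^+ 2 + 2 * cmod (g x) ^+ 2)).
- by meas.
- by under eq_fun do rewrite EFinD; apply: integrableD.
- move=> x; have := cmodD (f x) (g x); have := cmod_ge0 (f x + g x).
 move: (cmod _) (cmod (f x)) (cmod (g x)) => a b c a0 abc.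
 have := sqr_ge0 (b - c); nra.
Qed.

Lemma L2Mb (b : plane R -> R[i]) (B : R) f : cmeas b -> (forall x, cmod (b x) <= B) ->
 L2 f -> L2 (fun x => b x * f x).
move=> mb bB /L2P[mf hf].
apply: (@L2_le _ (fun x => B ^+ 2 * cmod (f x) ^+ 2)).
- by meas.
- by under eq_fun do rewrite EFinM; apply: integrableZl.
- move=> x; rewrite cmodM exprMn ler_wpM2r ?sqr_ge0//.
 by rewrite ler_sqr ?nnegrE ?cmod_ge0// (letr (cmod_ge0 _) (bB x)).
Qed.

Lemma L2Z (c : R[i]) f : L2 f -> L2 (fun x => c * f x).
by apply: (@L2Mb (fun=> c) (cmod c)) => //; exact: cmeas_cst. Qed.
Lemma L2N f : L2 f -> L2 (fun x => - f x).
by move=> h; under eq_fun do rewrite -mulN1r; exact: L2Z. Qed.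
Lemma L2B f g : L2 f -> L2 g -> L2 (fun x => f x - g x).
by move=> hf hg; apply: L2D => //; apply: L2N. Qed.

Lemma L2_conj f : L2 f -> L2 (fun x => conjc (f x)).
move=> /L2P[mf hf]; apply/L2P; split; first exact: cmeas_conj.
by under eq_fun do rewrite cmod_conj.
Qed.

Lemma L2_0 : L2 (fun _ : plane R => 0).
apply: (@L2_le _ (fun=> 0)); first exact: cmeas_cst.
- exact: integrable0.
- by move=> x; rewrite cmod0 expr0n.
Qed.

Lemma L2_cint1M f g : L2 f -> L2 g -> cint1 mu (fun x => f x * g x).
move=> /L2P[mf hf] /L2P[mg hg].
apply: (@cint1_le _ _ _ _ _ (fun x => cmod (f x) ^+ 2 + cmod (g x) ^+ 2)).
- by meas.
- by under eq_fun do rewrite EFinD; apply: integrableD.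
- move=> x; rewrite cmodM; move: (cmod (f x)) (cmod (g x)) (cmod_ge0 (f x)) (cmod_ge0 (g x)) => a b a0 b0.
 nra.
Qed.

(** The choice made by [xget] depends only on the set of admissible representatives, hence only on
    the class of [f]. A function outside L^2 is sent to the representative of 0, which makes the map
    total. *)
Definition canonL2 f : plane R -> R[i] :=
 xget (fun=> 0) [set g | L2 g /\
  {ae mu, forall x, g x = (if `[< L2 f >] then f else fun=> 0) x}].

Lemma canonL2_L2_ae f : L2 (canonL2 f) /\
 {ae mu, forall x, canonL2 f x = (if `[< L2 f >] then f else fun=> 0) x}.
have : [set g | L2 g /\ {ae mu, forall x, g x = (if `[< L2 f >] then f else fun=> 0) x}]
  (if `[< L2 f >] then f else fun=> 0).
 by split; [case: asboolP => // _; exact: L2_0|exact: aeW].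
by move=> /(xgetI (fun=> 0)).
Qed.

Lemma canonL2_L2 f : L2 (canonL2 f). Proof. by have [] := canonL2_L2_ae f. Qed.
Lemma canonL2_ae f : L2 f -> {ae mu, forall x, canonL2 f x = f x}.
by move=> h; have [_] := canonL2_L2_ae f; rewrite asboolT. Qed.

Lemma canonL2_eq f g : L2 f -> L2 g -> {ae mu, forall x, f x = g x} -> canonL2 f = canonL2 g.
move=> hf hg fg; rewrite /canonL2 !asboolT//; congr xget; apply/funext => k /=.
apply/propext; split=> -[hk kf]; split=> //.
 by apply: filterS2 kf fg => x -> ->.
by apply: filterS2 kf fg => x -> ->.
Qed.

Lemma canonL2K f : canonL2 (canonL2 f) = canonL2 f.
have [h1 h2] := canonL2_L2_ae f.
have e : canonL2 f = canonL2 (if `[< L2 f >] then f else fun=> 0).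
 case: asboolP => // nf; rewrite /canonL2; congr xget; apply/funext => k /=.
 by rewrite asboolF// asboolT//; exact: L2_0.
rewrite [RHS]e; apply: canonL2_eq => //.
by case: asboolP => // _; exact: L2_0.
Qed.

End SquareIntegrable.
#[local] Hint Resolve measurable_cmod_sqr : meas.

(* Elements of L^2 are functions that are the chosen representative of their
  class, so that equality almost everywhere is Leibniz equality. *)
Record Lsq (R : realType) := MkLsq {
 fn :> plane R -> R[i];
 fn_L2 : L2 fn;
 fn_canon : canonL2 fn = fn }.

(* The operations on classes are sealed behind opaque proofs of their
  specifications: conversion must not unfold them. *)
Fact cls_spec (R : realType) :
 {c : (plane R -> R[i]) -> Lsq R | forall f, fn (c f) = canonL2 f}.
by exists (fun f => MkLsq (canonL2_L2 f) (canonL2K f)). Qed.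

Definition cls {R : realType} : (plane R -> R[i]) -> Lsq R := sval (cls_spec R).
Lemma fn_cls {R : realType} (f : plane R -> R[i]) : fn (cls f) = canonL2 f.
exact: (svalP (cls_spec R)). Qed.

HB.instance Definition _ (R : realType) := gen_eqMixin (Lsq R).
HB.instance Definition _ (R : realType) := gen_choiceMixin (Lsq R).

(** * The Hilbert space of L^2 classes *)

Section SquareIntegrableClasses.
Context {R : realType}.
Implicit Types (f g : plane R -> R[i]) (a b c : Lsq R).

Lemma cls_ae f : L2 f -> {ae mu, forall x, cls f x = f x}.
by move=> hf; rewrite fn_cls; exact: canonL2_ae. Qed.

Lemma Lsq_eq a b : (fn a = fn b) -> a = b.
case: a b => f h1 h2 [g h3 h4] /= fg; subst g.
by rewrite (Prop_irrelevance h1 h3) (Prop_irrelevance h2 h4).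
Qed.

Lemma cls_eq f g : L2 f -> L2 g -> {ae mu, forall x, f x = g x} -> cls f = cls g.
by move=> hf hg fg; apply: Lsq_eq; rewrite !fn_cls; exact: canonL2_eq. Qed.
Lemma cls_fn a : cls a = a.
by apply: Lsq_eq; rewrite fn_cls fn_canon. Qed.
Lemma Lsq_ext a b : {ae mu, forall x, a x = b x} -> a = b.
by move=> ab; rewrite -(cls_fn a) -(cls_fn b); apply: cls_eq => //; exact: fn_L2. Qed.
Lemma cls_eqP f a : L2 f -> {ae mu, forall x, f x = a x} -> cls f = a.
by move=> hf fa; rewrite -(cls_fn a); apply: cls_eq => //; exact: fn_L2. Qed.

Fact Lsq_zero_spec : {z : Lsq R | z = cls (fun=> 0)}.
by eexists. Qed.
Fact Lsq_opp_spec : {o : Lsq R -> Lsq R | o = fun a => cls (fun x => - a x)}.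
by eexists. Qed.
Fact Lsq_add_spec : {p : Lsq R -> Lsq R -> Lsq R | p = fun a b => cls (fun x => a x + b x)}.
by eexists. Qed.
Fact Lsq_scale_spec :
 {m : R[i] -> Lsq R -> Lsq R | m = fun k a => cls (fun x => k * a x)}.
by eexists. Qed.

Definition Lsq_zero : Lsq R := sval Lsq_zero_spec.
Definition Lsq_opp : Lsq R -> Lsq R := sval Lsq_opp_spec.
Definition Lsq_add : Lsq R -> Lsq R -> Lsq R := sval Lsq_add_spec.
Definition Lsq_scale : R[i] -> Lsq R -> Lsq R := sval Lsq_scale_spec.

Let addE a b : {ae mu, forall x, Lsq_add a b x = a x + b x}.
by rewrite /Lsq_add (svalP Lsq_add_spec); apply: cls_ae; apply: L2D; exact: fn_L2. Qed.
Let oppE a : {ae mu, forall x, Lsq_opp a x = - a x}.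
by rewrite /Lsq_opp (svalP Lsq_opp_spec); apply: cls_ae; apply: L2N; exact: fn_L2. Qed.
Let scaleE k a : {ae mu, forall x, Lsq_scale k a x = k * a x}.
by rewrite /Lsq_scale (svalP Lsq_scale_spec); apply: cls_ae; apply: L2Z; exact: fn_L2. Qed.
Let zeroE : {ae mu, forall x, Lsq_zero x = 0}.
by rewrite /Lsq_zero (svalP Lsq_zero_spec); apply: cls_ae; exact: L2_0. Qed.

Fact Lsq_addA : associative Lsq_add.
move=> a b c; apply: Lsq_ext.
apply: filterS2 (filterI (addE a (Lsq_add b c)) (addE b c)) (filterI (addE (Lsq_add a b) c) (addE a b)).
by move=> x [-> ->] [-> ->]; rewrite addrA.
Qed.

Fact Lsq_addC : commutative Lsq_add.
by move=> a b; apply: Lsq_ext; apply: filterS2 (addE a b) (addE b a) => x -> ->; rewrite addrC. Qed.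

Fact Lsq_add0 : left_id Lsq_zero Lsq_add.
by move=> a; apply: Lsq_ext; apply: filterS2 (addE Lsq_zero a) zeroE => x -> ->; rewrite add0r. Qed.

Fact Lsq_addN : left_inverse Lsq_zero Lsq_opp Lsq_add.
move=> a; apply: Lsq_ext; apply: filterS2 (filterI (addE (Lsq_opp a) a) (oppE a)) zeroE.
by move=> x [-> ->] ->; rewrite addNr.
Qed.

HB.instance Definition _ := GRing.isZmodule.Build (Lsq R) Lsq_addA Lsq_addC Lsq_add0 Lsq_addN.

Fact Lsq_scaleA k l a : Lsq_scale k (Lsq_scale l a) = Lsq_scale (k * l) a.
apply: Lsq_ext; apply: filterS2 (filterI (scaleE k (Lsq_scale l a)) (scaleE l a)) (scaleE (k * l) a).
by move=> x [-> ->] ->; rewrite mulrA.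
Qed.

Fact Lsq_scale1 : left_id 1 Lsq_scale.
by move=> a; apply: Lsq_ext; apply: filterS (scaleE 1 a) => x ->; rewrite mul1r. Qed.

Fact Lsq_scaleDr : right_distributive Lsq_scale +%R.
move=> k a b; apply: Lsq_ext.
apply: filterS2 (filterI (scaleE k (Lsq_add a b)) (addE a b))
 (filterI (addE (Lsq_scale k a) (Lsq_scale k b)) (filterI (scaleE k a) (scaleE k b))).
by move=> x [e1 e2] [e3 [e4 e5]]; rewrite e1 e2 e3 e4 e5 mulrDr.
Qed.

Fact Lsq_scaleDl a : {morph Lsq_scale^~ a : k l / k + l}.
move=> k l; apply: Lsq_ext.
apply: filterS2 (scaleE (k + l) a)
 (filterI (addE (Lsq_scale k a) (Lsq_scale l a)) (filterI (scaleE k a) (scaleE l a))).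
by move=> x e1 [e3 [e4 e5]]; rewrite e1 e3 e4 e5 mulrDl.
Qed.

HB.instance Definition _ := GRing.Zmodule_isLmodule.Build R[i] (Lsq R)
 Lsq_scaleA Lsq_scale1 Lsq_scaleDr Lsq_scaleDl.

Lemma fnD a b : {ae mu, forall x, (a + b) x = a x + b x}.
exact: addE. Qed.
Lemma fnN a : {ae mu, forall x, (- a) x = - a x}.
exact: oppE. Qed.
Lemma fnB a b : {ae mu, forall x, (a - b) x = a x - b x}.
by apply: filterS2 (fnD a (- b)) (fnN b) => x -> ->. Qed.
Lemma fnZ k a : {ae mu, forall x, (k *: a) x = k * a x}.
exact: scaleE. Qed.
Lemma fn0 : {ae mu, forall x, (0 : Lsq R) x = 0}.
exact: zeroE. Qed.

Lemma clsD f g : L2 f -> L2 g -> cls (fun x => f x + g x) = cls f + cls g.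
move=> hf hg; apply: cls_eqP; first exact: L2D.
apply: filterS2 (fnD (cls f) (cls g)) (filterI (cls_ae hf) (cls_ae hg)).
by move=> x -> [-> ->].
Qed.

Lemma clsZ k f : L2 f -> cls (fun x => k * f x) = k *: cls f.
move=> hf; apply: cls_eqP; first exact: L2Z.
by apply: filterS2 (fnZ k (cls f)) (cls_ae hf) => x -> ->.
Qed.

Lemma clsB f g : L2 f -> L2 g -> cls (fun x => f x - g x) = cls f - cls g.
move=> hf hg; apply: cls_eqP; first exact: L2B.
apply: filterS2 (fnB (cls f) (cls g)) (filterI (cls_ae hf) (cls_ae hg)).
by move=> x -> [-> ->].
Qed.

Lemma fn_cmeas a : cmeas a. Proof. exact/L2_cmeas/fn_L2. Qed.
Hint Resolve fn_cmeas : core.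

(** Only the real part of the inner product is kept: it determines the norm and suffices for
    duality, complex scalars being moved across by [ip_Zconj]. *)
Fact ip_spec : {p : Lsq R -> Lsq R -> R |
 forall a b, p a b = Re (CI mu (fun x => a x * conjc (b x)))}.
by exists (fun a b => Re (CI mu (fun x => a x * conjc (b x)))). Qed.
Definition ip : Lsq R -> Lsq R -> R := sval ip_spec.
Lemma ipE a b : ip a b = Re (CI mu (fun x => a x * conjc (b x))).
exact: (svalP ip_spec). Qed.

Fact nrm_spec : {p : Lsq R -> R | forall a, p a = sqrt (ip a a)}.
by exists (fun a => sqrt (ip a a)). Qed.
Definition nrm : Lsq R -> R := sval nrm_spec.
Lemma nrmE a : nrm a = sqrt (ip a a).
exact: (svalP nrm_spec). Qed.

Lemma ip_cint1 a b : cint1 mu (fun x => a x * conjc (b x)).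
by apply: L2_cint1M; [exact: fn_L2|apply: L2_conj; exact: fn_L2]. Qed.

Lemma ip_ae a b (f g : plane R -> R[i]) : L2 f -> L2 g ->
 {ae mu, forall x, a x = f x} -> {ae mu, forall x, b x = g x} ->
 ip a b = Re (CI mu (fun x => f x * conjc (g x))).
move=> hf hg af bg; rewrite ipE; congr Re; apply: CI_ae.
- by apply: filterS2 af bg => x -> ->.
- by meas.
- by apply: cmeasM; [exact: L2_cmeas|apply: cmeas_conj; exact: L2_cmeas].
Qed.

Lemma ip_cls f g : L2 f -> L2 g ->
 ip (cls f) (cls g) = Re (CI mu (fun x => f x * conjc (g x))).
by move=> hf hg; apply: ip_ae => //; exact: cls_ae. Qed.

Lemma ipC a b : ip a b = ip b a.
rewrite !ipE /=; apply: eq_Rintegral => x _.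
by rewrite !ReM !Re_conj !Im_conj; ring.
Qed.

Lemma ipDl a b c : ip (a + b) c = ip a c + ip b c.
rewrite (@ip_ae _ _ (fun x => a x + b x) c) ?fnD//; [|exact: L2D (fn_L2 _) (fn_L2 _)|exact: fn_L2|exact: aeW].
under eq_CI do rewrite mulrDl.
by rewrite CID ?ReD ?ipE//; exact: ip_cint1.
Qed.

Lemma ipDr a b c : ip a (b + c) = ip a b + ip a c.
by rewrite ipC ipDl !(ipC a). Qed.

Lemma ipZl (k : R) a b : ip (k%:C *: a) b = k * ip a b.
rewrite (@ip_ae _ _ (fun x => k%:C * a x) b) ?fnZ//; [|exact: L2Z (fn_L2 _)|exact: fn_L2|exact: aeW].
under eq_CI do rewrite -mulrA.
by rewrite CIZ ?ReM /= ?mul0r ?subr0 ?ipE//; exact: ip_cint1.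
Qed.

Lemma ipZr (k : R) a b : ip a (k%:C *: b) = k * ip a b.
by rewrite ipC ipZl ipC. Qed.
Lemma ipNl a b : ip (- a) b = - ip a b.
by rewrite -scaleN1r -(mulN1r (ip a b)) -ipZl rmorphN1. Qed.
Lemma ipNr a b : ip a (- b) = - ip a b.
by rewrite ipC ipNl ipC. Qed.
Lemma ipBl a b c : ip (a - b) c = ip a c - ip b c.
by rewrite ipDl ipNl. Qed.
Lemma ipBr a b c : ip a (b - c) = ip a b - ip a c.
by rewrite ipDr ipNr. Qed.

Lemma ip_Zconj (k : R[i]) a b : ip (k *: a) b = ip a (conjc k *: b).
rewrite (@ip_ae _ _ (fun x => k * a x) b) ?fnZ//; [|exact: L2Z (fn_L2 _)|exact: fn_L2|exact: aeW].
rewrite (@ip_ae a _ a (fun x => conjc k * b x)) ?fnZ//; [|exact: fn_L2|exact: L2Z (fn_L2 _)|exact: aeW].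
by congr Re; apply: eq_CI => x; rewrite conjcM conjcK; ring.
Qed.

Lemma ip_sqr a : ip a a = (\int[mu]_x (cmod (a x) ^+ 2))%R.
rewrite !ipE /=; apply: eq_Rintegral => x _.
by rewrite ReM Re_conj Im_conj cmod_sqr; ring.
Qed.

Lemma ip_ge0 a : 0 <= ip a a.
by rewrite ip_sqr; apply: Rintegral_ge0 => x _; exact: sqr_ge0. Qed.
Lemma nrm_ge0 a : 0 <= nrm a. Proof. by rewrite nrmE. Qed.
Hint Resolve nrm_ge0 : core.
Lemma nrm_sqr a : nrm a ^+ 2 = ip a a. Proof. by rewrite nrmE sqr_sqrtr ?ip_ge0. Qed.

Lemma nrm_eq0 a : nrm a = 0 -> a = 0.
move=> h; have : ip a a = 0 by rewrite -nrm_sqr h expr0n.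
have /L2P[ma ia] := fn_L2 a.
rewrite ip_sqr /Rintegral => h0; apply: Lsq_ext.
have {}h0 : (\int[mu]_x (cmod (a x) ^+ 2)%:E = 0)%E.
 by rewrite -(fineK (integrable_fin_num measurableT ia)) h0.
have : ae_eq mu setT (fun x => (cmod (a x) ^+ 2)%:E) (fun=> 0%E).
 apply/ae_eq_integral_abs => //; first exact: measurable_cmod_sqr.
 by under eq_integral do rewrite /= ger0_norm ?sqr_ge0//.
move=> h1; apply: filterS2 h1 fn0 => x /(_ I) [] /eqP; rewrite sqrf_eq0 => /eqP /cmod_eq0 -> ->.
by [].
Qed.

Lemma nrm0 : nrm 0 = 0.
by rewrite !nrmE -(scale0r 0) (ipZl 0) mul0r sqrtr0. Qed.

Lemma nrmZ (k : R[i]) a : nrm (k *: a) = cmod k * nrm a.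
rewrite !nrmE ip_Zconj scalerA.
have -> : conjc k * k = (cmod k ^+ 2)%:C.
 by rewrite cmod_sqr; case: (k) => x y; apply: complex_eq => /=; ring.
by rewrite ipZr sqrtrM ?sqr_ge0// sqrtr_sqr ger0_norm ?cmod_ge0.
Qed.

Lemma nrmN a : nrm (- a) = nrm a.
by rewrite -scaleN1r nrmZ cmodN cmod1 mul1r. Qed.
Lemma nrmBC a b : nrm (a - b) = nrm (b - a).
by rewrite -nrmN opprB. Qed.
Lemma nrmD_sqr a b : nrm (a + b) ^+ 2 = nrm a ^+ 2 + 2 * ip a b + nrm b ^+ 2.
by rewrite !nrm_sqr ipDl !ipDr (ipC b a); ring. Qed.
Lemma nrmB_sqr a b : nrm (a - b) ^+ 2 = nrm a ^+ 2 - 2 * ip a b + nrm b ^+ 2.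
by rewrite nrmD_sqr ipNr nrmN; ring. Qed.

Lemma ip_CS a b : ip a b <= nrm a * nrm b.
have [a0|a0] := eqVneq (nrm a) 0.
 by rewrite a0 mul0r (nrm_eq0 a0) -(scale0r 0) (ipZl 0) mul0r.
have ap : 0 < nrm a by rewrite lt_neqAle eq_sym a0 nrm_ge0.
have := sqr_ge0 (nrm ((nrm b)%:C *: a - (nrm a)%:C *: b)).
rewrite nrmB_sqr !nrmZ !cmod_real !ger0_norm// ipZl ipZr.
have [b0|b0] := eqVneq (nrm b) 0.
 by move=> _; rewrite b0 mulr0 (nrm_eq0 b0) -(scale0r 0) (ipZr 0) mul0r.
have bp : 0 < nrm b by rewrite lt_neqAle eq_sym b0 nrm_ge0.
rewrite (mulrC (nrm b) (nrm a)) => h.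
have abp : 0 < nrm a * nrm b by pos.
nra.
Qed.

Lemma ip_CS_abs a b : `|ip a b| <= nrm a * nrm b.
by rewrite ler_norml ip_CS andbT lerNl -ipNl (letr (ip_CS _ _))// nrmN. Qed.

Lemma nrmD a b : nrm (a + b) <= nrm a + nrm b.
rewrite -(@ler_sqr _ _ _) ?nnegrE ?addr_ge0// nrmD_sqr sqrrD lerD2r lerD2l.
by rewrite mulr_natl ler_pMn2r// ip_CS.
Qed.

Lemma nrm_dist b a c : nrm (a - c) <= nrm (a - b) + nrm (b - c).
have -> : a - c = (a - b) + (b - c) by rewrite addrA subrK.
exact: nrmD.
Qed.

Lemma nrm_sum (I : Type) (s : seq I) (P : pred I) (F : I -> Lsq R) :
 nrm (\sum_(i <- s | P i) F i) <= \sum_(i <- s | P i) nrm (F i).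
elim/big_rec2: _ => [|i y x _ h]; first by rewrite nrm0.
by rewrite (letr (nrmD _ _))// lerD2l.
Qed.

Lemma nrm_cls f : L2 f -> nrm (cls f) = sqrt (\int[mu]_x (cmod (f x) ^+ 2))%R.
move=> hf; rewrite !nrmE ip_cls//; congr sqrt => /=; apply: eq_Rintegral => x _.
by rewrite ReM Re_conj Im_conj cmod_sqr; ring.
Qed.

Lemma L2norm_nrm f : L2 f -> L2norm f = (nrm (cls f))%:E.
move=> hf; rewrite /L2norm Lnorm2E nrm_cls//; have /L2P[mf ih] := hf.
rewrite -(fineK (integrable_fin_num measurableT ih)) poweR_EFin powR12_sqrt//.
by apply/fine_ge0/integral_ge0 => x _; rewrite lee_fin sqr_ge0.
Qed.

Lemma nrm_sqrE a : ((nrm a ^+ 2)%:E = \int[mu]_x (cmod (a x) ^+ 2)%:E)%E.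
have /L2P[mf ih] := fn_L2 a.
by rewrite nrm_sqr ip_sqr /Rintegral fineK// integrable_fin_num.
Qed.

Lemma nrm_le_ae a b : {ae mu, forall x, cmod (a x) <= cmod (b x)} -> nrm a <= nrm b.
move=> h; rewrite -(@ler_sqr _ _ _) ?nnegrE// -lee_fin !nrm_sqrE.
exact: sqint_le.
Qed.

End SquareIntegrableClasses.
#[local] Hint Resolve nrm_ge0 ip_ge0 fn_cmeas : core.

(** * Completeness of L^2 and almost everywhere limits *)

Section Completeness.
Context {R : realType}.
Implicit Types (f g : plane R -> R[i]) (a b c : Lsq R).

Lemma cvg_cmod (z_ : nat -> R[i]) (z : R[i]) :
 (fun n => Re (z_ n)) @ \oo --> Re z ->
 (fun n => Im (z_ n)) @ \oo --> Im z ->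
 (fun n => cmod (z_ n - z)) @ \oo --> (0 : R).
move=> h1 h2.
apply: (@squeeze_cvgr _ _ _ _ (cst 0)
 (fun n => `|Re (z_ n) - Re z| + `|Im (z_ n) - Im z|)).
- apply: nearW => n; apply/andP; split; first exact: cmod_ge0.
 by rewrite (letr (cmod_le_ReIm _))// ReD ReN ImD ImN.
- exact: cvg_cst.
- have e1 : (fun n => `|Re (z_ n) - Re z|) @ \oo --> (0 : R).
  by rewrite -(normr0 R); apply: cvg_norm; rewrite -(subrr (Re z)); apply: cvgB => //; exact: cvg_cst.
 have e2 : (fun n => `|Im (z_ n) - Im z|) @ \oo --> (0 : R).
  by rewrite -(normr0 R); apply: cvg_norm; rewrite -(subrr (Im z)); apply: cvgB => //; exact: cvg_cst.
 by rewrite -(addr0 (0 : R)); apply: cvgD.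
Qed.

Lemma fatou_sqr (f_ : nat -> plane R -> R[i]) f (B : R) :
 (forall n, cmeas (f_ n)) -> cmeas f ->
 {ae mu, forall x, (fun n => cmod (f_ n x - f x)) @ \oo --> (0 : R)} ->
 (forall n, (\int[mu]_x (cmod (f_ n x) ^+ 2)%:E <= B%:E)%E) ->
 (\int[mu]_x (cmod (f x) ^+ 2)%:E <= B%:E)%E.
move=> mf_ mf cf hB.
have ms n : mfun (fun x => (cmod (f_ n x) ^+ 2)%:E) by meas.
have s0 n x : setT x -> (0 <= (cmod (f_ n x) ^+ 2)%:E)%E by pos.
have F := fatou mu measurableT ms s0.
have mL : mfun (fun x => limn_einf (fun n => (cmod (f_ n x) ^+ 2)%:E)).
 apply: (emeasurable_fun_cvg (fun n x => einfs (fun n => (cmod (f_ n x) ^+ 2)%:E) n)).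
  by move=> n; exact: measurable_fun_einfs.
 by move=> x _; rewrite limn_einf_lim; exact: is_cvg_einfs.
apply: (via (\int[mu]_x limn_einf (fun n => (cmod (f_ n x) ^+ 2)%:E))%E).
 have e : {ae mu, forall x, limn_einf (fun n => (cmod (f_ n x) ^+ 2)%:E) = (cmod (f x) ^+ 2)%:E}.
  apply: filterS cf => x cx.
  have /cvg_limn_einf_sup[-> _] // : (fun n => (cmod (f_ n x) ^+ 2)%:E) @ \oo --> (cmod (f x) ^+ 2)%:E.
  apply/fine_cvgP; split; first exact: nearW.
  have e : (fun n => cmod (f_ n x)) @ \oo --> cmod (f x).
   apply/cvgrPdist_le => e e0; move/cvgrPdist_le : cx => /(_ _ e0).
   apply: filterS => n; rewrite sub0r normrN ger0_norm ?cmod_ge0// => h.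
   by rewrite distrC (letr (ler_cmod_dist _ _)).
  by apply: cvgM; exact: e.
 apply: ae_ge0_le_integral => //.
 - by pos.
 - by meas.
 - move=> x _; rewrite limn_einf_lim; apply: lime_ge; first exact: is_cvg_einfs.
  by apply: nearW => n; apply: le_ereal_inf_tmp => _ [k /= _ <-]; rewrite lee_fin sqr_ge0.
 - by apply: filterS e => x ->.
apply: (letr F); rewrite limn_einf_lim; apply: lime_le; first exact: is_cvg_einfs.
apply: nearW => n; apply: (letr _ (hB n)); apply: ereal_inf_lbound.
by exists n => /=.
Qed.

Definition cvgL2 (a_ : nat -> Lsq R) a :=
 forall e : R, 0 < e -> exists n, forall i, (n <= i)%N -> nrm (a_ i - a) <= e.

Lemma geo2_sum n : \sum_(k < n) (2^-1 : R) ^+ k <= 2.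
have -> : \sum_(k < n) (2^-1 : R) ^+ k = 2 - 2 * 2^-1 ^+ n.
 elim: n => [|n IH]; first by rewrite big_ord0 expr0; ring.
 by rewrite big_ord_recr /= IH exprS; field.
by rewrite gerBl mulr_ge0// exprn_ge0.
Qed.

Lemma rapid_nrm (b : nat -> Lsq R) : (forall k, nrm (b k.+1 - b k) <= 2^-1 ^+ k) ->
 forall k n, nrm (b (k + n)%N - b k) <= 2 * 2^-1 ^+ k.
move=> hb k n.
have -> : b (k + n)%N - b k = \sum_(j < n) (b (k + j).+1 - b (k + j)%N).
 elim: n => [|n IH]; first by rewrite addn0 subrr big_ord0.
 by rewrite big_ord_recr /= -IH addnS addrC addrA subrK.
rewrite (letr (nrm_sum _ _ _))//.
apply: (via (\sum_(j < n) 2^-1 ^+ k * 2^-1 ^+ j)).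
 by apply: ler_sum => j _; rewrite -exprD; exact: hb.
by rewrite -mulr_sumr mulrC ler_wpM2r ?exprn_ge0 ?geo2_sum.
Qed.

(** Riesz-Fischer: the partial sums [G n] of the moduli of the increments have L^2 norm at most 2,
    so by monotone convergence the increments are absolutely summable at almost every point. *)
Lemma rapid_cvg_ae (b : nat -> Lsq R) : (forall k, nrm (b k.+1 - b k) <= 2^-1 ^+ k) ->
 exists2 f : plane R -> R[i], cmeas f &
  {ae mu, forall x, (fun n => cmod (b n x - f x)) @ \oo --> (0 : R)}.
move=> hb; pose d k x := cmod (b k.+1 x - b k x).
have dL k : L2 (fun x => (d k x)%:C).
 have /L2P[m i] : L2 (fun x => b k.+1 x - b k x) by apply: L2B; exact: fn_L2.
 apply/L2P; split; first by apply: cmeas_real; exact: measurable_cmod.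
 by under eq_fun do rewrite cmod_real ger0_norm ?cmod_ge0//.
pose D k : Lsq R := cls (fun x => (d k x)%:C).
have nD k : nrm (D k) <= 2^-1 ^+ k.
 rewrite (letr _ (hb k))//; apply: nrm_le_ae.
 apply: filterS2 (cls_ae (dL k)) (fnB (b k.+1) (b k)) => x -> ->.
 by rewrite cmod_real ger0_norm ?cmod_ge0.
pose G n x := \sum_(k < n) d k x.
have d0 k x : 0 <= d k x by exact: cmod_ge0.
have G0 n x : 0 <= G n x by apply: sumr_ge0.
have mG n : mfun (G n).
 rewrite /G; elim: n => [|n IH].
  by under eq_fun do rewrite big_ord0; exact: measurable_cst.
 under eq_fun do rewrite big_ord_recr /=.
 by apply: measurable_funD => //; apply: measurable_cmod; apply: cmeasB.
have iG n : (\int[mu]_x (G n x ^+ 2)%:E <= 4%:E)%E.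
 have e : {ae mu, forall x, (\sum_(k < n) D k) x = (G n x)%:C}.
  rewrite /G; elim: n => [|n IH].
   by rewrite big_ord0; apply: filterS fn0 => x ->; rewrite big_ord0.
  rewrite big_ord_recr /=.
  apply: filterS2 (filterI IH (cls_ae (dL n))) (fnD (\sum_(k < n) D k) (D n)).
  by move=> x [e1 e2] ->; rewrite e1 e2 big_ord_recr realcD.
 apply: (via (nrm (\sum_(k < n) D k) ^+ 2)%:E).
  rewrite nrm_sqrE; apply: ae_ge0_le_integral; try by [pos|meas].
  by apply: filterS e => x -> _; rewrite cmod_real ger0_norm.
 rewrite lee_fin; have -> : 4 = 2 ^+ 2 :> R by ring.
 apply: sqr_le2 => //; apply: (letr (nrm_sum _ _ _)); apply: (letr _ (geo2_sum n)).
 by apply: ler_sum => k _; exact: nD.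
pose S x := limn (fun n => (G n x ^+ 2)%:E).
have ndG x : {homo (fun n => (G n x ^+ 2)%:E) : n m / (n <= m)%N >-> (n <= m)%E}.
 apply/nondecreasing_seqP => n; rewrite lee_fin ler_sqr ?nnegrE//.
 by rewrite /G big_ord_recr /= lerDl.
have cS x : (fun n => (G n x ^+ 2)%:E) @ \oo --> S x.
 exact: ereal_nondecreasing_is_cvgn.
have mS : mfun S.
 apply: (emeasurable_fun_cvg (fun n x => (G n x ^+ 2)%:E)) => [n|x _]; last exact: cS.
 by meas.
have S0 x : (0 <= S x)%E.
 by apply: lime_ge; [apply/cvg_ex; exists (S x); exact: cS|apply: nearW => n; rewrite lee_fin sqr_ge0].
have iS : (\int[mu]_x S x <= 4%:E)%E.
 have C : (fun n => \int[mu]_x (G n x ^+ 2)%:E)%E @ \oo --> (\int[mu]_x S x)%E.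
  apply: cvg_monotone_convergence => //.
  - by meas.
  - by pos.
 rewrite -(cvg_lim _ C)//; apply: lime_le; first by apply/cvg_ex; eexists; exact: C.
 by apply: nearW => n; exact: iG.
have Sfin : {ae mu, forall x, (S x < +oo)%E}.
 have intS : mu.-integrable setT S.
  apply/integrableP; split=> //.
  under eq_integral do rewrite gee0_abs//.
  by apply: (le_lt_trans iS); rewrite ltry.
 by apply: filterS (integrable_ae measurableT intS) => x /(_ I); rewrite ltey_eq => ->.
have cvgP (P : R[i] -> R) x : (forall z w, P (z + w) = P z + P w) ->
  (forall z, `|P z| <= cmod z) -> (S x < +oo)%E -> cvgn (fun n => P (b n x)).
 move=> PD Pm Sx.
 have Gb n : G n x <= sqrt (fine (S x)).
  rewrite -(ger0_norm (G0 n x)) -sqrtr_sqr ler_wsqrtr// -lee_fin fineK ?ge0_fin_numE//.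
  apply: lime_ge; first by apply/cvg_ex; exists (S x); exact: cS.
  by exists n => // m /= nm; exact: ndG.
 have c1 : cvgn (series (fun k => d k x)).
  apply: nondecreasing_is_cvgn.
   by apply/nondecreasing_seqP => n; rewrite /series /= big_nat_recr //= lerDl.
  exists (sqrt (fine (S x))) => _ [n _ <-].
  by rewrite /series /= big_mkord; exact: Gb.
 have c2 : cvgn (series (fun k => P (b k.+1 x - b k x))).
  apply: normed_cvg; apply: (series_le_cvg _ _ _ c1) => n //=.
 have -> : (fun n => P (b n x)) =
   (fun n => P (b 0%N x) + series (fun k => P (b k.+1 x - b k x)) n).
  apply/funext; elim=> [|n IH]; first by rewrite /series /= big_geq// addr0.
  by rewrite /series /= big_nat_recr //= addrA -IH -PD addrC subrK.
 by apply: is_cvgD => //; exact: is_cvg_cst.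
(* Off [A], whose complement is null, the sequence is replaced by 0; the pointwise limit is then a
   measurable function defined everywhere. *)
pose A := [set x | (S x < +oo)%E].
have mA : measurable A by rewrite /A -[X in measurable X]setTI; exact: emeasurable_fun_infty_o.
pose b' n x : R[i] := (\1_A x)%:C * b n x.
have mb' n : cmeas (b' n) by apply: cmeasM => //; apply: cmeas_real; exact: measurable_indic.
have cb' x : cvgn (fun n => Re (b' n x)) /\ cvgn (fun n => Im (b' n x)).
 rewrite /b' indicE; have [xA|xA] := boolP (x \in A).
  rewrite inE in xA; have e n : (true%:R)%:C * b n x = b n x by rewrite mul1r.
  under eq_fun do rewrite e; under [X in _ /\ cvgn X]eq_fun do rewrite e.
  by split; apply: cvgP => //; [exact: ReD|exact: Re_le_cmod|exact: ImD|exact: Im_le_cmod].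
 have e n : (false%:R)%:C * b n x = 0 by rewrite mul0r.
 by under eq_fun do rewrite e; under [X in _ /\ cvgn X]eq_fun do rewrite e; split; exact: is_cvg_cst.
pose f x : R[i] := limn (fun n => Re (b' n x)) +i* limn (fun n => Im (b' n x)).
exists f.
 split.
  apply: (measurable_fun_cvg (h := fun n x => Re (b' n x))) => [n|x _].
   by have [] := mb' n.
  by have [] := cb' x.
 apply: (measurable_fun_cvg (h := fun n x => Im (b' n x))) => [n|x _].
  by have [] := mb' n.
 by have [] := cb' x.
apply: filterS Sfin => x Sx.
have e n : b n x = b' n x by rewrite /b' indicE mem_set// mul1r.
under eq_fun do rewrite e.
by have [c1 c2] := cb' x; apply: cvg_cmod.
Qed.

Lemma fatou_nrm (a_ : nat -> Lsq R) c f (B : R) N : cmeas f ->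
 {ae mu, forall x, (fun n => cmod (a_ n x - f x)) @ \oo --> (0 : R)} ->
 (forall n, (N <= n)%N -> nrm (a_ n - c) <= B) ->
 (\int[mu]_x (cmod (f x - c x) ^+ 2)%:E <= (B ^+ 2)%:E)%E.
move=> mf cf hB; apply: (@fatou_sqr (fun n x => a_ (n + N)%N x - c x)); try by meas.
 apply: filterS cf => x cx.
 rewrite [X in X @ _ --> _](_ : _ = (fun n => cmod (a_ (n + N)%N x - f x))).
  by rewrite (cvg_shiftn N (fun n => cmod (a_ n x - f x))).
 by apply/funext => n; congr cmod; ring.
move=> n; apply: (via (nrm (a_ (n + N)%N - c) ^+ 2)%:E).
 rewrite nrm_sqrE; apply: sqint_le; try by meas.
 by apply: filterS (fnB (a_ (n + N)%N) c) => x ->.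
by rewrite lee_fin sqr_le2// hB// leq_addl.
Qed.

Lemma rapid_cvg (b : nat -> Lsq R) : (forall k, nrm (b k.+1 - b k) <= 2^-1 ^+ k) ->
 exists a, forall k, nrm (b k - a) <= 2 * 2^-1 ^+ k.
move=> hb; have [f mf cf] := rapid_cvg_ae hb.
have key k : (\int[mu]_x (cmod (f x - b k x) ^+ 2)%:E <= ((2 * 2^-1 ^+ k) ^+ 2)%:E)%E.
 by apply: (fatou_nrm (N := k) mf cf) => n kn; rewrite -(subnKC kn); exact: rapid_nrm.
have mk k : cmeas (fun x => f x - b k x) by meas.
have L2f : L2 f.
 apply: (L2_ae (f := fun x => f x - b 0%N x + b 0%N x) _ mf); first by apply: aeW => x; rewrite subrK.
 apply: L2D (fn_L2 _); apply/L2P; split=> //; apply/integrable_sqrP => //.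
 by apply: (le_lt_trans (key 0%N)); rewrite ltry.
exists (cls f) => k; rewrite nrmBC; apply: le_sqr2; first by pos.
rewrite -lee_fin nrm_sqrE (letr _ (key k))//; apply: sqint_le => //.
by apply: filterS2 (fnB (cls f) (b k)) (cls_ae L2f) => x -> ->.
Qed.

Lemma Lsq_complete (a_ : nat -> Lsq R) :
 (forall e : R, 0 < e -> exists n, forall i j, (n <= i)%N -> (n <= j)%N -> nrm (a_ i - a_ j) <= e) ->
 exists a, cvgL2 a_ a.
move=> ca.
have /choice[N hN] k : exists n, forall i j, (n <= i)%N -> (n <= j)%N ->
  nrm (a_ i - a_ j) <= 2^-1 ^+ k by apply: ca; rewrite exprn_gt0.
(* Adding up the indices makes [M] monotone while keeping [M k] beyond [N k], so that two
   consecutive terms are close. *)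
pose M k := (\sum_(i < k.+1) N i)%N.
have NM k : (N k <= M k)%N by rewrite /M big_ord_recr /= leq_addl.
have MM k : (M k <= M k.+1)%N by rewrite /M [leqRHS]big_ord_recr /= leq_addr.
have [|a ha] := @rapid_cvg (fun k => a_ (M k)).
 by move=> k; apply: hN; [exact: leq_trans (NM k) (MM k)|exact: NM].
exists a => e e0.
have [k hk] : exists k, 3 * (2^-1 : R) ^+ k <= e.
 have /cvgrPdist_le/(_ (e / 3)) : (fun k => (2^-1 : R) ^+ k) @ \oo --> (0 : R).
  by apply: cvg_expr; rewrite ger0_norm// invf_lt1// ltr1n.
 rewrite divr_gt0// => /(_ isT)[k _ /(_ k (leqnn k))].
 rewrite sub0r normrN ger0_norm ?exprn_ge0// => h; exists k.
 by rewrite mulrC -ler_pdivlMr.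
exists (N k) => i ki; rewrite (letr (nrm_dist (a_ (M k)) _ _))//.
have := ha k; have := hN k i (M k) ki (NM k) => /=; lra.
Qed.

Lemma cvgL2_unique (a_ : nat -> Lsq R) a b : cvgL2 a_ a -> cvgL2 a_ b -> a = b.
move=> ha hb; apply/eqP; rewrite -subr_eq0; apply/eqP/nrm_eq0/eqP.
rewrite eq_le nrm_ge0 andbT; apply/ler_addgt0Pl => e e0; rewrite addr0.
have [n hn] := ha (e / 2) (divr_gt0 e0 (ltr0Sn _ _)).
have [m hm] := hb (e / 2) (divr_gt0 e0 (ltr0Sn _ _)).
rewrite (letr (nrm_dist (a_ (maxn n m)) _ _))// nrmBC.
have := hn _ (leq_maxl n m); have := hm _ (leq_maxr n m); lra.
Qed.

(** By Fatou the L^2 distance between the two limits is below every positive [e]. This is the bridge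
    from abstract L^2 limits to explicit formulas. *)
Lemma cvgL2_ae_eq (a_ : nat -> Lsq R) a f : cvgL2 a_ a -> cmeas f ->
 {ae mu, forall x, (fun n => cmod (a_ n x - f x)) @ \oo --> (0 : R)} ->
 {ae mu, forall x, a x = f x}.
move=> ca mf cf.
have key e : 0 < e -> (\int[mu]_x (cmod (f x - a x) ^+ 2)%:E <= (e ^+ 2)%:E)%E.
 by move=> e0; have [n hn] := ca e e0; exact: fatou_nrm mf cf hn.
have z : (\int[mu]_x (cmod (f x - a x) ^+ 2)%:E = 0)%E.
 apply/eqP; rewrite eq_le; apply/andP; split; last first.
  by apply: integral_ge0 => x _; rewrite lee_fin sqr_ge0.
 apply/lee_addgt0Pr => e e0; rewrite add0e.
 have := key (sqrt e); rewrite sqrtr_gt0 e0 => /(_ isT).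
 by rewrite sqr_sqrtr ?(ltW e0).
have : ae_eq mu setT (fun x => (cmod (f x - a x) ^+ 2)%:E) (fun=> 0%E).
 apply/ae_eq_integral_abs => //; first by meas; exact: cmeasB.
 by under eq_integral do rewrite /= ger0_norm ?sqr_ge0//.
apply: filterS => x /(_ I)[] /eqP; rewrite sqrf_eq0 => /eqP /cmod_eq0 /eqP.
by rewrite subr_eq0 => /eqP.
Qed.

End Completeness.

(** * Maps that multiply a measure by a constant *)

Section MeasureScaling.
Context {d : measure_display} {T : measurableType d} {R : realType}.
Variable mu : {measure set T -> \bar R}.

(** The constant [k] is the inverse Jacobian: 1 for translations, 1/t for the dilation of the line
    by t. Change of variables, integrability and invariance of null sets all follow from this single
    property. *)
Definition scales_measure (phi : T -> T) (k : R) :=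
 [/\ mfun phi, 0 < k &
   forall A, measurable A -> mu (phi @^-1` A) = (k%:E * mu A)%E].

Variables (phi : T -> T) (k : R).
Hypothesis hphi : scales_measure phi k.
Let mphi : mfun phi. Proof. by case: hphi. Qed.
Let k0 : 0 < k. Proof. by case: hphi. Qed.

Lemma scales_ge0_integral (f : T -> \bar R) : mfun f ->
 (forall x, 0 <= f x)%E -> (\int[mu]_x f (phi x) = k%:E * \int[mu]_x f x)%E.
move=> mf f0.
pose kk := NngNum (ltW k0).
have -> : (k%:E * \int[mu]_x f x = \int[mscale kk mu]_x f x)%E.
 by rewrite ge0_integral_mscale.
rewrite -[LHS](@ge0_integral_pushforward _ _ _ _ R phi mphi mu setT f)//.
apply: eq_measure_integral => A mA _.
rewrite -[LHS]/(mu (phi @^-1` A)) -[RHS]/(k%:E * mu A)%E.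
by case: hphi => _ _ ->.
Qed.

Lemma scales_integrable (f : T -> \bar R) : mu.-integrable setT f ->
 mu.-integrable setT (fun x => f (phi x)).
move=> /integrableP[mf h]; apply/integrableP; split.
 exact: measurableT_comp mf mphi.
rewrite (scales_ge0_integral (f := fun x => `|f x|%E))//; last exact: measurableT_comp.
by rewrite lte_mul_pinfty// ?lee_fin ?ltW.
Qed.

Lemma scales_Rintegral (f : T -> R) : mu.-integrable setT (fun x => (f x)%:E) ->
 (\int[mu]_x f (phi x) = k * \int[mu]_x f x)%R.
move=> fi; have /integrableP[/measurable_EFinP mf _] := fi.
have e : f = (fun x => Num.max (f x) 0 - Num.max (- f x) 0).
 by apply/funext => x; rewrite /Num.max; case: ifPn; case: ifPn => /=; lra.
have mp : mfun (fun x => Num.max (f x) 0) by exact: measurable_maxr.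
have mn : mfun (fun x => Num.max (- f x) 0).
 by apply: measurable_maxr => //; exact: measurable_funN.
have ip : mu.-integrable setT (EFin \o (fun x => Num.max (f x) 0)).
 apply: (le_integrable measurableT _ _ fi); first exact/measurable_EFinP.
 by move=> x _ /=; rewrite lee_fin ger0_norm ?le_max ?lexx ?orbT// ge_max ler_norm normr_ge0.
have in_ : mu.-integrable setT (EFin \o (fun x => Num.max (- f x) 0)).
 apply: (le_integrable measurableT _ _ fi); first exact/measurable_EFinP.
 by move=> x _ /=; rewrite lee_fin ger0_norm ?le_max ?lexx ?orbT// ge_max -normrN ler_norm normr_ge0.
have key (g : T -> R) : (forall x, 0 <= g x) -> mu.-integrable setT (EFin \o g) ->
  (\int[mu]_x g (phi x) = k * \int[mu]_x g x)%R.
 move=> g0 gi; have /integrableP[/measurable_EFinP mg _] := gi.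
 rewrite /Rintegral (scales_ge0_integral (f := fun x => (g x)%:E))//.
 - have gi' : mu.-integrable setT (fun x => (g x)%:E).
   exact: gi.
  by rewrite fineM// integrable_fin_num.
 - by meas.
rewrite e.
have cp : mu.-integrable setT (EFin \o (fun x => Num.max (f (phi x)) 0)).
 exact: (scales_integrable ip).
have cn : mu.-integrable setT (EFin \o (fun x => Num.max (- f (phi x)) 0)).
 exact: (scales_integrable in_).
rewrite [RHS](_ : _ = k * (\int[mu]_x Num.max (f x) 0 - \int[mu]_x Num.max (- f x) 0)%R); last first.
 by congr (_ * _); exact: RintegralB.
rewrite mulrBr -!key//; first exact: RintegralB.
- by move=> x; rewrite le_max lexx orbT.
- by move=> x; rewrite le_max lexx orbT.
Qed.

Lemma scales_cint1 (f : T -> R[i]) : cint1 mu f -> cint1 mu (fun x => f (phi x)).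
by move=> [a b]; split; [exact: (scales_integrable a)|exact: (scales_integrable b)]. Qed.

Lemma scales_CI (f : T -> R[i]) : cint1 mu f -> CI mu (fun x => f (phi x)) = k%:C * CI mu f.
move=> [a b]; apply: complex_eq; rewrite ?ReM ?ImM /= mul0r ?subr0 ?addr0.
 exact: (scales_Rintegral a).
exact: (scales_Rintegral b).
Qed.

Lemma scales_ae (P : T -> Prop) : {ae mu, forall x, P x} -> {ae mu, forall x, P (phi x)}.
move=> [N [mN N0 PN]]; exists (phi @^-1` N); split.
- by rewrite -[X in measurable X]setTI; exact: mphi.
- by case: hphi => _ _ ->//; rewrite N0 mule0.
- by move=> x /= Px; apply: PN.
Qed.

End MeasureScaling.

(** * Translations and dilations of Lebesgue measure *)

Section LebesgueScaling.
Context {R : realType}.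
Local Notation leb := (@lebesgue_measure R).

Lemma leb_shift (a : R) : scales_measure leb (fun x => x + a) 1.
have mphi : mfun (fun x : measurableTypeR R => (x + a : measurableTypeR R)).
 by meas.
split=> // A mA; rewrite mul1e.
rewrite -[LHS]/(pushforward leb (fun x : measurableTypeR R => (x + a : measurableTypeR R)) A).
apply/esym; apply: lebesgue_measure_unique => // _ [[x y] _ <-] /=.
rewrite /pushforward /=.
rewrite (_ : _ @^-1` _ = `]x - a, y - a]%classic); last first.
 by apply/seteqP; split => z /=; rewrite !in_itv/= ltrBlDr lerBrDr.
by rewrite !lebesgue_measure_itv /= !lte_fin ltrD2r; case: ifP => // _; rewrite -!EFinB; congr EFin; ring.
Qed.

Lemma leb_scale (t : R) : 0 < t -> scales_measure leb (fun x => t * x) t^-1.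
move=> t0.
have mphi : mfun (fun x : measurableTypeR R => (t * x : measurableTypeR R)).
 by meas.
split=> //; first by pos.
move=> A mA.
pose kk := NngNum (ltW t0).
have E : leb A = mscale kk (pushforward leb (fun x : measurableTypeR R => (t * x : measurableTypeR R))) A.
 move=> m; apply: lebesgue_measure_unique => // _ [[x y] _ <-].
 rewrite -[RHS]/((t%:E * leb ((fun z : R => (t * z)%R) @^-1` `]x, y]%classic))%E).
 have -> : (fun z : R => t * z) @^-1` `]x, y]%classic = `]x / t, y / t]%classic.
  by apply/seteqP; split => z /=; rewrite !in_itv/= ltr_pdivrMr// ler_pdivlMr// ![z * t]mulrC.
 rewrite !lebesgue_measure_itv /= !lte_fin ltr_pM2r ?invr_gt0//; case: ifP => _; last by rewrite mule0.
 by rewrite -!EFinB -EFinM; congr EFin; field; rewrite gt_eqF.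
have inv (X Y : \bar R) : X = (t%:E * Y)%E -> Y = ((t^-1)%:E * X)%E.
 by move=> ->; rewrite muleA -EFinM mulVf ?gt_eqF// mul1e.
exact: inv (E mphi).
Qed.

Lemma leb2_box (n : nat) : ((@leb2 R) (`[(- n%:R)%R, n%:R%R] `*` `[(- n%:R)%R, n%:R%R])%classic < +oo)%E.
rewrite /leb2 /= product_measure1E//.
have lt : (leb `[(- n%:R)%R, n%:R%R] < +oo)%E.
 by rewrite lebesgue_measure_itv /=; case: ifP => _; rewrite ?ltry// -EFinB ltry.
by apply: lte_mul_pinfty => //; rewrite ge0_fin_numE.
Qed.

(** An alias of [leb2], whose declared type is that of a plain measure; the alias carries the
    sigma-finite structure on which Fubini relies. *)
Definition leb2f : set (plane R) -> \bar R := leb2.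
HB.instance Definition _ := Measure.on leb2f.

Fact leb2f_sigma_finite : sigma_finite setT leb2f.
exists (fun n : nat => `[- n%:R, n%:R] `*` `[- n%:R, n%:R]).
 apply/esym; rewrite -subTset => x _.
 have [n hn] : exists n : nat, `|x.1| + `|x.2| <= n%:R.
  exists (Num.bound (`|x.1| + `|x.2|)).
  by rewrite ltW// archi_boundP// addr_ge0.
 exists n => //; rewrite /= !in_itv /= -!ler_norml; split.
  by rewrite (letr _ hn)// lerDl.
 by rewrite (letr _ hn)// lerDr.
by move=> n; split; [exact: measurableX|exact: leb2_box].
Qed.
HB.instance Definition _ := Measure_isSigmaFinite.Build _ _ _ leb2f leb2f_sigma_finite.

Lemma leb2_fubini (f g : plane R -> R[i]) (k : plane R * plane R -> R[i]) :
 cint1 leb2 f -> cint1 leb2 g -> cmeas k -> (forall z, cmod (k z) <= 1) ->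
 CI leb2 (fun x => f x * CI leb2 (fun y => g y * k (x, y))) =
 CI leb2 (fun y => g y * CI leb2 (fun x => f x * k (x, y))).
exact: (@CI_fubini _ _ _ _ _ leb2f leb2f). Qed.

Lemma leb2_prod (f1 f2 : R -> R) (k1 k2 : R) :
 scales_measure leb f1 k1 -> scales_measure leb f2 k2 ->
 scales_measure (@leb2 R) (fun x => (f1 x.1, f2 x.2)) (k1 * k2).
move=> [m1 k10 h1] [m2 k20 h2].
have mphi : mfun (fun x : plane R => ((f1 x.1, f2 x.2) : plane R)).
 apply: measurable_fun_pair.
  exact: measurableT_comp m1 measurable_fst.
 exact: measurableT_comp m2 measurable_snd.
have k0 : 0 < k1 * k2 by pos.
split=> // A mA.
have k0' : 0 <= (k1 * k2)^-1 by pos.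
pose kk := NngNum k0'.
have E : leb2 A = mscale kk (pushforward (@leb2 R) (fun x : plane R => ((f1 x.1, f2 x.2) : plane R))) A.
 move=> m; apply: product_measure_unique => // A1 A2 mA1 mA2.
 rewrite -[LHS]/(((k1 * k2)^-1)%:E * (leb \x leb)%E ((f1 @^-1` A1) `*` (f2 @^-1` A2)))%E.
 rewrite product_measure1E//; last 2 first.
 - by rewrite -[X in measurable X]setTI; exact: m1.
 - by rewrite -[X in measurable X]setTI; exact: m2.
 have alg (X Y X1 Y1 : \bar R) : X = (k1%:E * X1)%E -> Y = (k2%:E * Y1)%E ->
   (((k1 * k2)^-1)%:E * (X * Y) = X1 * Y1)%E.
  move=> -> ->; rewrite (_ : (k1%:E * X1 * (k2%:E * Y1) = (k1 * k2)%:E * (X1 * Y1))%E).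
   by rewrite muleA -EFinM mulVf ?gt_eqF// mul1e.
  by rewrite EFinM muleACA.
 exact: alg (h1 _ mA1) (h2 _ mA2).
have inv (X Y : \bar R) : X = (((k1 * k2)^-1)%:E * Y)%E -> Y = ((k1 * k2)%:E * X)%E.
 by move=> ->; rewrite muleA -EFinM divff ?gt_eqF// mul1e.
exact: inv (E mphi).
Qed.

Definition shift (a : plane R) (x : plane R) : plane R := (x.1 + a.1, x.2 + a.2).
Definition dilate (t : R) (x : plane R) : plane R := (t * x.1, t * x.2).
Lemma leb2_shift a : scales_measure (@leb2 R) (shift a) 1.
by have := leb2_prod (leb_shift a.1) (leb_shift a.2); rewrite mulr1. Qed.

Lemma leb2_dilate t : 0 < t -> exists2 k, 0 < k & scales_measure (@leb2 R) (dilate t) k.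
move=> t0; exists (t^-1 * t^-1); first by pos.
exact: leb2_prod (leb_scale t0) (leb_scale t0).
Qed.

Lemma leb2_CI_prod (f g : R -> R[i]) : cint1 leb f -> cint1 leb g ->
 cint1 (@leb2 R) (fun z => f z.1 * g z.2) /\
 CI (@leb2 R) (fun z => f z.1 * g z.2) = CI leb f * CI leb g.
exact: CI_prod. Qed.

End LebesgueScaling.

(** * Differentiation under the integral sign *)

Section DifferentiationUnderIntegral.
Context {R : realType}.
Local Notation leb := (@lebesgue_measure R).

Lemma is_derive_under (f df : R -> R -> R) (G : R -> R) (a u v : R) : u < a < v ->
 (forall s x, u < s < v -> is_derive s 1 (f^~ x) (df s x)) ->
 (forall s, u < s < v -> leb.-integrable setT (fun x => (f s x)%:E)) ->
 leb.-integrable setT (fun x => (G x)%:E) ->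
 (forall s x, u < s < v -> `|df s x| <= G x) ->
 is_derive a 1 (fun s => \int[leb]_x f s x)%R (\int[leb]_x df a x)%R.
move=> uav dfP fi Gi Gb.
have Ia : `]u, v[%classic a by rewrite /= in_itv.
have d1 s x : `]u, v[%classic s -> partial1of2 f s x = df s x.
 rewrite /= in_itv /= => us; rewrite partial1of2E.
 by have h := dfP s x us; rewrite derive_val.
have fi' s : `]u, v[%classic s -> leb.-integrable setT (EFin \o f s).
 by rewrite /= in_itv /= => us; exact: fi.
have dfb s x : `]u, v[%classic s -> setT x -> derivable (f^~ x) s 1.
 by rewrite /= in_itv /= => us _; have h := dfP s x us.
have G0 x : 0 <= G x by exact: letr (normr_ge0 _) (Gb a x uav).
have Gb' s x : `]u, v[%classic s -> setT x -> `|partial1of2 f s x| <= G x.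
 by move=> us _; rewrite d1//; move: us; rewrite /= in_itv; exact: Gb.
have D := derivable_under_integral measurableT Ia fi' dfb G0 Gi Gb'.
have E := differentiation_under_integral measurableT Ia fi' dfb G0 Gi Gb'.
apply: DeriveDef; first exact: D.
rewrite -derive1E E; apply: eq_Rintegral => x _; exact: d1.
Qed.

End DifferentiationUnderIntegral.

(** * Gaussian integrals with complex parameters *)

Section GaussianIntegral.
Context {R : realType}.
Local Notation leb := (@lebesgue_measure R).

Lemma gauss_scaled (k : R) : 0 < k -> leb.-integrable setT (fun x => (expR (- k * x ^+ 2))%:E).
move=> k0; have := scales_integrable (leb_scale (_ : 0 < sqrt k)) (@integrableT_gauss R).
rewrite sqrtr_gt0 k0 => /(_ isT); apply: eq_integrable => // x _ /=.
by rewrite /gauss_fun exprMn sqr_sqrtr ?ltW// mulNr.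
Qed.

Definition cder (F : R -> R[i]) (s : R) (F' : R[i]) :=
 is_derive s 1 (fun t => Re (F t)) (Re F') /\
 is_derive s 1 (fun t => Im (F t)) (Im F').

Lemma cder_affine (a b : R[i]) s : cder (fun t => a + t%:C * b) s b.
have A (u v : R) : is_derive s 1 (fun s : R => u + s * v) v.
 have H := is_deriveD (is_derive_cst u s 1) (is_deriveM (is_derive_id s 1) (is_derive_cst v s 1)).
 by apply: (is_derive_eq H); rewrite /GRing.scale /=; ring.
split; [have := A (Re a) (Re b)|have := A (Im a) (Im b)];
 congr is_derive; apply/funext => t; rewrite !(ReD, ReM, ImD, ImM) /=; ring.
Qed.

Lemma cderM F G s F' G' : cder F s F' -> cder G s G' -> cder (fun t => F t * G t) s (F' * G s + F s * G').
move=> [f1 f2] [g1 g2]; split.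
 have H := is_deriveB (is_deriveM f1 g1) (is_deriveM f2 g2); under eq_fun do rewrite ReM.
 by apply: (is_derive_eq H); rewrite ReD !ReM /GRing.scale /=; ring.
have H := is_deriveD (is_deriveM f1 g2) (is_deriveM f2 g1); under eq_fun do rewrite ImM.
by apply: (is_derive_eq H); rewrite ImD !ImM /GRing.scale /=; ring.
Qed.

Lemma cder_cexp F s F' : cder F s F' -> cder (fun t => cexp (F t)) s (F' * cexp (F s)).
move=> [f1 f2].
have dE : is_derive s 1 (expR \o (fun t => Re (F t))) (expR (Re (F s)) * Re F').
 by apply: is_derive_eq.
have dC : is_derive s 1 (cos \o (fun t => Im (F t))) (- (Im F' * sin (Im (F s)))).
 by apply: is_derive_eq; rewrite /GRing.scale /=; ring.
have dS : is_derive s 1 (sin \o (fun t => Im (F t))) (Im F' * cos (Im (F s))).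
 by apply: is_derive_eq; rewrite /GRing.scale /=; ring.
split; [have H := is_deriveM dE dC|have H := is_deriveM dE dS].
 rewrite (_ : (fun t => _) = (expR \o (fun t => Re (F t))) * (cos \o (fun t => Im (F t)))); last first.
  by apply/funext => t; rewrite /cexp ReM /= mul0r subr0.
 by apply: (is_derive_eq H); rewrite !(ReM, ImM) /GRing.scale /=; ring.
rewrite (_ : (fun t => _) = (expR \o (fun t => Re (F t))) * (sin \o (fun t => Im (F t)))); last first.
 by apply/funext => t; rewrite /cexp ImM /= mul0r addr0.
by apply: (is_derive_eq H); rewrite !(ReM, ImM) /GRing.scale /=; ring.
Qed.

(* With w = c x + d, the s-derivative of (dw/dx) exp (- w^2) along a path in
  (c, d) is the x-derivative of (dw/ds) exp (- w^2). *)
Definition gaussW (c d : R[i]) (x : R) : R[i] := c * x%:C + d.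
Definition gaussI (c d : R[i]) (x : R) : R[i] := c * cexp (- gaussW c d x ^+ 2).
Definition gaussA (c d : R[i]) (x : R) : R[i] :=
 (1 - (2 * x)%:C * (c * gaussW c d x)) * cexp (- gaussW c d x ^+ 2).
Definition gaussB (c d : R[i]) (x : R) : R[i] :=
 - (2%:C * (c * gaussW c d x)) * cexp (- gaussW c d x ^+ 2).

Lemma Re_gaussW c d x : Re (gaussW c d x) = Re c * x + Re d.
by rewrite /gaussW ReD ReM /= mulr0 subr0. Qed.
Lemma Im_gaussW c d x : Im (gaussW c d x) = Im c * x + Im d.
by rewrite /gaussW ImD ImM /= mulr0 add0r. Qed.
Lemma Re_Nsqr (w : R[i]) : Re (- w ^+ 2) = Im w ^+ 2 - Re w ^+ 2.
by rewrite expr2 ReN ReM; ring. Qed.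
Lemma Im_Nsqr (w : R[i]) : Im (- w ^+ 2) = - (2 * Re w * Im w).
by rewrite expr2 ImN ImM; ring. Qed.

Lemma cder_gaussI (c d g e : R[i]) (x s : R) : let cs := c + s%:C * g in let ds := d + s%:C * e in
 cder (fun s => gaussI (c + s%:C * g) (d + s%:C * e) x) s (g * gaussA cs ds x + e * gaussB cs ds x).
move=> cs ds; pose w := c * x%:C + d; pose w' := g * x%:C + e.
have := cderM (cder_affine c g s) (cder_cexp (cderM (cder_affine w w' s) (cder_affine (- w) (- w') s))).
have E t : (w + t%:C * w') * (- w + t%:C * - w') = - gaussW (c + t%:C * g) (d + t%:C * e) x ^+ 2.
 by rewrite /gaussW /w /w'; ring.
rewrite E (_ : (fun t => _ * cexp _) = fun s => gaussI (c + s%:C * g) (d + s%:C * e) x); last first.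
 by apply/funext => t; rewrite E.
congr cder; rewrite /gaussA /gaussB -/cs -/ds realcM (rmorph_nat (real_complex R) 2) /w /w'.
have -> : gaussW cs ds x = c * x%:C + d + s%:C * (g * x%:C + e) by rewrite /gaussW /cs /ds; ring.
ring.
Qed.

(** The third condition keeps the real part of c^2 at least dl^2, so exp (- w^2) decays like a
    Gaussian uniformly in the parameters. *)
Definition gauss_adm (M dl : R) (c d : R[i]) :=
 [/\ cmod c <= M, cmod d <= M & `|Im c| + dl <= Re c].

Lemma gauss_bound (M dl : R) (c d : R[i]) (x : R) : 0 < dl -> gauss_adm M dl c d ->
 cmod (cexp (- gaussW c d x ^+ 2)) <=
 expR (8 * M ^+ 4 / dl ^+ 2 + M ^+ 2) * expR (- (dl ^+ 2 / 2) * x ^+ 2).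
move=> dl0 [cM dM cd]; rewrite cmod_cexp Re_Nsqr Re_gaussW Im_gaussW -expRD ler_expR.
have := letr (Re_le_cmod c) cM; have := letr (Im_le_cmod c) cM.
have := letr (Re_le_cmod d) dM; have := letr (Im_le_cmod d) dM.
move: cd; move: (Re c) (Im c) (Re d) (Im d) => p q u v.
move=> pq vM uM qM pM.
have p0 : 0 <= p by rewrite (letr _ pq)// addr_ge0// ltW.
have M0 : 0 <= M by exact: letr (normr_ge0 _) pM.
have h1 : dl ^+ 2 <= p ^+ 2 - q ^+ 2.
 rewrite -(real_normK (num_real q)); have := normr_ge0 q; nra.
have h2 : `|p * u - q * v| <= 2 * M ^+ 2.
 rewrite (letr (ler_normB _ _))// !normrM.
 have := normr_ge0 u; have := normr_ge0 v; have := normr_ge0 p; have := normr_ge0 q; nra.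
have h3 : v ^+ 2 <= M ^+ 2.
 by rewrite -(real_normK (num_real v)) sqr_le2.
have h4 : `|(p * u - q * v) * x| <= 2 * M ^+ 2 * `|x| by rewrite normrM ler_wpM2r.
(* Young's inequality absorbs the linear term into half of the quadratic one. *)
have h5 : 4 * M ^+ 2 * `|x| <= dl ^+ 2 / 2 * x ^+ 2 + 8 * M ^+ 4 / dl ^+ 2.
 rewrite -(real_normK (num_real x)); move: (normr_ge0 x); move: `|x| => y y0.
 rewrite -subr_ge0.
 have -> : dl ^+ 2 / 2 * y ^+ 2 + 8 * M ^+ 4 / dl ^+ 2 - 4 * M ^+ 2 * y =
  (dl * y / 2 - 2 * M ^+ 2 / dl) ^+ 2 * 2 by field; rewrite gt_eqF.
 by pos.
have h6 : dl ^+ 2 * x ^+ 2 <= (p ^+ 2 - q ^+ 2) * x ^+ 2 by rewrite ler_wpM2r ?sqr_ge0.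
have h7 := ler_norm (- ((p * u - q * v) * x)); rewrite normrN in h7.
nra.
Qed.

(** Half of the exponent absorbs the polynomial factor, by 1 + u <= exp u. *)
Lemma sqr_gauss_bound (k x : R) : 0 < k ->
 (1 + x ^+ 2) * expR (- (k * x ^+ 2)) <= (1 + 2 / k) * expR (- (k / 2) * x ^+ 2).
move=> k0; have e : expR (- (k * x ^+ 2)) = expR (- (k / 2 * x ^+ 2)) * expR (- (k / 2) * x ^+ 2).
 by rewrite -expRD; congr expR; field.
rewrite e mulrA ler_wpM2r// expRN ler_pdivrMr ?expR_gt0//.
have h : 1 + k / 2 * x ^+ 2 <= expR (k / 2 * x ^+ 2) by exact: expR_ge1Dx.
have k2 : 0 <= 2 / k by pos.
apply: (via ((1 + 2 / k) * (1 + k / 2 * x ^+ 2))); last by rewrite ler_wpM2l// addr_ge0.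
have -> : (1 + 2 / k) * (1 + k / 2 * x ^+ 2) = 1 + 2 / k + k / 2 * x ^+ 2 + x ^+ 2 by field; rewrite gt_eqF.
nra.
Qed.

Definition gaussK (M dl : R) : R := expR (8 * M ^+ 4 / dl ^+ 2 + M ^+ 2).
(** An integrable majorant of the parameter derivatives, the same for all admissible parameters, as
    differentiation under the integral demands. *)
Definition gaussG (M dl : R) (x : R) : R :=
 (2 * M * (1 + 6 * M ^+ 2) * (1 + 4 / dl ^+ 2) * gaussK M dl) * expR (- (dl ^+ 2 / 4) * x ^+ 2).

Lemma gaussG_integrable M dl : 0 < dl -> leb.-integrable setT (fun x => (gaussG M dl x)%:E).
move=> dl0; rewrite /gaussG; under eq_fun do rewrite EFinM.
by apply: integrableZl => //; apply: gauss_scaled; rewrite divr_gt0// exprn_gt0.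
Qed.

Lemma gauss_poly_bound (M dl : R) (c d g e : R[i]) (x : R) : 0 < dl -> gauss_adm M dl c d ->
 cmod g <= M -> cmod e <= M ->
 cmod (g * gaussA c d x + e * gaussB c d x) <= gaussG M dl x.
move=> dl0 adm gM eM; have [cM dM _] := adm; have b := gauss_bound x dl0 adm.
have M0 : 0 <= M by exact: letr (cmod_ge0 _) cM.
set E := cexp (- gaussW c d x ^+ 2) in b.
have wb : cmod (gaussW c d x) <= M * (1 + `|x|).
 rewrite /gaussW (letr (cmodD _ _))// cmodM cmod_real mulrDr mulr1 addrC lerD//.
 by rewrite ler_wpM2r.
have cw : cmod (c * gaussW c d x) <= M ^+ 2 * (1 + `|x|).
 rewrite cmodM expr2 -mulrA ler_pM ?cmod_ge0//.
have -> : g * gaussA c d x + e * gaussB c d x =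
  (g * (1 - (2 * x)%:C * (c * gaussW c d x)) - e * (2%:C * (c * gaussW c d x))) * E.
 by rewrite /gaussA /gaussB -/E; ring.
have pb : cmod (g * (1 - (2 * x)%:C * (c * gaussW c d x)) - e * (2%:C * (c * gaussW c d x)))
  <= 2 * M * (1 + 6 * M ^+ 2) * (1 + x ^+ 2).
 rewrite (letr (cmodB _ _))// !cmodM.
 have h1 : cmod (1 - (2 * x)%:C * (c * gaussW c d x)) <= 1 + 2 * `|x| * (M ^+ 2 * (1 + `|x|)).
  rewrite (letr (cmodB _ _))// cmod1 lerD2l cmodM cmod_real normrM (ger0_norm (ler0n _ 2)).
  by rewrite ler_wpM2l// mulr_ge0.
 have h2 : cmod (2 : R)%:C * (cmod c * cmod (gaussW c d x)) <= 2 * (M ^+ 2 * (1 + `|x|)).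
  by rewrite -cmodM cmod_real (ger0_norm (ler0n _ 2)) ler_wpM2l.
 apply: (via (M * (1 + 2 * `|x| * (M ^+ 2 * (1 + `|x|))) + M * (2 * (M ^+ 2 * (1 + `|x|))))).
  rewrite lerD// ler_pM ?cmod_ge0// !mulr_ge0 ?cmod_ge0//.
 have : `|x| <= 1 + x ^+ 2 by rewrite -(real_normK (num_real x)); have := normr_ge0 x; nra.
 rewrite -(real_normK (num_real x)); move: (normr_ge0 x); move: `|x| => y y0 y1.
 rewrite -subr_ge0.
 have -> : 2 * M * (1 + 6 * M ^+ 2) * (1 + y ^+ 2) -
   (M * (1 + 2 * y * (M ^+ 2 * (1 + y))) + M * (2 * (M ^+ 2 * (1 + y)))) =
   M * (1 + 2 * y ^+ 2) + M ^+ 3 * (10 + 10 * y ^+ 2 - 4 * y) by ring.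
 apply: addr_ge0; apply: mulr_ge0; rewrite ?exprn_ge0//; nra.
rewrite cmodM /gaussG.
apply: (via (2 * M * (1 + 6 * M ^+ 2) * (1 + x ^+ 2) * (gaussK M dl * expR (- (dl ^+ 2 / 2) * x ^+ 2)))).
 by apply: ler_pM; rewrite ?cmod_ge0.
have k0 : 0 < dl ^+ 2 / 2 by pos.
have := sqr_gauss_bound x k0.
have -> : 1 + 2 / (dl ^+ 2 / 2) = 1 + 4 / dl ^+ 2 :> R by field; rewrite gt_eqF.
have -> : dl ^+ 2 / 2 / 2 = dl ^+ 2 / 4 :> R by field.
rewrite -mulNr => h.
have K0 : 0 <= 2 * M * (1 + 6 * M ^+ 2) * gaussK M dl.
 by rewrite !mulr_ge0 ?expR_ge0// addr_ge0// mulr_ge0// sqr_ge0.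
nra.
Qed.

Lemma cmeas_id : cmeas (fun x : R => x%:C).
by meas; exact: measurable_id. Qed.

Lemma cmeas_gaussW c d : cmeas (gaussW c d).
by apply: cmeasD; [apply: cmeasM; [exact: cmeas_cst|exact: cmeas_id]|exact: cmeas_cst].
Qed.

Lemma cmeas_gaussE c d : cmeas (fun x => cexp (- gaussW c d x ^+ 2)).
apply: cmeas_cexp; apply: cmeasN.
by under eq_fun do rewrite expr2; apply: cmeasM; exact: cmeas_gaussW.
Qed.

Lemma gaussI_cint1 M dl c d : 0 < dl -> gauss_adm M dl c d -> cint1 leb (gaussI c d).
move=> dl0 adm; apply: cint1Z.
apply: (@cint1_le _ (measurableTypeR R) R leb _ (fun x => gaussK M dl * expR (- (dl ^+ 2 / 2) * x ^+ 2))).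
- exact: cmeas_gaussE.
- under eq_fun do rewrite EFinM.
 by apply: integrableZl => //; apply: gauss_scaled; rewrite divr_gt0// exprn_gt0.
- by move=> x; exact: gauss_bound.
Qed.

Lemma gaussAB_cint1 M dl c d : 0 < dl -> gauss_adm M dl c d ->
 cint1 leb (gaussA c d) /\ cint1 leb (gaussB c d).
move=> dl0 adm; have [cM dM h] := adm.
have adm' : gauss_adm (Num.max M 1) dl c d.
 by split; rewrite // le_max ?cM ?dM.
have m0 : cmod (0 : R[i]) <= Num.max M 1 by rewrite cmod0 le_max ler01 orbT.
have m1 : cmod (1 : R[i]) <= Num.max M 1 by rewrite cmod1 le_max lexx orbT.
have mW := cmeas_gaussW c d; have mE := cmeas_gaussE c d.
split; apply: (@cint1_le _ (measurableTypeR R) R leb _ (gaussG (Num.max M 1) dl)).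
- apply: cmeasM => //; apply: cmeasB; first exact: cmeas_cst.
 by meas.
- exact: gaussG_integrable.
- move=> x; have := gauss_poly_bound x dl0 adm' m1 m0.
 by rewrite mul1r mul0r addr0.
- apply: cmeasM => //; apply: cmeasN; apply: cmeasM; first exact: cmeas_cst.
 by meas.
- exact: gaussG_integrable.
- move=> x; have := gauss_poly_bound x dl0 adm' m0 m1.
 by rewrite mul1r mul0r add0r.
Qed.

Lemma cder_gaussint M dl (c d g e : R[i]) (s u v : R) : 0 < dl -> u < s < v ->
 (forall t, u < t < v -> gauss_adm M dl (c + t%:C * g) (d + t%:C * e)) ->
 cmod g <= M -> cmod e <= M ->
 let cs := c + s%:C * g in let ds := d + s%:C * e in
 cder (fun t => CI leb (gaussI (c + t%:C * g) (d + t%:C * e))) s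
  (g * CI leb (gaussA cs ds) + e * CI leb (gaussB cs ds)).
move=> dl0 us adm gM eM cs ds; have [iA iB] := gaussAB_cint1 dl0 (adm s us).
rewrite -!CIZ// -CID; [|exact: cint1Z..].
pose F t x := gaussI (c + t%:C * g) (d + t%:C * e) x.
pose dF t x := g * gaussA (c + t%:C * g) (d + t%:C * e) x + e * gaussB (c + t%:C * g) (d + t%:C * e) x.
have dFG t x : u < t < v -> cmod (dF t x) <= gaussG M dl x by move=> ut; exact: gauss_poly_bound dl0 (adm t ut) gM eM.
split; [apply: (@is_derive_under _ (fun t x => Re (F t x)) (fun t x => Re (dF t x)) (gaussG M dl) s u v us)|
 apply: (@is_derive_under _ (fun t x => Im (F t x)) (fun t x => Im (dF t x)) (gaussG M dl) s u v us)];
 try exact: gaussG_integrable.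
- by move=> t x ut; have [] := cder_gaussI c d g e x t.
- by move=> t ut; have [] := gaussI_cint1 dl0 (adm t ut).
- by move=> t x ut; apply: letr (dFG t x ut); exact: Re_le_cmod.
- by move=> t x ut; have [] := cder_gaussI c d g e x t.
- by move=> t ut; have [] := gaussI_cint1 dl0 (adm t ut).
- by move=> t x ut; apply: letr (dFG t x ut); exact: Im_le_cmod.
Qed.

(** The cone |Im c| < Re c is open. A displacement of size [dl * K] changes [|Im c|] and [Re c] by
    at most that much each, hence uses at most half of the gap [dl * (4 * K)]. *)
Lemma gauss_admP (c d : R[i]) (K : R) : `|Im c| < Re c -> 1 <= K ->
 exists M dl : R, [/\ 0 < dl, K <= M, gauss_adm M dl c d & forall t (g e : R[i]), `|t| < dl -> cmod g <= K ->
  cmod e <= K -> gauss_adm M dl (c + t%:C * g) (d + t%:C * e)].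
move=> h K0; pose dl := (Re c - `|Im c|) / (4 * K).
have dl0 : 0 < dl by rewrite divr_gt0 ?subr_gt0// mulr_gt0//; lra.
have dlK : dl * (4 * K) = Re c - `|Im c| by rewrite /dl divfK// gt_eqF// mulr_gt0//; lra.
have c0 := cmod_ge0 c; have d0 := cmod_ge0 d; pose M := K + cmod c + cmod d + K * dl.
have A t (g e : R[i]) : `|t| < dl -> cmod g <= K -> cmod e <= K -> gauss_adm M dl (c + t%:C * g) (d + t%:C * e).
 move=> tdl gK eK.
 have tb (z : R[i]) : cmod z <= K -> cmod (t%:C * z) <= K * dl.
  by move=> zK; rewrite cmodM cmod_real mulrC ler_pM ?cmod_ge0//; exact: ltW.
 have tg := tb g gK; have te := tb e eK.
 split; [by rewrite (letr (cmodD _ _))// /M; lra..|rewrite ImD ReD].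
 have h1 := letr (Re_le_cmod _) tg; have h2 := letr (Im_le_cmod _) tg.
 have h3 := ler_normD (Im c) (Im (t%:C * g)).
 have h4 := ler_norm (- Re (t%:C * g)); rewrite normrN in h4.
 nra.
exists M, dl; split=> //; first by rewrite /M; nra.
by have := A 0 0 0; rewrite normr0 !mulr0 !addr0 cmod0; apply => //; lra.
Qed.

(** Both integrals are read off along real symmetries instead of integrating by parts: replacing c
    by (1 + t)c dilates the variable and replacing d by d + tc translates it. The integral is
    constant along these paths, and its derivative there is c times the integral in question. *)
Lemma gauss_AB0 (c d : R[i]) : `|Im c| < Re c ->
 CI leb (gaussA c d) = 0 /\ CI leb (gaussB c d) = 0.
move=> h; pose K := 1 + cmod c; have K1 : 1 <= K by rewrite lerDl cmod_ge0.
have [M [dl [dl0 KM adm0 adm]]] := gauss_admP d h K1.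
have c0 : c != 0.
 apply/eqP => c0; move: h; rewrite c0 /= normr0 ltxx; exact.
have mc : cmod c <= K by rewrite lerDr.
have m0 : cmod (0 : R[i]) <= K by rewrite cmod0 (letr _ K1).
have ii := gaussI_cint1 dl0 adm0.
(* The bound 1/2 keeps [1 + t] positive, so that it is a legitimate dilation factor. *)
pose r := Num.min dl 2^-1.
have r0 : 0 < r by rewrite lt_min dl0 invr_gt0 ltr0n.
have rr : - r < 0 < r by rewrite oppr_lt0 r0.
have rdl (t : R) : - r < t < r -> `|t| < dl.
 move=> /andP[a b]; have rd : r <= dl by rewrite ge_min lexx.
 by rewrite ltr_norml (lt_le_trans b rd) andbT (le_lt_trans _ a)// lerN2.
have key (g e : R[i]) : cmod g <= K -> cmod e <= K ->
  (forall t, - r < t < r -> CI leb (gaussI (c + t%:C * g) (d + t%:C * e)) = CI leb (gaussI c d)) ->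
  g * CI leb (gaussA c d) + e * CI leb (gaussB c d) = 0.
 move=> g1 e1 cst_.
 have [] := @cder_gaussint M dl c d g e 0 (- r) r dl0 rr _ (letr g1 KM) (letr e1 KM).
  by move=> t tr; apply: adm => //; exact: rdl.
 rewrite !mul0r !addr0 => d1 d2.
 have near0 (P : R[i] -> R) : \forall t \near 0, P (CI leb (gaussI (c + t%:C * g) (d + t%:C * e))) = P (CI leb (gaussI c d)).
  near=> t; rewrite cst_//.
  have : t \in `](- r), r[ by near: t; exact: near_in_itvoo.
  by rewrite in_itv.
 have z (P : R[i] -> R) : is_derive (0 : R) (1 : R) (fun t : R => P (CI leb (gaussI (c + t%:C * g) (d + t%:C * e)))) 0.
  apply: (near_eq_is_derive (f := cst (P (CI leb (gaussI c d))))); try exact: is_derive_cst; try exact: oner_neq0.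
  by apply: filterS (near0 P) => t ->.
 apply: complex_eq => /=.
  have z1 := z (@Re R).
  by have := @derive_val _ _ _ _ _ _ _ d1; have := @derive_val _ _ _ _ _ _ _ z1 => -> .
 have z1 := z (@Im R).
 by have := @derive_val _ _ _ _ _ _ _ d2; have := @derive_val _ _ _ _ _ _ _ z1 => -> .
split.
 have := key c 0 mc m0; rewrite mul0r addr0 => H; apply/eqP.
 have : c * CI leb (gaussA c d) == 0.
  apply/eqP; apply: H => t tr.
  have t1 : 0 < 1 + t.
   move: tr => /andP[a _]; have : r <= 2^-1 by rewrite ge_min lexx orbT.
   lra.
  rewrite mulr0 addr0.
  have -> : gaussI (c + t%:C * c) d = (fun x => (1 + t)%:C * gaussI c d ((1 + t) * x)).
   by apply/funext => x; rewrite /gaussI /gaussW !realcM !realcD mulrA; congr (_ * cexp (- _ ^+ 2)); ring.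
  rewrite CIZ ?(scales_CI (leb_scale t1))// ?mulrA -?realcM ?divff ?gt_eqF ?mul1r//.
  exact: (scales_cint1 (leb_scale t1)).
 by rewrite mulf_eq0 (negbTE c0).
have := key 0 c m0 mc; rewrite mul0r add0r => H; apply/eqP.
have : c * CI leb (gaussB c d) == 0.
 apply/eqP; apply: H => t tr.
 rewrite mulr0 addr0.
 have -> : gaussI c (d + t%:C * c) = (fun x => gaussI c d (x + t)).
  by apply/funext => x; rewrite /gaussI /gaussW realcD; congr (_ * cexp (- _ ^+ 2)); ring.
 by rewrite (scales_CI (leb_shift t))// mul1r.
by rewrite mulf_eq0 (negbTE c0).
Unshelve. all: by end_near. Qed.

Lemma gauss_path (c d : R[i]) (t : R) : `|Im c| < Re c -> 0 <= t <= 1 ->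
 `|Im (1 + t%:C * (c - 1))| < Re (1 + t%:C * (c - 1)).
move=> h /andP[t0 t1]; rewrite !(ReD, ImD, ReM, ImM, ReN, ImN) /= !mul0r !subr0 !addr0 add0r.
rewrite normrM (ger0_norm t0); have := normr_ge0 (Im c).
have [->|tn] := eqVneq t 0; first by rewrite !mul0r addr0 ltr01.
have tp : 0 < t by rewrite lt_neqAle eq_sym tn.
nra.
Qed.

Lemma cder_path (c d : R[i]) (t : R) : `|Im c| < Re c -> 0 <= t <= 1 ->
 cder (fun s => CI leb (gaussI (1 + s%:C * (c - 1)) (0 + s%:C * d))) t 0.
move=> h t01; pose ct := 1 + t%:C * (c - 1); pose dt := t%:C * d.
have ht : `|Im ct| < Re ct by exact: gauss_path.
have [A0 B0] := gauss_AB0 dt ht.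
pose K := 1 + cmod (c - 1) + cmod d; have c0 := cmod_ge0 (c - 1); have d0 := cmod_ge0 d.
have [|M [dl [dl0 KM _ adm]]] := @gauss_admP ct dt K ht; first by rewrite /K; lra.
have gK : cmod (c - 1) <= K by rewrite /K; lra.
have eK : cmod d <= K by rewrite /K; lra.
have E s : ct + (s - t)%:C * (c - 1) = 1 + s%:C * (c - 1) by rewrite /ct (rmorphB (real_complex R)); ring.
have E' s : dt + (s - t)%:C * d = 0 + s%:C * d by rewrite /dt (rmorphB (real_complex R)); ring.
have := @cder_gaussint M dl 1 0 (c - 1) d t (t - dl) (t + dl) dl0 _ _ (letr gK KM) (letr eK KM).
cbv zeta; rewrite (add0r (t%:C * d)) A0 B0 !mulr0 addr0; apply; first lra.
by move=> s sI; rewrite -E -E'; apply: adm => //; rewrite ltr_norml; move: sI => /andP[]; lra.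
Qed.

(** A contour shift without contours: on the segment from (1, 0) to (c, d), which stays in the cone,
    the derivative vanishes by [gauss_AB0], and at (1, 0) the integral is the classical one. *)
Lemma gauss_integral0 (c d : R[i]) : `|Im c| < Re c ->
 CI leb (gaussI c d) = (sqrt pi)%:C.
move=> h.
have base : CI leb (gaussI 1 0) = (sqrt pi)%:C.
 have e : gaussI 1 0 = fun x => (expR (- x ^+ 2))%:C.
  apply/funext => x; rewrite /gaussI /gaussW mul1r addr0 mul1r /cexp Re_Nsqr Im_Nsqr /=.
  by rewrite mulr0 oppr0 cis0 mulr1 expr0n /= add0r.
 rewrite e; apply: complex_eq => /=.
  rewrite /Rintegral -[RHS]/(fine (sqrt pi)%:E); congr fine; exact: integralT_gauss.
 by rewrite /Rintegral integral0.
have cst_ (F : R -> R) : (forall t : R, 0 <= t <= 1 -> is_derive t (1 : R) F 0) -> F 1 = F 0.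
 move=> dF.
 have [||x _] := @MVT_segment R F (fun=> 0) 0 1 ler01.
 - by move=> x; rewrite in_itv /= => /andP[/ltW x0 /ltW x1]; apply: dF; rewrite x0.
 - apply: derivable_within_continuous => x; rewrite in_itv /= => x01.
  by have := dF x x01 => -[].
 - by rewrite mul0r => /eqP; rewrite subr_eq0 => /eqP.
have cst2 (F : R -> R[i]) : (forall t : R, 0 <= t <= 1 -> cder F t 0) -> F 1 = F 0.
 move=> dF; apply: complex_eq; [apply: (cst_ (fun t => Re (F t)))|apply: (cst_ (fun t => Im (F t)))];
  by move=> t t01; have [] := dF t t01.
have := cst2 _ (fun t t01 => cder_path d h t01); rewrite !mul1r !mul0r addr0 addrC subrK !add0r => ->.
by [].
Qed.

Lemma gauss_fourier1 (c : R[i]) (x : R) : `|Im c| < Re c ->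
 cint1 leb (fun y => cexp (- c ^+ 2 * (y ^+ 2)%:C) * cis (x * y)) /\
 CI leb (fun y => cexp (- c ^+ 2 * (y ^+ 2)%:C) * cis (x * y)) =
 (sqrt pi)%:C / c * cexp (- (x ^+ 2)%:C / (4%:R * c ^+ 2)).
move=> h; have c0 : c != 0.
 by apply/eqP => c0; move: h; rewrite c0 /= normr0 ltxx.
(* Completing the square: with this [d], the cross term of - (c y + d)^2 is i x y. *)
pose d := - ('i%C * x%:C / (2%:R * c)).
have e y : cexp (- c ^+ 2 * (y ^+ 2)%:C) * cis (x * y) =
  c^-1 * cexp (- (x ^+ 2)%:C / (4%:R * c ^+ 2)) * gaussI c d y.
 rewrite /gaussI /gaussW mulrACA mulVf// mul1r -cexpD.
 have -> : cis (x * y) = cexp ('i%C * x%:C * y%:C).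
  have -> : 'i%C * x%:C * y%:C = 0 +i* (x * y) by apply: complex_eq; rewrite !(ReM, ImM) /=; ring.
  by rewrite /cexp /= expR0 mul1r.
 rewrite -cexpD; congr cexp.
 have i2 : 'i%C ^+ 2 = -1 :> R[i] by exact: sqr_i.
 rewrite /d (rmorphXn (real_complex R)) (rmorphXn (real_complex R)) /=.
 have -> : - (c * y%:C + - ('i%C * x%:C / (2 * c))) ^+ 2 =
  - c ^+ 2 * y%:C ^+ 2 + 'i%C * x%:C * y%:C - 'i%C ^+ 2 * x%:C ^+ 2 / (4 * c ^+ 2) by field.
 rewrite i2; field.
 by [].
have [M [dl [dl0 _ adm0 _]]] := gauss_admP d h (lexx 1).
have ii := gaussI_cint1 dl0 adm0.
under eq_fun do rewrite e.
split; first exact: cint1Z.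
by rewrite CIZ// gauss_integral0// mulrC mulrA.
Qed.

Lemma gauss_fourier2 (c : R[i]) (x : plane R) : `|Im c| < Re c ->
 cint1 (@leb2 R) (fun y => cexp (- c ^+ 2 * (dot y y)%:C)) /\
 CI (@leb2 R) (fun y => cexp (- c ^+ 2 * (dot y y)%:C) * cis (dot x y)) =
 (pi%:C / c ^+ 2) * cexp (- (dot x x)%:C / (4%:R * c ^+ 2)).
move=> h.
have prodE (z y : plane R) : cexp (- c ^+ 2 * (dot y y)%:C) * cis (dot z y) =
  (cexp (- c ^+ 2 * (y.1 ^+ 2)%:C) * cis (z.1 * y.1)) *
  (cexp (- c ^+ 2 * (y.2 ^+ 2)%:C) * cis (z.2 * y.2)).
 rewrite mulrACA -cexpD -cisD -mulrDr -realcD.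
 by [].
have [i1 e1] := gauss_fourier1 x.1 h; have [i2 e2] := gauss_fourier1 x.2 h.
have [_ E] := leb2_CI_prod i1 i2.
have [j _] := gauss_fourier1 0 h.
have [J _] := leb2_CI_prod j j.
split.
 have e : (fun y : plane R => cexp (- c ^+ 2 * (dot y y)%:C)) = (fun z : plane R =>
   (cexp (- c ^+ 2 * (z.1 ^+ 2)%:C) * cis (0 * z.1)) *
   (cexp (- c ^+ 2 * (z.2 ^+ 2)%:C) * cis (0 * z.2))).
  apply/funext => y; have := prodE (0, 0) y => /= <-.
  have -> : dot (0, 0) y = 0 :> R by rewrite /dot !mul0r addr0.
  by rewrite cis0 mulr1.
 by rewrite e.
under eq_CI do rewrite prodE.
rewrite E e1 e2 mulrACA -cexpD; congr (_ * _).
 rewrite mulrACA -realcM -expr2 sqr_sqrtr ?pi_ge0//.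
 by congr (_ * _); rewrite expr2 invfM.
by congr cexp; rewrite -mulrDl -opprD -realcD /dot !expr2.
Qed.

End GaussianIntegral.

(** * The Fourier integral of integrable functions *)

Section FourierIntegral.
Context {R : realType}.
Implicit Types (f g : plane R -> R[i]) (x y xi : plane R) (c : R).

Lemma measurable_param (h : plane R * plane R -> R) : mfun h ->
 (forall x, mu.-integrable setT (fun y => (h (x, y))%:E)) ->
 mfun (fun x => \int[mu]_y h (x, y))%R.
move=> mh ih; have mh' : mfun (EFin \o h) by exact/measurable_EFinP.
have mp : mfun (fun x => \int[mu]_y ((fun y => (h (x, y))%:E)^\+ y))%E.
 have := @measurable_fun_fubini_tonelli_F _ _ _ _ R leb2f (EFin \o h)^\+%E.
 move=> /(_ (measurable_funepos mh') (funepos_ge0 _)); congr (measurable_fun _ _).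
 by apply/funext => x; rewrite /fubini_F; apply: eq_integral => y _; rewrite !funeposE.
have mn : mfun (fun x => \int[mu]_y ((fun y => (h (x, y))%:E)^\- y))%E.
 have := @measurable_fun_fubini_tonelli_F _ _ _ _ R leb2f (EFin \o h)^\-%E.
 move=> /(_ (measurable_funeneg mh') (funeneg_ge0 _)); congr (measurable_fun _ _).
 by apply/funext => x; rewrite /fubini_F; apply: eq_integral => y _; rewrite !funenegE.
have -> : (fun x => \int[mu]_y h (x, y))%R = fine \o (fun x => \int[mu]_y ((fun y => (h (x, y))%:E)^\+ y) - \int[mu]_y ((fun y => (h (x, y))%:E)^\- y))%E.
 by apply/funext => x; rewrite /= /Rintegral integralE.
apply: measurableT_comp => //; exact: emeasurable_funB.
Qed.

Lemma cmeas_param (k : plane R * plane R -> R[i]) : cmeas k ->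
 (forall x, cint1 mu (fun y => k (x, y))) -> cmeas (fun x => CI mu (fun y => k (x, y))).
move=> [mR mI] ik; split => /=.
 by apply: (measurable_param (h := fun z => Re (k z))) => // x; have [] := ik x.
by apply: (measurable_param (h := fun z => Im (k z))) => // x; have [] := ik x.
Qed.

Lemma dotC x y : dot x y = dot y x.
by rewrite /dot mulrC [x.2 * _]mulrC. Qed.

Lemma measurable_dot2 : mfun (fun z : plane R * plane R => dot z.1 z.2).
apply: measurable_funD; apply: measurable_funM.
- exact: measurableT_comp measurable_fst measurable_fst.
- exact: measurableT_comp measurable_fst measurable_snd.
- exact: measurableT_comp measurable_snd measurable_fst.
- exact: measurableT_comp measurable_snd measurable_snd.
Qed.

Lemma measurable_dotr x : mfun (fun y : plane R => dot x y).
apply: measurable_funD; apply: measurable_funM => //;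
 (try exact: measurable_fst); exact: measurable_snd.
Qed.

Lemma measurable_dotl x : mfun (fun y : plane R => dot y x).
by under eq_fun do rewrite dotC; exact: measurable_dotr. Qed.

Lemma measurable_sqnorm : mfun (fun y : plane R => dot y y).
apply: measurable_funD; apply: measurable_funM => //;
 (try exact: measurable_fst); exact: measurable_snd.
Qed.
Hint Resolve measurable_sqnorm : meas.

Lemma pi2_gt0 : 0 < 2 * pi :> R. Proof. by rewrite mulr_gt0 ?pi_gt0. Qed.
Lemma pi2K : (2 * pi : R)%:C * ((2 * pi)^-1)%:C = 1.
by rewrite -realcM divff// gt_eqF// pi2_gt0. Qed.
Definition fh c f xi : R[i] := ((2 * pi)^-1)%:C * CI mu (fun x => cis (c * dot x xi) * f x).
Lemma cmeas_cisdot c xi : cmeas (fun x : plane R => cis (c * dot x xi)).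
by apply: cmeas_cis; apply: measurable_funM => //; exact: measurable_dotl. Qed.

Lemma cint1_bM (b f : plane R -> R[i]) (B : R) : cmeas b -> (forall x, cmod (b x) <= B) ->
 cint1 mu f -> cint1 mu (fun x => b x * f x).
move=> mb bB fi.
have ih : mu.-integrable setT (fun x => (B * cmod (f x))%:E).
 by under eq_fun do rewrite EFinM; apply: integrableZl => //; exact: cint1_cmod.
apply: (cint1_le _ ih); first exact: cmeasM mb (cint1_cmeas fi).
by move=> x; rewrite cmodM ler_wpM2r ?cmod_ge0.
Qed.

Lemma cint1_cisM c f xi : cint1 mu f -> cint1 mu (fun x => cis (c * dot x xi) * f x).
by move=> fi; apply: (@cint1_bM _ _ 1) => //; [exact: cmeas_cisdot|move=> x; rewrite cmod_cis].
Qed.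

Lemma cmod_pi2 : cmod ((2 * pi : R)^-1)%:C = (2 * pi)^-1.
by rewrite cmod_real ger0_norm// invr_ge0 ltW ?pi2_gt0. Qed.

Lemma fh_cmeas c f : cint1 mu f -> cmeas (fh c f).
move=> fi; apply: cmeasM; first exact: cmeas_cst.
apply: (cmeas_param (k := fun z => cis (c * dot z.2 z.1) * f z.2)).
 apply: cmeasM.
  apply: cmeas_cis; apply: measurable_funM => //.
  by under eq_fun do rewrite dotC; exact: measurable_dot2.
 exact: (cmeas_comp (cint1_cmeas fi) measurable_snd).
by move=> x; exact: cint1_cisM.
Qed.

Lemma fh_le c f xi : cint1 mu f ->
 cmod (fh c f xi) <= (2 * pi)^-1 * (\int[mu]_x cmod (f x))%R.
move=> fi; rewrite /fh cmodM cmod_pi2; apply: ler_wpM2l.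
 by pos.
apply: (letr (cmod_CI (cint1_cisM c xi fi))).
by under eq_Rintegral do rewrite cmodM cmod_cis mul1r.
Qed.

Lemma fhD c f g xi : cint1 mu f -> cint1 mu g ->
 fh c (fun x => f x + g x) xi = fh c f xi + fh c g xi.
move=> fi gi; rewrite /fh -mulrDr -CID; [|exact: cint1_cisM..].
by congr (_ * _); apply: eq_CI => x; rewrite mulrDr.
Qed.

Lemma fhZ c (k : R[i]) f xi : cint1 mu f -> fh c (fun x => k * f x) xi = k * fh c f xi.
move=> fi; rewrite /fh mulrCA -(CIZ k (cint1_cisM c xi fi)).
by congr (_ * _); apply: eq_CI => x; rewrite mulrCA.
Qed.

Lemma fhB c f g xi : cint1 mu f -> cint1 mu g ->
 fh c (fun x => f x - g x) xi = fh c f xi - fh c g xi.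
move=> fi gi.
have e : (fun x => f x - g x) = (fun x => f x + -1 * g x) by apply/funext => x; rewrite mulN1r.
by rewrite e fhD ?fhZ ?mulN1r//; exact: cint1Z.
Qed.

Lemma fh_conj c f xi : cint1 mu f -> fh c (fun x => conjc (f x)) xi = conjc (fh (- c) f xi).
move=> fi; rewrite /fh conjcM conjc_real -CI_conj; last exact: cint1_cisM.
by congr (_ * _); apply: eq_CI => x; rewrite conjcM conj_cis mulNr opprK.
Qed.

Lemma fh_ae c f g : {ae mu, forall x, f x = g x} -> cmeas f -> cmeas g -> fh c f = fh c g.
move=> fg mf mg; apply/funext => xi; rewrite /fh; congr (_ * _); apply: CI_ae.
- by apply: filterS fg => x ->.
- by apply: cmeasM => //; exact: cmeas_cisdot.
- by apply: cmeasM => //; exact: cmeas_cisdot.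
Qed.

(** Fubini, together with the symmetry of the kernel in its two arguments. This multiplication
    formula is behind Plancherel, inversion and the adjoint. *)
Lemma fh_adj c f g : cint1 mu f -> cint1 mu g ->
 CI mu (fun xi => g xi * fh c f xi) = CI mu (fun x => f x * fh c g x).
move=> fi gi.
have key : CI mu (fun xi => g xi * CI mu (fun x => f x * cis (c * dot x xi))) =
  CI mu (fun x => f x * CI mu (fun xi => g xi * cis (c * dot x xi))).
 apply/esym; apply: (leb2_fubini (k := fun z => cis (c * dot z.1 z.2)) fi gi).
  by apply: cmeas_cis; apply: measurable_funM => //; exact: measurable_dot2.
 by move=> z; rewrite cmod_cis.
have outer (a b : plane R -> R[i]) : cint1 mu a -> cint1 mu b ->
  CI mu (fun xi => a xi * fh c b xi) = ((2 * pi)^-1)%:C *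
  CI mu (fun xi => a xi * CI mu (fun x => b x * cis (c * dot x xi))).
 move=> ai bi.
 have e xi : CI mu (fun x => b x * cis (c * dot x xi)) = (2 * pi)%:C * fh c b xi.
  rewrite /fh mulrA pi2K mul1r.
  by apply: eq_CI => x; rewrite mulrC.
 have h1 : cint1 mu (fun xi => fh c b xi * a xi).
  by apply: (@cint1_bM (fh c b) a _ (fh_cmeas c bi) (fun xi => fh_le c xi bi)).
 transitivity (((2 * pi)^-1)%:C * CI mu (fun xi => (2 * pi)%:C * (fh c b xi * a xi))); last first.
  congr (_ * _); apply: eq_CI => xi; rewrite e.
  ring.
 rewrite (CIZ _ h1) mulrA [X in _ = X * _]mulrC pi2K mul1r.
 by apply: eq_CI => xi; rewrite mulrC.
have e x xi : g xi * cis (c * dot x xi) = g xi * cis (c * dot xi x) by rewrite dotC.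
apply: (etrans (outer _ _ gi fi)); apply: etrans (esym (outer _ _ fi gi)).
apply: (f_equal (fun w => ((2 * pi)^-1)%:C * w)); apply: (etrans key).
apply: eq_CI => x; apply: (f_equal (fun w => f x * w)); apply: eq_CI => xi; exact: e.
Qed.

(** [gau a] is a damping factor on the Fourier side and [gker a], its transform, the corresponding
    mollifier. Complex [a] is allowed so that a^2 can approach the imaginary axis, where damping
    becomes free evolution. *)
Definition gau (a : R[i]) x : R[i] := cexp (- a ^+ 2 * (dot x x)%:C).
Definition gker (a : R[i]) x : R[i] :=
 (2%:R * a ^+ 2)^-1 * cexp (- (dot x x)%:C / (4%:R * a ^+ 2)).

Definition diff (x y : plane R) : plane R := (x.1 - y.1, x.2 - y.2).
Lemma gau_cint1 a : `|Im a| < Re a -> cint1 mu (gau a).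
by move=> h; have [] := gauss_fourier2 (0, 0) h. Qed.

Lemma Re_sqr_gt0 (a : R[i]) : `|Im a| < Re a -> 0 < Re (a ^+ 2).
move=> h; rewrite expr2 ReM subr_gt0 -!expr2 -(real_normK (num_real (Im a))).
by rewrite ltr_pXn2r ?nnegrE// (letr (normr_ge0 _) (ltW h)).
Qed.

Lemma dot_ge0 x : 0 <= dot x x.
by rewrite addr_ge0// -expr2 sqr_ge0. Qed.
Hint Resolve dot_ge0 : core.

Lemma cmod_gau (a : R[i]) x : cmod (gau a x) = expR (- Re (a ^+ 2) * dot x x).
by rewrite /gau cmod_cexp ReM ReN /= mulr0 subr0. Qed.

Lemma gau_le1 a x : `|Im a| < Re a -> cmod (gau a x) <= 1.
move=> h; rewrite cmod_gau -expR0 ler_expR mulNr oppr_le0 mulr_ge0 ?dot_ge0//.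
exact: ltW (Re_sqr_gt0 h).
Qed.

Lemma cmeas_gau a : cmeas (gau a).
by apply: cmeas_cexp; apply: cmeasM; [exact: cmeas_cst|apply: cmeas_real; exact: measurable_sqnorm].
Qed.

(** The multiplication formula moves the inner transform onto a modulated Gaussian, whose transform
    is explicit. The condition [c ^+ 2 = 1] covers both signs of the exponent. *)
Lemma fh_mollify c a f x : c ^+ 2 = 1 -> `|Im a| < Re a -> cint1 mu f ->
 fh (- c) (fun xi => gau a xi * fh c f xi) x =
 ((2 * pi)^-1)%:C * CI mu (fun y => f y * gker a (diff y x)).
move=> c2 ha fi.
have a0 : a != 0 by apply/eqP => a0; move: ha; rewrite a0 /= normr0 ltxx.
rewrite {1}/fh; congr (_ * _).
pose phi xi := cis (- c * dot xi x) * gau a xi.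
have iphi : cint1 mu phi by apply: cint1_cisM; exact: gau_cint1.
transitivity (CI mu (fun xi => phi xi * fh c f xi)).
 by apply: eq_CI => xi; rewrite /phi mulrA.
rewrite fh_adj//; apply: eq_CI => y; congr (_ * _).
rewrite /fh /phi.
pose z : plane R := (c * (y.1 - x.1), c * (y.2 - x.2)).
have e xi : cis (c * dot xi y) * (cis (- c * dot xi x) * gau a xi) = gau a xi * cis (dot z xi).
 by rewrite mulrA -cisD mulrC; congr (_ * cis _); rewrite /dot /z /=; ring.
rewrite (eq_CI _ e); have [_ ->] := gauss_fourier2 z ha.
have -> : dot z z = dot (diff y x) (diff y x).
 rewrite /dot /z /diff /=; transitivity (c ^+ 2 * ((y.1 - x.1) * (y.1 - x.1) + (y.2 - x.2) * (y.2 - x.2))).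
  ring.
 by rewrite c2 mul1r.
rewrite mulrA /gker; congr (_ * _).
have p0 : pi%:C != 0 :> R[i] by rewrite eq_complex /= eqxx andbT gt_eqF ?pi_gt0.
have -> : ((2 * pi : R)^-1)%:C = (2%:R * pi%:C)^-1.
 by rewrite (fmorphV (real_complex R)) rmorphM /= rmorph_nat.
by rewrite !invfM mulrA -[2%:R^-1 * _ * _]mulrA mulVf// mulr1.
Qed.

End FourierIntegral.
#[local] Hint Resolve measurable_sqnorm : meas.
#[local] Hint Resolve dot_ge0 : core.

(** * Boxes as a determining class *)

Section Boxes.
Context {R : realType}.

Definition box (p q : R * R) : set (plane R) := `]p.1, q.1] `*` `]p.2, q.2].

Lemma measurable_box p q : measurable (box p q).
by apply: measurableX; exact: measurable_itv. Qed.
Hint Resolve measurable_box : meas.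

Lemma boxI p q p' q' : box p q `&` box p' q' =
 box (Num.max p.1 p'.1, Num.max p.2 p'.2) (Num.min q.1 q'.1, Num.min q.2 q'.2).
apply/seteqP; split=> -[x y]; rewrite /box /= !in_itv /= !gt_max !le_min.
 by move=> [[/andP[-> ->] /andP[-> ->]] [/andP[-> ->] /andP[-> ->]]].
by move=> [/andP[/andP[-> ->] /andP[-> ->]] /andP[/andP[-> ->] /andP[-> ->]]].
Qed.

Let boxes : set (set (plane R)) := [set B | exists p q, B = box p q].

(** A strip is a countable union of boxes, so both coordinate projections are measurable for the
    sigma-algebra generated by the boxes. *)
Lemma boxes_generate : @measurable _ (plane R) = <<s boxes >>.
rewrite measurable_prod_measurableType; apply/seteqP; split; last first.
 apply: smallest_sub; first exact: smallest_sigma_algebra.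
 move=> _ [p [q ->]]; apply: sub_sigma_algebra.
 by exists `]p.1, q.1]%classic; [exact: measurable_itv|exists `]p.2, q.2]%classic => //; exact: measurable_itv].
apply: smallest_sub; first exact: smallest_sigma_algebra.
pose T := g_sigma_algebraType boxes.
have cover (x : R) : exists n : nat, - n%:R < x <= n%:R.
 exists (Num.truncn `|x|).+1; have := truncnS_gt `|x|; have := ler_norm x; have := lerNnormlW (lexx `|x|).
 by move=> a b c; apply/andP; split; lra.
have hfst (A : set (measurableTypeR R)) : measurable A -> @measurable _ T (fst @^-1` A).
 move=> mA; have := @smallest_sub _ (sigma_algebra setT) (R.-ocitv.-measurable)
  (image_set_system setT (fst : T -> measurableTypeR R) (@measurable _ T)).
 move=> /(_ (sigma_algebra_image _ (@sigma_algebra_measurable _ T)))H.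
 have /H/(_ A mA) : R.-ocitv.-measurable `<=` image_set_system setT (fst : T -> measurableTypeR R) (@measurable _ T).
  move=> _ [p _ <-]; rewrite /image_set_system /= setTI.
  have -> : fst @^-1` `]p.1, p.2] = \bigcup_n (box (p.1, - n%:R) (p.2, n%:R)).
   apply/seteqP; split=> -[x y]; rewrite /box /=.
    by move=> xp; have [n hn] := cover y; exists n => //; split => //=; rewrite in_itv.
   by move=> [n _ []].
  apply: bigcup_measurable => n _; apply: sub_sigma_algebra; by exists (p.1, - n%:R), (p.2, n%:R).
 by rewrite /image_set_system /= setTI.
have hsnd (A : set (measurableTypeR R)) : measurable A -> @measurable _ T (snd @^-1` A).
 move=> mA; have := @smallest_sub _ (sigma_algebra setT) (R.-ocitv.-measurable)
  (image_set_system setT (snd : T -> measurableTypeR R) (@measurable _ T)).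
 move=> /(_ (sigma_algebra_image _ (@sigma_algebra_measurable _ T)))H.
 have /H/(_ A mA) : R.-ocitv.-measurable `<=` image_set_system setT (snd : T -> measurableTypeR R) (@measurable _ T).
  move=> _ [p _ <-]; rewrite /image_set_system /= setTI.
  have -> : snd @^-1` `]p.1, p.2] = \bigcup_n (box (- n%:R, p.1) (n%:R, p.2)).
   apply/seteqP; split=> -[x y]; rewrite /box /=.
    by move=> xp; have [n hn] := cover x; exists n => //; split => //=; rewrite in_itv.
   by move=> [n _ []].
  apply: bigcup_measurable => n _; apply: sub_sigma_algebra; by exists (- n%:R, p.1), (n%:R, p.2).
 by rewrite /image_set_system /= setTI.
move=> _ [A mA [B mB <-]]; have -> : A `*` B = fst @^-1` A `&` snd @^-1` B by [].
exact: (@measurableI _ T _ _ (hfst _ mA) (hsnd _ mB)).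
Qed.

(** Boxes form a generating pi-system, and the sets on which [h] integrates to 0 form a Dynkin
    class; stability under complements uses that the total integral is 0. *)
Lemma box_uniq (h : plane R -> R) : mu.-integrable setT (fun x => (h x)%:E) ->
 (\int[mu]_x (h x)%:E = 0)%E -> (forall p q, \int[mu]_(x in box p q) (h x)%:E = 0)%E ->
 {ae mu, forall x, h x = 0}.
move=> ih hT hB.
have P A : measurable A -> (\int[mu]_(x in A) (h x)%:E = 0)%E.
 move=> mA; move: (mA); rewrite boxes_generate; move: A {mA}.
 apply: (@dynkin_induction _ _ boxes (fun A => \int[mu]_(x in A) (h x)%:E = 0)%E).
 - exact: boxes_generate.
 - by move=> _ _ [p [q ->]] [p' [q' ->]]; rewrite boxI; do 2 eexists.
 - by [].
 - by move=> _ [p [q ->]].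
 - move=> S mS hS; move: hT; rewrite -(setUv S) integral_setU_EFin//.
  + by rewrite hS add0e.
  + exact: measurableC.
  + by rewrite setUv; apply/measurable_EFinP; exact: measurable_int ih.
  + by apply/disj_setPS; rewrite setICr.
 - move=> F mF tF hF; rewrite integral_bigcup//.
  + by rewrite eseries0// => i _ _; exact: hF.
  + apply: integrableS ih => //; exact: bigcupT_measurable.
have H : ae_eq mu setT (fun x => (h x)%:E) (fun=> 0%E).
 apply: integral_ae_eq => //; first by move=> E _ mE; rewrite P// integral0.
by apply: filterS H => x /(_ I)[].
Qed.

Lemma measurable_indicR (A : set (plane R)) : measurable A ->
 mfun (fun x => \1_A x : R).
by move=> mA; exact: measurable_indic. Qed.

Lemma box_perp_real (h : plane R -> R) :
 (forall p q, mu.-integrable setT (fun x => (h x * \1_(box p q) x)%:E)) ->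
 (forall p q, \int[mu]_x (h x * \1_(box p q) x) = 0)%R -> {ae mu, forall x, h x = 0}.
(* Cutting off to the large boxes [K n] makes [h] integrable, and the intersection of a box with
   [K n] is again a box. *)
move=> ih h0; pose K n := box (- n%:R, - n%:R) (n%:R, n%:R).
have e0 p q : (\int[mu]_x (h x * \1_(box p q) x)%:E = 0)%E.
 rewrite -(fineK (integrable_fin_num _ (ih p q)))//.
 by have := h0 p q; rewrite /Rintegral => ->.
have H n : {ae mu, forall x, h x * \1_(K n) x = 0}.
 apply: box_uniq; [exact: ih|exact: e0|move=> p q].
 rewrite integral_mkcond -[RHS](e0 (Num.max p.1 (- n%:R), Num.max p.2 (- n%:R)) (Num.min q.1 n%:R, Num.min q.2 n%:R)).
 apply: eq_integral => x _; rewrite /= -(boxI p q (- n%:R, - n%:R) (n%:R, n%:R)) -/(K n).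
 rewrite indicI /patch /=; case: ifPn => [xB|]; first by rewrite [X in _ * (X * _)]indicE xB mul1r.
 by rewrite notin_setE => xB; rewrite [X in _ * (X * _)]indicE memNset// mul0r mulr0.
have : {ae mu, forall x, forall n, h x * \1_(K n) x = 0} by apply/ae_foralln.
apply: filterS => x hx.
have [n1 hn1] : exists n : nat, - n%:R < x.1 <= n%:R /\ - n%:R < x.2 <= n%:R.
 exists (Num.truncn (`|x.1| + `|x.2|)).+1; have := truncnS_gt (`|x.1| + `|x.2|).
 have := ler_norm x.1; have := lerNnormlW (lexx `|x.1|).
 have := ler_norm x.2; have := lerNnormlW (lexx `|x.2|).
 have := normr_ge0 x.1; have := normr_ge0 x.2.
 by pos.
by have := hx n1; rewrite indicE mem_set ?mulr1//.
Qed.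

Definition ind (A : set (plane R)) (x : plane R) : R[i] := (\1_A x : R)%:C.

Lemma ind_cmeas A : measurable A -> cmeas (ind A).
by move=> mA; apply: cmeas_real; exact: measurable_indicR. Qed.
Hint Resolve ind_cmeas : meas.

Lemma ind_integrable A : measurable A -> (mu A < +oo)%E -> mu.-integrable setT (fun x => (\1_A x : R)%:E).
move=> mA fA; apply/integrableP; split; first by apply/measurable_EFinP; exact: measurable_indicR.
under eq_integral do rewrite gee0_abs ?lee_fin//.
by rewrite integral_indic ?setIT.
Qed.

Lemma ind_cint1 A : measurable A -> (mu A < +oo)%E -> cint1 mu (ind A).
move=> mA fA; apply: (cint1_le (ind_cmeas mA) (ind_integrable mA fA)) => x.
by rewrite cmod_real ger0_norm.
Qed.

Lemma ind_L2 A : measurable A -> (mu A < +oo)%E -> L2 (ind A).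
move=> mA fA; apply: (L2_le (ind_cmeas mA) (ind_integrable mA fA)) => x.
by rewrite cmod_real ger0_norm// /indic; case: (_ \in _); rewrite ?expr1n ?expr0n.
Qed.

Lemma box_fin p q : (mu (box p q) < +oo)%E.
rewrite /leb2 /= product_measure1E; [|exact: measurable_itv|exact: measurable_itv].
have lt (u v : R) : ((@lebesgue_measure R) `]u, v]%classic < +oo)%E.
 by rewrite lebesgue_measure_itv /=; case: ifP => _; rewrite ?ltry// -EFinB ltry.
by rewrite lte_mul_pinfty ?ge0_fin_numE ?lt.
Qed.

(** Indicators of boxes are total in L^2. The scalar [k] is there because [ip] sees real parts only:
    [k] equal to 1 and to the imaginary unit recover the real and the imaginary part. *)
Lemma box_perp (a : Lsq R) : (forall p q (k : R[i]), ip a (k *: cls (ind (box p q))) = 0) -> a = 0.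
move=> h.
have L p q := ind_L2 (measurable_box p q) (box_fin p q).
have i0 p q : cint1 mu (fun x => a x * ind (box p q) x).
 by apply: L2_cint1M; [exact: fn_L2|exact: L].
have H p q (k : R[i]) : Re (conjc k * CI mu (fun x => a x * ind (box p q) x)) = 0.
 rewrite -CIZ// -[RHS](h p q k) -clsZ//.
 rewrite -[in RHS](cls_fn a) ip_cls; [|exact: fn_L2|exact: L2Z].
 congr Re; apply: eq_CI => x; rewrite conjcM mulrCA; congr (_ * (_ * _)).
 ring.
have HR : {ae mu, forall x, Re (a x) = 0}.
 apply: box_perp_real => p q.
  have [+ _] := i0 p q; congr (integrable _ _ _); apply/funext => x.
  by rewrite ReM /ind /= mulr0 subr0.
 have := H p q 1; rewrite conjc1 mul1r /CI /= => H1; rewrite -[RHS]H1; apply: eq_Rintegral => x _.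
 by rewrite ReM /ind /= mulr0 subr0.
have HI : {ae mu, forall x, Im (a x) = 0}.
 apply: box_perp_real => p q.
  have [_ +] := i0 p q; congr (integrable _ _ _); apply/funext => x.
  by rewrite ImM /ind /= mulr0 add0r.
 have := H p q 'i%C; rewrite ReM Re_conj Im_conj /= mul0r sub0r mulN1r opprK => H1.
 rewrite -[RHS]H1; apply: eq_Rintegral => x _; by rewrite ImM /ind /= mulr0 add0r.
apply: Lsq_ext; apply: filterS2 (filterI HR HI) fn0 => x [h1 h2] ->.
exact: complex_eq.
Qed.

End Boxes.
#[local] Hint Resolve measurable_box ind_cmeas : meas.

(** * The heat kernel and the Schur test *)

Section GaussKernel.
Context {R : realType}.
Implicit Types (f g : plane R -> R[i]) (c a : R).

Lemma RintE (h : plane R -> R) : mu.-integrable setT (fun x => (h x)%:E) ->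
 ((\int[mu]_x h x)%R%:E = \int[mu]_x (h x)%:E)%E.
by move=> ih; rewrite /Rintegral fineK//; exact: integrable_fin_num. Qed.

Lemma CI_real (h : plane R -> R) : CI mu (fun x => (h x)%:C) = (\int[mu]_x h x)%R%:C.
by rewrite /CI /=; congr (_ +i* _); rewrite /Rintegral integral0. Qed.
Lemma cexp_real a : cexp a%:C = (expR a)%:C.
by rewrite /cexp /= cis0 mulr1. Qed.
Definition gkr a (x : plane R) : R := (2 * a ^+ 2)^-1 * expR (- dot x x / (4 * a ^+ 2)).

Lemma gker_real a x : gker a%:C x = (gkr a x)%:C.
rewrite /gker /gkr realcM -cexp_real; congr (_ * cexp _).
 by rewrite (fmorphV (real_complex R)) rmorphM rmorphXn /= rmorph_nat.
by rewrite [RHS]realcM (fmorphV (real_complex R)) rmorphM rmorphXn /= rmorph_nat rmorphN.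
Qed.

Lemma gau_real a x : gau a%:C x = (expR (- (a ^+ 2 * dot x x)))%:C.
by rewrite /gau -cexp_real rmorphN rmorphM rmorphXn /= mulNr. Qed.

Lemma gkr_ge0 a x : 0 <= gkr a x.
by rewrite /gkr mulr_ge0 ?expR_ge0// invr_ge0 mulr_ge0 ?sqr_ge0. Qed.
Hint Resolve gkr_ge0 : core.

Lemma adm_real a : 0 < a -> `|Im a%:C| < Re a%:C.
by rewrite /= normr0. Qed.

Lemma gkr_integral a : 0 < a ->
 mu.-integrable setT (fun x => (gkr a x)%:E) /\ (\int[mu]_x gkr a x = 2 * pi)%R.
move=> a0; have b0 : 0 < (2 * a)^-1 by pos.
have [H1 H2] := gauss_fourier2 (0, 0) (adm_real b0).
have e (y : plane R) : cexp (- (((2 * a)^-1)%:C) ^+ 2 * (dot y y)%:C) = (expR (- dot y y / (4 * a ^+ 2)))%:C.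
 rewrite -cexp_real; congr cexp.
 rewrite -rmorphXn -rmorphN -rmorphM /=; congr (_ %:C); field; by rewrite gt_eqF.
have I : mu.-integrable setT (fun y => (expR (- dot y y / (4 * a ^+ 2)))%:E).
 by have [+ _] := H1; congr (integrable _ _ _); apply/funext => y; rewrite e.
have V : (\int[mu]_y expR (- dot y y / (4 * a ^+ 2)) = 4 * a ^+ 2 * pi)%R.
 have e2 (y : plane R) : cexp (- (((2 * a)^-1)%:C) ^+ 2 * (dot y y)%:C) * cis (dot (0, 0) y) =
   (expR (- dot y y / (4 * a ^+ 2)))%:C.
  by rewrite e {2}/dot /= !mul0r addr0 cis0 mulr1.
 have d0 : dot (0, 0) (0, 0) = 0 :> R by rewrite /dot /= !mul0r addr0.
 have r : pi%:C / ((2 * a)^-1)%:C ^+ 2 = (4 * a ^+ 2 * pi)%:C.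
  rewrite -rmorphXn -fmorphV -rmorphM /=; congr (_%:C); field; by rewrite gt_eqF.
 have := H2; rewrite (eq_CI _ e2) d0 r oppr0 mul0r CI_real (_ : cexp 0 = 1) ?mulr1; last first.
  by rewrite -[0]/(0%:C) cexp_real expR0.
 by move/(f_equal (@Re R)).
split.
 by under eq_fun do rewrite EFinM; exact: integrableZl.
rewrite /gkr RintegralZl//= V; field; by rewrite gt_eqF.
Qed.

Lemma measurable_dot_diff : mfun (fun z : plane R * plane R => dot (diff z.2 z.1) (diff z.2 z.1)).
have m1 : mfun (fun z : plane R * plane R => z.2.1 - z.1.1).
 by apply: measurable_funB; exact: measurableT_comp measurable_fst _.
have m2 : mfun (fun z : plane R * plane R => z.2.2 - z.1.2).
 by apply: measurable_funB; exact: measurableT_comp measurable_snd _.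
by rewrite /dot /diff /=; apply: measurable_funD; apply: measurable_funM.
Qed.

Lemma measurable_gkr_diff a : mfun (fun z : plane R * plane R => gkr a (diff z.2 z.1)).
rewrite /gkr; apply: measurable_funM => //; apply: measurableT_comp => //.
apply: measurable_funM => //; apply: measurableT_comp => //; exact: measurable_dot_diff.
Qed.

Lemma measurable_gkr a : mfun (@gkr a).
rewrite /gkr; apply: measurable_funM => //; apply: measurableT_comp => //.
by meas.
Qed.

Lemma gkr_diffC a (x y : plane R) : gkr a (diff y x) = gkr a (diff x y).
by rewrite /gkr /dot /diff /= -(opprB y.1) -(opprB y.2) !mulrNN. Qed.

Lemma gkr_translate a (y : plane R) : 0 < a -> (\int[mu]_x (gkr a (diff x y))%:E = (2 * pi)%:E)%E.
move=> a0; have [I V] := gkr_integral a0.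
have := scales_ge0_integral (leb2_shift (- y.1, - y.2)) (f := fun x => (gkr a x)%:E).
have <- : (\int[mu]_x (gkr a x)%:E = (2 * pi)%:E)%E by rewrite -V RintE.
rewrite mul1e => <- //; last by move=> x; rewrite lee_fin gkr_ge0.
by apply/measurable_EFinP; exact: measurable_gkr.
Qed.

Lemma gkr_fubini a (w : plane R -> R) : 0 < a -> mfun w -> (forall x, 0 <= w x) ->
 (\int[mu]_x \int[mu]_y (w y * gkr a (diff y x))%:E = (2 * pi)%:E * \int[mu]_x (w x)%:E)%E.
move=> a0 mw w0.
have -> : (\int[mu]_x \int[mu]_y (w y * gkr a (diff y x))%:E =
  \int[mu]_y \int[mu]_x (w y * gkr a (diff y x))%:E)%E.
 apply: (@fubini_tonelli _ _ (plane R) (plane R) R leb2f leb2f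
  (fun z => (w z.2 * gkr a (diff z.2 z.1))%:E)).
  apply/measurable_EFinP; apply: measurable_funM; last exact: measurable_gkr_diff.
  exact: measurableT_comp mw measurable_snd.
 by pos.
rewrite -ge0_integralZl ?lee_fin//; last 3 first.
- by meas.
- by pos.
- by pos.
apply: eq_integral => y _; under eq_integral do rewrite EFinM.
rewrite ge0_integralZl ?lee_fin//; last 2 first.
- apply/measurable_EFinP; under eq_fun do rewrite gkr_diffC.
 exact: measurableT_comp (measurable_gkr a) (let: And3 h _ _ := leb2_shift (- y.1, - y.2) in h).
- by pos.
by under eq_integral do rewrite gkr_diffC; rewrite gkr_translate// muleC.
Qed.

(** Schur test: |f(x)||f(y)| is at most the mean of the two squares, and integrating the kernel in
    the remaining variable gives its mass 2 pi in both halves. *)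
Lemma gkr_schur a f : 0 < a -> cint1 mu f -> L2 f ->
 (\int[mu]_x (cmod (f x) * cmod (CI mu (fun y => f y * gker a%:C (diff y x))))%:E <=
  (2 * pi)%:E * \int[mu]_x (cmod (f x) ^+ 2)%:E)%E.
move=> a0 fi f2.
have q0 x z : 0 <= cmod (f x) ^+ 2 * 2^-1 * gkr a z.
 by pos.
have mf := cint1_cmeas fi; have mmf := measurable_cmod mf.
have bd z : gkr a z <= (2 * a ^+ 2)^-1.
 rewrite -[leRHS]mulr1 ler_wpM2l//; first by pos.
 rewrite -expR0 ler_expR mulNr oppr_le0 divr_ge0 ?dot_ge0//.
 by pos.
have mk x : mfun (fun y => gkr a (diff y x)).
 exact: measurableT_comp (measurable_gkr a) (let: And3 h _ _ := leb2_shift (- x.1, - x.2) in h).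
have i1 x : cint1 mu (fun y => f y * gker a%:C (diff y x)).
 have := @cint1_bM _ (fun y => (gkr a (diff y x))%:C) f ((2 * a ^+ 2)^-1) (cmeas_real (mk x)) _ fi.
 have h y : cmod (gkr a (diff y x))%:C <= (2 * a ^+ 2)^-1 by rewrite cmod_real ger0_norm ?gkr_ge0.
 by move=> /(_ h); congr (cint1 _ _); apply/funext => y; rewrite gker_real mulrC.
have pw x : ((cmod (f x) * cmod (CI mu (fun y => f y * gker a%:C (diff y x))))%:E <=
  (cmod (f x) ^+ 2 * 2^-1)%:E * (2 * pi)%:E +
  \int[mu]_y ((cmod (f y) ^+ 2 * 2^-1) * gkr a (diff y x))%:E)%E.
 have h1 : ((cmod (CI mu (fun y => f y * gker a%:C (diff y x))))%:E <=
   \int[mu]_y (cmod (f y) * gkr a (diff y x))%:E)%E.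
  apply: (via (\int[mu]_y (cmod (f y * gker a%:C (diff y x))))%R%:E).
   by rewrite lee_fin; exact: cmod_CI.
  rewrite RintE; last exact: cint1_cmod.
  by apply: eq_ler; apply: eq_integral => y _;
   rewrite cmodM gker_real cmod_real ger0_norm ?gkr_ge0.
 apply: (via ((cmod (f x))%:E * \int[mu]_y (cmod (f y) * gkr a (diff y x))%:E)%E).
  by rewrite EFinM; apply: lee_pmul; rewrite ?lee_fin ?cmod_ge0.
 rewrite -ge0_integralZl ?lee_fin ?cmod_ge0//; last 2 first.
 - by meas.
 - by pos.
 have -> : ((cmod (f x) ^+ 2 * 2^-1)%:E * (2 * pi)%:E =
   \int[mu]_y (cmod (f x) ^+ 2 * 2^-1 * gkr a (diff y x))%:E)%E.
  rewrite -(gkr_translate x a0) -ge0_integralZl ?lee_fin//.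
  - by meas.
  - by pos.
  - by pos.
 rewrite -ge0_integralD//; last 4 first.
 - by pos.
 - by meas.
 - by pos.
 - by meas.
 apply: ge0_le_integral => //.
 - by move=> y _; rewrite -EFinM lee_fin mulr_ge0 ?cmod_ge0// mulr_ge0 ?gkr_ge0 ?cmod_ge0.
 - apply/measurable_EFinP; apply: measurable_funM => //; exact: measurable_funM.
 - apply: emeasurable_funD; apply/measurable_EFinP.
   by meas.
  by meas.
 move=> y _; rewrite -EFinD lee_fin mulrA -mulrDl ler_wpM2r ?gkr_ge0//.
 have := sqr_ge0 (cmod (f x) - cmod (f y)); rewrite sqrrB; lra.
have mM : mfun (fun x => cmod (CI mu (fun y => f y * gker a%:C (diff y x)))).
 apply: measurable_cmod.
 apply: (cmeas_param (k := fun z => f z.2 * gker a%:C (diff z.2 z.1))); last exact: i1.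
 apply: cmeasM; first exact: (cmeas_comp mf measurable_snd).
 under eq_fun do rewrite gker_real; apply: cmeas_real; exact: measurable_gkr_diff.
have mW : mfun (fun x => \int[mu]_y ((cmod (f y) ^+ 2 * 2^-1) * gkr a (diff y x))%:E)%E.
 have := @measurable_fun_fubini_tonelli_F _ _ (plane R) (plane R) R leb2f
  (fun z => ((cmod (f z.2) ^+ 2 * 2^-1) * gkr a (diff z.2 z.1))%:E).
 move=> H; apply: H.
  apply/measurable_EFinP; apply: measurable_funM; last exact: measurable_gkr_diff.
  apply: measurable_funM => //; apply: measurable_funX.
  exact: measurableT_comp mmf measurable_snd.
 by pos.
have W0 x : (0 <= \int[mu]_y ((cmod (f y) ^+ 2 * 2^-1) * gkr a (diff y x))%:E)%E.
 by apply: integral_ge0 => y _; rewrite lee_fin q0.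
apply: (via (\int[mu]_x ((cmod (f x) ^+ 2 * 2^-1)%:E * (2 * pi)%:E +
  \int[mu]_y ((cmod (f y) ^+ 2 * 2^-1) * gkr a (diff y x))%:E))%E).
 apply: ge0_le_integral => //.
 - by pos.
 - by apply/measurable_EFinP; exact: measurable_funM.
 - apply: emeasurable_funD => //; under eq_fun do rewrite -EFinM.
  apply/measurable_EFinP; apply: measurable_funM => //; apply: measurable_funM => //.
  by meas.
have mh : mfun (fun x => (cmod (f x) ^+ 2 * 2^-1)%:E).
 by meas.
have h0 x : (0 <= (cmod (f x) ^+ 2 * 2^-1)%:E)%E by pos.
have p0 : (0 <= (2 * pi : R)%:E)%E by pos.
rewrite ge0_integralD//; last 2 first.
- by move=> x _; rewrite mule_ge0.
- by apply: emeasurable_funM.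
rewrite gkr_fubini//; last by apply/measurable_EFinP; exact: mh.
rewrite ge0_integralZr// [X in (X + _)%E]muleC -ge0_muleDr ?integral_ge0//.
rewrite -ge0_integralD//; under eq_integral do rewrite -EFinD -mulrDr.
apply: lee_wpmul2l => //; apply: eq_ler; apply: eq_integral => x _.
congr EFin; lra.
Qed.

End GaussKernel.
#[local] Hint Resolve gkr_ge0 : core.

(** * Plancherel's inequality and the Fourier transform on L^2 *)

Section Plancherel.
Context {R : realType}.
Implicit Types (f g : plane R -> R[i]) (c : R) (a b : Lsq R).

Lemma mul_conjc (z : R[i]) : z * conjc z = (cmod z ^+ 2)%:C.
apply: complex_eq; rewrite ?ReM ?ImM Re_conj Im_conj /= ?cmod_sqr; ring.
Qed.

Lemma cvg0_harmonic (u : nat -> R) (K : R) : (forall n, `|u n| <= K / n.+1%:R) ->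
 u @ \oo --> (0 : R).
move=> h; apply/norm_cvg0P.
have H : (fun n : nat => K / n.+1%:R) @ \oo --> (0 : R).
 by rewrite -[X in _ --> X](mulr0 K); apply: cvgMr; exact: cvg_harmonic.
apply: squeeze_cvgr H; last exact: cvg_cst.
by near=> n; rewrite normr_ge0 h.
Unshelve. all: by end_near. Qed.

(** With a Gaussian weight, the integral of |fh c f|^2 is the pairing of [f] with its mollification
    by a kernel of mass 2 pi, to which the Schur test applies. *)
Lemma plancherel_mollified (e : R) c f : 0 < e -> c ^+ 2 = 1 -> cint1 mu f -> L2 f ->
 (\int[mu]_x (cmod (gau e%:C x * fh c f x) ^+ 2)%:E <= \int[mu]_x (cmod (f x) ^+ 2)%:E)%E.
move=> e0 c2 fi f2; have adm := adm_real e0.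
pose G xi := gau e%:C xi * fh c f xi.
have Gi : cint1 mu G.
 have := @cint1_bM _ (fh c f) (gau e%:C) _ (fh_cmeas c fi) (fun xi => fh_le c xi fi) (gau_cint1 adm).
 by congr (cint1 _ _); apply/funext => xi; rewrite /G mulrC.
pose w xi := expR (- (e ^+ 2 * dot xi xi)) * cmod (fh c f xi) ^+ 2.
have wG xi : G xi * fh (- c) (fun x => conjc (f x)) xi = (w xi)%:C.
 by rewrite /G fh_conj// opprK gau_real -mulrA mul_conjc /w realcM.
have cfi := cint1_conj fi.
have iw : mu.-integrable setT (fun x => (w x)%:E).
 have := @cint1_bM _ (fh (- c) (fun x => conjc (f x))) G _ (fh_cmeas (- c) cfi) (fun xi => fh_le (- c) xi cfi) Gi.
 case=> + _; congr (integrable _ _ _); apply/funext => xi.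
 by rewrite mulrC wG.
have M x : fh (- c) G x = ((2 * pi)^-1)%:C * CI mu (fun y => f y * gker e%:C (diff y x)).
 exact: fh_mollify.
have H : (\int[mu]_x w x)%R%:C = CI mu (fun x => conjc (f x) * fh (- c) G x).
 rewrite -CI_real -(fh_adj (- c) cfi Gi); apply: eq_CI => xi; exact/esym.
have i2 : cint1 mu (fun x => conjc (f x) * fh (- c) G x).
 have := @cint1_bM _ (fh (- c) G) _ _ (fh_cmeas (- c) Gi) (fun xi => fh_le (- c) xi Gi) cfi.
 by congr (cint1 _ _); apply/funext => xi; rewrite mulrC.
apply: (via (\int[mu]_x (w x)%:E)%E).
 apply: ge0_le_integral => //.
 - by pos.
 - exact: measurable_cmod_sqr (cint1_cmeas Gi).
 - exact: measurable_int iw.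
 move=> x _; rewrite lee_fin /w cmodM gau_real cmod_real ger0_norm//.
 rewrite exprMn ler_wpM2r ?sqr_ge0// expr2 ger_pMl ?expR_gt0//.
 by rewrite -expR0 ler_expR oppr_le0 mulr_ge0 ?sqr_ge0 ?dot_ge0.
rewrite -RintE//.
apply: (via (\int[mu]_x (cmod (conjc (f x) * fh (- c) G x)))%R%:E).
 rewrite lee_fin (letr _ (cmod_CI i2))// -H cmod_real ler_norm//.
rewrite RintE; last exact: cint1_cmod.
have e1 x : (cmod (conjc (f x) * fh (- c) G x))%:E =
  (((2 * pi)^-1)%:E * (cmod (f x) * cmod (CI mu (fun y => f y * gker e%:C (diff y x))))%:E)%E.
 by rewrite M !cmodM cmod_pi2 cmod_conj -EFinM mulrCA.
under eq_integral do rewrite e1.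
have mm : mfun (fun x => (cmod (f x) * cmod (CI mu (fun y => f y * gker e%:C (diff y x))))%:E).
 have e3 x : cmod (f x) * cmod (CI mu (fun y => f y * gker e%:C (diff y x))) =
   cmod ((2 * pi)%:C * (conjc (f x) * fh (- c) G x)).
  rewrite M !cmodM cmod_pi2 cmod_conj cmod_real ger0_norm; last by pos.
  have k : (2 * pi : R) * (2 * pi)^-1 = 1 by rewrite mulfV ?gt_eqF ?pi2_gt0.
  by rewrite [X in _ = _ * X]mulrCA [RHS]mulrA k mul1r.
 under eq_fun do rewrite e3; apply/measurable_EFinP/measurable_cmod.
 exact: cint1_cmeas (cint1Z (2 * pi)%:C i2).
rewrite ge0_integralZl//; last 2 first.
- by pos.
- by pos.
have := gkr_schur e0 fi f2; rewrite -(@lee_pmul2l _ ((2 * pi)^-1)%:E) ?lte_fin ?invr_gt0 ?pi2_gt0//.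
by rewrite muleA -EFinM mulVf ?gt_eqF ?pi2_gt0// mul1e.
Qed.

Lemma gau_cvg (z : R[i]) (x : plane R) :
 (fun n => cmod (gau (n.+1%:R^-1)%:C x * z - z)) @ \oo --> (0 : R).
apply: (@cvg0_harmonic _ (dot x x * cmod z)) => n.
rewrite ger0_norm ?cmod_ge0// -[X in _ - X]mul1r -mulrBl cmodM gau_real.
rewrite [leRHS]mulrAC ler_wpM2r ?cmod_ge0// -[X in _ - X]/(1%:C) -rmorphB cmod_real.
set t := _ * dot x x.
have t0 : 0 <= t by rewrite mulr_ge0 ?sqr_ge0 ?dot_ge0.
rewrite distrC ger0_norm; last by rewrite subr_ge0 -expR0 ler_expR oppr_le0.
apply: (via t); first by have := expR_ge1Dx (- t); lra.
rewrite /t mulrC ler_wpM2l ?dot_ge0// expr2 ger_pMl ?invr_gt0//.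
by rewrite invf_le1 // ler1n.
Qed.

(** Fatou removes the Gaussian weight. Only an inequality results; equality is recovered from
    inversion in [nrm_FT]. *)
Lemma plancherel_le c f : c ^+ 2 = 1 -> cint1 mu f -> L2 f ->
 (\int[mu]_x (cmod (fh c f x) ^+ 2)%:E <= \int[mu]_x (cmod (f x) ^+ 2)%:E)%E.
move=> c2 fi f2; have mF := fh_cmeas c fi; have /L2P[mf iff] := f2.
rewrite -(RintE iff).
apply: (@fatou_sqr _ (fun n xi => gau (n.+1%:R^-1)%:C xi * fh c f xi)) => //.
- by move=> n; apply: cmeasM => //; exact: cmeas_gau.
- by apply: aeW => x; exact: gau_cvg.
- by move=> n; rewrite RintE//; apply: plancherel_mollified => //; rewrite invr_gt0.
Qed.

Lemma fh_L2 c f : c ^+ 2 = 1 -> cint1 mu f -> L2 f -> L2 (fh c f).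
move=> c2 fi f2; have mF := fh_cmeas c fi; apply/L2P; split => //.
apply/(integrable_sqrP mF); have /L2P[mf /(integrable_sqrP mf)] := f2.
exact: le_lt_trans (plancherel_le c2 fi f2).
Qed.

Lemma nrm_fh c f : c ^+ 2 = 1 -> cint1 mu f -> L2 f -> nrm (cls (fh c f)) <= nrm (cls f).
move=> c2 fi f2; apply: le_sqr2 => //; rewrite -lee_fin !nrm_sqrE.
have h := plancherel_le c2 fi f2.
rewrite (_ : (\int[mu]_x (cmod (cls f x) ^+ 2)%:E = \int[mu]_x (cmod (f x) ^+ 2)%:E)%E); last first.
 apply: ae_eq_integral => //; [exact: measurable_cmod_sqr|exact: measurable_cmod_sqr (proj1 (iffLR (L2P _) f2))|].
 by apply: filterS (cls_ae f2) => x -> _.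
rewrite (_ : (\int[mu]_x (cmod (cls (fh c f) x) ^+ 2)%:E = \int[mu]_x (cmod (fh c f x) ^+ 2)%:E)%E)//.
apply: ae_eq_integral => //; [exact: measurable_cmod_sqr|exact: measurable_cmod_sqr (fh_cmeas c fi)|].
by apply: filterS (cls_ae (fh_L2 c2 fi f2)) => x -> _.
Qed.

Definition disc (n : nat) : set (plane R) := [set x | dot x x <= n%:R ^+ 2].
Definition tr n f x : R[i] := ind (disc n) x * f x.

Lemma measurable_disc n : measurable (disc n).
have := measurable_sqnorm measurableT (@measurable_itv R `]-oo, n%:R ^+ 2]).
rewrite setTI; congr measurable; apply/seteqP; split => x /=; by rewrite in_itv.
Qed.

Lemma disc_fin n : (mu (disc n) < +oo)%E.
apply: le_lt_trans (leb2_box n); apply: le_measure; rewrite ?inE//.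
- exact: measurable_disc.
- by apply: measurableX; exact: measurable_itv.
move=> [x y]; rewrite /disc /dot /= !in_itv /= -!expr2 => h.
have H (u v : R) : u ^+ 2 + v ^+ 2 <= n%:R ^+ 2 -> - n%:R <= u <= n%:R.
 move=> h'; rewrite -ler_norml; apply: le_sqr2 => //; rewrite sqr_normr.
 nra.
by split; apply: H; [exact: h|rewrite addrC; exact: h].
Qed.

Lemma ind_le1 (A : set (plane R)) x : cmod (ind A x) <= 1.
by rewrite cmod_real ger0_norm// /indic; case: (_ \in _). Qed.
Lemma tr_L2 n f : L2 f -> L2 (tr n f).
move=> f2; apply: L2Mb f2; [exact: ind_cmeas (measurable_disc n)|exact: ind_le1]. Qed.
Lemma tr_cint1 n f : L2 f -> cint1 mu (tr n f).
by move=> f2; apply: L2_cint1M f2; exact: ind_L2 (measurable_disc n) (disc_fin n). Qed.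

Lemma cint_CI (A : set (plane R)) f : cint A f = CI mu (fun x => ind A x * f x).
rewrite /cint /CI; congr (_ +i* _); rewrite Rintegral_mkcond; apply: eq_Rintegral => x _.
 by rewrite ReM /= mul0r subr0 /patch indicE; case: (x \in A); rewrite ?mul1r ?mul0r.
by rewrite ImM /= mul0r addr0 /patch indicE; case: (x \in A); rewrite ?mul1r ?mul0r.
Qed.

Lemma fourier_truncE c f n : fourier_trunc c f n = fh c (tr n f).
apply/funext => xi; rewrite /fourier_trunc /fh cint_CI; congr (_ * _).
by apply: eq_CI => x; rewrite /tr mulrCA.
Qed.

Lemma nrm_cls_cvg0 (f_ : nat -> plane R -> R[i]) f (h : plane R -> R) :
 (forall n, L2 (f_ n)) -> L2 f -> mu.-integrable setT (fun x => (h x)%:E) ->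
 (forall n x, cmod (f_ n x - f x) ^+ 2 <= h x) ->
 {ae mu, forall x, (fun n => cmod (f_ n x - f x)) @ \oo --> (0 : R)} ->
 cvgL2 (fun n => cls (f_ n)) (cls f).
move=> hf_ hf ih le cv.
have H : (fun n => \int[mu]_x (cmod (f_ n x - f x) ^+ 2))%R @ \oo --> (0 : R).
 apply: (Rintegral_dct0 _ _ ih).
 - move=> n; apply: measurable_funX; apply: measurable_cmod.
  by apply: cmeasB; [have /L2P[]:= hf_ n|have /L2P[]:= hf].
 - apply: filterS cv => x cx; rewrite -[X in _ --> X](mulr0 (0 : R)).
  by under eq_fun do rewrite expr2; exact: cvgM.
 - by move=> n x; rewrite ger0_norm ?sqr_ge0.
move=> e e0; move/cvgr0Pnorm_le : H => /(_ _ (exprn_gt0 2 e0)) [N _ HN].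
exists N => i Ni; rewrite -clsB// nrm_cls; last exact: L2B.
rewrite -(ger0_norm (ltW e0)) -sqrtr_sqr ler_wsqrtr//.
by have := HN i Ni; rewrite /= => h'; rewrite (letr (ler_norm _)).
Qed.

Lemma tr_cvg f : L2 f -> cvgL2 (fun n => cls (tr n f)) (cls f).
move=> f2; have /L2P[mf iff] := f2.
apply: (nrm_cls_cvg0 _ f2 iff) => [n|n x|]; first exact: tr_L2.
 rewrite /tr /ind indicE; case: (_ \in _); rewrite ?mul1r ?subrr ?cmod0 ?mul0r ?sub0r ?cmodN//.
 nra.
apply: aeW => x.
have [n0 hn0] : exists n0 : nat, forall n, (n0 <= n)%N -> disc n x.
 exists (Num.truncn (dot x x)).+1 => n hn; rewrite /disc /=.
 have := truncnS_gt (dot x x); have : ((Num.truncn (dot x x)).+1%:R <= n%:R :> R) by rewrite ler_nat.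
 have : (1 <= n%:R :> R) by rewrite ler1n (leq_trans _ hn).
 nra.
apply: cvg_near_cst; exists n0 => // n /= hn.
by rewrite /tr /ind indicE (mem_set (hn0 _ hn)) mul1r subrr cmod0.
Qed.

Lemma cvgL2_norm_le (a_ : nat -> Lsq R) a (B : R) : cvgL2 a_ a -> (forall n, nrm (a_ n) <= B) -> nrm a <= B.
move=> h hB; apply/ler_addgt0Pr => e e0; have [n /(_ _ (leqnn n)) hn] := h _ e0.
have := nrm_dist (a_ n) a 0; rewrite !subr0 nrmBC => /letr; apply.
by rewrite addrC lerD.
Qed.

Lemma cvgL2D (a_ b_ : nat -> Lsq R) a b : cvgL2 a_ a -> cvgL2 b_ b -> cvgL2 (fun n => a_ n + b_ n) (a + b).
move=> ha hb e e0; have e2 : 0 < e / 2 by pos.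
have [n hn] := ha _ e2; have [m hm] := hb _ e2; exists (maxn n m) => i.
rewrite geq_max => /andP[/hn h1 /hm h2]; rewrite opprD addrACA.
by apply: (letr (nrmD _ _)); lra.
Qed.

Lemma cvgL2Z (k : R[i]) (a_ : nat -> Lsq R) a : cvgL2 a_ a -> cvgL2 (fun n => k *: a_ n) (k *: a).
move=> ha e e0; have k0 : 0 < cmod k + 1 by rewrite ltr_wpDl ?cmod_ge0.
have [n hn] := ha (e / (cmod k + 1)) (divr_gt0 e0 k0); exists n => i /hn h1.
rewrite -scalerBr nrmZ; apply: (via ((cmod k + 1) * nrm (a_ i - a))).
 by mr; lra.
by rewrite mulrC -ler_pdivlMr.
Qed.

Lemma cvgL2_lip (F : Lsq R -> Lsq R) (K : R) (a_ : nat -> Lsq R) a :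
 (forall u v, nrm (F u - F v) <= K * nrm (u - v)) -> cvgL2 a_ a -> cvgL2 (fun n => F (a_ n)) (F a).
move=> hF ha e e0; have k0 : 0 < `|K| + 1 by rewrite ltr_wpDl.
have [n hn] := ha (e / (`|K| + 1)) (divr_gt0 e0 k0); exists n => i /hn h1.
apply: (letr (hF _ _)); apply: (via ((`|K| + 1) * nrm (a_ i - a))).
 by mr; have := ler_norm K; lra.
by rewrite mulrC -ler_pdivlMr.
Qed.

Lemma cvgL2_cst a : cvgL2 (fun=> a) a.
by move=> e e0; exists 0%N => i _; rewrite subrr nrm0 ltW. Qed.

Lemma cvgL2_ip (a_ b_ : nat -> Lsq R) a b : cvgL2 a_ a -> cvgL2 b_ b ->
 (fun n => ip (a_ n) (b_ n)) @ \oo --> ip a b.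
move=> ha hb; apply/cvgrPdist_le => e e0.
pose K := nrm a + nrm b + 1.
have K0 : 0 < K by rewrite /K; have := nrm_ge0 a; have := nrm_ge0 b; lra.
have d0 : 0 < Num.min 1 (e / (2 * K)) by rewrite lt_min ltr01 divr_gt0// mulr_gt0.
have [n hn] := ha _ d0; have [m hm] := hb _ d0; exists (maxn n m) => // i /=.
rewrite geq_max => /andP[/hn + /hm]; rewrite !le_min => /andP[a1 a2] /andP[b1 b2].
have -> : ip a b - ip (a_ i) (b_ i) = ip (a - a_ i) b + ip (a_ i) (b - b_ i).
 by rewrite ipBl ipBr; ring.
apply: (letr (ler_normD _ _)).
have := ip_CS_abs (a - a_ i) b; have := ip_CS_abs (a_ i) (b - b_ i).
have na : nrm (a_ i) <= nrm a + 1.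
 by have := nrmD (a_ i - a) a; rewrite subrK; lra.
rewrite (nrmBC a) (nrmBC b).
have h1 : nrm (a_ i) * nrm (b_ i - b) <= K * (e / (2 * K)).
 by apply: ler_pM; rewrite ?nrm_ge0//; rewrite /K; have := nrm_ge0 b; lra.
have h2 : nrm (a_ i - a) * nrm b <= (e / (2 * K)) * K.
 by apply: ler_pM; rewrite ?nrm_ge0//; rewrite /K; have := nrm_ge0 a; lra.
have h3 : K * (e / (2 * K)) = e / 2 by field; rewrite gt_eqF.
have h4 : (e / (2 * K)) * K = e / 2 by rewrite mulrC.
rewrite h3 in h1; rewrite h4 in h2; lra.
Qed.

(** The condition on [c] sits inside the specification so that [FT] is total. The contraction
    [nrm_fh] makes the transforms of the truncations Cauchy. *)
Fact FT_spec c : {F : Lsq R -> Lsq R | c ^+ 2 = 1 ->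
 forall a, cvgL2 (fun n => cls (fh c (tr n a))) (F a)}.
apply: cid; suff H (a : Lsq R) : exists b, c ^+ 2 = 1 -> cvgL2 (fun n => cls (fh c (tr n a))) b.
 by exists (fun a => sval (cid (H a))) => c2 a; case: cid => b /=; exact.
have [c2|nc2] := pselect (c ^+ 2 = 1); last by exists 0.
suff [b hb] : exists b, cvgL2 (fun n => cls (fh c (tr n a))) b by exists b.
apply: Lsq_complete => e e0; have e2 : 0 < e / 2 by pos.
have [n hn] := tr_cvg (fn_L2 a) e2; exists n => i j /hn hi /hn hj.
have L k := tr_L2 k (fn_L2 a); have I k := tr_cint1 k (fn_L2 a).
rewrite -clsB; [|exact: fh_L2..].
have -> : (fun x => fh c (tr i a) x - fh c (tr j a) x) = fh c (fun x => tr i a x - tr j a x).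
 by apply/funext => x; rewrite fhB.
apply: letr (nrm_fh c2 _ _) _; [| exact: L2B|].
 have := cint1D (I i) (cint1N (I j)); exact.
rewrite clsB//; apply: (letr (nrm_dist (cls a) _ _)); rewrite (nrmBC (cls a)); lra.
Qed.

Definition FT c : Lsq R -> Lsq R := sval (FT_spec c).
Lemma FT_cvg c a : c ^+ 2 = 1 -> cvgL2 (fun n => cls (fh c (tr n a))) (FT c a).
by move=> c2; exact: (svalP (FT_spec c)). Qed.

Section Transform.
Variable c : R.
Hypothesis c2 : c ^+ 2 = 1.

Let trL (n : nat) a := tr_L2 n (fn_L2 a).
Let trI (n : nat) a := tr_cint1 n (fn_L2 a).

Lemma fh_trD n a b : fh c (tr n (a + b)) = (fun x => fh c (tr n a) x + fh c (tr n b) x).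
rewrite (@fh_ae _ _ _ (fun x => tr n a x + tr n b x)).
- by apply/funext => x; rewrite fhD.
- by apply: filterS (fnD a b) => x hx; rewrite /tr hx mulrDr.
- exact: cint1_cmeas (trI n (a + b)).
- exact: cint1_cmeas (cint1D (trI n a) (trI n b)).
Qed.

Lemma FTD a b : FT c (a + b) = FT c a + FT c b.
apply: cvgL2_unique (FT_cvg _ c2) _.
have := cvgL2D (FT_cvg a c2) (FT_cvg b c2); congr cvgL2; apply/funext => n.
by rewrite fh_trD clsD//; exact: fh_L2.
Qed.

Lemma FTZ k a : FT c (k *: a) = k *: FT c a.
apply: cvgL2_unique (FT_cvg _ c2) _.
have := cvgL2Z k (FT_cvg a c2); congr cvgL2; apply/funext => n.
rewrite -clsZ; last exact: fh_L2.
congr cls; rewrite (@fh_ae _ _ (tr n (k *: a)) (fun x => k * tr n a x)).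
- by apply/funext => x; rewrite fhZ.
- by apply: filterS (fnZ k a) => x hx; rewrite /tr hx mulrCA.
- exact: cint1_cmeas (trI n (k *: a)).
- exact: cint1_cmeas (cint1Z k (trI n a)).
Qed.

Lemma FTB a b : FT c (a - b) = FT c a - FT c b.
by rewrite FTD -scaleN1r FTZ scaleN1r. Qed.

Lemma nrm_tr n a : nrm (cls (tr n a)) <= nrm a.
rewrite -[in leRHS](cls_fn a); apply: nrm_le_ae.
apply: filterS2 (cls_ae (trL n a)) (cls_ae (fn_L2 a)) => x -> ->.
by rewrite /tr cmodM ler_piMl ?cmod_ge0// ind_le1.
Qed.

Lemma FT_contr a : nrm (FT c a) <= nrm a.
apply: cvgL2_norm_le (FT_cvg a c2) _ => n.
by apply: letr (nrm_fh c2 _ _) (nrm_tr n a).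
Qed.

Lemma FT_fh f : cint1 mu f -> L2 f -> FT c (cls f) = cls (fh c f).
move=> fi f2; apply: cvgL2_unique (FT_cvg _ c2) _ => e e0.
have [n hn] := tr_cvg (fn_L2 (cls f)) e0; exists n => i /hn; rewrite cls_fn.
apply: letr; rewrite -clsB//; [|exact: fh_L2..].
have -> : (fun x => fh c (tr i (cls f)) x - fh c f x) = fh c (fun x => tr i (cls f) x - f x).
 by apply/funext => x; rewrite fhB.
by rewrite -clsB//; apply: nrm_fh => //; [have := cint1D (trI i (cls f)) (cint1N fi); exact|exact: L2B].
Qed.

End Transform.

Lemma FT_adj c a b : c ^+ 2 = 1 -> ip (FT c a) b = ip a (FT (- c) b).
move=> c2; have c2' : (- c) ^+ 2 = 1 by rewrite sqrrN.
have trL n (d : Lsq R) := tr_L2 n (fn_L2 d); have trI n (d : Lsq R) := tr_cint1 n (fn_L2 d).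
have E n : ip (cls (fh c (tr n a))) (cls (tr n b)) = ip (cls (tr n a)) (cls (fh (- c) (tr n b))).
 rewrite !ip_cls//; [|exact: fh_L2..]; congr Re.
 have := fh_adj c (trI n a) (cint1_conj (trI n b)) => H.
 transitivity (CI mu (fun xi => conjc (tr n b xi) * fh c (tr n a) xi)).
  by apply: eq_CI => x; rewrite mulrC.
 by rewrite H; apply: eq_CI => x; rewrite fh_conj.
have T (d : Lsq R) : cvgL2 (fun n => cls (tr n d)) d by have := tr_cvg (fn_L2 d); rewrite cls_fn.
have h1 := cvgL2_ip (FT_cvg a c2) (T b).
have h2 := cvgL2_ip (T a) (FT_cvg b c2').
by rewrite -(funext E) in h2; apply: (cvg_unique _ h1 h2).
Qed.

(** Both sides are limits of the transforms of truncations to discs, because [fourier_trunc c f n]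
    is exactly [fh c (tr n f)]. *)
Lemma is_fourierP c f g : c ^+ 2 = 1 ->
 is_fourier c f g <-> [/\ L2 f, L2 g & cls g = FT c (cls f)].
move=> c2.
have E n : L2 f -> L2 g -> L2norm (fun xi => fourier_trunc c f n xi - g xi) =
  (nrm (cls (fh c (tr n (cls f))) - cls g))%:E.
 move=> f2 g2; rewrite fourier_truncE.
 have -> : fh c (tr n f) = fh c (tr n (cls f)).
  apply: fh_ae; [|exact: cint1_cmeas (tr_cint1 n f2)|exact: cint1_cmeas (tr_cint1 n (fn_L2 _))].
  by apply: filterS (cls_ae f2) => x hx; rewrite /tr hx.
 have h : L2 (fh c (tr n (cls f))) by exact: fh_L2 c2 (tr_cint1 n (fn_L2 _)) (tr_L2 n (fn_L2 _)).
 by rewrite L2norm_nrm ?clsB//; exact: L2B.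
split=> [[f2 g2 h]|[f2 g2 h]]; split => //.
 apply/esym; apply: cvgL2_unique (FT_cvg _ c2) _ => e e0.
 move: h; under eq_fun do rewrite E//.
 move=> /fine_cvgP[_ /cvgr0Pnorm_le/(_ _ e0)[N _ HN]]; exists N => i Ni.
 by have := HN i Ni; rewrite /= ger0_norm ?nrm_ge0.
under eq_fun do rewrite E//; rewrite h; apply/fine_cvgP; split; first by near=> n.
apply/cvgr0Pnorm_le => e e0; have [N HN] := FT_cvg (cls f) c2 e0.
by exists N => // i /= /HN; rewrite ger0_norm ?nrm_ge0.
Unshelve. all: by end_near. Qed.

End Plancherel.

(** * Fourier inversion *)

Section Inversion.
Context {R : realType}.
Implicit Types (f g : plane R -> R[i]) (c : R) (a b : Lsq R).

(** After this change of variables the kernel no longer depends on [e], which turns the limit e -> 0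
    into dominated convergence. *)
Lemma gkr_dilate (e : R) (x : plane R) (F : plane R -> R) : 0 < e -> mfun F ->
 (forall y, 0 <= F y <= 1) ->
 (\int[mu]_y (F y * gkr e (diff y x)) = \int[mu]_y (F (shift x (dilate e y)) * gkr 1 y))%R.
move=> e0 mF F01; have [I _] := gkr_integral e0.
pose Phi y := F y * gkr e (diff y x); pose Psi y := F (shift x y) * gkr e y.
have [ms _ _] := leb2_shift x.
have iPsi : mu.-integrable setT (fun y => (Psi y)%:E).
 apply: (le_integrable measurableT _ _ I).
  apply/measurable_EFinP; apply: measurable_funM; first exact: measurableT_comp mF ms.
  exact: measurable_gkr.
 move=> y _; have /andP[h0 h1] := F01 (shift x y).
 have P0 : 0 <= Psi y by rewrite mulr_ge0 ?gkr_ge0.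
 rewrite /= (ger0_norm P0) ger0_norm ?gkr_ge0//.
 by rewrite lee_fin /Psi ler_piMl ?gkr_ge0.
have iPhi : mu.-integrable setT (fun y => (Phi y)%:E).
 have := scales_integrable (leb2_shift (- x.1, - x.2)) iPsi.
 congr (integrable _ _ _); apply/funext => y; rewrite /Psi /Phi /diff; congr (F _ * _)%:E.
 by rewrite /shift /= !subrK -surjective_pairing.
have := scales_Rintegral (leb2_shift x) iPhi; rewrite mul1r => <-.
have -> : (\int[mu]_y Phi (shift x y) = \int[mu]_y Psi y)%R.
 apply: eq_Rintegral => y _; rewrite /Phi /Psi; congr (_ * gkr _ _).
 by rewrite /diff /shift /= !addrK -surjective_pairing.
have hd := leb2_prod (leb_scale e0) (leb_scale e0).
have := scales_Rintegral hd iPsi => /(f_equal (fun z => e ^+ 2 * z)).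
have k : e ^+ 2 * (e^-1 * e^-1) = 1 by field; rewrite gt_eqF.
rewrite mulrA k mul1r => <-.
have := scales_integrable hd iPsi => iP.
rewrite -RintegralZl//; apply: eq_Rintegral => y _.
rewrite /Psi mulrCA; congr (_ * _).
have -> : gkr e (e * y.1, e * y.2) = e ^- 2 * gkr 1 y.
 rewrite /gkr mulrA; congr (_ * expR _).
  by field; rewrite gt_eqF.
 by rewrite /dot /=; field; rewrite gt_eqF.
by rewrite mulrA mulfV ?expf_neq0 ?gt_eqF// mul1r.
Qed.

Lemma cvg_itv_shift (p q v w : R) : v != p -> v != q ->
 \forall n \near \oo, (v + n.+1%:R^-1 * w \in `]p, q]) = (v \in `]p, q]).
move=> vp vq.
pose d := Num.min `|v - p| `|v - q|.
have d0 : 0 < d by rewrite lt_min !normr_gt0 !subr_eq0 vp vq.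
have H : (fun n : nat => n.+1%:R^-1 * w) @ \oo --> (0 : R).
 by apply: (@cvg0_harmonic _ _ `|w|) => n; rewrite normrM [X in X * _]ger0_norm ?invr_ge0// mulrC.
move/cvgr0Pnorm_lt: H => /(_ _ d0); apply: filterS => n.
set u := _ * w; rewrite /d lt_min => /andP[h1 h2]; rewrite !in_itv /=.
have E (r : R) : `|u| < `|v - r| -> ((r < v + u) = (r < v)) /\ ((v + u <= r) = (v <= r)).
 move: (ler_norm u) (lerNnormlW (lexx `|u|)) => n1 n2.
 case: (ltrP 0 (v - r)) => h.
  rewrite (ger0_norm (ltW h)) => hu; split; apply/idP/idP; lra.
 rewrite (ler0_norm h) => hu; split; apply/idP/idP; lra.
by rewrite (E p h1).1 (E q h2).2.
Qed.

Lemma leb2_line1 (p : R) : {ae mu, forall x : plane R, x.1 != p}.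
exists ([set p] `*` setT); split.
- by apply: measurableX => //; exact: measurable_set1.
- rewrite /leb2 /= product_measure1E; [|exact: measurable_set1|exact: measurableT].
 by rewrite [X in (X * _)%E](_ : _ = 0%E) ?mul0e//; exact: lebesgue_measure_set1.
- by move=> [x y] /= /negP; rewrite negbK => /eqP ->.
Qed.

Lemma leb2_line2 (p : R) : {ae mu, forall x : plane R, x.2 != p}.
exists (setT `*` [set p]); split.
- by apply: measurableX => //; exact: measurable_set1.
- rewrite /leb2 /= product_measure1E; [|exact: measurableT|exact: measurable_set1].
 by rewrite [X in (_ * X)%E](_ : _ = 0%E) ?mule0//; exact: lebesgue_measure_set1.
- by move=> [x y] /= /negP; rewrite negbK => /eqP ->.
Qed.

(** Off the four lines that carry the sides of the box, the indicator is locally constant; dominated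
    convergence against the fixed kernel [gkr 1] gives its value. *)
Lemma box_mollify_cvg (p q : R * R) : {ae mu, forall x,
 (fun n => ((2 * pi)^-1 * \int[mu]_y (\1_(box p q) y * gkr (n.+1%:R^-1) (diff y x)))%R)
  @ \oo --> (\1_(box p q) x : R)}.
have H1 := @filterI _ _ (ae_filter_ringOfSetsType mu) _ _ (leb2_line1 p.1) (leb2_line1 q.1).
have H2 := @filterI _ _ (ae_filter_ringOfSetsType mu) _ _ (leb2_line2 p.2) (leb2_line2 q.2).
apply: (@filterS2 _ _ (ae_filter_ringOfSetsType mu) _ _ _ _ H1 H2).
move=> x [x1 x2] [x3 x4].
have mB := measurable_box p q.
have [I V] := gkr_integral (@ltr01 R).
have I01 y : 0 <= (\1_(box p q) y : R) <= 1 by rewrite indicE; case: (_ \in _); rewrite ?lexx ?ler01.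
have ms n : mfun (fun y => \1_(box p q) (shift x (dilate n.+1%:R^-1 y)) : R).
 have [m1 _ _] := leb2_shift x; have [|k _ [m2 _ _]] := @leb2_dilate R n.+1%:R^-1; first by pos.
 apply: (measurableT_comp (measurable_indicR mB)).
 by apply: measurableT_comp m1 m2.
have H : (fun n => \int[mu]_y ((\1_(box p q) (shift x (dilate n.+1%:R^-1 y)) - \1_(box p q) x) * gkr 1 y))%R
  @ \oo --> (0 : R).
 apply: (Rintegral_dct0 _ _ I).
 - move=> n; apply: measurable_funM; last exact: measurable_gkr.
  by meas.
 - apply: aeW => y; apply: cvg_near_cst.
  have H3 := cvg_itv_shift y.1 x1 x2; have H4 := cvg_itv_shift y.2 x3 x4.
  apply: filterS2 H3 H4 => n h1 h2.
  rewrite !indicE; have -> : (shift x (dilate n.+1%:R^-1 y) \in box p q) = (x \in box p q).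
   apply/idP/idP; rewrite !inE => -[]; rewrite /box /= !(addrC _ x.1) !(addrC _ x.2) ?h1 ?h2 => a b; split => //=;
    by rewrite !(addrC _ x.1) !(addrC _ x.2) ?h1 ?h2.
  ring.
 - move=> n y; rewrite normrM [X in _ * X]ger0_norm ?gkr_ge0// ler_piMl ?gkr_ge0//.
  have /andP[a b] := I01 (shift x (dilate n.+1%:R^-1 y)); have /andP[a' b'] := I01 x.
  by rewrite ler_norml; apply/andP; split; lra.
apply/cvgrPdist_le => e e0.
have e2 : 0 < e * (2 * pi) by rewrite mulr_gt0 ?pi2_gt0.
move/cvgr0Pnorm_le: H => /(_ _ e2); apply: filterS => n hn.
have en : 0 < n.+1%:R^-1 :> R by pos.
rewrite (gkr_dilate x en (measurable_indicR mB) I01).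
have iF : mu.-integrable setT (fun y => (\1_(box p q) (shift x (dilate n.+1%:R^-1 y)) * gkr 1 y)%:E).
 apply: (le_integrable measurableT _ _ I).
  by apply/measurable_EFinP; apply: measurable_funM; last exact: measurable_gkr.
 move=> y _; have /andP[h0 h1] := I01 (shift x (dilate n.+1%:R^-1 y)).
 rewrite /= !ger0_norm ?gkr_ge0//; last by pos.
 by rewrite lee_fin ler_piMl ?gkr_ge0.
have eqn : (\int[mu]_y ((\1_(box p q) (shift x (dilate n.+1%:R^-1 y)) - \1_(box p q) x) * gkr 1 y) =
  \int[mu]_y (\1_(box p q) (shift x (dilate n.+1%:R^-1 y)) * gkr 1 y) - \1_(box p q) x * (2 * pi))%R.
 rewrite -V -RintegralZl// -RintegralB//.
  by apply: eq_Rintegral => y _; rewrite mulrBl.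
 exact: (integrableZl measurableT (\1_(box p q) x) I).
rewrite eqn in hn.
have -> : \1_(box p q) x - (2 * pi)^-1 * (\int[mu]_y (\1_(box p q) (shift x (dilate n.+1%:R^-1 y)) * gkr 1 y))%R =
  - ((2 * pi)^-1 * ((\int[mu]_y (\1_(box p q) (shift x (dilate n.+1%:R^-1 y)) * gkr 1 y))%R - \1_(box p q) x * (2 * pi))).
 by rewrite mulrBr opprB [X in _ = X - _]mulrCA mulVf ?mulr1 ?gt_eqF ?pi2_gt0.
rewrite normrN normrM [X in X * _]ger0_norm; last by pos.
by rewrite [X in X <= _]mulrC ler_pdivrMr ?pi2_gt0.
Qed.

(** The damped transforms [G n] converge in L^2, hence so do their inverse transforms; these are
    mollified indicators, which converge almost everywhere, and the two limits agree. *)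
Lemma FT_inv_box c p q : c ^+ 2 = 1 -> FT (- c) (FT c (cls (ind (box p q)))) = cls (ind (box p q)).
move=> c2; have c2' : (- c) ^+ 2 = 1 by rewrite sqrrN.
have mB := measurable_box p q; have fB := box_fin p q.
have f2 := ind_L2 mB fB; have fi := ind_cint1 mB fB; set f := ind (box p q) in f2 fi *.
have en (n : nat) : 0 < (n.+1%:R^-1 : R) by pos.
pose G n (xi : plane R) := gau (n.+1%:R^-1)%:C xi * fh c f xi.
have F2 := fh_L2 c2 fi f2.
have gle n (xi : plane R) : cmod (gau (n.+1%:R^-1)%:C xi) <= 1 by apply: gau_le1; exact: adm_real.
have G2 n : L2 (G n) by apply: L2Mb F2; [exact: cmeas_gau|exact: gle].
have Gi n : cint1 mu (G n).
 have := @cint1_bM _ (fh c f) (gau (n.+1%:R^-1)%:C) _ (fh_cmeas c fi) (fun xi => fh_le c xi fi) (gau_cint1 (adm_real (en n))).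
 by congr (cint1 _ _); apply/funext => xi; rewrite /G mulrC.
have cG : cvgL2 (fun n => cls (G n)) (cls (fh c f)).
 have /L2P[mF iF] := F2.
 apply: (nrm_cls_cvg0 G2 F2 (integrableZl measurableT 4 iF)) => [n x|].
  rewrite -[X in _ - X]mul1r -mulrBl cmodM exprMn ler_wpM2r ?sqr_ge0//.
  have -> : 4 = 2 ^+ 2 :> R by ring.
  apply: sqr_le2; rewrite//; apply: (letr (cmodB _ _)).
  by rewrite cmod1; have := gle n x; lra.
 by apply: aeW => x; exact: gau_cvg.
have lip u v : nrm (FT (- c) u - FT (- c) v) <= 1 * nrm (u - v) by rewrite -FTB// mul1r FT_contr.
have := cvgL2_lip lip cG; rewrite -(FT_fh c2 fi f2).
under [X in cvgL2 X]eq_fun do rewrite (FT_fh c2' (Gi _) (G2 _)).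
move=> H; apply/esym/cls_eqP => //.
have K : {ae mu, forall x, forall n, cls (fh (- c) (G n)) x = fh (- c) (G n) x}.
 by apply/ae_foralln => n; apply: cls_ae; exact: fh_L2.
have := cvgL2_ae_eq H (ind_cmeas mB); move=> L.
have {}L : {ae mu, forall x, FT (- c) (FT c (cls f)) x = f x}.
 apply: L; apply: filterS2 K (box_mollify_cvg p q) => x hK hx.
 have E n : cmod (cls (fh (- c) (G n)) x - f x) =
   `|(2 * pi)^-1 * (\int[mu]_y (\1_(box p q) y * gkr (n.+1%:R^-1) (diff y x)))%R - \1_(box p q) x|.
  rewrite hK /G (fh_mollify x c2 (adm_real (en n)) fi).
  have -> : CI mu (fun y => f y * gker (n.+1%:R^-1)%:C (diff y x)) =
    (\int[mu]_y (\1_(box p q) y * gkr (n.+1%:R^-1) (diff y x)))%R%:C.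
   by rewrite -CI_real; apply: eq_CI => y; rewrite gker_real [RHS]realcM.
  by rewrite -realcM -[f x]/((\1_(box p q) x)%:C) -rmorphB cmod_real.
 apply/cvgr0Pnorm_le => e e0; move/cvgrPdist_le: hx => /(_ e e0); apply: filterS => n.
 by rewrite E normr_id distrC.
by apply: filterS L => x ->.
Qed.

(** By adjointness the defect is orthogonal to every box, since inversion is known for boxes. *)
Lemma FTK c a : c ^+ 2 = 1 -> FT (- c) (FT c a) = a.
move=> c2; have c2' : (- c) ^+ 2 = 1 by rewrite sqrrN.
apply/eqP; rewrite -subr_eq0; apply/eqP; apply: box_perp => p q k.
rewrite ipBl (FT_adj _ _ c2') opprK FTZ// (FT_adj _ _ c2) FTZ// FT_inv_box// subrr//.
Qed.

(** Two contractions that undo each other are isometries. *)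
Lemma nrm_FT c a : c ^+ 2 = 1 -> nrm (FT c a) = nrm a.
move=> c2; have c2' : (- c) ^+ 2 = 1 by rewrite sqrrN.
by apply/eqP; rewrite eq_le FT_contr// -[in leLHS](FTK a c2) FT_contr.
Qed.

Definition Fhat : Lsq R -> Lsq R := FT (-1).
Definition Finv : Lsq R -> Lsq R := FT 1.
Let sqrN1 : (-1 : R) ^+ 2 = 1. Proof. by rewrite sqrrN expr1n. Qed.
Let sqr1 : (1 : R) ^+ 2 = 1. Proof. by rewrite expr1n. Qed.
Lemma FhatK : cancel Fhat Finv.
by move=> a; have := FTK a sqrN1; rewrite opprK. Qed.
Lemma FinvK : cancel Finv Fhat.
by move=> a; exact: FTK. Qed.

Lemma nrm_Fhat a : nrm (Fhat a) = nrm a. Proof. exact: nrm_FT. Qed.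
Lemma nrm_Finv a : nrm (Finv a) = nrm a. Proof. exact: nrm_FT. Qed.
Lemma FhatD a b : Fhat (a + b) = Fhat a + Fhat b. Proof. exact: FTD. Qed.
Lemma FinvD a b : Finv (a + b) = Finv a + Finv b. Proof. exact: FTD. Qed.
Lemma FhatZ k a : Fhat (k *: a) = k *: Fhat a. Proof. exact: FTZ. Qed.
Lemma FinvZ k a : Finv (k *: a) = k *: Finv a. Proof. exact: FTZ. Qed.

Lemma fourierE f : L2 f -> L2 (fourier f) /\ cls (fourier f) = Fhat (cls f).
move=> f2; rewrite /fourier; case: xgetP => [g _ /= /(is_fourierP _ _ sqrN1)[]//|].
move=> /(_ (Fhat (cls f))) []; apply/(is_fourierP _ _ sqrN1); split => //; first exact: fn_L2.
by rewrite cls_fn.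
Qed.

Lemma inv_fourierE f : L2 f -> L2 (inv_fourier f) /\ cls (inv_fourier f) = Finv (cls f).
move=> f2; rewrite /inv_fourier; case: xgetP => [g _ /= /(is_fourierP _ _ sqr1)[]//|].
move=> /(_ (Finv (cls f))) []; apply/(is_fourierP _ _ sqr1); split => //; first exact: fn_L2.
by rewrite cls_fn.
Qed.

End Inversion.

(** * Multiplication by phases and translations on L^2 classes *)

Section PhasesAndShifts.
Context {R : realType}.
Implicit Types (f g : plane R -> R[i]) (c t : R) (a b : Lsq R) (th ph : plane R -> R) (v w x y : plane R).

Fact phase_spec : {P : (plane R -> R) -> Lsq R -> Lsq R | forall th a, mfun th ->
 {ae mu, forall x, P th a x = cis (th x) * a x}}.
exists (fun th a => cls (fun x => cis (th x) * a x)) => th a mth; apply: cls_ae.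
apply: (@L2Mb _ _ 1 _ (cmeas_cis mth)); last exact: fn_L2.
by move=> x; rewrite cmod_cis.
Qed.

Definition phase : (plane R -> R) -> Lsq R -> Lsq R := sval phase_spec.
Lemma phase_ae th a : mfun th -> {ae mu, forall x, phase th a x = cis (th x) * a x}.
exact: (svalP phase_spec). Qed.

Lemma L2_shift v f : L2 f -> L2 (fun x => f (shift v x)).
move=> /L2P[mf iff]; have [ms _ _] := leb2_shift v; apply/L2P; split; first exact: cmeas_comp mf ms.
exact: (scales_integrable (leb2_shift v) iff).
Qed.

Fact trans_spec : {S : plane R -> Lsq R -> Lsq R | forall v a,
 {ae mu, forall x, S v a x = a (shift v x)}}.
exists (fun v a => cls (fun x => a (shift v x))) => v a; apply: cls_ae.
exact: L2_shift (fn_L2 a).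
Qed.

Definition trans : plane R -> Lsq R -> Lsq R := sval trans_spec.
Lemma trans_ae v a : {ae mu, forall x, trans v a x = a (shift v x)}.
exact: (svalP trans_spec). Qed.

Section Phase.
Variable th : plane R -> R.
Hypothesis mth : mfun th.

Lemma phaseD a b : phase th (a + b) = phase th a + phase th b.
apply: Lsq_ext; apply: filterS2 (fnD (phase th a) (phase th b)) (filterI (fnD a b) (filterI (phase_ae (a + b) mth) (filterI (phase_ae a mth) (phase_ae b mth)))) => x -> [h1 [-> [-> ->]]].
by rewrite h1 mulrDr.
Qed.

Lemma phaseZ k a : phase th (k *: a) = k *: phase th a.
apply: Lsq_ext; apply: filterS2 (fnZ k (phase th a)) (filterI (fnZ k a) (filterI (phase_ae (k *: a) mth) (phase_ae a mth))) => x -> [h1 [-> ->]].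
by rewrite h1 mulrCA.
Qed.

Lemma phaseN a : phase th (- a) = - phase th a.
by rewrite -scaleN1r phaseZ scaleN1r. Qed.
Lemma phaseB a b : phase th (a - b) = phase th a - phase th b.
by rewrite phaseD phaseN. Qed.

Lemma nrm_phase a : nrm (phase th a) = nrm a.
by apply/eqP; rewrite eq_le !nrm_le_ae//; apply: filterS (phase_ae a mth) => x ->; rewrite cmodM cmod_cis mul1r.
Qed.

End Phase.

Lemma phaseA th ph a : mfun th -> mfun ph ->
 phase th (phase ph a) = phase (fun x => th x + ph x) a.
move=> m1 m2; apply: Lsq_ext.
apply: filterS2 (phase_ae (phase ph a) m1) (filterI (phase_ae a m2) (phase_ae a (measurable_funD m1 m2))) => x -> [-> ->].
by rewrite cisD mulrA.
Qed.

Lemma phase_cst (k : R) a : phase (fun=> k) a = cis k *: a.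
apply: Lsq_ext; apply: filterS2 (@phase_ae (fun=> k) a (measurable_cst _)) (fnZ (cis k) a) => x -> ->//.
Qed.

Lemma phase0 a : phase (fun=> 0) a = a.
by rewrite phase_cst cis0 scale1r. Qed.

Lemma phaseK th a : mfun th -> phase (fun x => - th x) (phase th a) = a.
move=> m; have m' : mfun (fun x => - th x) by meas.
by rewrite phaseA// -[RHS]phase0; congr phase; apply/funext => x; rewrite addNr.
Qed.

Lemma transD v a b : trans v (a + b) = trans v a + trans v b.
have H := scales_ae (leb2_shift v) (fnD a b).
apply: Lsq_ext; apply: filterS2 (fnD (trans v a) (trans v b)) (filterI H (filterI (trans_ae v (a + b)) (filterI (trans_ae v a) (trans_ae v b)))) => x -> [h1 [-> [-> ->]]].
by [].
Qed.

Lemma transZ v k a : trans v (k *: a) = k *: trans v a.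
have H := scales_ae (leb2_shift v) (fnZ k a).
apply: Lsq_ext; apply: filterS2 (fnZ k (trans v a)) (filterI H (filterI (trans_ae v (k *: a)) (trans_ae v a))) => x -> [h1 [-> ->]].
by [].
Qed.

Lemma transN v a : trans v (- a) = - trans v a.
by rewrite -scaleN1r transZ scaleN1r. Qed.
Lemma transB v a b : trans v (a - b) = trans v a - trans v b.
by rewrite transD transN. Qed.

Lemma nrm_trans v a : nrm (trans v a) = nrm a.
have L := L2_shift v (fn_L2 a).
rewrite -(cls_eqP L (filterS (fun x => @esym _ _ _) (trans_ae v a))) -[in RHS](cls_fn a).
rewrite !nrm_cls//; last exact: fn_L2.
congr sqrt; have /L2P[_ ia] := fn_L2 a.
by have := scales_Rintegral (leb2_shift v) ia; rewrite mul1r.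
Qed.

Definition vadd v w : plane R := (v.1 + w.1, v.2 + w.2).
Definition vscale (k : R) v : plane R := (k * v.1, k * v.2).

Lemma transA v w a : trans v (trans w a) = trans (vadd w v) a.
have H := scales_ae (leb2_shift v) (trans_ae w a).
apply: Lsq_ext; apply: filterS2 (trans_ae v (trans w a)) (filterI H (trans_ae (vadd w v) a)) => x -> [-> ->].
by congr (a _); rewrite /shift /vadd /=; congr pair; ring.
Qed.

Lemma trans0 a : trans (0, 0) a = a.
apply: Lsq_ext; apply: filterS (trans_ae (0, 0) a) => x ->.
by congr (a _); rewrite /shift /= !addr0 -surjective_pairing.
Qed.

Lemma transK v a : trans (vscale (-1) v) (trans v a) = a.
by rewrite transA -[RHS]trans0; congr trans; rewrite /vadd /vscale /=; congr pair; ring. Qed.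

Lemma trans_phase v th a : mfun th ->
 trans v (phase th a) = phase (fun x => th (shift v x)) (trans v a).
move=> m; have H := scales_ae (leb2_shift v) (phase_ae a m).
have [ms _ _] := leb2_shift v.
have m2 : mfun (fun x => th (shift v x)) by exact: measurableT_comp m ms.
by apply: Lsq_ext; apply: filterS2 (trans_ae v (phase th a)) (filterI H (filterI (phase_ae (trans v a) m2) (trans_ae v a))) => x -> [-> [-> ->]].
Qed.

Lemma measurable_lin v : mfun (fun x => dot v x).
exact: measurable_dotr. Qed.

(** Truncations to discs are integrable and dense, so Lipschitz maps may be compared on functions
    for which the transform is an integral. *)
Lemma Lsq_dense_eq (F G : Lsq R -> Lsq R) (K L : R) :
 (forall a b, nrm (F a - F b) <= K * nrm (a - b)) ->
 (forall a b, nrm (G a - G b) <= L * nrm (a - b)) ->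
 (forall f, cint1 mu f -> L2 f -> F (cls f) = G (cls f)) -> forall a, F a = G a.
move=> hF hG h a; have T : cvgL2 (fun n => cls (tr n a)) a by have := tr_cvg (fn_L2 a); rewrite cls_fn.
apply: cvgL2_unique (cvgL2_lip hF T) _.
have := cvgL2_lip hG T; congr cvgL2; apply/funext => n.
by rewrite h//; [exact: tr_cint1 (fn_L2 a)|exact: tr_L2 (fn_L2 a)].
Qed.

Lemma FT_trans c v a : c ^+ 2 = 1 ->
 FT c (trans v a) = phase (fun xi => - c * dot v xi) (FT c a).
move=> c2; have mp : mfun (fun xi => - c * dot v xi).
 by apply: measurable_funM => //; exact: measurable_lin.
move: a; apply: (@Lsq_dense_eq _ _ 1 1).
- by move=> a b; rewrite -FTB// -transB mul1r nrm_FT// nrm_trans.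
- by move=> a b; rewrite -phaseB// -FTB// mul1r nrm_phase// nrm_FT.
move=> f fi f2; have L := L2_shift v f2.
have fi' : cint1 mu (fun x => f (shift v x)) by apply: (scales_cint1 (leb2_shift v)); exact: fi.
have -> : trans v (cls f) = cls (fun x => f (shift v x)).
 apply/esym/cls_eqP => //; apply: filterS2 (trans_ae v (cls f)) (scales_ae (leb2_shift v) (cls_ae f2)) => x -> ->//.
rewrite !FT_fh//; apply: cls_eqP; first exact: fh_L2.
apply: filterS2 (phase_ae (cls (fh c f)) mp) (cls_ae (fh_L2 c2 fi f2)) => xi -> ->.
rewrite /fh mulrCA; congr (_ * _).
have i1 := cint1_cisM c xi fi.
rewrite -CIZ//.
have i2 : cint1 mu (fun x => cis (- c * dot v xi) * (cis (c * dot x xi) * f x)) by exact: cint1Z.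
have := scales_CI (leb2_shift v) i2; rewrite mul1r => <-; apply: eq_CI => x.
rewrite mulrA -cisD; congr (cis _ * _); rewrite /dot /shift /=; ring.
Qed.

Lemma FT_phase c v a : c ^+ 2 = 1 ->
 FT c (phase (fun x => dot v x) a) = trans (vscale c v) (FT c a).
move=> c2; have mp := measurable_lin v.
move: a; apply: (@Lsq_dense_eq _ _ 1 1).
- by move=> a b; rewrite -FTB// -phaseB// mul1r nrm_FT// nrm_phase.
- by move=> a b; rewrite -transB -FTB// mul1r nrm_trans nrm_FT.
move=> f fi f2.
have b1 x : cmod (cis (dot v x)) <= 1 by rewrite cmod_cis.
have L : L2 (fun x => cis (dot v x) * f x) by exact: L2Mb (cmeas_cis mp) b1 f2.
have fi' : cint1 mu (fun x => cis (dot v x) * f x) by exact: cint1_bM (cmeas_cis mp) b1 fi.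
have -> : phase (fun x => dot v x) (cls f) = cls (fun x => cis (dot v x) * f x).
 by apply/esym/cls_eqP => //; apply: filterS2 (phase_ae (cls f) mp) (cls_ae f2) => x -> ->.
rewrite !FT_fh//; apply: cls_eqP; first exact: fh_L2.
apply: filterS2 (trans_ae (vscale c v) (cls (fh c f))) (scales_ae (leb2_shift (vscale c v)) (cls_ae (fh_L2 c2 fi f2))) => xi -> ->.
rewrite /fh; congr (_ * _); apply: eq_CI => x; rewrite mulrA -cisD; congr (cis _ * _).
rewrite /dot /shift /vscale /=; transitivity (c * (x.1 * xi.1 + x.2 * xi.2) + c ^+ 2 * (x.1 * v.1 + x.2 * v.2)); last ring.
by rewrite c2; ring.
Qed.

End PhasesAndShifts.

(** * The free evolution as a Fourier multiplier *)

Section FreeEvolution.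
Context {R : realType}.
Implicit Types (m t : R) (a b : Lsq R) (v w x : plane R).

Definition symb m t : plane R -> R := fun xi => - (t / (2 * m) * dot xi xi).
Lemma measurable_symb m t : mfun (symb m t).
by apply: measurable_funN; apply: measurable_funM => //; exact: measurable_sqnorm. Qed.
Definition U m t a : Lsq R := Finv (phase (symb m t) (Fhat a)).

Lemma U0 m a : U m 0 a = a.
rewrite /U (_ : symb m 0 = fun=> 0) ?phase0 ?FhatK//.
by apply/funext => x; rewrite /symb !mul0r oppr0.
Qed.

Lemma Uadd m t t' a : U m t (U m t' a) = U m (t + t') a.
rewrite /U FinvK phaseA; [|exact: measurable_symb..].
congr (Finv (phase _ _)); apply/funext => x; rewrite /symb; ring.
Qed.

Lemma UK m t a : U m (- t) (U m t a) = a.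
by rewrite Uadd addNr U0. Qed.
Lemma UNK m t a : U m t (U m (- t) a) = a.
by rewrite Uadd addrN U0. Qed.
Lemma UD m t a b : U m t (a + b) = U m t a + U m t b.
by rewrite /U FhatD phaseD ?FinvD//; exact: measurable_symb. Qed.
Lemma UZ m t k a : U m t (k *: a) = k *: U m t a.
by rewrite /U FhatZ phaseZ ?FinvZ//; exact: measurable_symb. Qed.
Lemma UN m t a : U m t (- a) = - U m t a.
by rewrite -scaleN1r UZ scaleN1r. Qed.
Lemma UB m t a b : U m t (a - b) = U m t a - U m t b.
by rewrite UD UN. Qed.
Lemma nrm_U m t a : nrm (U m t a) = nrm a.
by rewrite /U nrm_Finv nrm_phase ?nrm_Fhat//; exact: measurable_symb. Qed.

Lemma Fhat_trans v a : Fhat (trans v a) = phase (fun xi => dot v xi) (Fhat a).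
rewrite /Fhat FT_trans; last by rewrite sqrrN expr1n.
by congr phase; apply/funext => x; rewrite opprK mul1r.
Qed.

Lemma U_trans m t v a : U m t (trans v a) = trans v (U m t a).
rewrite /U Fhat_trans phaseA; [|exact: measurable_symb|exact: measurable_lin].
rewrite -[RHS]FhatK Fhat_trans FinvK phaseA; [|exact: measurable_lin|exact: measurable_symb].
by congr (Finv (phase _ _)); apply/funext => x; rewrite addrC.
Qed.

(* Multiplication by [cis (k . x)] is conjugated by the free evolution into a
  translation followed by a phase. *)
Lemma U_phase m t k a : m != 0 ->
 U m t (phase (fun x => dot k x) a) =
 phase (fun x => dot k x - t / (2 * m) * dot k k) (trans (vscale (- (t / m)) k) (U m t a)).
move=> m0; have s1 : (-1 : R) ^+ 2 = 1 by rewrite sqrrN expr1n.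
have s2 : (1 : R) ^+ 2 = 1 by rewrite expr1n.
have mk := measurable_lin k.
have ms := measurable_symb m t.
rewrite /U [Fhat (phase _ _)](FT_phase k a s1).
set ga := FT (-1) a.
have -> : phase (symb m t) (trans (vscale (-1) k) ga) =
  trans (vscale (-1) k) (phase (fun x => symb m t (shift k x)) ga).
 rewrite trans_phase; last first.
  have [mk' _ _] := leb2_shift k; exact: measurableT_comp ms mk'.
 by congr phase; apply/funext => x; congr symb; rewrite /shift /vscale /=; rewrite !mulN1r !subrK -surjective_pairing.
(* The shifted symbol is a constant plus a linear phase plus the symbol itself; the linear phase
   becomes a translation after the inverse transform. *)
have E : (fun x => symb m t (shift k x)) = (fun x => - (t / (2 * m) * dot k k) + (- 1 * dot (vscale (t / m) k) x + symb m t x)).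
 apply/funext => x; rewrite /symb /dot /shift /vscale /=; field; by rewrite m0.
have ml : mfun (fun x => - 1 * dot (vscale (t / m) k) x).
 by apply: measurable_funM => //; exact: measurable_lin.
rewrite E -(phaseA _ (measurable_cst _)); last exact: measurable_funD.
rewrite phase_cst transZ FinvZ -(phaseA ga ml ms).
set w := phase (symb m t) ga.
have -> : trans (vscale (-1) k) (phase (fun x => - 1 * dot (vscale (t / m) k) x) w) =
  Fhat (phase (fun x => dot k x) (trans (vscale (- (t / m)) k) (Finv w))).
 rewrite [RHS](FT_phase k _ s1); congr trans.
 rewrite -[w in LHS]FinvK -/(Finv w) [RHS]Fhat_trans; congr phase; apply/funext => x.
 by rewrite /dot /vscale /=; ring.
rewrite FhatK -phase_cst phaseA//.
by congr phase; apply/funext => x; rewrite addrC.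
Qed.

End FreeEvolution.

(** * The nonlinearity at a point *)

Section PointwiseNonlinearity.
Context {R : realType}.

Lemma absz_lip (a b : R[i]) (L : R) : cmod a <= L -> cmod b <= L ->
 cmod ((cmod a)%:C * a - (cmod b)%:C * b) <= 2 * L * cmod (a - b).
move=> ha hb.
have -> : (cmod a)%:C * a - (cmod b)%:C * b = (cmod a)%:C * (a - b) + (cmod a - cmod b)%:C * b.
 ring.
apply: (letr (cmodD _ _)); rewrite !cmodM !cmod_real (ger0_norm (cmod_ge0 a)).
have h1 := ler_cmod_dist a b; have := cmod_ge0 a; have := cmod_ge0 b.
have := cmod_ge0 (a - b); have := normr_ge0 (cmod a - cmod b); nra.
Qed.

(** Since z -> |z|z has merely Lipschitz first derivatives, its second difference costs |a - b|^2
    besides the second difference of the arguments. The identity [e], in terms of the sum [s] and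
    the difference [d], makes this explicit without calculus. *)
Lemma absz_diff2 (a b c : R[i]) (L : R) : cmod a <= L -> cmod b <= L -> cmod c <= L ->
 cmod ((cmod a)%:C * a + (cmod b)%:C * b - ((cmod c)%:C * c + (cmod c)%:C * c)) <=
 2 * L * cmod (a + b - (c + c)) + cmod (a - b) ^+ 2.
move=> ha hb hc.
set X := cmod _; pose s := a + b; pose d := a - b; pose c2 := c + c.
have mc2 : cmod c2 = 2 * cmod c.
 have -> : c2 = 2%:C * c by rewrite /c2 -[2]/(1 + 1) rmorphD /= mulrDl mul1r.
 by rewrite cmodM cmod_real ger0_norm.
have e : 2%:C * ((cmod a)%:C * a + (cmod b)%:C * b - ((cmod c)%:C * c + (cmod c)%:C * c)) =
  (cmod a + cmod b - cmod s)%:C * s + (cmod a - cmod b)%:C * d +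
  ((cmod s)%:C * s - (cmod c2)%:C * c2).
 rewrite mc2 /s /d /c2 -[2]/(1 + 1) realcM !rmorphB !rmorphD /= !rmorph1.
 ring.
have hs : cmod s <= cmod a + cmod b := cmodD a b.
have hs2 : cmod s <= 2 * L by lra.
have hc2 : cmod c2 <= 2 * L by rewrite mc2; lra.
have par : cmod s ^+ 2 + cmod d ^+ 2 = 2 * cmod a ^+ 2 + 2 * cmod b ^+ 2.
 by rewrite !cmod_sqr /s /d !ReD !ImD !ReN !ImN; ring.
have := cmodD ((cmod a + cmod b - cmod s)%:C * s + (cmod a - cmod b)%:C * d) ((cmod s)%:C * s - (cmod c2)%:C * c2).
have := cmodD ((cmod a + cmod b - cmod s)%:C * s) ((cmod a - cmod b)%:C * d).
rewrite -e !cmodM !cmod_real -/X (ger0_norm (_ : 0 <= 2))// ger0_norm; last by rewrite subr_ge0.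
have := absz_lip hs2 hc2; have := ler_cmod_dist a b; rewrite -/d.
set D := cmod (s - c2).
have := cmod_ge0 d; have := cmod_ge0 s; have := cmod_ge0 a; have := cmod_ge0 b.
have := normr_ge0 (cmod a - cmod b).
move: (cmod ((cmod s)%:C * s - (cmod c2)%:C * c2)) => V.
move: (cmod ((cmod a + cmod b - cmod s)%:C * s + (cmod a - cmod b)%:C * d)) => W.
move: (cmod a) (cmod b) (cmod d) (cmod s) par hs => ma mb md ms par hs.
move: (`|ma - mb|) D X => t D X t0 b0 a0 s0 d0 td hV hW hX.
(* The parallelogram law bounds (ma + mb)^2 - ms^2 by md^2, and [ms] is at most half of
   [ma + mb + ms]. *)
have k1 : (ma + mb - ms) * ms <= md ^+ 2 / 2.
 have : (ma + mb - ms) * (ma + mb + ms) <= md ^+ 2 by have := sqr_ge0 (ma - mb); nra.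
 nra.
nra.
Qed.

Lemma prod_lip (a1 a2 b1 b2 : R[i]) (L : R) : cmod a2 <= L -> cmod b1 <= L ->
 cmod (a1 * a2 - b1 * b2) <= L * (cmod (a1 - b1) + cmod (a2 - b2)).
move=> h1 h2; have -> : a1 * a2 - b1 * b2 = (a1 - b1) * a2 + b1 * (a2 - b2) by ring.
apply: (letr (cmodD _ _)); rewrite !cmodM.
have := cmod_ge0 (a1 - b1); have := cmod_ge0 (a2 - b2); nra.
Qed.

Lemma prod_diff2 (a1 a2 b1 b2 c1 c2 : R[i]) (L : R) :
 cmod a2 <= L -> cmod b2 <= L -> cmod c1 <= L ->
 cmod (a1 * a2 + b1 * b2 - (c1 * c2 + c1 * c2)) <=
 L * (cmod (a1 + b1 - (c1 + c1)) + cmod (a2 + b2 - (c2 + c2))) +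
 (cmod (a1 - b1) ^+ 2 + cmod (a2 - b2) ^+ 2) / 2.
move=> h1 h2 h3.
have e : 2%:C * (a1 * a2 + b1 * b2 - (c1 * c2 + c1 * c2)) = (a1 + b1 - (c1 + c1)) * (a2 + b2) +
  (2%:C * c1) * (a2 + b2 - (c2 + c2)) + (a1 - b1) * (a2 - b2).
 ring.
have := cmodD ((a1 + b1 - (c1 + c1)) * (a2 + b2) + (2%:C * c1) * (a2 + b2 - (c2 + c2))) ((a1 - b1) * (a2 - b2)).
have := cmodD ((a1 + b1 - (c1 + c1)) * (a2 + b2)) ((2%:C * c1) * (a2 + b2 - (c2 + c2))).
rewrite -e !cmodM cmod_real (ger0_norm (_ : 0 <= 2))//.
have := cmodD a2 b2; have := cmod_ge0 (a1 + b1 - (c1 + c1)); have := cmod_ge0 (a2 + b2 - (c2 + c2)).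
move: (cmod (a1 + b1 - (c1 + c1))) (cmod (a2 + b2 - (c2 + c2))) => D1 D2.
have := sqr_ge0 (cmod (a1 - b1) - cmod (a2 - b2)); rewrite sqrrB.
move: (cmod (a1 - b1)) (cmod (a2 - b2)) (cmod (a2 + b2)) => d1 d2 s.
move: (cmod (a1 * a2 + _ - _)) (cmod (_ * _ + _ * _)) (cmod c1) h1 h2 h3 => X Y mc h1 h2 h3 hd D20 D10 hs hY hX.
nra.
Qed.

(** The factor |a|^2 + |b|^2 is kept, rather than a sup bound, because the Gagliardo-Nirenberg
    argument pairs it back with the norms of these squares. *)
Lemma cube_lip (a b : R[i]) : cmod ((cmod a ^+ 2)%:C * a - (cmod b ^+ 2)%:C * b) <=
 3 / 2 * (cmod a ^+ 2 + cmod b ^+ 2) * cmod (a - b).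
have -> : (cmod a ^+ 2)%:C * a - (cmod b ^+ 2)%:C * b =
  (cmod a ^+ 2)%:C * (a - b) + (cmod a ^+ 2 - cmod b ^+ 2)%:C * b.
 ring.
apply: (letr (cmodD _ _)); rewrite !cmodM !cmod_real (ger0_norm (sqr_ge0 _)).
rewrite subr_sqr normrM (ger0_norm (addr_ge0 (cmod_ge0 a) (cmod_ge0 b))).
have := ler_cmod_dist a b; have := cmod_ge0 a; have := cmod_ge0 b.
have := cmod_ge0 (a - b); have := normr_ge0 (cmod a - cmod b).
move: (cmod a) (cmod b) (cmod (a - b)) => p q r; move: `|p - q| => t t0 r0 q0 p0 tr.
have h : (p ^+ 2 + (p + q) * q) * r <= 3 / 2 * (p ^+ 2 + q ^+ 2) * r.
 by mr; have := sqr_ge0 (p - q); rewrite sqrrB; lra.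
have : t * (p + q) * q <= r * (p + q) * q by rewrite -!mulrA; apply: ler_wpM2r => //; rewrite mulr_ge0 ?addr_ge0.
lra.
Qed.

Definition additive_isometry (sg : R[i] -> R[i]) :=
 (forall x y, sg (x + y) = sg x + sg y) /\ (forall x, cmod (sg x) = cmod x).
Lemma additive_isometryB sg x y : additive_isometry sg -> sg (x - y) = sg x - sg y.
by case=> h _; have := h (x - y) y; rewrite subrK => ->; rewrite addrK. Qed.

Lemma I3P (P : 'I_3 -> Prop) : P i1 -> P i2 -> P i3 -> forall j, P j.
move=> h1 h2 h3 [[|[|[|//]]] hj].
- by have -> : Ordinal hj = i1 by apply/val_inj.
- by have -> : Ordinal hj = i2 by apply/val_inj.
- by have -> : Ordinal hj = i3 by apply/val_inj.
Qed.

Lemma sum3 (F : 'I_3 -> R) : \sum_j F j = F i1 + F i2 + F i3.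
rewrite !big_ord_recl big_ord0 addr0 addrA; congr (F _ + F _ + F _); exact/val_inj.
Qed.

Variables (lam mu : 'I_3 -> R[i]).
Implicit Types (z a b c : 'I_3 -> R[i]).
Definition Fz (z : 'I_3 -> R[i]) (j : 'I_3) : R[i] := nonlin lam mu (\row_l z l) j.

(** The three coupling terms share one shape, a product of two components with optional
    conjugations. Estimates need of a conjugation only that it is an additive isometry, so the three
    components are treated at once. *)
Lemma Fz_form j : exists l l' sg sg', [/\ additive_isometry sg, additive_isometry sg' &
 forall z, Fz z j = lam j * ((cmod (z j))%:C * z j) + mu j * (sg (z l) * sg' (z l'))].
have id_ai : additive_isometry id by [].
have cj_ai : additive_isometry (@conjc R) by split=> [x y|x]; rewrite ?conjcD ?cmod_conj.
by move: j; apply: I3P; [exists i2, i3, (@conjc R), id|exists i1, i3, (@conjc R), id|exists i1, i2, id, id];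
 split => // z; rewrite /Fz /nonlin /= !mxE !mulrA.
Qed.

Definition KF : R := \sum_j (cmod (lam j) + cmod (mu j)).

Lemma KF_ge0 : 0 <= KF.
by apply: sumr_ge0 => j _; rewrite addr_ge0 ?cmod_ge0. Qed.
Hint Resolve KF_ge0 : core.

Lemma KF_le j : cmod (lam j) + cmod (mu j) <= KF.
by rewrite /KF (bigD1 j)//= lerDl sumr_ge0// => i _; rewrite addr_ge0 ?cmod_ge0. Qed.
Lemma le_sum3 (F : 'I_3 -> R) j : (forall i, 0 <= F i) -> F j <= \sum_i F i.
by move=> h; rewrite (bigD1 j)//= lerDl sumr_ge0. Qed.

Lemma Fz_lip z z' j (L : R) : (forall l, cmod (z l) <= L) -> (forall l, cmod (z' l) <= L) ->
 cmod (Fz z j - Fz z' j) <= 2 * KF * L * \sum_l cmod (z l - z' l).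
move=> h h'; have [l [l' [sg [sg' [[sD sM] [sD' sM'] e]]]]] := Fz_form j.
rewrite !e; have -> : lam j * ((cmod (z j))%:C * z j) + mu j * (sg (z l) * sg' (z l')) -
  (lam j * ((cmod (z' j))%:C * z' j) + mu j * (sg (z' l) * sg' (z' l'))) =
  lam j * ((cmod (z j))%:C * z j - (cmod (z' j))%:C * z' j) +
  mu j * (sg (z l) * sg' (z l') - sg (z' l) * sg' (z' l')) by ring.
apply: (letr (cmodD _ _)); rewrite !cmodM.
have S0 i : 0 <= cmod (z i - z' i) by pos.
have k1 := absz_lip (h j) (h' j).
have k2 : cmod (sg (z l) * sg' (z l') - sg (z' l) * sg' (z' l')) <= L * (cmod (z l - z' l) + cmod (z l' - z' l')).
 rewrite -(sM (z l - _)) -(sM' (z l' - _)) !additive_isometryB//.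
 by apply: prod_lip; rewrite ?sM ?sM'.
have := le_sum3 j S0; have := le_sum3 l S0; have := le_sum3 l' S0.
set S := \sum_l0 _ => s1 s2 s3.
have L0 : 0 <= L := letr (cmod_ge0 _) (h j).
have SS : 0 <= S by rewrite sumr_ge0.
have LS : 0 <= L * S by pos.
have p1 : cmod ((cmod (z j))%:C * z j - (cmod (z' j))%:C * z' j) <= 2 * (L * S).
 nra.
have p2 : cmod (sg (z l) * sg' (z l') - sg (z' l) * sg' (z' l')) <= 2 * (L * S).
 nra.
apply: (via ((cmod (lam j) + cmod (mu j)) * (2 * (L * S)))).
 by rewrite mulrDl lerD// ler_wpM2l ?cmod_ge0.
have := KF_le j; move: (cmod _ + cmod _) => q hq.
nra.
Qed.

Lemma Fz0 j : Fz (fun=> 0) j = 0.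
have [l [l' [sg [sg' [[sD sM] _ e]]]]] := Fz_form j.
have s0 : sg 0 = 0 by apply: cmod_eq0; rewrite sM cmod0.
by rewrite e s0 mul0r [mu j * 0]mulr0 addr0 !mulr0.
Qed.

Lemma Fz_le z j (L : R) : (forall l, cmod (z l) <= L) ->
 cmod (Fz z j) <= 2 * KF * L * \sum_l cmod (z l).
move=> h; have L0 : 0 <= L := letr (cmod_ge0 _) (h j).
have := @Fz_lip z (fun=> 0) j L h; rewrite Fz0 subr0.
under eq_bigr do rewrite subr0.
by apply => l; rewrite cmod0.
Qed.

Lemma Fz_diff2 a b c j (L : R) : (forall l, cmod (a l) <= L) -> (forall l, cmod (b l) <= L) ->
 (forall l, cmod (c l) <= L) ->
 cmod (Fz a j + Fz b j - (Fz c j + Fz c j)) <=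
 KF * (2 * L * \sum_l cmod (a l + b l - (c l + c l)) + \sum_l cmod (a l - b l) ^+ 2).
move=> ha hb hc; have [l [l' [sg [sg' [[sD sM] [sD' sM'] e]]]]] := Fz_form j.
rewrite !e; set Ta := (cmod (a j))%:C * a j; set Tb := (cmod (b j))%:C * b j; set Tc := (cmod (c j))%:C * c j.
have -> : lam j * Ta + mu j * (sg (a l) * sg' (a l')) + (lam j * Tb + mu j * (sg (b l) * sg' (b l'))) -
  (lam j * Tc + mu j * (sg (c l) * sg' (c l')) + (lam j * Tc + mu j * (sg (c l) * sg' (c l')))) =
  lam j * (Ta + Tb - (Tc + Tc)) +
  mu j * (sg (a l) * sg' (a l') + sg (b l) * sg' (b l') - (sg (c l) * sg' (c l') + sg (c l) * sg' (c l'))) by ring.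
apply: (letr (cmodD _ _)); rewrite !cmodM.
have k1 := absz_diff2 (ha j) (hb j) (hc j); rewrite -/Ta -/Tb -/Tc in k1.
have k2 := @prod_diff2 (sg (a l)) (sg' (a l')) (sg (b l)) (sg' (b l')) (sg (c l)) (sg' (c l')) L.
rewrite !sM !sM' in k2; move/(_ (ha l') (hb l') (hc l)): k2.
rewrite -!(additive_isometryB _ _ (conj sD sM)) -!(additive_isometryB _ _ (conj sD' sM')).
rewrite -!sD -!sD' -!(additive_isometryB _ _ (conj sD sM)) -!(additive_isometryB _ _ (conj sD' sM')) !sM !sM' => k2.
have S0 i : 0 <= cmod (a i + b i - (c i + c i)) by pos.
have T0 i : 0 <= cmod (a i - b i) ^+ 2 by pos.
have := le_sum3 j S0; have := le_sum3 l S0; have := le_sum3 l' S0.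
have := le_sum3 j T0; have := le_sum3 l T0; have := le_sum3 l' T0.
set S := \sum_l0 cmod _; set T := \sum_l0 _ ^+ 2 => t1 t2 t3 s1 s2 s3.
have L0 : 0 <= L := letr (cmod_ge0 _) (ha j).
pose Q := 2 * L * S + T.
have Q0 : 0 <= Q by rewrite addr_ge0 ?mulr_ge0 ?sumr_ge0.
have p1 : cmod (Ta + Tb - (Tc + Tc)) <= Q.
 apply: (letr k1); rewrite /Q lerD// ler_wpM2l// mulr_ge0//.
have p2 : cmod (sg (a l) * sg' (a l') + sg (b l) * sg' (b l') - (sg (c l) * sg' (c l') + sg (c l) * sg' (c l'))) <= Q.
 apply: (letr k2); rewrite /Q lerD//; last lra.
 nra.
apply: (via ((cmod (lam j) + cmod (mu j)) * Q)).
 by rewrite mulrDl lerD// ler_wpM2l ?cmod_ge0.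
by mr; exact: KF_le.
Qed.

(** Mass resonance enters here: the phases of a coupling term add up to that of its component, for
    instance - m2 + m3 = m1 in the first equation. *)
Lemma Fz_gauge (m : 'I_3 -> R) (th : R) z j : m i1 + m i2 = m i3 ->
 Fz (fun l => cis (m l * th) * z l) j = cis (m j * th) * Fz z j.
move=> hm; move: j; apply: I3P; rewrite /Fz /nonlin /= !mxE !cmodM !cmod_cis !mul1r ?conjcM ?conj_cis -?hm mulrDr.
- rewrite [(m i1 + m i2) * th]mulrDl cisD.
 have := cisKN (m i2 * th); move: (cis (m i1 * th)) (cis (m i2 * th)) (cis (- (m i2 * th))) => p q r h.
 by rewrite -[in RHS](mul1r (z i3)) -h; ring.
- rewrite [(m i1 + m i2) * th]mulrDl cisD.
 have := cisKN (m i1 * th); move: (cis (m i1 * th)) (cis (m i2 * th)) (cis (- (m i1 * th))) => p q r h.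
 by rewrite -[in RHS](mul1r (z i3)) -h; ring.
- rewrite [(m i1 + m i2) * th]mulrDl cisD.
 ring.
Qed.

End PointwiseNonlinearity.
#[local] Hint Resolve KF_ge0 : core.

(** * Pointwise domination and sup bounds *)

Section Domination.
Context {R : realType}.
Implicit Types (f g : plane R -> R[i]) (a b : Lsq R) (L : R).

Lemma L2_le_ae f (h : Lsq R) : cmeas f -> {ae mu, forall x, cmod (f x) <= cmod (h x)} -> L2 f.
move=> mf hf; apply/L2P; split => //; apply/(integrable_sqrP mf).
have /L2P[mh /(integrable_sqrP mh)] := fn_L2 h; apply: le_lt_trans.
exact: sqint_le.
Qed.

Definition absL a : Lsq R := cls (fun x => (cmod (a x))%:C).

Lemma absL_L2 a : L2 (fun x => (cmod (a x))%:C).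
apply: (@L2_le_ae _ a); first by meas; exact: measurable_cmod.
by apply: aeW => x; rewrite cmod_real ger0_norm ?cmod_ge0.
Qed.

Lemma absL_ae a : {ae mu, forall x, absL a x = (cmod (a x))%:C}.
exact: cls_ae (absL_L2 a). Qed.

Lemma nrm_absL a : nrm (absL a) = nrm a.
by apply/eqP; rewrite eq_le !nrm_le_ae//; apply: filterS (absL_ae a) => x ->;
 rewrite cmod_real ger0_norm ?cmod_ge0.
Qed.

Lemma fn_sum (I : finType) (F : I -> Lsq R) (P : pred I) (s : seq I) :
 {ae mu, forall x, (\sum_(i <- s | P i) F i) x = \sum_(i <- s | P i) F i x}.
elim: s => [|i s IH].
 by apply: filterS fn0 => x h; rewrite !big_nil h.
rewrite !big_cons; case: ifPn => Pi.
 apply: filterS2 IH (fnD (F i) (\sum_(j <- s | P j) F j)) => x h1 h2.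
 by rewrite !big_cons Pi h2 h1.
by apply: filterS IH => x h1; rewrite !big_cons (negbTE Pi).
Qed.

(** Moduli of classes are classes again, so a pointwise bound becomes the triangle inequality for
    their sum. *)
Lemma nrm_dom (I : finType) (k : I -> R) (b : I -> Lsq R) a : (forall i, 0 <= k i) ->
 {ae mu, forall x, cmod (a x) <= \sum_i k i * cmod (b i x)} ->
 nrm a <= \sum_i k i * nrm (b i).
move=> k0 h; pose c := \sum_i (k i)%:C *: absL (b i).
apply: (via (nrm c)); last first.
 apply: (letr (nrm_sum _ _ _)); apply: ler_sum => i _.
 by rewrite nrmZ cmod_real ger0_norm// nrm_absL.
apply: nrm_le_ae.
have hs : {ae mu, forall x, forall i, ((k i)%:C *: absL (b i)) x = (k i * cmod (b i x))%:C}.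
 have : \forall x \ae mu, forall i : nat, forall j, enum_rank j = i :> nat -> ((k j)%:C *: absL (b j)) x = (k j * cmod (b j x))%:C.
  apply/ae_foralln => n.
  have [[j hj]|nj] := pselect (exists j : I, enum_rank j = n :> nat).
   apply: filterS2 (fnZ (k j)%:C (absL (b j))) (absL_ae (b j)) => x h1 h2 j' hj'.
   have -> : j' = j by apply/enum_rank_inj/val_inj; rewrite /= hj hj'.
   by rewrite h1 h2 realcM.
  by apply: aeW => x j hj; case: nj; exists j.
 by apply: filterS => x hx i; apply: (hx _ i erefl).
apply: filterS2 h (filterI (fn_sum (fun i => (k i)%:C *: absL (b i)) predT (index_enum I)) hs) => x h1 [h2 h3].
rewrite /c h2; under eq_bigr do rewrite h3.
rewrite -(raddf_sum (real_complex R)) cmod_real ger0_norm//.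
by rewrite sumr_ge0// => i _; rewrite mulr_ge0 ?cmod_ge0.
Qed.

Lemma nrm_dom2 (I : finType) (k k' : I -> R) (b b' : I -> Lsq R) a : (forall i, 0 <= k i) -> (forall i, 0 <= k' i) ->
 {ae mu, forall x, cmod (a x) <= \sum_i k i * cmod (b i x) + \sum_i k' i * cmod (b' i x)} ->
 nrm a <= \sum_i k i * nrm (b i) + \sum_i k' i * nrm (b' i).
move=> k0 k0' h.
have := @nrm_dom (I + I)%type (fun i => match i with inl i => k i | inr i => k' i end)
 (fun i => match i with inl i => b i | inr i => b' i end) a.
rewrite big_sumType /=; apply; first by case.
by apply: filterS h => x; rewrite big_sumType.
Qed.

Lemma ip_le_ae a b (c d : Lsq R) :
 {ae mu, forall x, Re (a x * conjc (b x)) <= Re (c x * conjc (d x))} -> ip a b <= ip c d.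
move=> h; rewrite !ipE /CI /=.
have [i1 _] := ip_cint1 a b; have [i2 _] := ip_cint1 c d.
rewrite -subr_ge0 -RintegralB//.
rewrite /Rintegral fine_ge0//.
have -> : (\int[mu]_x (Re (c x * conjc (d x)) - Re (a x * conjc (b x)))%:E =
  \int[mu]_x (`|Re (c x * conjc (d x)) - Re (a x * conjc (b x))|)%:E)%E.
 apply: ae_eq_integral => //.
 - have := integrableB measurableT i2 i1; exact: measurable_int.
 - apply/measurable_EFinP; apply: measurableT_comp => //; apply/measurable_EFinP.
  have := integrableB measurableT i2 i1; exact: measurable_int.
 - by apply: filterS h => x hx _; rewrite ger0_norm// subr_ge0.
by apply: integral_ge0 => x _; rewrite lee_fin.
Qed.

(** Polarisation: the real inner product is determined by the norms of [a], [b] and [a + b]. *)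
Lemma isometry_ip (F : Lsq R -> Lsq R) a b : (forall u v, F (u + v) = F u + F v) ->
 (forall u, nrm (F u) = nrm u) -> ip (F a) (F b) = ip a b.
move=> FD FN; have := nrmD_sqr (F a) (F b); have := nrmD_sqr a b.
rewrite -FD !FN; lra.
Qed.

Definition Linf L a := {ae mu, forall x, cmod (a x) <= L}.

Lemma Linf_trans v L a : Linf L a -> Linf L (trans v a).
move=> h; apply: filterS2 (trans_ae v a) (scales_ae (leb2_shift v) h) => x -> //.
Qed.

Lemma Linf_phase th L a : mfun th -> Linf L a -> Linf L (phase th a).
by move=> m h; apply: filterS2 (phase_ae a m) h => x ->; rewrite cmodM cmod_cis mul1r.
Qed.

Lemma LinfD L L' a b : Linf L a -> Linf L' b -> Linf (L + L') (a + b).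
move=> h h'; apply: filterS2 (fnD a b) (filterI h h') => x -> [h1 h2].
exact: letr (cmodD _ _) (lerD h1 h2).
Qed.

Lemma LinfN L a : Linf L a -> Linf L (- a).
by move=> h; apply: filterS2 (fnN a) h => x ->; rewrite cmodN. Qed.
Lemma LinfB L L' a b : Linf L a -> Linf L' b -> Linf (L + L') (a - b).
by move=> h h'; apply: LinfD => //; exact: LinfN. Qed.
Lemma Linf_le L L' a : L <= L' -> Linf L a -> Linf L' a.
by move=> le; apply: filterS => x h; exact: letr le. Qed.

(** A rapidly convergent subsequence converges almost everywhere, and there the pointwise bound
    passes to the limit. *)
Lemma cvgL2_Linf (a_ : nat -> Lsq R) a L : cvgL2 a_ a -> (forall n, Linf L (a_ n)) -> Linf L a.
move=> ha hL.
have [N hN] : exists N : nat -> nat, forall k i, (N k <= i)%N -> nrm (a_ i - a) <= 4^-1 ^+ k.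
 have H k : exists n, forall i, (n <= i)%N -> nrm (a_ i - a) <= 4^-1 ^+ k by apply: ha; rewrite exprn_gt0// invr_gt0.
 by exists (fun k => sval (cid (H k))) => k i; case: cid => n /=; exact.
have hr k : nrm (a_ (N k.+1 + N k)%N - a) <= 4^-1 ^+ k.+1 by apply: hN; exact: leq_addr.
have rap : forall k, nrm (a_ (N k.+2 + N k.+1)%N - a_ (N k.+1 + N k)%N) <= 2^-1 ^+ k.
 move=> k; apply: (letr (nrm_dist a _ _)); rewrite (nrmBC a).
 have := hr k; have := hr k.+1.
 have -> : 4^-1 ^+ k.+1 = 4^-1 * 4^-1 ^+ k :> R by rewrite exprS.
 have -> : 4^-1 ^+ k.+2 = 4^-1 * (4^-1 * 4^-1 ^+ k) :> R by rewrite !exprS.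
 have le : (4^-1 : R) ^+ k <= 2^-1 ^+ k by apply: lerXn2r; rewrite ?nnegrE ?invr_ge0//; lra.
 have : 0 <= (4^-1 : R) ^+ k by pos.
 lra.
have [f mf cf] := rapid_cvg_ae rap.
have ca : cvgL2 (fun k => a_ (N k.+1 + N k)%N) a.
 move=> e e0; have [n hn] := ha e e0.
 have ge0 : (fun k => (4^-1 : R) ^+ k) @ \oo --> (0 : R) by apply: cvg_expr; rewrite ger0_norm ?invr_ge0// invf_lt1//; lra.
 move/cvgr0Pnorm_le: ge0 => /(_ _ e0)[M _ HM]; exists M => i Mi.
 apply: (letr (hr i)); have := HM i.+1 (leq_trans Mi (leqnSn i)).
 by rewrite /= ger0_norm// exprn_ge0// invr_ge0.
have ae1 := cvgL2_ae_eq ca mf cf.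
have ae2 : {ae mu, forall x, forall n, cmod (a_ n x) <= L} by apply/ae_foralln.
apply: filterS2 ae1 (filterI ae2 cf) => x -> [h1 h2].
apply/ler_addgt0Pr => e e0; move/cvgr0Pnorm_le: h2 => /(_ _ e0)[M _ HM].
have := HM M (leqnn M); rewrite /= ger0_norm ?cmod_ge0// => h3.
have := h1 (N M.+1 + N M)%N; have := ler_cmod_dist (a_ (N M.+1 + N M)%N x) (f x).
by rewrite ler_norml => /andP[]; lra.
Qed.

Definition sqL a : Lsq R := cls (fun x => (cmod (a x) ^+ 2)%:C).
Definition cubeL a : Lsq R := cls (fun x => (cmod (a x) ^+ 2)%:C * a x).

Lemma sqL_L2 L a : Linf L a -> L2 (fun x => (cmod (a x) ^+ 2)%:C).
move=> h; apply: (@L2_le_ae _ (L%:C *: a)).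
 by meas.
apply: filterS2 h (fnZ L%:C a) => x h1 ->.
have L0 := letr (cmod_ge0 _) h1.
by rewrite cmodM !cmod_real ger0_norm ?sqr_ge0// ger0_norm// expr2 ler_wpM2r ?cmod_ge0.
Qed.

Lemma cubeL_L2 L a : Linf L a -> L2 (fun x => (cmod (a x) ^+ 2)%:C * a x).
move=> h; apply: (@L2_le_ae _ ((L ^+ 2)%:C *: a)).
 by meas.
apply: filterS2 h (fnZ (L ^+ 2)%:C a) => x h1 ->.
by rewrite !cmodM !cmod_real !ger0_norm ?sqr_ge0// ler_wpM2r ?cmod_ge0// sqr_le2.
Qed.

End Domination.
Arguments Linf {R} L a.

(** * Gauge translations and their second differences *)

Section GaugeTranslations.
Context {R : realType}.
Implicit Types (a b w : Lsq R) (L : R).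

Lemma measurable_shift (v : plane R) (th : plane R -> R) : mfun th ->
 mfun (fun x => th (shift v x)).
by move=> m; have [ms _ _] := leb2_shift v; exact: measurableT_comp m ms. Qed.

(** A gauge translation S, its inverse [gtV] and the symmetric second difference [gt2], which is S +
    S^-1 - 2. Pure shifts in position and in frequency are the cases of zero phase and of zero
    translation. *)
Definition gt (th : plane R -> R) (v : plane R) a : Lsq R := phase th (trans v a).
Definition gtV (th : plane R -> R) (v : plane R) a : Lsq R :=
 trans (vscale (-1) v) (phase (fun x => - th x) a).

Definition gt2 th v a : Lsq R := gt th v a + gtV th v a - (a + a).

Lemma vscaleN1K (v : plane R) : vscale (-1) (vscale (-1) v) = v.
by case: v => p q; rewrite /vscale /= !mulN1r !opprK. Qed.

Section OneSymmetry.
Variables (th : plane R -> R) (v : plane R).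
Hypothesis mth : mfun th.

Let mthN : mfun (fun x => - th x). Proof. exact: measurable_funN. Qed.
Lemma gt_ae a : {ae mu, forall x, gt th v a x = cis (th x) * a (shift v x)}.
by apply: filterS2 (phase_ae (trans v a) mth) (trans_ae v a) => x -> ->. Qed.
Lemma gtD a b : gt th v (a + b) = gt th v a + gt th v b.
by rewrite /gt transD phaseD. Qed.
Lemma gtN a : gt th v (- a) = - gt th v a.
by rewrite /gt transN phaseN. Qed.
Lemma gtB a b : gt th v (a - b) = gt th v a - gt th v b.
by rewrite gtD gtN. Qed.
Lemma nrm_gt a : nrm (gt th v a) = nrm a.
by rewrite /gt nrm_phase// nrm_trans. Qed.
Lemma gtVK a : gtV th v (gt th v a) = a.
by rewrite /gtV /gt phaseK// transK. Qed.

Lemma gtKV a : gt th v (gtV th v a) = a.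
have := transK (vscale (-1) v) (phase (fun x => - th x) a); rewrite vscaleN1K /gt /gtV => ->.
have := phaseK a mthN; congr (_ = _); congr phase; by apply/funext => x; rewrite opprK.
Qed.

Lemma gtVE a : gtV th v a = gt (fun x => - th (shift (vscale (-1) v) x)) (vscale (-1) v) a.
by rewrite /gtV trans_phase. Qed.
Lemma nrm_gtV a : nrm (gtV th v a) = nrm a.
by rewrite /gtV nrm_trans nrm_phase. Qed.
Lemma Linf_gt L a : Linf L a -> Linf L (gt th v a).
by move=> h; apply: Linf_phase => //; exact: Linf_trans. Qed.
Lemma Linf_gtV L a : Linf L a -> Linf L (gtV th v a).
by move=> h; apply: Linf_trans; exact: Linf_phase. Qed.
Lemma sqL_ae L a : Linf L a -> {ae mu, forall x, sqL a x = (cmod (a x) ^+ 2)%:C}.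
by move=> h; apply: cls_ae; exact: sqL_L2 h. Qed.
Lemma cubeL_ae L a : Linf L a -> {ae mu, forall x, cubeL a x = (cmod (a x) ^+ 2)%:C * a x}.
by move=> h; apply: cls_ae; exact: cubeL_L2 h. Qed.

(* Gagliardo-Nirenberg for second differences: with [e = w - S^-1 w] and
  [d = S w - w = S e], invariance of the integral under [S] gives
  [int |d|^4 = Re int w conj (|e|^2 e - |d|^2 d)], and [d - e] is the second
  difference of [w]. *)
Lemma gn_gt2 L w : 0 <= L -> Linf L w -> nrm (sqL (gt th v w - gtV th v w)) <= 12 * L * nrm (gt2 th v w).
move=> L0 hw; pose e := w - gtV th v w; pose d := gt th v w - w.
have de : d = gt th v e by rewrite /d /e gtB gtKV.
have Ddef : gt2 th v w = d - e by rewrite /gt2 /d /e opprB opprD addrACA [_ - w + _]addrC addrACA [- w + _]addrC.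
have he : Linf (L + L) e by apply: LinfB => //; exact: Linf_gtV.
have hd : Linf (L + L) d by apply: LinfB => //; exact: Linf_gt.
have h1 : nrm (sqL d) = nrm (sqL e).
 rewrite -(nrm_trans v (sqL e)); congr nrm; apply: Lsq_ext.
 apply: filterS2 (sqL_ae hd) (filterI (gt_ae e) (filterI (trans_ae v (sqL e)) (scales_ae (leb2_shift v) (sqL_ae he)))) => x -> [h2 [-> ->]].
 by rewrite de h2 cmodM cmod_cis mul1r.
have h3 : cubeL d = gt th v (cubeL e).
 apply: Lsq_ext.
 apply: filterS2 (cubeL_ae hd) (filterI (gt_ae e) (filterI (gt_ae (cubeL e)) (scales_ae (leb2_shift v) (cubeL_ae he)))) => x -> [h2 [-> ->]].
 by rewrite de h2 cmodM cmod_cis mul1r mulrCA.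
have h2 : nrm (sqL d) ^+ 2 <= ip d (cubeL d).
 rewrite nrm_sqr; apply: ip_le_ae.
 apply: filterS2 (sqL_ae hd) (cubeL_ae hd) => x -> ->.
 rewrite conjcM conjc_real mulrCA mul_conjc -realcM /=; lra.
have h4 : ip d (cubeL d) = ip w (cubeL e - cubeL d).
 rewrite {1}/d ipBl h3 (isometry_ip _ _ gtD nrm_gt) -h3 ipBr.
 by [].
have h5 : ip w (cubeL e - cubeL d) <= ip ((3 / 2 * L)%:C *: (sqL e + sqL d)) (absL (gt2 th v w)).
 apply: ip_le_ae.
 apply: filterS2 (fnB (cubeL e) (cubeL d)) (filterI (cubeL_ae he) (filterI (cubeL_ae hd) (filterI (fnZ (3 / 2 * L)%:C (sqL e + sqL d))
  (filterI (fnD (sqL e) (sqL d)) (filterI (sqL_ae he) (filterI (sqL_ae hd) (filterI (absL_ae (gt2 th v w)) (filterI hw (fnB d e))))))))) => x -> [-> [-> [-> [-> [-> [-> [-> [hx hD]]]]]]]].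
 rewrite Ddef hD conjc_real -!realcD -!realcM /=.
 apply: (letr (ler_norm _)); apply: (letr (Re_le_cmod _)); rewrite cmodM cmod_conj.
 have := cube_lip (e x) (d x); rewrite -(cmodN (d x - e x)) opprB.
 have := cmod_ge0 ((cmod (e x) ^+ 2)%:C * e x - (cmod (d x) ^+ 2)%:C * d x).
 move: hx (cmod_ge0 (w x)).
 move: (cmod (w x)) (cmod (_ - (cmod (d x) ^+ 2)%:C * d x)) => p q hx p0 q0 hq.
 nra.
set N := nrm (sqL d); set D := nrm (gt2 th v w).
have h6 : N ^+ 2 <= 3 * L * N * D.
 apply: (letr h2); rewrite h4; apply: (letr h5); apply: (letr (ip_CS _ _)).
 rewrite nrm_absL nrmZ cmod_real ger0_norm; last by pos.
 rewrite -/D; have := nrmD (sqL e) (sqL d); rewrite -h1 -/N => h.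
 have : 3 / 2 * L * nrm (sqL e + sqL d) * D <= 3 / 2 * L * (N + N) * D.
  by apply: ler_wpM2r; [exact: nrm_ge0|apply: ler_wpM2l => //; rewrite mulr_ge0].
 lra.
have h7 : N <= 3 * L * D.
 have [N0|N0] := leP N 0; first by apply: (letr N0); rewrite !mulr_ge0 ?nrm_ge0.
 nra.
(* S w - S^-1 w equals [d + e], and |d + e|^2 <= 2 |d|^2 + 2 |e|^2 turns the bound 3 L D for each
   square into 12 L D. *)
have hde : gt th v w - gtV th v w = d + e by rewrite /d /e addrA subrK.
have := @nrm_dom R bool (fun=> 2) (fun i : bool => if i then sqL d else sqL e) (sqL (gt th v w - gtV th v w)).
rewrite big_bool /= -h1 -/N => H; apply: (via (2 * N + 2 * N)); last by clear H; lra.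
apply: H => // ; rewrite hde.
apply: filterS2 (fnD d e) (filterI (sqL_ae (LinfD hd he)) (filterI (sqL_ae he) (sqL_ae hd))) => x h8 [-> [h9 h10]].
have E (F : bool -> R) : \sum_(i : bool) F i = F true + F false by rewrite big_bool.
rewrite cmod_real (ger0_norm (sqr_ge0 _)) E h9 h10 !cmod_real !ger0_norm ?sqr_ge0// h8.
have := cmodD (d x) (e x); have := cmod_ge0 (d x + e x).
move: (cmod (d x + e x)) (cmod (d x)) (cmod (e x)) => p q r p0 pq.
have : p ^+ 2 <= (q + r) ^+ 2 by exact: sqr_le2.
have := sqr_ge0 (q - r); rewrite sqrrB sqrrD; lra.
Qed.

End OneSymmetry.
End GaugeTranslations.

(** * The nonlinear map on triples of L^2 classes *)

Section NonlinearMap.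
Context {R : realType}.
Variables (lam nu : 'I_3 -> R[i]) (m : 'I_3 -> R).
Hypothesis hm : m i1 + m i2 = m i3.
Implicit Types (w : 'I_3 -> Lsq R) (L : R).

Local Notation KF := (KF lam nu).
(** For unbounded components the products may leave L^2, and [cls] then returns the class of 0;
    bounded components avoid this. *)
Definition FL w (j : 'I_3) : Lsq R := cls (fun x => Fz lam nu (fun l => w l x) j).

Lemma Fz_cmeas (w : 'I_3 -> plane R -> R[i]) j : (forall l, cmeas (w l)) -> cmeas (fun x => Fz lam nu (fun l => w l x) j).
move=> m0.
have m1 l : cmeas (fun x => (cmod (w l x))%:C) by apply: cmeas_real; exact: measurable_cmod.
have mc l : cmeas (fun x => conjc (w l x)) by exact: cmeas_conj.
move: j; apply: I3P; rewrite /Fz /nonlin /=; under eq_fun do rewrite !mxE;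
 by apply: cmeasD; apply: cmeasM => //; apply: cmeasM => //; exact: cmeas_cst.
Qed.

Lemma ae_all3 (P : 'I_3 -> plane R -> Prop) : (forall l, {ae mu, forall x, P l x}) ->
 {ae mu, forall x, forall l, P l x}.
move=> h; apply: filterS2 (h i1) (filterI (h i2) (h i3)) => x h1 [h2 h3].
by apply: I3P.
Qed.

Lemma FL_L2 L w : (forall l, Linf L (w l)) -> forall j, L2 (fun x => Fz lam nu (fun l => w l x) j).
move=> hw j; apply: (@L2_le_ae _ _ ((2 * KF * L)%:C *: \sum_l absL (w l))); first by apply: Fz_cmeas => l; exact: fn_cmeas.
have hs := fn_sum (fun l => absL (w l)) predT (index_enum 'I_3).
have ha := ae_all3 (fun l => absL_ae (w l)).
apply: filterS2 (ae_all3 hw) (filterI ha (filterI hs (fnZ (2 * KF * L)%:C (\sum_l absL (w l))))) => x hx [h1 [h2 ->]].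
rewrite h2; under eq_bigr do rewrite h1.
rewrite -(raddf_sum (real_complex R)) -realcM cmod_real.
by apply: (letr (Fz_le lam nu j hx)); exact: ler_norm.
Qed.

Lemma FL_ae L w : (forall l, Linf L (w l)) -> forall j,
 {ae mu, forall x, FL w j x = Fz lam nu (fun l => w l x) j}.
by move=> h j; apply: cls_ae; exact: FL_L2 h j. Qed.

Lemma nrm_FL_lip L w w' j : 0 <= L -> (forall l, Linf L (w l)) -> (forall l, Linf L (w' l)) ->
 nrm (FL w j - FL w' j) <= 2 * KF * L * \sum_l nrm (w l - w' l).
move=> L0 h h'; rewrite mulr_sumr; apply: nrm_dom => [l|].
 by pos.
apply: filterS2 (fnB (FL w j) (FL w' j)) (filterI (FL_ae h j) (filterI (FL_ae h' j)
 (filterI (ae_all3 h) (filterI (ae_all3 h') (ae_all3 (fun l => fnB (w l) (w' l))))))) => x -> [-> [-> [h1 [h2 h3]]]].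
apply: (letr (Fz_lip lam nu j h1 h2)); rewrite mulr_sumr.
by apply: ler_sum => l _; rewrite h3.
Qed.

Lemma nrm_FL L w j : 0 <= L -> (forall l, Linf L (w l)) ->
 nrm (FL w j) <= 2 * KF * L * \sum_l nrm (w l).
move=> L0 h; rewrite mulr_sumr; apply: nrm_dom => [l|].
 by pos.
apply: filterS2 (FL_ae h j) (ae_all3 h) => x -> h1.
by apply: (letr (Fz_le lam nu j h1)); rewrite mulr_sumr.
Qed.

Section Symmetry.
Variables (th : plane R -> R) (v : plane R).
Hypothesis mth : mfun th.

Definition mth_ (j : 'I_3) (x : plane R) : R := m j * th x.
Lemma measurable_mth j : mfun (mth_ j).
exact: measurable_funM. Qed.

Lemma FL_gt L w j : (forall l, Linf L (w l)) ->
 FL (fun l => gt (mth_ l) v (w l)) j = gt (mth_ j) v (FL w j).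
move=> h; have h' l : Linf L (gt (mth_ l) v (w l)) by apply: Linf_gt => //; exact: measurable_mth.
apply: Lsq_ext; apply: filterS2 (FL_ae h' j) (filterI (gt_ae v (measurable_mth j) (FL w j))
 (filterI (scales_ae (leb2_shift v) (FL_ae h j)) (ae_all3 (fun l => gt_ae v (measurable_mth l) (w l))))) => x -> [-> [-> h1]].
rewrite /mth_ -Fz_gauge//; congr Fz; apply/funext => l; exact: h1.
Qed.

End Symmetry.

Lemma FL_gtV th v L w j : mfun th -> (forall l, Linf L (w l)) ->
 FL (fun l => gtV (mth_ th l) v (w l)) j = gtV (mth_ th j) v (FL w j).
move=> mth h; pose th' x := - th (shift (vscale (-1) v) x).
have mth' : mfun th' by apply: measurable_funN; exact: measurable_shift.
have E l a : gtV (mth_ th l) v a = gt (mth_ th' l) (vscale (-1) v) a.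
 rewrite gtVE; last exact: measurable_mth.
 by congr gt; apply/funext => x; rewrite /mth_ /th' mulrN.
rewrite E -(FL_gt _ mth' j h); congr FL; apply/funext => l; exact: E.
Qed.

(** Because [FL] commutes with gauge translations, its second difference is the pointwise one at S
    w, S^-1 w and w. The quadratic remainder of [Fz_diff2] is brought back to first order in [gt2]
    by Gagliardo-Nirenberg at the price of a factor [L], so that 14 = 2 + 12. *)
Lemma FL_gt2 th v L w j : mfun th -> 0 <= L -> (forall l, Linf L (w l)) ->
 nrm (gt2 (mth_ th j) v (FL w j)) <= 14 * KF * L * \sum_l nrm (gt2 (mth_ th l) v (w l)).
move=> mth L0 h; rewrite /gt2 -(FL_gt v mth j h) -(FL_gtV v j mth h).
set wp := fun l => gt (mth_ th l) v (w l); set wm := fun l => gtV (mth_ th l) v (w l).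
have mm l := measurable_mth mth l.
have hp l : Linf L (wp l) by exact: Linf_gt.
have hn l : Linf L (wm l) by exact: Linf_gtV.
have h2 l : Linf (L + L) (wp l - wm l) by exact: LinfB.
apply: (via (\sum_l (2 * KF * L) * nrm (gt2 (mth_ th l) v (w l)) + \sum_l KF * nrm (sqL (wp l - wm l)))).
 apply: nrm_dom2 => [l|l|]; rewrite ?mulr_ge0 ?KF_ge0//.
 have hD l : {ae mu, forall x, gt2 (mth_ th l) v (w l) x = wp l x + wm l x - (w l x + w l x)}.
  by apply: filterS2 (fnB (wp l + wm l) (w l + w l)) (filterI (fnD (wp l) (wm l)) (fnD (w l) (w l))) => x h1 [h3 h4]; rewrite /gt2 h1 h3 h4.
 apply: filterS2 (fnB (FL wp j + FL wm j) (FL w j + FL w j)) (filterI (fnD (FL wp j) (FL wm j)) (filterI (fnD (FL w j) (FL w j))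
  (filterI (FL_ae hp j) (filterI (FL_ae hn j) (filterI (FL_ae h j) (filterI (ae_all3 h) (filterI (ae_all3 hp) (filterI (ae_all3 hn)
  (filterI (ae_all3 hD) (filterI (ae_all3 (fun l => sqL_ae (h2 l))) (ae_all3 (fun l => fnB (wp l) (wm l)))))))))))))
  => x -> [-> [-> [-> [-> [-> [b1 [b2 [b3 [b4 [b5 b6]]]]]]]]]].
 apply: (letr (Fz_diff2 lam nu j b2 b3 b1)).
 rewrite mulrDr mulrA mulrA [KF * 2]mulrC !mulr_sumr; apply: lerD; apply: ler_sum => l _.
  by rewrite b4.
 by rewrite b5 b6 cmod_real ger0_norm ?sqr_ge0.
rewrite -!mulr_sumr.
have : \sum_l nrm (sqL (wp l - wm l)) <= \sum_l 12 * L * nrm (gt2 (mth_ th l) v (w l)).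
 by apply: ler_sum => l _; exact: gn_gt2.
rewrite -mulr_sumr; set S := \sum_l _; set T := \sum_l _ => hT.
have := ler_wpM2l (KF_ge0 lam nu) hT; lra.
Qed.

End NonlinearMap.

(** * Dyadic sums equivalent to the weight (1 + y^2)^s *)

Section DyadicSums.
Context {R : realType}.

Lemma sin_sqr_le (x : R) : sin x ^+ 2 <= x ^+ 2.
have pos (y : R) : 0 <= y -> sin y ^+ 2 <= y ^+ 2.
 move=> y0; have [c _] := MVT_segment y0 (fun z _ => is_derive_sin z) (continuous_subspaceT (@continuous_sin R)).
 rewrite sin0 !subr0 => ->; rewrite exprMn ler_piMl ?sqr_ge0//.
have [x0|x0] := leP 0 x; first exact: pos.
by have := pos (- x); rewrite sinN !sqrrN; apply; lra.
Qed.

(** The symbol of a symmetric second difference up to sign, equal to |exp(i th) - 1|^2. *)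
Definition c2 (th : R) : R := 2 - 2 * cos th.

Lemma c2_ge0 th : 0 <= c2 th.
by rewrite /c2; have := cos_le1 th; lra. Qed.
Hint Resolve c2_ge0 : core.

Lemma c2_le4 th : c2 th <= 4.
by rewrite /c2; have := cos_geN1 th; lra. Qed.

Lemma c2_le_sqr th : c2 th <= th ^+ 2.
have e : th = (th / 2) *+ 2 by rewrite -mulr_natr divfK.
rewrite [in leLHS]e [in leRHS]e /c2 cos_mulr2n cos2sin2; set t := th / 2.
have -> : 2 - 2 * ((1 - sin t ^+ 2) *+ 2 - 1) = 4 * sin t ^+ 2 by ring.
have -> : (t *+ 2) ^+ 2 = 4 * t ^+ 2 by ring.
by rewrite ler_pM2l// sin_sqr_le.
Qed.

Lemma c2_cos1 : 0 < c2 1.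
have := @ltr_cos R 0 1; rewrite !in_itv /= cos0 lexx pi_ge0 ler01 /= => /(_ isT).
by have := pi_ge2 R => p2; rewrite (letr _ p2) ?ler1n// ltr01 => /(_ isT) h; rewrite /c2; lra.
Qed.

Lemma c2_lower th : 1 <= th <= 2 -> c2 1 <= c2 th.
move=> /andP[h1 h2]; rewrite /c2.
have p2 := pi_ge2 R.
have : cos th <= cos 1.
 move: h1; rewrite le_eqVlt => /orP[/eqP <-//|h1]; apply/ltW.
 by rewrite ltr_cos// in_itv /=; apply/andP; split; lra.
by lra.
Qed.

Lemma c2_norm th : c2 `|th| = c2 th. Proof. by rewrite /c2 cos_norm. Qed.
(** A majorant of c2^2 that is monotone in |z|, which c2^2 is not; monotonicity allows all scales
    below a given one to be dominated at once. *)
Definition psi (z : R) : R := Num.min 16 (z ^+ 4).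

Lemma psi_ge0 z : 0 <= psi z.
by rewrite /psi le_min; apply/andP; split => //; rewrite exprn_even_ge0. Qed.
Hint Resolve psi_ge0 : core.

Lemma c2_psi th : c2 th ^+ 2 <= psi th.
rewrite /psi le_min; apply/andP; split.
 have := sqr_le2 (c2_ge0 th) (c2_le4 th); lra.
by have := sqr_le2 (c2_ge0 th) (c2_le_sqr th); rewrite -exprM.
Qed.

Lemma psi_mono z z' : 0 <= z -> z <= z' -> psi z <= psi z'.
move=> z0 zz; rewrite /psi le_min ge_min lexx /= ge_min; apply/orP; right.
by apply: lerXn2r; rewrite ?nnegrE//; exact: letr zz.
Qed.

Lemma psi_norm z : psi `|z| = psi z.
by rewrite /psi -normrX ger0_norm// exprn_even_ge0. Qed.

Lemma dyadic (y : R) : 0 <= y -> exists n : nat, y < 2 ^+ n.+1 /\ (n = 0%N \/ 2 ^+ n <= y).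
move=> y0; have ex : exists n : nat, y < 2 ^+ n.+1.
 exists (Num.truncn y).+1; apply: (lt_trans (truncnS_gt y)).
 by rewrite -natrX ltr_nat; apply: (ltn_trans (ltn_expl _ (isT : 1 < 2)%N)); rewrite ltn_exp2l.
exists (ex_minn ex); case: ex_minnP => n hn hmin; split => //.
case: n hn hmin => [|n] hn hmin; [by left|right; rewrite leNgt; apply/negP => /hmin].
by rewrite ltnn.
Qed.

Variable s : R.
Hypothesis hs : 1 < s < 2.
Let s1 : 1 < s. Proof. by case/andP: hs. Qed.
Let s2 : s < 2. Proof. by case/andP: hs. Qed.
Let s0 : 0 <= s. Proof. by rewrite ltW// (lt_trans ltr01). Qed.

Definition rr : R := 4 `^ s.

Lemma rr_gt4 : 4 < rr.
rewrite /rr -[X in X < _]powRr1//.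
by rewrite /powR !gt_eqF// ltr_expR ltr_pM2r// ln_gt0//; lra.
Qed.

Lemma rr_lt16 : rr < 16.
have -> : 16 = 4 `^ 2%:R :> R by rewrite powR_mulrn//; lra.
by rewrite /rr /powR !gt_eqF// ltr_expR ltr_pM2r// ln_gt0//; lra.
Qed.

Lemma rr_exp n : rr ^+ n = ((2 ^+ n) ^+ 2) `^ s.
rewrite -powR_mulrn ?powR_ge0// /rr powRAC powR_mulrn//; congr (_ `^ _).
by rewrite -exprM mulnC exprM; congr (_ ^+ _); lra.
Qed.

Definition Cu : R := 256 * (1 / (rr - 1) + 16 / (16 - rr)).

Lemma Cu_ge0 : 0 <= Cu.
have h1 := rr_gt4; have h2 := rr_lt16; rewrite /Cu mulr_ge0// addr_ge0// divr_ge0// subr_ge0 ltW//.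
lra.
Qed.

(** Two geometric series meet at the dyadic level n of [y]: below it [psi] is at most 16 and the
    terms grow like [rr ^+ k]; above it [psi] is a fourth power and the terms decay with ratio
    rr/16, which is below 1 because s < 2. *)
Lemma dyadic_upper (y : R) (K : nat) : 0 <= y ->
 \sum_(k < K) rr ^+ k * psi (y * 2^-1 ^+ k) <= Cu * (1 + y ^+ 2) `^ s.
move=> y0; have [n [yn hn]] := dyadic y0.
have r4 := rr_gt4; have r16 := rr_lt16.
have rn0 k : 0 < rr ^+ k by rewrite exprn_gt0//; lra.
have P1 k : rr ^+ k * psi (y * 2^-1 ^+ k) <= 16 * rr ^+ k.
 by rewrite mulrC ler_wpM2r ?(ltW (rn0 k))// /psi ge_min lexx.
pose q := rr / 16.
have q0 : 0 < q by rewrite divr_gt0//; lra.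
have q1 : q < 1 by rewrite ltr_pdivrMr// mul1r.
have P2 j : rr ^+ (n.+1 + j) * psi (y * 2^-1 ^+ (n.+1 + j)) <= rr ^+ n.+1 * q ^+ j.
 rewrite exprD -mulrA ler_wpM2l ?(ltW (rn0 _))//.
 apply: (via (rr ^+ j * (16^-1) ^+ j)); last by rewrite -exprMn.
 rewrite ler_wpM2l ?(ltW (rn0 _))// /psi ge_min; apply/orP; right.
 have h : 0 <= y * 2^-1 ^+ (n.+1 + j) <= 2^-1 ^+ j.
  apply/andP; split; first by pos.
  rewrite exprD mulrA; rewrite -[leRHS]mul1r ler_wpM2r ?exprn_ge0//.
  by rewrite exprVn ler_pdivrMr ?exprn_gt0// mul1r ltW.
 have -> : (16^-1 : R) ^+ j = (2^-1 ^+ j) ^+ 4 by rewrite -exprM mulnC exprM; congr (_ ^+ _); field.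
 by apply: lerXn2r; rewrite ?nnegrE; case/andP: h => h1 h2//; exact: letr h2.
have G1 k : \sum_(i < k) rr ^+ i * psi (y * 2^-1 ^+ i) <= 16 * (rr ^+ k / (rr - 1)).
 elim: k => [|k IH]; first by rewrite big_ord0 mulr_ge0// divr_ge0//; lra.
 rewrite big_ord_recr /=; apply: (letr (lerD IH (P1 k))).
 rewrite -mulrDr ler_pM2l// exprS le_eqVlt; apply/orP; left; apply/eqP; field; lra.
have G2 j : \sum_(i < n.+1 + j) rr ^+ i * psi (y * 2^-1 ^+ i) <=
  16 * (rr ^+ n.+1 / (rr - 1)) + rr ^+ n.+1 * ((1 - q ^+ j) / (1 - q)).
 elim: j => [|j IH]; first by rewrite addn0 expr0 subrr mul0r mulr0 addr0 G1.
 rewrite addnS big_ord_recr /=; apply: (letr (lerD IH (P2 j))).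
 rewrite -addrA -mulrDr lerD2l ler_pM2l// exprS le_eqVlt; apply/orP; left; apply/eqP; field; lra.
have key : \sum_(k < K) rr ^+ k * psi (y * 2^-1 ^+ k) <= 16 * (rr ^+ n.+1 / (rr - 1)) + rr ^+ n.+1 * (1 / (1 - q)).
 apply: (via (\sum_(i < n.+1 + K) rr ^+ i * psi (y * 2^-1 ^+ i))).
  rewrite addnC big_split_ord /= lerDl sumr_ge0// => i _.
  by pos.
 apply: (letr (G2 K)); rewrite lerD2l ler_pM2l// ler_pM2r ?invr_gt0; last lra.
 by have := exprn_ge0 K (ltW q0); lra.
apply: (letr key).
have rn : rr ^+ n <= (1 + y ^+ 2) `^ s.
 rewrite rr_exp; apply: ge0_ler_powR; rewrite ?nnegrE//.
 - by pos.
 case: hn => [->|h]; first by rewrite expr0 expr1n; have := sqr_ge0 y; lra.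
 by have := sqr_le2 (exprn_ge0 n (ler0n R 2)) h; lra.
have e : 16 * (rr ^+ n.+1 / (rr - 1)) + rr ^+ n.+1 * (1 / (1 - q)) = rr ^+ n * (rr * 16 * (1 / (rr - 1) + 1 / (16 - rr))).
 rewrite exprS /q; field; rewrite !subr_eq0 !gt_eqF//; lra.
rewrite e mulrC; apply: ler_pM => //.
- by rewrite !mulr_ge0//; [lra|rewrite addr_ge0// divr_ge0//; lra].
- by pos.
rewrite /Cu; apply: ler_pM; rewrite ?mulr_ge0//; [lra|by rewrite addr_ge0// divr_ge0//; lra|lra|].
rewrite lerD2l ler_pM2r ?invr_gt0; lra.
Qed.

(** The first summand serves y < 1, where 1 + y^2 <= 2; the second serves y >= 1, where 1 + y^2 <= 8
    (2^n)^2 for the dyadic level n of y. *)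
Definition Cl : R := 2 `^ s + 8 `^ s / c2 1 ^+ 2.

Lemma Cl_ge0 : 0 <= Cl.
by rewrite addr_ge0 ?divr_ge0 ?powR_ge0 ?sqr_ge0. Qed.
Hint Resolve Cl_ge0 : core.

(** A single term suffices: at the level n with 1 <= y 2^-n < 2 the symbol is at least [c2 1]. *)
Lemma dyadic_lower (y : R) (K : nat) : 0 <= y -> y < 2 ^+ K ->
 (1 + y ^+ 2) `^ s <= Cl * (1 + \sum_(k < K) rr ^+ k * c2 (y * 2^-1 ^+ k) ^+ 2).
move=> y0 yK; have r4 := rr_gt4.
have rn0 k : 0 < rr ^+ k by rewrite exprn_gt0//; lra.
have t0 k : 0 <= rr ^+ k * c2 (y * 2^-1 ^+ k) ^+ 2 by rewrite mulr_ge0 ?sqr_ge0 ?ltW.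
have S0 : 0 <= \sum_(k < K) rr ^+ k * c2 (y * 2^-1 ^+ k) ^+ 2 by pos.
have [y1|y1] := ltP y 1.
 apply: (via (2 `^ s * 1)).
  rewrite mulr1; apply: ge0_ler_powR; rewrite ?nnegrE//; first by pos.
  nra.
 apply: ler_pM; rewrite//; last lra.
 by rewrite /Cl lerDl divr_ge0 ?powR_ge0 ?sqr_ge0.
have [n [yn hn]] := dyadic y0.
have {}hn : 2 ^+ n <= y by case: hn => // ->; rewrite expr0.
have nK : (n < K)%N by rewrite -(@ltr_eXn2l R 2) ?ltr1n//; exact: le_lt_trans yK.
have b : rr ^+ n * c2 1 ^+ 2 <= \sum_(k < K) rr ^+ k * c2 (y * 2^-1 ^+ k) ^+ 2.
 rewrite (bigD1 (Ordinal nK))//=; apply: (via (rr ^+ n * c2 (y * 2^-1 ^+ n) ^+ 2)).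
  rewrite ler_pM2l//; apply: sqr_le2; first by [].
  apply: c2_lower; rewrite exprVn; apply/andP; split.
   by rewrite ler_pdivlMr ?exprn_gt0// mul1r.
  by rewrite ler_pdivrMr ?exprn_gt0// -exprS ltW.
 by rewrite lerDl sumr_ge0.
have c0 : 0 < c2 1 ^+ 2 by rewrite exprn_gt0 ?c2_cos1.
apply: (via (8 `^ s / c2 1 ^+ 2 * (rr ^+ n * c2 1 ^+ 2))).
 rewrite mulrCA -mulrA mulVf ?gt_eqF// mulr1 [rr ^+ n * _]mulrC rr_exp -powRM//.
 apply: ge0_ler_powR; rewrite ?nnegrE//.
 - by pos.
 have := sqr_le2 y0 (ltW yn); rewrite [2 ^+ n.+1]exprS exprMn.
 have := sqr_le2 ler01 y1; rewrite expr1n.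
 lra.
apply: ler_pM.
- by pos.
- by pos.
- by rewrite /Cl lerDr.
- lra.
Qed.

End DyadicSums.
#[local] Hint Resolve c2_ge0 psi_ge0 Cl_ge0 : core.

(** * Weighted L^2 norms through dyadic second differences *)

Section WeightedSpaces.
Context {R : realType}.
Implicit Types (a b : Lsq R) (x : plane R).

Lemma bracket_gt0 (r : R) x : 0 < bracket r x.
by rewrite /bracket powR_gt0// ltr_pwDl ?dot_ge0. Qed.
Hint Resolve bracket_gt0 : core.

Lemma bracket_sqr (r : R) x : bracket r x ^+ 2 = (1 + dot x x) `^ r.
rewrite /bracket -powR_mulrn// -powRrM; congr (_ `^ _); by field.
Qed.

Lemma bracketD (r r' : R) x : bracket (r + r') x = bracket r x * bracket r' x.
rewrite /bracket mulrDl powRD//; apply/implyP => _.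
by rewrite gt_eqF// ltr_pwDl ?dot_ge0.
Qed.

Lemma bracket0 x : bracket (0 : R) x = 1.
by rewrite /bracket mul0r powRr0. Qed.

Lemma measurable_bracket (r : R) : mfun (@bracket R r).
apply: (measurableT_comp (measurable_powR (r / 2))).
by apply: measurable_funD => //; exact: measurable_sqnorm.
Qed.
Hint Resolve measurable_bracket : meas.

Lemma cmeas_bracket (r : R) : cmeas (fun x => (bracket r x)%:C).
exact: cmeas_real (measurable_bracket r). Qed.
Hint Resolve cmeas_bracket : meas.

Definition inW (r : R) a := L2 (fun x => (bracket r x)%:C * a x).
Definition wt (r : R) a : Lsq R := cls (fun x => (bracket r x)%:C * a x).
Lemma wt_ae r a : inW r a -> {ae mu, forall x, wt r a x = (bracket r x)%:C * a x}.
exact: cls_ae. Qed.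

Lemma inW_cmeas r a : cmeas (fun x => (bracket r x)%:C * a x).
by apply: cmeasM => //; exact: cmeas_bracket. Qed.
Hint Resolve inW_cmeas : meas.

Lemma inW_le r r' a : r' <= r -> inW r a -> inW r' a /\ nrm (wt r' a) <= nrm (wt r a).
move=> rr' h; have le x : bracket r' x <= bracket r x.
 by rewrite /bracket; apply: ler_powR; rewrite ?lerDl ?dot_ge0// ler_pM2r.
have h' : inW r' a.
 apply: (L2_le_ae (h := wt r a) (inW_cmeas _ _)); apply: filterS (wt_ae h) => x ->.
 by rewrite !cmodM !cmod_real !gtr0_norm ?bracket_gt0// ler_wpM2r ?cmod_ge0.
split => //; apply: nrm_le_ae; apply: filterS2 (wt_ae h) (wt_ae h') => x -> ->.
by rewrite !cmodM !cmod_real !gtr0_norm ?bracket_gt0// ler_wpM2r ?cmod_ge0.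
Qed.

Lemma inW0 a : inW 0 a /\ wt 0 a = a.
have e : (fun x => (bracket 0 x)%:C * a x) = a by apply/funext => x; rewrite bracket0 mul1r.
by rewrite /inW /wt e cls_fn; split => //; exact: fn_L2.
Qed.

Lemma inWD r a b : inW r a -> inW r b -> inW r (a + b) /\ wt r (a + b) = wt r a + wt r b.
move=> h1 h2; have h : inW r (a + b).
 apply: (@L2_ae _ (fun x => (bracket r x)%:C * a x + (bracket r x)%:C * b x)) (inW_cmeas _ _) (L2D h1 h2).
 by apply: filterS (fnD a b) => x ->; rewrite mulrDr.
split=> //; apply: Lsq_ext.
apply: filterS2 (wt_ae h) (filterI (wt_ae h1) (filterI (wt_ae h2) (filterI (fnD a b) (fnD (wt r a) (wt r b))))) => x -> [h3 [h4 [-> ->]]].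
by rewrite h3 h4 mulrDr.
Qed.

Lemma inWZ r k a : inW r a -> inW r (k *: a) /\ wt r (k *: a) = k *: wt r a.
move=> h1; have h : inW r (k *: a).
 apply: (@L2_ae _ (fun x => k * ((bracket r x)%:C * a x))) (inW_cmeas _ _) (L2Z k h1).
 by apply: filterS (fnZ k a) => x ->; rewrite mulrCA.
split=> //; apply: Lsq_ext.
apply: filterS2 (wt_ae h) (filterI (wt_ae h1) (filterI (fnZ k a) (fnZ k (wt r a)))) => x -> [h3 [-> ->]].
by rewrite h3 mulrCA.
Qed.

Lemma inWB r a b : inW r a -> inW r b -> inW r (a - b) /\ wt r (a - b) = wt r a - wt r b.
move=> h1 h2; have [h3 h4] := inWZ (-1) h2; have := inWD h1 h3.
by rewrite h4 !scaleN1r.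
Qed.

Lemma nrm_sqr_int (a : Lsq R) f : L2 f -> {ae mu, forall x, a x = f x} ->
 ((nrm a ^+ 2)%:E = \int[mu]_x (cmod (f x) ^+ 2)%:E)%E.
move=> /L2P[mf _] h; rewrite nrm_sqrE; apply: ae_eq_integral => //.
- by meas.
- by meas.
- by apply: filterS h => x -> _.
Qed.

(** [Pd k] multiplies by - c2 (dot k x), and [Td], a second difference in position, becomes [Pd]
    after the Fourier transform; one device thus measures the weights on both sides. *)
Definition Pd (k : plane R) a : Lsq R := gt2 (fun x => dot k x) (0, 0) a.
Definition Td (v : plane R) a : Lsq R := gt2 (fun=> 0) v a.
Lemma cis_c2 (t : R) : cis t + cis (- t) - (1 + 1) = - (c2 t)%:C.
by apply: complex_eq; rewrite /c2 /cis ?cosN ?sinN /=; ring. Qed.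

Lemma Pd_ae k a : {ae mu, forall x, Pd k a x = - (c2 (dot k x))%:C * a x}.
have mk := measurable_lin k; have z : vscale (-1) (0, 0) = (0, 0) :> plane R by rewrite /vscale /= mulr0.
have e : gtV (fun x => dot k x) (0, 0) a = phase (fun x => - dot k x) a by rewrite /gtV z trans0.
have e' : gt (fun x => dot k x) (0, 0) a = phase (fun x => dot k x) a by rewrite /gt trans0.
rewrite /Pd /gt2 e e'.
apply: filterS2 (fnB (phase (fun x => dot k x) a + phase (fun x => - dot k x) a) (a + a)) (filterI (fnD a a)
 (filterI (fnD (phase (fun x => dot k x) a) (phase (fun x => - dot k x) a)) (filterI (phase_ae a mk) (phase_ae a (measurable_funN mk))))) => x -> [-> [-> [-> ->]]].
by rewrite -cis_c2; ring.
Qed.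

Lemma trans_gtV0 v a : gtV (fun=> 0) v a = trans (vscale (-1) v) a.
by rewrite /gtV (_ : (fun=> - 0) = fun=> 0) ?phase0//; apply/funext => x; rewrite oppr0. Qed.
Lemma trans_gt0 v a : gt (fun=> 0) v a = trans v a.
by rewrite /gt phase0. Qed.
Lemma FhatB a b : Fhat (a - b) = Fhat a - Fhat b.
by rewrite FhatD -scaleN1r FhatZ scaleN1r. Qed.

Lemma Fhat_Td v a : Fhat (Td v a) = Pd v (Fhat a).
have z : vscale (-1) (0, 0) = (0, 0) :> plane R by rewrite /vscale /= mulr0.
rewrite /Td /Pd /gt2 trans_gt0 trans_gtV0 FhatB !FhatD !Fhat_trans; congr (_ + _ - _).
 by rewrite /gt trans0.
rewrite /gtV z trans0; congr phase; apply/funext => x; rewrite /dot /vscale /=; ring.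
Qed.

Lemma nrm_Td v a : nrm (Td v a) = nrm (Pd v (Fhat a)).
by rewrite -Fhat_Td nrm_Fhat. Qed.
Lemma Td_U m t v a : Td v (U m t a) = U m t (Td v a).
by rewrite /Td /gt2 !trans_gt0 !trans_gtV0 UB !UD !U_trans. Qed.
Definition e1 : plane R := (1, 0).
Definition e2 : plane R := (0, 1).
Lemma dot_e1 (c : R) x : dot (vscale c e1) x = c * x.1.
by rewrite /dot /vscale /e1 /= mulr1 mulr0 mul0r addr0. Qed.
Lemma dot_e2 (c : R) x : dot (vscale c e2) x = c * x.2.
by rewrite /dot /vscale /e2 /= mulr1 mulr0 mul0r add0r. Qed.
Definition PP (nu : R) (k : nat) a : R :=
 nrm (Pd (vscale (nu * 2^-1 ^+ k) e1) a) ^+ 2 + nrm (Pd (vscale (nu * 2^-1 ^+ k) e2) a) ^+ 2.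

Definition cc (nu : R) (k : nat) x : R :=
 c2 (nu * 2^-1 ^+ k * x.1) ^+ 2 + c2 (nu * 2^-1 ^+ k * x.2) ^+ 2.
Definition pp (nu : R) (k : nat) x : R :=
 psi (nu * 2^-1 ^+ k * x.1) + psi (nu * 2^-1 ^+ k * x.2).

Lemma PP_ge0 nu k a : 0 <= PP nu k a.
by rewrite addr_ge0 ?sqr_ge0. Qed.
Hint Resolve PP_ge0 : core.

Lemma cc_ge0 nu k x : 0 <= cc nu k x.
by rewrite addr_ge0 ?sqr_ge0. Qed.
Hint Resolve cc_ge0 : core.

Lemma pp_ge0 nu k x : 0 <= pp nu k x.
by rewrite addr_ge0 ?psi_ge0. Qed.
Hint Resolve pp_ge0 : core.

Lemma measurable_c2 (h : plane R -> R) : mfun h -> mfun (fun x => c2 (h x)).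
move=> mh; apply: measurable_funB => //; apply: measurable_funM => //.
by apply: measurableT_comp mh; apply: continuous_measurable_fun; exact: continuous_cos.
Qed.

Lemma measurable_cx (c : R) : mfun (fun x : plane R => c * x.1).
by meas; exact: measurable_fst. Qed.
Lemma measurable_cy (c : R) : mfun (fun x : plane R => c * x.2).
by meas; exact: measurable_snd. Qed.

Lemma measurable_cc nu k : mfun (cc nu k).
apply: measurable_funD; apply: measurable_funX; apply: measurable_c2.
 exact: measurable_cx.
exact: measurable_cy.
Qed.
Hint Resolve measurable_cc : meas.

Lemma measurable_pp nu k : mfun (pp nu k).
apply: measurable_funD; apply: measurable_minr => //; apply: measurable_funX.
 exact: measurable_cx.
exact: measurable_cy.
Qed.
Hint Resolve measurable_pp : meas.

Lemma PP_int nu k a : ((PP nu k a)%:E = \int[mu]_x (cc nu k x * cmod (a x) ^+ 2)%:E)%E.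
have L (K : plane R) : ((nrm (Pd K a) ^+ 2)%:E = \int[mu]_x (c2 (dot K x) ^+ 2 * cmod (a x) ^+ 2)%:E)%E.
 rewrite nrm_sqrE; apply: ae_eq_integral => //.
 - by meas.
 - apply/measurable_EFinP; apply: measurable_funM; apply: measurable_funX.
   by apply: measurable_c2; exact: measurable_lin.
  by meas.
 - apply: filterS (Pd_ae K a) => x -> _.
  by rewrite cmodM cmodN cmod_real exprMn sqr_normr.
rewrite /PP EFinD !L -ge0_integralD//.
- by apply: eq_integral => x _; rewrite -EFinD dot_e1 dot_e2 -mulrDl.
- by pos.
- apply/measurable_EFinP; apply: measurable_funM; apply: measurable_funX.
  by apply: measurable_c2; exact: measurable_lin.
 by meas.
- by pos.
- apply/measurable_EFinP; apply: measurable_funM; apply: measurable_funX.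
  by apply: measurable_c2; exact: measurable_lin.
 by meas.
Qed.

Lemma pp_integrable nu k a : mu.-integrable setT (fun x => (pp nu k x * cmod (a x) ^+ 2)%:E).
have /L2P[ma ia] := fn_L2 a.
apply: (le_integrable measurableT _ _ (integrableZl measurableT 32 ia)).
 by meas.
move=> x _; have q0 : 0 <= cmod (a x) ^+ 2 := sqr_ge0 _; have P0 := pp_ge0 nu k x.
rewrite -EFinM !abse_EFin lee_fin (ger0_norm (mulr_ge0 P0 q0)) (ger0_norm (mulr_ge0 (ler0n R 32) q0)).
rewrite ler_wpM2r//.
have p16 z : psi z <= 16 :> R by rewrite /psi ge_min lexx.
by rewrite /pp; have := p16 (nu * 2^-1 ^+ k * x.1); have := p16 (nu * 2^-1 ^+ k * x.2); lra.
Qed.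

(** The analogue of [PP] with the monotone majorant [psi]: unlike [PP] it can be compared across
    different scales [nu]. *)
Definition QQ (nu : R) (k : nat) a : R := (\int[mu]_x (pp nu k x * cmod (a x) ^+ 2))%R.
Lemma QQ_int nu k a : ((QQ nu k a)%:E = \int[mu]_x (pp nu k x * cmod (a x) ^+ 2)%:E)%E.
by rewrite -RintE//; exact: pp_integrable. Qed.

Lemma QQ_ge0 nu k a : 0 <= QQ nu k a.
by rewrite -lee_fin QQ_int; apply: integral_ge0 => x _; rewrite lee_fin mulr_ge0 ?pp_ge0 ?sqr_ge0. Qed.
Hint Resolve QQ_ge0 : core.

Lemma PP_QQ nu nu' k a : `|nu| <= `|nu'| -> PP nu k a <= QQ nu' k a.
move=> le; rewrite -lee_fin PP_int QQ_int; apply: ge0_le_integral => //.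
- by pos.
- by meas.
- by meas.
move=> x _; rewrite lee_fin ler_wpM2r ?sqr_ge0//.
have H (y : R) : c2 (nu * 2^-1 ^+ k * y) ^+ 2 <= psi (nu' * 2^-1 ^+ k * y).
 apply: (letr (c2_psi _)); rewrite -psi_norm -[leRHS]psi_norm; apply: psi_mono => //.
 by rewrite !normrM !ler_wpM2r.
exact: lerD.
Qed.

Section Weight.
Variable s : R.
Hypothesis hs : 1 < s < 2.
Local Notation rr := (rr s).
Let s0 : 0 <= s. Proof. by case/andP: hs => h _; rewrite ltW// (lt_trans ltr01). Qed.
Let rr0 k : 0 <= rr ^+ k. Proof. by rewrite exprn_ge0// powR_ge0. Qed.

Lemma powR_add (p q : R) : 0 <= p -> 0 <= q -> (p + q) `^ s <= 2 `^ s * (p `^ s + q `^ s).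
move=> p0 q0; wlog pq : p q p0 q0 / p <= q.
 move=> H; have [/H|/ltW/H] := leP p q; first exact.
 by rewrite addrC [q `^ s + _]addrC; exact.
apply: (via ((2 * q) `^ s)); first by apply: ge0_ler_powR; rewrite ?nnegrE ?addr_ge0 ?mulr_ge0//; lra.
by rewrite powRM// ler_wpM2l// lerDr powR_ge0.
Qed.

Definition Cw (nu : R) : R := 2 `^ s * (1 + nu ^- 2) `^ s * (2 * Cl s).

Lemma Cw_ge0 nu : 0 <= Cw nu.
by rewrite /Cw !mulr_ge0 ?powR_ge0 ?Cl_ge0. Qed.
Hint Resolve Cw_ge0 : core.

(** The weight is split into its two coordinates, each handled by [dyadic_lower]; the factor with
    nu^-2 in [Cw] passes from [y] to [nu * y]. *)
Lemma bracket_dyadic nu x (K : nat) : nu != 0 -> `|nu * x.1| < 2 ^+ K -> `|nu * x.2| < 2 ^+ K ->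
 bracket s x ^+ 2 <= Cw nu * (1 + \sum_(k < K) rr ^+ k * cc nu k x).
move=> nu0 h1 h2; rewrite bracket_sqr.
have nn : 0 < nu ^+ 2 by rewrite exprn_even_gt0.
have H (y : R) : `|nu * y| < 2 ^+ K -> (1 + y ^+ 2) `^ s <=
  (1 + nu ^- 2) `^ s * (Cl s * (1 + \sum_(k < K) rr ^+ k * c2 (nu * 2^-1 ^+ k * y) ^+ 2)).
 move=> hy; apply: (via ((1 + nu ^- 2) `^ s * (1 + `|nu * y| ^+ 2) `^ s)).
  have n2 : 0 <= 1 + nu ^- 2 by pos.
  have n3 : 0 <= 1 + `|nu * y| ^+ 2 by pos.
  rewrite -(powRM _ n2 n3); apply: ge0_ler_powR; rewrite ?nnegrE ?mulr_ge0//.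
   by pos.
  rewrite sqr_normr exprMn.
  have -> : (1 + nu ^- 2) * (1 + nu ^+ 2 * y ^+ 2) = 1 + y ^+ 2 + nu ^- 2 + nu ^+ 2 * y ^+ 2 by field.
  nra.
 rewrite ler_wpM2l ?powR_ge0//; apply: (letr (dyadic_lower hs (normr_ge0 _) hy)).
 apply: eq_ler; congr (_ * (_ + _)); apply: eq_bigr => k _.
 have -> : `|nu * y| * 2^-1 ^+ k = `|nu * 2^-1 ^+ k * y|.
  by rewrite mulrAC [in RHS]normrM (ger0_norm (exprn_ge0 _ _)) ?invr_ge0.
 by rewrite c2_norm.
apply: (via (((1 + x.1 ^+ 2) + (1 + x.2 ^+ 2)) `^ s)).
 apply: ge0_ler_powR; rewrite ?nnegrE ?addr_ge0 ?sqr_ge0 ?dot_ge0//.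
 rewrite /dot -!expr2; lra.
apply: (letr (powR_add _ _)); rewrite ?addr_ge0 ?sqr_ge0//.
rewrite /Cw -!mulrA ler_wpM2l//.
apply: (letr (lerD (H _ h1) (H _ h2))); rewrite -mulrDr ler_wpM2l ?powR_ge0// -mulrDr.
rewrite mulrCA ler_wpM2l ?Cl_ge0//.
have -> : \sum_(k < K) rr ^+ k * cc nu k x = \sum_(k < K) rr ^+ k * c2 (nu * 2^-1 ^+ k * x.1) ^+ 2 +
  \sum_(k < K) rr ^+ k * c2 (nu * 2^-1 ^+ k * x.2) ^+ 2.
 by rewrite -big_split; apply: eq_bigr => k _; rewrite /cc mulrDr.
have Sge (y : R) : 0 <= \sum_(k < K) rr ^+ k * c2 (nu * 2^-1 ^+ k * y) ^+ 2.
 by apply: sumr_ge0 => k _; rewrite mulr_ge0 ?rr0 ?sqr_ge0.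
have := Sge x.1; have := Sge x.2; lra.
Qed.

Lemma weighted_sum_int (w : nat -> plane R -> R) (I_ : nat -> R) K a : (forall k x, 0 <= w k x) ->
 (forall k, mfun (w k)) -> (forall k, ((I_ k)%:E = \int[mu]_x (w k x * cmod (a x) ^+ 2)%:E)%E) ->
 ((\sum_(k < K) rr ^+ k * I_ k)%:E = \int[mu]_x ((\sum_(k < K) rr ^+ k * w k x) * cmod (a x) ^+ 2)%:E)%E.
move=> w0 mw hI; have ma : mfun (fun x => cmod (a x) ^+ 2) by meas.
elim: K => [|K IH]; first by rewrite big_ord0 integral0_eq// => x _; rewrite big_ord0 mul0r.
rewrite big_ord_recr /= EFinD IH EFinM hI -ge0_integralZl ?lee_fin//; first last.
- by pos.
- by meas.
rewrite -ge0_integralD//; first last.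
- under eq_fun do rewrite -EFinM; apply/measurable_EFinP; apply: measurable_funM => //; exact: measurable_funM.
- by move=> x _; rewrite -EFinM lee_fin mulr_ge0// mulr_ge0 ?sqr_ge0.
- by meas.
- by move=> x _; rewrite lee_fin mulr_ge0 ?sqr_ge0// sumr_ge0// => k _; rewrite mulr_ge0.
by apply: eq_integral => x _; rewrite -EFinM -EFinD big_ord_recr /=; congr EFin; ring.
Qed.

Lemma PP_sum_int nu K a : ((nrm a ^+ 2 + \sum_(k < K) rr ^+ k * PP nu k a)%:E =
 \int[mu]_x ((1 + \sum_(k < K) rr ^+ k * cc nu k x) * cmod (a x) ^+ 2)%:E)%E.
rewrite EFinD nrm_sqrE (weighted_sum_int _ (cc_ge0 nu) (measurable_cc nu) (fun k => PP_int nu k a)) -ge0_integralD//; first last.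
- by meas.
- by move=> x _; rewrite lee_fin mulr_ge0 ?sqr_ge0// sumr_ge0// => k _; rewrite mulr_ge0 ?cc_ge0.
- by meas.
- by pos.
by apply: eq_integral => x _; rewrite -EFinD mulrDl mul1r.
Qed.

Lemma W_low nu a (A : R) : nu != 0 ->
 (forall K, nrm a ^+ 2 + \sum_(k < K) rr ^+ k * PP nu k a <= A) ->
 inW s a /\ nrm (wt s a) ^+ 2 <= Cw nu * A.
move=> nu0 hA; pose Reg K : set (plane R) := [set x | `|nu * x.1| < 2 ^+ K /\ `|nu * x.2| < 2 ^+ K].
have mReg K : measurable (Reg K).
 have m (h : plane R -> R) : mfun h -> measurable [set x | `|h x| < 2 ^+ K].
  move=> mh; have mn : mfun (fun x => `|h x|) by exact: measurableT_comp mh.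
  have := mn measurableT _ (@measurable_itv R `]-oo, 2 ^+ K[); rewrite setTI; congr measurable.
 exact: measurableI (m _ (measurable_cx nu)) (m _ (measurable_cy nu)).
have B : (\int[mu]_x (cmod ((bracket s x)%:C * a x) ^+ 2)%:E <= (Cw nu * A)%:E)%E.
 apply: (@fatou_sqr _ (fun K x => ind (Reg K) x * ((bracket s x)%:C * a x))).
 - by meas.
 - by meas.
 - apply: aeW => x; apply: cvg_near_cst.
  have [N hN] : exists N, forall K, (N <= K)%N -> Reg K x.
   have [n1 hn1] := dyadic (normr_ge0 (nu * x.1)); have [n2 hn2] := dyadic (normr_ge0 (nu * x.2)).
   exists (maxn n1 n2).+1 => K hK; split; [apply: (lt_le_trans hn1.1)|apply: (lt_le_trans hn2.1)];
    rewrite ler_eXn2l ?ltr1n//; apply: leq_trans hK; rewrite ltnS ?leq_maxl ?leq_maxr//.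
  exists N => // K /= hK; rewrite /ind indicE (mem_set (hN _ hK)) mul1r subrr cmod0//.
 - move=> K; apply: (via ((Cw nu)%:E * (nrm a ^+ 2 + \sum_(k < K) rr ^+ k * PP nu k a)%:E)%E); last first.
   by rewrite -EFinM lee_fin ler_wpM2l ?Cw_ge0.
  rewrite PP_sum_int.
  have S0 x : 0 <= 1 + \sum_(k < K) rr ^+ k * cc nu k x.
   by rewrite addr_ge0// sumr_ge0// => k _; rewrite mulr_ge0 ?cc_ge0.
  have mS : mfun (fun x => 1 + \sum_(k < K) rr ^+ k * cc nu k x).
   by meas.
  have mm : mfun (fun x => ((1 + \sum_(k < K) rr ^+ k * cc nu k x) * cmod (a x) ^+ 2)%:E).
   by meas.
  rewrite -ge0_integralZl//; last 2 first.
  - by pos.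
  - by rewrite lee_fin Cw_ge0.
  apply: ge0_le_integral => //.
  - by pos.
  - by meas.
  - by under eq_fun do rewrite -EFinM; apply/measurable_EFinP; apply: measurable_funM => //; exact/measurable_EFinP.
  move=> x _; rewrite -EFinM lee_fin.
  have [hx|hx] := pselect (Reg K x); last first.
   by rewrite /ind indicE memNset// mul0r cmod0 expr0n /= mulr_ge0 ?Cw_ge0// mulr_ge0 ?sqr_ge0.
  rewrite /ind indicE mem_set// mul1r cmodM cmod_real exprMn sqr_normr [leRHS]mulrA ler_wpM2r ?sqr_ge0//.
  by case: hx => x1 x2; exact: bracket_dyadic.
have h : inW s a.
 apply/L2P; split; first exact: inW_cmeas.
 by apply/(integrable_sqrP (inW_cmeas _ _)); apply: le_lt_trans B _; rewrite ltry.
by split => //; rewrite -lee_fin (nrm_sqr_int h (wt_ae h)).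
Qed.

Definition Cup (nu : R) : R := 2 * Cu s * (1 + nu ^+ 2) `^ s.

(** The converse of [W_low], proved for the larger quantities [QQ] so that it also covers second
    differences at every scale not exceeding [nu]. *)
Lemma W_up nu K a : inW s a -> \sum_(k < K) rr ^+ k * QQ nu k a <= Cup nu * nrm (wt s a) ^+ 2.
move=> h; rewrite -lee_fin.
rewrite (weighted_sum_int _ (pp_ge0 nu) (fun k => _ : mfun (pp nu k)) (fun k => QQ_int nu k a)); last exact: measurable_pp.
have C0 : 0 <= Cup nu by rewrite /Cup mulr_ge0 ?powR_ge0// mulr_ge0 ?(Cu_ge0 hs).
rewrite EFinM (nrm_sqr_int h (wt_ae h)) -ge0_integralZl ?lee_fin//; last 2 first.
- by meas.
- by pos.
have S0 x : 0 <= \sum_(k < K) rr ^+ k * pp nu k x.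
 by rewrite sumr_ge0// => k _; rewrite mulr_ge0 ?pp_ge0.
have mS : mfun (fun x => \sum_(k < K) rr ^+ k * pp nu k x).
 by meas.
apply: ge0_le_integral => //.
- by move=> x _; rewrite lee_fin mulr_ge0 ?sqr_ge0.
- by meas.
- by under eq_fun do rewrite -EFinM; apply/measurable_EFinP; apply: measurable_funM => //; apply: measurable_funX; apply: measurable_cmod; exact: inW_cmeas.
move=> x _; rewrite -EFinM lee_fin cmodM cmod_real exprMn sqr_normr [leRHS]mulrA ler_wpM2r ?sqr_ge0//.
rewrite bracket_sqr /Cup.
have H (y : R) : y ^+ 2 <= dot x x -> \sum_(k < K) rr ^+ k * psi (nu * 2^-1 ^+ k * y) <= Cu s * ((1 + nu ^+ 2) `^ s * (1 + dot x x) `^ s).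
 move=> hy; have -> : \sum_(k < K) rr ^+ k * psi (nu * 2^-1 ^+ k * y) = \sum_(k < K) rr ^+ k * psi (`|nu * y| * 2^-1 ^+ k).
  apply: eq_bigr => k _; rewrite -psi_norm; congr (_ * psi _).
  by rewrite mulrAC [in LHS]normrM (ger0_norm (exprn_ge0 _ _)) ?invr_ge0.
 apply: (letr (dyadic_upper hs _ (normr_ge0 _))); rewrite ler_wpM2l ?Cu_ge0//.
 rewrite -powRM ?addr_ge0 ?sqr_ge0 ?dot_ge0//; apply: ge0_ler_powR; rewrite ?nnegrE ?mulr_ge0 ?addr_ge0 ?sqr_ge0 ?dot_ge0//.
 rewrite sqr_normr exprMn mulrDl mul1r mulrDr mulr1.
 nra.
have -> : \sum_(k < K) rr ^+ k * pp nu k x = \sum_(k < K) rr ^+ k * psi (nu * 2^-1 ^+ k * x.1) + \sum_(k < K) rr ^+ k * psi (nu * 2^-1 ^+ k * x.2).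
 by rewrite -big_split; apply: eq_bigr => k _; rewrite /pp mulrDr.
have h1 : x.1 ^+ 2 <= dot x x by rewrite /dot -!expr2 lerDl sqr_ge0.
have h2 : x.2 ^+ 2 <= dot x x by rewrite /dot -!expr2 lerDr sqr_ge0.
have := H _ h1; have := H _ h2; lra.
Qed.

End Weight.
End WeightedSpaces.
#[local] Hint Resolve measurable_bracket inW_cmeas measurable_cc measurable_pp cmeas_bracket : meas.
#[local] Hint Resolve bracket_gt0 PP_ge0 cc_ge0 pp_ge0 QQ_ge0 Cw_ge0 : core.

(** * Embeddings of the weighted spaces into L^1 and L^oo *)

Section Embeddings.
Context {R : realType}.
Implicit Types (a b : Lsq R) (x : plane R).

Definition sq (k : nat) : set (plane R) := box (- 2 ^+ k, - 2 ^+ k) (2 ^+ k, 2 ^+ k).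

Lemma leb2_sq k : mu (sq k) = (4 * 4 ^+ k)%:E.
rewrite /sq /box /leb2 /= product_measure1E; [|exact: measurable_itv|exact: measurable_itv].
have e : (@lebesgue_measure R) `](- 2 ^+ k), 2 ^+ k]%classic = (2 * 2 ^+ k)%:E.
 have h : - 2 ^+ k < 2 ^+ k :> R by rewrite gtrN// exprn_gt0.
 by rewrite lebesgue_measure_itv /= lte_fin h -EFinB; congr EFin; ring.
transitivity ((2 * 2 ^+ k : R)%:E * (2 * 2 ^+ k : R)%:E)%E; first by congr (_ * _)%E; exact: e.
rewrite -EFinM; congr EFin; have -> : 4 = 2 * 2 :> R by ring.
rewrite exprMn; ring.
Qed.

Lemma sqP k x : ~ sq k x -> (2 ^+ k) ^+ 2 <= dot x x.
have H (y : R) : ~ (- 2 ^+ k < y <= 2 ^+ k) -> (2 ^+ k) ^+ 2 <= y ^+ 2.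
 move=> h; rewrite -(real_normK (num_real y)); apply: sqr_le2; first by pos.
 rewrite leNgt; apply/negP => /ltr_normlP[h1 h2]; apply: h; apply/andP; split; lra.
move=> h; have [h1|h1] := pselect (- 2 ^+ k < x.1 <= 2 ^+ k).
 have : ~ (- 2 ^+ k < x.2 <= 2 ^+ k) by move=> h2; apply: h; split => /=; rewrite in_itv.
 by move=> /H; rewrite /dot -!expr2; have := sqr_ge0 x.1; lra.
by move/H: h1; rewrite /dot -!expr2; have := sqr_ge0 x.2; lra.
Qed.

Variable sg : R.
Hypothesis sg1 : 1 < sg.

Definition Csg : R := 4 `^ sg * 4 / (1 - 4 `^ (1 - sg)).
Let q : R := 4 `^ (- sg).

(** The squares [sq k] of measure 4 4^k exhaust the plane, and (1 + |x|^2)^(-sg) is at most 4^sg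
    4^(-sg k) on the shell completing the k-th square. The resulting series has ratio 4^(1 - sg),
    below 1 because sg > 1. *)
Lemma bracketN_int : L2 (fun x => (bracket (- sg) x)%:C) /\
 (\int[mu]_x (cmod (bracket (- sg) x)%:C ^+ 2)%:E <= (Csg)%:E)%E.
have mB : cmeas (fun x => (bracket (- sg) x)%:C) by meas.
have q0 : 0 < q by rewrite powR_gt0.
pose p := 4 `^ (1 - sg) : R.
have pq : p = 4 * q by rewrite /p powRD ?powRr1//; apply/implyP => _; rewrite gt_eqF.
have p0 : 0 < p by pos.
have p1 : p < 1.
 have ln4 : 0 < ln (4 : R) by apply: ln_gt0; lra.
 rewrite -[ltRHS]expR0 /p /powR gt_eqF// ltr_expR pmulr_llt0 ?subr_lt0//.
have qE k : q ^+ k = ((2 ^+ k) ^+ 2) `^ (- sg).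
 rewrite -powR_mulrn ?powR_ge0// /q powRAC powR_mulrn//; congr (_ `^ _).
 by rewrite -exprM mulnC exprM; congr (_ ^+ _); lra.
have bsq x : cmod (bracket (- sg) x)%:C ^+ 2 = (1 + dot x x) `^ (- sg).
 by rewrite cmod_real sqr_normr bracket_sqr.
have c0 k : 0 <= 4 `^ sg * q ^+ k by pos.
have pw x : ((cmod (bracket (- sg) x)%:C ^+ 2)%:E <= \sum_(k <oo) (4 `^ sg * q ^+ k * \1_(sq k) x)%:E)%E.
 have ex : exists k, `[< sq k x >].
  have [n [hn _]] := dyadic (dot_ge0 x); exists n.+1; apply/asboolP; apply: contrapT => hN; have h := sqP hN.
  have h2 : 1 <= (2 : R) ^+ n.+1 by rewrite exprn_ege1// ler1n.
  have h3 : (2 : R) ^+ n.+1 <= (2 ^+ n.+1) ^+ 2 by rewrite expr2 ler_peMl// (letr ler01).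
  by have := le_lt_trans (letr h3 h) hn; rewrite ltxx.
 have [n /asboolP hn hmin] := ex_minnP ex.
 have t0 k : (0 <= (4 `^ sg * q ^+ k * (\1_(sq k) x : R))%:E)%E by pos.
 apply: (letr _ (nneseries_lim_ge n.+1 (fun k _ _ => t0 k))).
 rewrite big_nat_recr//=; have -> : \1_(sq n) x = 1 :> R by rewrite indicE mem_set.
 rewrite mulr1; apply: lee_paddl; first by apply: sume_ge0.
 rewrite lee_fin bsq.
 case: n hn hmin => [|n] hn hmin.
  rewrite expr0 mulr1; apply: (via 1).
   by rewrite -[leRHS](powRr0 (1 + dot x x)); apply: ler_powR; [by rewrite lerDl dot_ge0|rewrite oppr_le0; exact: ltW (lt_trans ltr01 sg1)].
  by rewrite -[leLHS](powRr0 4); apply: ler_powR; [lra|exact: ltW (lt_trans ltr01 sg1)].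
 have /sqP h : ~ sq n x by move=> /asboolP /hmin; rewrite ltnn.
 have -> : 4 `^ sg * q ^+ n.+1 = q ^+ n.
  by rewrite exprS mulrA /q -powRD ?subrr ?powRr0 ?mul1r//; apply/implyP => _; rewrite gt_eqF.
 rewrite qE !powRN lef_pV2 ?posrE ?powR_gt0 ?ltr_pwDl ?dot_ge0//.
 have d0 := dot_ge0 x; apply: ge0_ler_powR; rewrite ?nnegrE ?addr_ge0 ?sqr_ge0 ?dot_ge0//.
  exact: ltW (lt_trans ltr01 sg1).
 lra.
have mI k : mfun (fun x => (4 `^ sg * q ^+ k * \1_(sq k) x)%:E).
 by apply/measurable_EFinP; apply: measurable_funM => //; apply: measurable_indicR; exact: measurable_box.
have B : (\int[mu]_x (cmod (bracket (- sg) x)%:C ^+ 2)%:E <= (Csg)%:E)%E.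
 apply: (via (\int[mu]_x \sum_(k <oo) (4 `^ sg * q ^+ k * \1_(sq k) x)%:E)%E).
  apply: ge0_le_integral => //; try by pos.
  - by meas.
  - by apply: ge0_emeasurable_sum => // k x _ _; rewrite lee_fin mulr_ge0.
 rewrite integral_nneseries//; last by move=> k x _; rewrite lee_fin mulr_ge0.
 have E k : (\int[mu]_x (4 `^ sg * q ^+ k * \1_(sq k) x)%:E = (4 `^ sg * 4 * p ^+ k)%:E)%E.
  under eq_integral do rewrite EFinM; rewrite ge0_integralZl ?lee_fin//; first last.
  - by apply/measurable_EFinP; apply: measurable_indicR; exact: measurable_box.
  rewrite integral_indic ?setIT//; last exact: measurable_box.
  by rewrite [X in (_ * X)%E](leb2_sq k) -EFinM pq exprMn; congr EFin; ring.
 under eq_eseriesr do rewrite E.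
 apply: lime_le; first by apply: is_cvg_nneseries => k _ _; pos.
 apply: nearW => n; rewrite sumEFin lee_fin -mulr_sumr big_mkord /Csg -/p; ml; have G k : \sum_(i < k) p ^+ i = (1 - p ^+ k) / (1 - p).
  elim: k => [|k IH]; first by rewrite big_ord0 expr0 subrr mul0r.
  by rewrite big_ord_recr /= IH exprS; field; lra.
 rewrite G -[leRHS]mul1r ler_pM2r ?invr_gt0; last lra.
 by have := exprn_ge0 n (ltW p0); lra.
split => //; apply/L2P; split => //; apply/(integrable_sqrP mB); apply: le_lt_trans B _; exact: ltry.
Qed.

(** Cauchy-Schwarz against the square-integrable weight of exponent - [sg]. *)
Lemma inW_int a : inW sg a -> cint1 mu a /\
 (\int[mu]_x cmod (a x))%R <= sqrt Csg * nrm (wt sg a).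
move=> h; have [b2 bi] := bracketN_int.
have bK x : bracket (- sg) x * bracket sg x = 1 by rewrite -bracketD addNr bracket0.
have i1 : cint1 mu a.
 have := L2_cint1M b2 h; congr (cint1 _ _); apply/funext => x.
 by rewrite mulrA -realcM bK mul1r.
split => //.
pose w := cls (fun x => (bracket (- sg) x)%:C).
have wle : nrm w <= sqrt Csg.
 rewrite -(ger0_norm (nrm_ge0 w)) -sqrtr_sqr ler_wsqrtr// -lee_fin.
 by rewrite (nrm_sqr_int b2 (cls_ae b2)).
have -> : (\int[mu]_x cmod (a x) = ip w (absL (wt sg a)))%R.
 have e : {ae mu, forall x, cmod (a x) = Re (w x * conjc (absL (wt sg a) x))}.
  apply: filterS2 (cls_ae b2) (filterI (absL_ae (wt sg a)) (wt_ae h)) => x h1 [h2 h3].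
  rewrite h1 h2 h3 conjc_real -realcM /= cmodM cmod_real gtr0_norm ?bracket_gt0//.
  by rewrite mulrA bK mul1r.
 rewrite ipE /= /Rintegral; congr fine; apply: ae_eq_integral => //.
 - by apply/measurable_EFinP; exact: measurable_cmod (fn_cmeas a).
 - by have [/measurable_int] := ip_cint1 w (absL (wt sg a)).
 - by apply: filterS e => x -> _.
apply: (letr (ip_CS _ _)); rewrite nrm_absL; apply: ler_wpM2r => //; exact: nrm_ge0.
Qed.

Lemma Linf_embedding a : inW sg (Fhat a) ->
 Linf ((2 * pi)^-1 * (sqrt Csg * nrm (wt sg (Fhat a)))) a.
move=> h; have [i1 le] := inW_int h.
have e : a = cls (fh 1 (Fhat a)).
 by rewrite -[LHS]FhatK /Finv -[in LHS](cls_fn (Fhat a)) FT_fh//; [rewrite expr1n|exact: fn_L2].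
have L : L2 (fh 1 (Fhat a)) by apply: fh_L2 => //; [rewrite expr1n|exact: fn_L2].
rewrite [X in Linf _ X]e; apply: filterS (cls_ae L) => x ->.
apply: (letr (fh_le 1 x i1)); by rewrite ler_wpM2l// invr_ge0 ltW// pi2_gt0.
Qed.

End Embeddings.

(** * The kernel of the free evolution and its factorisation *)

Section FreeKernel.
Context {R : realType}.
Implicit Types (g : Lsq R) (x y : plane R) (m t : R).

Lemma cvg_rect (u v : nat -> R) (p q : R) : u @ \oo --> p -> v @ \oo --> q ->
 (fun n => cmod ((u n +i* v n) - (p +i* q))) @ \oo --> (0 : R).
by move=> hu hv; exact: (@cvg_cmod R (fun n => u n +i* v n) (p +i* q)). Qed.

Lemma cvg_polar (u v : nat -> R) (p q : R) : u @ \oo --> p -> v @ \oo --> q ->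
 (fun n => expR (u n) * cos (v n)) @ \oo --> expR p * cos q /\
 (fun n => expR (u n) * sin (v n)) @ \oo --> expR p * sin q.
move=> hu hv.
have e1 : (fun n => expR (u n)) @ \oo --> expR p by apply: continuous_cvg => //; exact: continuous_expR.
have e2 : (fun n => cos (v n)) @ \oo --> cos q by apply: continuous_cvg => //; exact: continuous_cos.
have e3 : (fun n => sin (v n)) @ \oo --> sin q by apply: continuous_cvg => //; exact: continuous_sin.
by split; apply: cvgM.
Qed.

Lemma cvg_cexp (u v : nat -> R) (p q : R) : u @ \oo --> p -> v @ \oo --> q ->
 (fun n => cmod (cexp (u n +i* v n) - cexp (p +i* q))) @ \oo --> (0 : R).
move=> hu hv; have [h1 h2] := cvg_polar hu hv.
have e (a b : R) : cexp (a +i* b) = (expR a * cos b) +i* (expR a * sin b).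
 by apply: complex_eq; rewrite /cexp ?ReM ?ImM /=; ring.
under eq_fun do rewrite !e; exact: cvg_rect.
Qed.

Lemma cvg_cmodM (z w : nat -> R[i]) (a b : R[i]) :
 (fun n => cmod (z n - a)) @ \oo --> (0 : R) -> (fun n => cmod (w n - b)) @ \oo --> (0 : R) ->
 (fun n => cmod (z n * w n - a * b)) @ \oo --> (0 : R).
move=> hz hw.
have H : (fun n => cmod (z n - a) * cmod (w n - b) + cmod (z n - a) * cmod b + cmod a * cmod (w n - b)) @ \oo --> (0 : R).
 rewrite -[X in _ --> X](_ : 0 * 0 + 0 * cmod b + cmod a * 0 = 0 :> R); last by rewrite !mul0r mulr0 !addr0.
 by apply: cvgD; [apply: cvgD; [exact: cvgM|apply: cvgM => //; exact: cvg_cst]|apply: cvgM => //; exact: cvg_cst].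
apply: squeeze_cvgr H; last exact: cvg_cst.
apply: nearW => n; rewrite cmod_ge0 /=.
have -> : z n * w n - a * b = (z n - a) * (w n - b) + (z n - a) * b + a * (w n - b) by ring.
apply: (letr (cmodD _ _)); rewrite cmodM lerD2r; apply: (letr (cmodD _ _)).
by rewrite !cmodM.
Qed.

Lemma cvg_harm : (fun n : nat => (n.+1%:R^-1 : R)) @ \oo --> (0 : R).
exact: cvg_harmonic. Qed.

Section Kernel.
Variables (m t : R).
Hypotheses (m0 : m != 0) (t0 : 0 < t).

Let q0 : R := t / (2 * m).
Let r2 : R := `|q0| / 2.
Let sg : R := Num.sg m.

Let q00 : q0 != 0. Proof. by rewrite mulf_neq0 ?invr_neq0 ?mulf_neq0// gt_eqF. Qed.
Let r20 : 0 < r2. Proof. by rewrite divr_gt0 ?normr_gt0. Qed.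
Let sg2 : sg ^+ 2 = 1. Proof. by rewrite /sg sqr_sg m0. Qed.
Let sgq : sg * r2 * 2 = q0.
rewrite /r2 -mulrA divfK// /sg.
have -> : Num.sg m = Num.sg q0.
 by rewrite /q0 sgrM (gtr0_sg t0) mul1r sgrV sgrM (gtr0_sg (_ : 0 < 2)) ?mul1r.
by rewrite -numEsg.
Qed.

(* [a_n ^ 2] tends to [i t / (2 m)] inside the region where the Gaussian of
  parameter [a_n] is integrable. *)
Let an (n : nat) : R[i] := (sqrt r2)%:C * ((1 + n.+1%:R^-1) +i* sg).
Let pn (n : nat) : R := r2 * ((1 + n.+1%:R^-1) ^+ 2 - 1).
Let qn (n : nat) : R := q0 * (1 + n.+1%:R^-1).

Let an_adm n : `|Im (an n)| < Re (an n).
have s0 : 0 < sqrt r2 by rewrite sqrtr_gt0.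
have i0 : 0 < n.+1%:R^-1 :> R by pos.
rewrite /an ImM ReM /= !mul0r addr0 subr0 normrM (gtr0_norm s0) ltr_pM2l//.
by rewrite /sg normr_sg m0 ltrDl.
Qed.

Let an_sqr n : an n ^+ 2 = pn n +i* qn n.
have -> : an n ^+ 2 = r2%:C * ((1 + n.+1%:R^-1) +i* sg) ^+ 2.
 by rewrite /an exprMn -rmorphXn /= sqr_sqrtr ?ltW.
have e1 := sg2; have e2 := sgq; rewrite expr2; apply: complex_eq; rewrite ?ReM ?ImM /= /pn /qn -?e2; last by ring.
by rewrite -[X in _ = r2 * (_ - X)]e1; ring.
Qed.

Let pn0 n : 0 <= pn n.
have i0 : 0 < n.+1%:R^-1 :> R by pos.
rewrite /pn; apply: mulr_ge0; first exact: ltW r20.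
by move: (n.+1%:R^-1 : R) i0 => z z0; rewrite subr_ge0; nra.
Qed.

Let cvg_pn : pn @ \oo --> (0 : R).
rewrite -[X in _ --> X](_ : r2 * ((1 + 0) * (1 + 0) - 1) = 0); last by rewrite addr0 mul1r subrr mulr0.
have c1 : (fun n : nat => 1 + (n.+1%:R^-1 : R)) @ \oo --> (1 + 0 : R) by apply: cvgD; [exact: cvg_cst|exact: cvg_harm].
apply: cvgM; first exact: cvg_cst.
by apply: cvgB; [under eq_fun do rewrite expr2; exact: cvgM|exact: cvg_cst].
Qed.

Let cvg_qn : qn @ \oo --> q0.
rewrite -[X in _ --> X](_ : q0 * (1 + 0) = q0); last by rewrite addr0 mulr1.
apply: cvgM; first exact: cvg_cst.
by apply: cvgD; [exact: cvg_cst|exact: cvg_harm].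
Qed.

Let qn_ge n : `|q0| <= `|qn n|.
have i0 : 0 < n.+1%:R^-1 :> R by pos.
rewrite /qn [leRHS]normrM ler_peMr// ger0_norm ?lerDl ?addr_ge0//; by [].
Qed.

Let qn0 n : qn n != 0.
by rewrite -normr_gt0 (lt_le_trans _ (qn_ge n))// normr_gt0. Qed.

Let gau_lim x (z : R[i]) : (fun n => cmod (gau (an n) x * z - cis (symb m t x) * z)) @ \oo --> (0 : R).
apply: cvg_cmodM; last by rewrite subrr cmod0; exact: cvg_cst.
have e n : gau (an n) x = cexp ((- pn n * dot x x) +i* (- qn n * dot x x)).
 by rewrite /gau an_sqr; congr cexp; apply: complex_eq; rewrite ?ReM ?ImM ?ReN ?ImN /=; ring.
have e' : cis (symb m t x) = cexp ((- 0 * dot x x) +i* (- q0 * dot x x)).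
 by rewrite /cexp /= oppr0 mul0r expR0 mul1r /symb -/q0 mulNr.
under eq_fun do rewrite e e'.
by apply: cvg_cexp; (apply: cvgM; last exact: cvg_cst); apply: cvgN.
Qed.

(** The Schrödinger kernel m/(i t) exp(i m |x|^2 / (2 t)), without its factor 1/(2 pi). *)
Definition free_kernel x : R[i] := (0 +i* - (m / t)) * cis (m / (2 * t) * dot x x).
Let kn n : R := pn n / (pn n ^+ 2 + qn n ^+ 2).
Let ln n : R := - qn n / (pn n ^+ 2 + qn n ^+ 2).
Let den0 n : 0 < pn n ^+ 2 + qn n ^+ 2.
by rewrite ltr_wpDl ?sqr_ge0// exprn_even_gt0//= qn0. Qed.

Let an_inv n : (an n ^+ 2)^-1 = kn n +i* ln n.
have h : (pn n +i* qn n) * (kn n +i* ln n) = 1.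
 have := lt0r_neq0 (den0 n); rewrite /kn /ln; move: (pn n) (qn n) => P Q PQ.
 by apply: complex_eq; rewrite ?ReM ?ImM /=; field; rewrite ?PQ.
have nz : pn n +i* qn n != 0.
 apply/eqP => z; move: h; rewrite z mul0r => /eqP; rewrite eq_sym oner_eq0//.
by rewrite an_sqr -[LHS]mulr1 -h mulrA mulVf// mul1r.
Qed.

Let cvg_den : (fun n => (pn n ^+ 2 + qn n ^+ 2)^-1) @ \oo --> (q0 ^+ 2)^-1.
apply: cvgV; first by rewrite expf_neq0.
rewrite -[X in _ --> X](_ : 0 * 0 + q0 * q0 = q0 ^+ 2); last by rewrite mul0r add0r.
by apply: cvgD; [under eq_fun do rewrite expr2; apply: cvgM|under eq_fun do rewrite expr2; apply: cvgM].
Qed.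

Let cvg_kn : kn @ \oo --> (0 : R).
by rewrite -[X in _ --> X](mul0r (q0 ^+ 2)^-1); rewrite /kn; apply: cvgM; [exact: cvg_pn|exact: cvg_den]. Qed.

Let cvg_ln : ln @ \oo --> - q0^-1.
rewrite -[X in _ --> X](_ : - q0 * (q0 ^+ 2)^-1 = - q0^-1); last by field.
by rewrite /ln; apply: cvgM; [apply: cvgN; exact: cvg_qn|exact: cvg_den].
Qed.

Let gker_form n x : gker (an n) x = (2^-1)%:C * (kn n +i* ln n) * cexp ((- kn n * (dot x x / 4)) +i* (- ln n * (dot x x / 4))).
have c2 : (2%:R : R[i])^-1 = (2^-1)%:C by rewrite (fmorphV (real_complex R)) rmorph_nat.
have c4 : (4%:R : R[i])^-1 = (4^-1)%:C by rewrite (fmorphV (real_complex R)) rmorph_nat.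
rewrite /gker invfM an_inv c2; congr (_ * cexp _); rewrite invfM an_inv c4.
by apply: complex_eq; rewrite ?ReM ?ImM ?ReN ?ImN /=; ring.
Qed.

Let gker_lim x (z : R[i]) : (fun n => cmod (z * gker (an n) x - z * free_kernel x)) @ \oo --> (0 : R).
apply: cvg_cmodM; first by rewrite subrr cmod0; exact: cvg_cst.
have e' : free_kernel x = (2^-1)%:C * (0 +i* - q0^-1) * cexp ((- 0 * (dot x x / 4)) +i* (- - q0^-1 * (dot x x / 4))).
 rewrite /free_kernel /cexp /= oppr0 mul0r expR0 mul1r; congr (_ * cis _).
  apply: complex_eq; rewrite ?ReM ?ImM /= /q0; field; by rewrite ?m0 ?gt_eqF.
 rewrite /q0; field; by rewrite ?m0 ?gt_eqF.
under eq_fun do rewrite gker_form e'.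
apply: cvg_cmodM.
 apply: cvg_cmodM; first by rewrite subrr cmod0; exact: cvg_cst.
 exact: cvg_rect.
by apply: cvg_cexp; (apply: cvgM; last exact: cvg_cst); apply: cvgN.
Qed.

Let kn0 n : 0 <= kn n.
by rewrite /kn; apply: divr_ge0; [exact: pn0|exact: ltW (den0 n)]. Qed.

Let ln_le n : cmod (kn n +i* ln n) <= `|q0|^-1.
rewrite -an_inv cmodV an_sqr lef_pV2 ?posrE ?normr_gt0//; last first.
 apply: lt_le_trans (Im_le_cmod _); by rewrite /= normr_gt0.
by apply: (letr (qn_ge n)); exact: (Im_le_cmod (pn n +i* qn n)).
Qed.

Let gker_le n x : cmod (gker (an n) x) <= `|q0|^-1.
rewrite gker_form cmodM cmod_cexp cmodM cmod_real ger0_norm//.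
rewrite [Re _]/=.
have h := ln_le n; have h0 := cmod_ge0 (kn n +i* ln n).
have e1 : expR (- kn n * (dot x x / 4)) <= 1.
 by rewrite -expR0 ler_expR mulNr oppr_le0 mulr_ge0// divr_ge0 ?dot_ge0.
nra.
Qed.

Let cmeas_gker n x : cmeas (fun y => gker (an n) (diff y x)).
rewrite /gker; apply: cmeasM; first exact: cmeas_cst.
apply: cmeas_cexp; apply: cmeasM; last exact: cmeas_cst.
apply: cmeasN; apply: cmeas_real.
exact: (measurableT_comp (@measurable_sqnorm R) (let: And3 h _ _ := leb2_shift (- x.1, - x.2) in h)).
Qed.

Let cmeas_fk x : cmeas (fun y => free_kernel (diff y x)).
apply: cmeasM; first exact: cmeas_cst.
apply: cmeas_cis; apply: measurable_funM => //.
exact: (measurableT_comp (@measurable_sqnorm R) (let: And3 h _ _ := leb2_shift (- x.1, - x.2) in h)).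
Qed.

Let cmod_fk y : cmod (free_kernel y) = `|m / t|.
by rewrite /free_kernel cmodM cmod_cis mulr1 cmod_im normrN. Qed.

(** Limit of the mollification formula along the parameters [an n]. On the Fourier side the factors
    have modulus at most 1 and tend to the symbol of the evolution; in space the kernels are bounded
    by 1/|q0| and tend to [free_kernel]. Dominated convergence applies on both sides. *)
Lemma U_kernel g : cint1 mu g ->
 {ae mu, forall x, U m t g x = ((2 * pi)^-1)%:C * CI mu (fun y => g y * free_kernel (diff y x))}.
move=> gi; have s1 : (-1 : R) ^+ 2 = 1 by rewrite sqrrN expr1n.
have s1' : (- - 1 : R) ^+ 2 = 1 by rewrite opprK expr1n.
pose F := fh (-1) g; have F2 : L2 F by exact: fh_L2 s1 gi (fn_L2 g).
pose G n (xi : plane R) := gau (an n) xi * F xi.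
have gle n xi : cmod (gau (an n) xi) <= 1 by exact: gau_le1 (an_adm n).
have G2 n : L2 (G n) by apply: (L2Mb (cmeas_gau _) (gle n) F2).
have Gi n : cint1 mu (G n).
 have := @cint1_bM _ F (gau (an n)) _ (fh_cmeas (-1) gi) (fun xi => fh_le (-1) xi gi) (gau_cint1 (an_adm n)).
 by congr (cint1 _ _); apply/funext => xi; rewrite /G mulrC.
have ms := measurable_symb m t.
have S2 : L2 (fun xi => cis (symb m t xi) * F xi).
 by apply: (L2Mb (cmeas_cis ms) _ F2) => x; rewrite cmod_cis.
have cG : cvgL2 (fun n => cls (G n)) (cls (fun xi => cis (symb m t xi) * F xi)).
 have /L2P[mF iF] := F2.
 apply: (nrm_cls_cvg0 G2 S2 (integrableZl measurableT 4 iF)) => [n x|].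
  rewrite -mulrBl cmodM exprMn ler_wpM2r ?sqr_ge0//.
  have -> : 4 = 2 ^+ 2 :> R by ring.
  apply: sqr_le2; rewrite//; apply: (letr (cmodB _ _)).
  by rewrite cmod_cis; have := gle n x; lra.
 by apply: aeW => x; exact: gau_lim.
have ph : cls (fun xi => cis (symb m t xi) * F xi) = phase (symb m t) (Fhat g).
 apply: cls_eqP => //; have -> : Fhat g = cls F by rewrite /Fhat -[in LHS](cls_fn g) FT_fh//; exact: fn_L2.
 by apply: filterS2 (phase_ae (cls F) ms) (cls_ae F2) => x -> ->.
have lip (u v : Lsq R) : nrm (FT (- - 1) u - FT (- - 1) v) <= 1 * nrm (u - v) by rewrite mul1r -(FTB s1'); exact: (FT_contr s1').
have := cvgL2_lip lip cG; rewrite ph.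
under [X in cvgL2 X]eq_fun do rewrite (FT_fh s1' (Gi _) (G2 _)).
have -> : FT (- - 1) (phase (symb m t) (Fhat g)) = U m t g by rewrite /U /Finv opprK.
move=> H; apply: (cvgL2_ae_eq H).
 apply: cmeasM; first exact: cmeas_cst.
 apply: (cmeas_param (k := fun z => g z.2 * free_kernel (diff z.2 z.1))).
  apply: cmeasM; first exact: cmeas_comp (fn_cmeas g) measurable_snd.
  rewrite /free_kernel; apply: cmeasM; first exact: cmeas_cst.
  by apply: cmeas_cis; apply: measurable_funM => //; exact: measurable_dot_diff.
 move=> x; have := @cint1_bM _ (fun y => free_kernel (diff y x)) g `|m / t| (cmeas_fk x) _ gi.
 by move=> /(_ (fun y => eq_ler (cmod_fk _))); congr (cint1 _ _); apply/funext => y; exact: mulrC.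
have K : {ae mu, forall x, forall n, cls (fh (- - 1) (G n)) x = fh (- - 1) (G n) x}.
 by apply/ae_foralln => n; apply: cls_ae; exact: fh_L2.
apply: filterS K => x hK.
have E n : cmod (cls (fh (- - 1) (G n)) x - ((2 * pi)^-1)%:C * CI mu (fun y => g y * free_kernel (diff y x))) =
  (2 * pi)^-1 * cmod (CI mu (fun y => g y * gker (an n) (diff y x)) - CI mu (fun y => g y * free_kernel (diff y x))).
 by rewrite hK /G (fh_mollify x s1 (an_adm n) gi) -mulrBr cmodM cmod_pi2.
rewrite (funext E) -[X in _ --> X](mulr0 ((2 * pi)^-1)); apply: cvgM; first exact: cvg_cst.
have dom : mu.-integrable setT (fun y => (`|q0|^-1 * cmod (g y))%:E).
 by under eq_fun do rewrite EFinM; apply: integrableZl => //; exact: cint1_cmod.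
have mfk : cmeas (fun y => g y * free_kernel (diff y x)) by apply: cmeasM.
apply: (CI_dct _ mfk _ dom).
- by meas.
- by apply: aeW => y; exact: gker_lim.
- by move=> n y; rewrite cmodM mulrC ler_wpM2r ?cmod_ge0// gker_le.
- move=> y; rewrite cmodM mulrC ler_wpM2r ?cmod_ge0//.
 rewrite cmod_fk.
 rewrite -normfV.
 have -> : q0^-1 = 2 * (m / t) by rewrite /q0; field; rewrite m0 gt_eqF.
 by rewrite [leRHS]normrM (ger0_norm (_ : 0 <= 2))// ler_peMl// ler1n.
Qed.

Definition chirp (k : R) x : R := k * dot x x.

(* The factorisation [U(t) = M D F M]. *)
Lemma U_factor g : cint1 mu g ->
 {ae mu, forall y, U m t g (dilate t y) =
  cis (chirp (m * t / 2) y) * (0 +i* - (m / t)) *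
  fh (-1) (fun w => cis (chirp (m / (2 * t)) w) * g w) (vscale m y)}.
move=> gi; have [k k0 hd] := leb2_dilate t0.
apply: filterS (scales_ae hd (U_kernel gi)) => y ->.
rewrite /fh mulrCA; congr (_ * _).
have mch : cmeas (fun w => cis (chirp (m / (2 * t)) w)).
 by apply: cmeas_cis; apply: measurable_funM => //; exact: measurable_sqnorm.
have ci : cint1 mu (fun w => cis (chirp (m / (2 * t)) w) * g w).
 by apply: (cint1_bM mch _ gi (B := 1)) => w; rewrite cmod_cis.
have ci2 := cint1_cisM (-1) (vscale m y) ci.
rewrite -CIZ//; apply: eq_CI => w.
have -> : free_kernel (diff w (dilate t y)) = (0 +i* - (m / t)) * (cis (chirp (m * t / 2) y) * (cis (- 1 * dot w (vscale m y)) * cis (chirp (m / (2 * t)) w))).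
 rewrite /free_kernel -!cisD; congr (_ * cis _); rewrite /chirp /dot /diff /dilate /vscale /=; field; by rewrite gt_eqF.
ring.
Qed.

End Kernel.

End FreeKernel.

(** * Second differences of the interaction term *)

Section Interaction.
Context {R : realType}.
Variables (lam nu : 'I_3 -> R[i]) (m : 'I_3 -> R).
Hypothesis hm : m i1 + m i2 = m i3.
Hypothesis hm0 : forall j, m j != 0.
Implicit Types (g w : 'I_3 -> Lsq R) (L t : R) (a b : Lsq R).
Local Notation KF := (KF lam nu).
Local Notation FL := (FL lam nu).

Definition NL t g (j : 'I_3) : Lsq R := U (m j) (- t) (FL (fun l => U (m l) t (g l)) j).

Definition bdd L t g := forall l, Linf L (U (m l) t (g l)).

Inductive sidx := S0 | ST of plane R | SP of plane R.

(* Second differences in position ([ST]) and in frequency ([SP]); the latter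
  are scaled by the masses, which makes them gauge compatible. *)
Definition qop (i : sidx) (l : 'I_3) a : Lsq R :=
 match i with S0 => a | ST v => Td v a | SP k => Pd (vscale (m l) k) a end.
Definition qn i l a : R := nrm (qop i l a).
Definition qs i g : R := \sum_l qn i l (g l).

Lemma qn_ge0 i l a : 0 <= qn i l a. Proof. exact: nrm_ge0. Qed.
Hint Resolve qn_ge0 : core.
Lemma qs_ge0 i g : 0 <= qs i g. Proof. by apply: sumr_ge0 => l _; exact: qn_ge0. Qed.
Hint Resolve qs_ge0 : core.

Lemma gtZ th v k a : mfun th -> gt th v (k *: a) = k *: gt th v a.
by move=> h; rewrite /gt transZ phaseZ. Qed.
Lemma gtVZ th v k a : mfun th -> gtV th v (k *: a) = k *: gtV th v a.
by move=> h; rewrite /gtV phaseZ ?transZ//; exact: measurable_funN. Qed.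
Lemma gtVD th v a b : mfun th -> gtV th v (a + b) = gtV th v a + gtV th v b.
by move=> h; rewrite /gtV phaseD ?transD//; exact: measurable_funN. Qed.
Lemma gt2Z th v k a : mfun th -> gt2 th v (k *: a) = k *: gt2 th v a.
by move=> h; rewrite /gt2 gtZ// gtVZ// scalerBr !scalerDr. Qed.

Lemma gt2D th v a b : mfun th -> gt2 th v (a + b) = gt2 th v a + gt2 th v b.
move=> h; rewrite /gt2 gtD// gtVD//.
move: (gt th v a) (gt th v b) (gtV th v a) (gtV th v b) => p q p' q'.
by rewrite (addrACA p q p' q') (addrACA a b a b) (opprD (a + a) (b + b)) (addrACA (p + p') (q + q')).
Qed.

Lemma qopD i l a b : qop i l (a + b) = qop i l a + qop i l b.
by case: i => [|v|k] //=; apply: gt2D => //; exact: measurable_lin. Qed.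
Lemma qopZ i l k a : qop i l (k *: a) = k *: qop i l a.
by case: i => [|v|z] //=; apply: gt2Z => //; exact: measurable_lin. Qed.
Lemma qnD i l a b : qn i l (a + b) <= qn i l a + qn i l b.
by rewrite /qn qopD nrmD. Qed.
Lemma qnZ i l k a : qn i l (k *: a) = cmod k * qn i l a.
by rewrite /qn qopZ nrmZ. Qed.
Definition gal (k : plane R) t (x : plane R) : R := dot k x - t / 2 * dot k k.
Lemma measurable_gal k t : mfun (gal k t).
by apply: measurable_funB => //; exact: measurable_lin. Qed.

(** Conjugated by the evolution, a frequency shift by m_l k becomes a Galilean boost whose
    translation -t k is the same for all components and whose phase is m_l times a common one. This
    is exactly the kind of symmetry that [FL_gt] accepts, and the reason for scaling frequency
    shifts by the masses. *)
Lemma U_gt l t k a : U (m l) t (gt (dot (vscale (m l) k)) (0, 0) a) =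
 gt (mth_ m (gal k t) l) (vscale (- t) k) (U (m l) t a).
rewrite /gt trans0 U_phase//; congr (phase _ (trans _ _)).
 by apply/funext => x; rewrite /mth_ /gal /dot /vscale /=; field; exact: hm0.
by rewrite /vscale /=; congr (_, _); field; exact: hm0.
Qed.

Lemma U_gtV l t k a : U (m l) t (gtV (dot (vscale (m l) k)) (0, 0) a) =
 gtV (mth_ m (gal k t) l) (vscale (- t) k) (U (m l) t a).
have mg := measurable_mth m (measurable_gal k t) l; have md := measurable_lin (vscale (m l) k).
by rewrite -[LHS](gtVK (vscale (- t) k) mg) -U_gt gtKV.
Qed.

Lemma U_Pd l t k a : U (m l) t (Pd (vscale (m l) k) a) =
 gt2 (mth_ m (gal k t) l) (vscale (- t) k) (U (m l) t a).
by rewrite /Pd /gt2 UB !UD U_gt U_gtV. Qed.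

(** All three kinds of seminorm obey the same linear bound, with no loss of regularity. With [L] of
    order 1/t this permits only a small power of t as growth. *)
Lemma NL_qn i L t g j : 0 <= L -> bdd L t g -> qn i j (NL t g j) <= 14 * KF * L * qs i g.
move=> L0 h; have KF0 := KF_ge0 lam nu; case: i => [|v|k]; rewrite /qn /NL /qs /=.
- rewrite nrm_U; apply: (letr (nrm_FL lam nu j L0 h)).
 rewrite (eq_bigr (fun l => nrm (g l)) (fun l _ => nrm_U (m l) t (g l))).
 have S0 : 0 <= \sum_l nrm (g l) by apply: sumr_ge0 => l _; exact: nrm_ge0.
 by mr; mr; mr; lra.
- rewrite Td_U nrm_U.
 have e (a : Lsq R) l : Td v a = gt2 (mth_ m (fun=> 0) l) v a.
  by rewrite /Td; congr gt2; apply/funext => x; rewrite /mth_ mulr0.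
 rewrite (e _ j); apply: (letr (FL_gt2 lam nu hm v j (measurable_cst _) L0 h)).
 by apply: eq_ler; congr (_ * _); apply: eq_bigr => l _; rewrite -e Td_U nrm_U.
- rewrite -(nrm_U (m j) t) U_Pd UNK.
 apply: (letr (FL_gt2 lam nu hm _ j (measurable_gal k t) L0 h)).
 by apply: eq_ler; congr (_ * _); apply: eq_bigr => l _; rewrite -U_Pd nrm_U.
Qed.

Lemma NL_qs i L t g : 0 <= L -> bdd L t g -> qs i (NL t g) <= 42 * KF * L * qs i g.
move=> L0 h; rewrite /qs; apply: (via (\sum_(l < 3) 14 * KF * L * qs i g)).
 by apply: ler_sum => l _; exact: NL_qn.
by rewrite sumr_const card_ord -/(qs i g) le_eqVlt; apply/orP; left; apply/eqP; ring.
Qed.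

Lemma nrm_NL_lip L t g g' j : 0 <= L -> bdd L t g -> bdd L t g' ->
 nrm (NL t g j - NL t g' j) <= 2 * KF * L * \sum_l nrm (g l - g' l).
move=> L0 h h'; rewrite -UB nrm_U; apply: (letr (nrm_FL_lip lam nu j L0 h h')).
by apply: eq_ler; congr (_ * _); apply: eq_bigr => l _; rewrite -UB nrm_U.
Qed.

End Interaction.
#[local] Hint Resolve qn_ge0 qs_ge0 : core.

(** * From second differences back to weights *)

Section Regularity.
Context {R : realType}.
Variables (m : 'I_3 -> R) (s : R).
Hypothesis hm0 : forall j, m j != 0.
Hypothesis hs : 1 < s < 2.
Implicit Types (g w : 'I_3 -> Lsq R) (L t : R) (a b : Lsq R).

Let s0 : 0 <= s. Proof. by case/andP: hs => h _; rewrite ltW// (lt_trans ltr01). Qed.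
Let rr0 k : 0 <= rr s ^+ k. Proof. by rewrite exprn_ge0// powR_ge0. Qed.
Definition inXe (X : R) g := 0 <= X /\ forall l,
 [/\ inW s (g l), inW s (Fhat (g l)), nrm (wt s (g l)) <= X & nrm (wt s (Fhat (g l))) <= X].
Lemma Cup_ge0 (nu : R) : 0 <= Cup s nu.
by rewrite /Cup mulr_ge0 ?powR_ge0// mulr_ge0 ?(Cu_ge0 hs). Qed.
Lemma sum3_sqr (F : 'I_3 -> R) : (\sum_l F l) ^+ 2 <= 3 * \sum_l F l ^+ 2.
by rewrite !sum3; have := sqr_ge0 (F i1 - F i2); have := sqr_ge0 (F i1 - F i3); have := sqr_ge0 (F i2 - F i3); lra. Qed.
Lemma nrm_wt a : inW s a -> nrm a <= nrm (wt s a).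
by move=> h; have [_] := inW_le s0 h; rewrite (inW0 a).2. Qed.
Definition Wc (nu : 'I_3 -> R) : R := 9 * (1 + \sum_l Cup s (nu l)).

(** Comparison at every dyadic level carries the weight from [b] to [a]: [W_up] sums the second
    differences of [b], and [W_low] rebuilds the weight of [a] from them. *)
Lemma weight_transfer (nu : 'I_3 -> R) (a b : 'I_3 -> Lsq R) (C X : R) :
 (forall l, nu l != 0) -> 0 <= C -> 0 <= X -> (forall l, inW s (b l) /\ nrm (wt s (b l)) <= X) ->
 \sum_l nrm (a l) <= C * \sum_l nrm (b l) ->
 (forall k (d : bool), let e := if d then e1 else e2 in
  \sum_l nrm (Pd (vscale (nu l * 2^-1 ^+ k) e) (a l)) <= C * \sum_l nrm (Pd (vscale (nu l * 2^-1 ^+ k) e) (b l))) ->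
 forall j, inW s (a j) /\ nrm (wt s (a j)) ^+ 2 <= Cw s (nu j) * (Wc nu * (C * X) ^+ 2).
move=> nu0 C0 X0 hb h0 hP j.
have key (F G : 'I_3 -> R) : (forall l, 0 <= F l) -> \sum_l F l <= C * \sum_l G l -> F j ^+ 2 <= 3 * C ^+ 2 * \sum_l G l ^+ 2.
 move=> F0 h; apply: (via ((C * \sum_l G l) ^+ 2)).
  by apply: sqr_le2 => //; apply: letr h; exact: le_sum3.
 have -> : 3 * C ^+ 2 * \sum_l G l ^+ 2 = C ^+ 2 * (3 * \sum_l G l ^+ 2) by ring.
 rewrite exprMn; ml; exact: sum3_sqr.
apply: W_low => // K; rewrite /Wc.
have a0 : nrm (a j) ^+ 2 <= 3 * C ^+ 2 * (3 * X ^+ 2).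
 apply: (letr (key (fun l => nrm (a l)) (fun l => nrm (b l)) (fun l => nrm_ge0 _) h0)).
 ml; have H l : nrm (b l) ^+ 2 <= X ^+ 2.
  by have [h1 h2] := hb l; apply: sqr_le2; [by []|apply: letr h2; exact: nrm_wt].
 by rewrite sum3; have := H i1; have := H i2; have := H i3; lra.
have aP k : PP (nu j) k (a j) <= 3 * C ^+ 2 * \sum_l PP (nu l) k (b l).
 have /= k1 := key _ _ (fun l => nrm_ge0 _) (hP k true); have /= k2 := key _ _ (fun l => nrm_ge0 _) (hP k false).
 apply: (letr (lerD k1 k2)); by rewrite -mulrDr -big_split.
have aS : \sum_(k < K) rr s ^+ k * PP (nu j) k (a j) <= 3 * C ^+ 2 * \sum_l Cup s (nu l) * X ^+ 2.
 apply: (via (\sum_(k < K) \sum_l 3 * C ^+ 2 * (rr s ^+ k * PP (nu l) k (b l)))).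
  apply: ler_sum => k _; rewrite -mulr_sumr -mulr_sumr [leRHS]mulrCA; exact: ler_wpM2l.
 rewrite exchange_big /= mulr_sumr; apply: ler_sum => l _; rewrite -mulr_sumr.
 ml; have [h1 h2] := hb l; apply: (via (\sum_(k < K) rr s ^+ k * QQ (nu l) k (b l))).
  by apply: ler_sum => k _; apply: ler_wpM2l => //; exact: PP_QQ.
 apply: (letr (W_up hs (nu l) K h1)); apply: ler_wpM2l; first exact: Cup_ge0.
 by apply: sqr_le2 => //; by [].
have S0 : 0 <= (\sum_l Cup s (nu l)) * C ^+ 2 * X ^+ 2.
 by apply: mulr_ge0; [apply: mulr_ge0; [apply: sumr_ge0 => l _; exact: Cup_ge0|exact: sqr_ge0]|exact: sqr_ge0].
move: aS; rewrite -mulr_suml exprMn; move: (\sum_l Cup s (nu l)) S0 (\sum_(k < K) _) => S S0 T hT; lra.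
Qed.

(** The summand 1 makes the constant at least 1, hence at most its own square; bounds on squared
    norms then give bounds on norms with the same constant. *)
Definition CW : R := 1 + \sum_j (Cw s (m j) + Cw s 1) * (Wc m + Wc (fun=> 1)).
Let Wc0 nu : 0 <= Wc nu.
by rewrite /Wc mulr_ge0// addr_ge0// sumr_ge0// => l _; exact: Cup_ge0. Qed.
Let CW_term j : 0 <= (Cw s (m j) + Cw s 1) * (Wc m + Wc (fun=> 1)).
by apply: mulr_ge0; apply: addr_ge0 => //; exact: Cw_ge0. Qed.
Lemma CW_ge1 : 1 <= CW.
by rewrite /CW lerDl sumr_ge0. Qed.

Lemma inXe_transfer C X g phi : 0 <= C -> inXe X phi -> (forall i, qs m i g <= C * qs m i phi) ->
 inXe (CW * (C * X)) g.
move=> C0 [X0 hX] hq; have CX0 : 0 <= C * X by pos.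
have W1 := CW_ge1; have W0 : 0 <= CW := letr ler01 W1; split; first exact: mulr_ge0.
have fin nu j (n : R) : 0 <= n -> 0 <= nu -> nu <= (Cw s (m j) + Cw s 1) * (Wc m + Wc (fun=> 1)) -> n ^+ 2 <= nu * (C * X) ^+ 2 -> n <= CW * (C * X).
 move=> n0 nu0 hnu h; apply: le_sqr2; first exact: mulr_ge0.
 apply: (letr h); rewrite [leRHS]exprMn; mr; apply: (letr hnu); apply: (via CW); last by rewrite expr2 ler_peMl.
 apply: (via (\sum_j (Cw s (m j) + Cw s 1) * (Wc m + Wc (fun=> 1)))); last by rewrite lerDr.
 exact: (le_sum3 (F := fun j => (Cw s (m j) + Cw s 1) * (Wc m + Wc (fun=> 1)))).
(* Two applications: the weight in x uses the seminorms [SP], whose scales are the masses; the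
   weight on the Fourier side uses [ST], with unit scales. *)
have h1 := @weight_transfer m g phi C X hm0 C0 X0.
have h2 := @weight_transfer (fun=> 1) (fun l => Fhat (g l)) (fun l => Fhat (phi l)) C X (fun=> oner_neq0 R) C0 X0.
have k1 : forall j, inW s (g j) /\ nrm (wt s (g j)) ^+ 2 <= Cw s (m j) * (Wc m * (C * X) ^+ 2).
 apply: h1; [by move=> l; have [] := hX l|exact: (hq S0)|].
 move=> k d; set e := if d then e1 else e2; have := hq (SP (vscale (2^-1 ^+ k) e)).
 have E l : vscale (m l) (vscale (2^-1 ^+ k) e) = vscale (m l * 2^-1 ^+ k) e by rewrite /vscale /= !mulrA.
 rewrite /qs /qn /=; under eq_bigr do rewrite E; by under [in leRHS]eq_bigr do rewrite E.
have k2 : forall j, inW s (Fhat (g j)) /\ nrm (wt s (Fhat (g j))) ^+ 2 <= Cw s 1 * (Wc (fun=> 1) * (C * X) ^+ 2).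
 apply: h2; [by move=> l; have [] := hX l| |].
  have := hq S0; rewrite /qs /qn /=; under eq_bigr do rewrite -nrm_Fhat; by under [in leRHS]eq_bigr do rewrite -nrm_Fhat.
 move=> k d; set e := if d then e1 else e2; have := hq (ST (vscale (1 * 2^-1 ^+ k) e)).
 rewrite /qs /qn /=; under eq_bigr do rewrite nrm_Td; by under [in leRHS]eq_bigr do rewrite nrm_Td.
move=> l; have [a1 b1] := k1 l; have [a2 b2] := k2 l.
have c1 := Cw_ge0 s (m l); have c2 := Cw_ge0 s 1; have w1 := Wc0 m; have w2 := Wc0 (fun=> 1).
split => //.
- apply: (@fin (Cw s (m l) * Wc m) l); [by []|exact: mulr_ge0| |by rewrite -mulrA].
 nra.
- apply: (@fin (Cw s 1 * Wc (fun=> 1)) l); [by []|exact: mulr_ge0| |by rewrite -mulrA].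
 nra.
Qed.

End Regularity.

(** * Asymptotic profiles and the removal of the chirp *)

Section Profiles.
Context {R : realType}.
Variable s : R.
Hypothesis hs : 1 < s < 2.
Implicit Types (g : Lsq R) (x y : plane R) (m t : R).

(** The weight is split as s = sgm + 2 aexp: the part sgm > 1 still embeds into L^1, and the rest
    pays for the decay t^(-aexp). *)
Definition sgm : R := (s + 1) / 2.
Definition aexp : R := (s - 1) / 4.

Let sgm1 : 1 < sgm. Proof. by have := hs => /andP[h1 h2]; rewrite /sgm; lra. Qed.
Lemma aexp01 : 0 < aexp <= 1.
by have := hs => /andP[h1 h2]; rewrite /aexp; apply/andP; split; lra. Qed.

Let s1 : 1 < s. Proof. by case/andP: hs. Qed.

(** Interpolation between the bounds 2 and |th|. *)
Lemma cis_sub1_le (th b : R) : 0 <= b <= 1 -> cmod (cis th - 1) <= 2 * `|th| `^ b.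
move=> /andP[b0 b1]; have le2 : cmod (cis th - 1) <= 2.
 by apply: (letr (cmodB _ _)); rewrite cmod_cis cmod1.
have [h|h] := leP 1 `|th|.
 apply: (letr le2); rewrite ler_peMr//.
 by rewrite -(powRr0 `|th|); apply: ler_powR.
have [->|t0] := eqVneq th 0; first by rewrite cis0 subrr cmod0 mulr_ge0//.
have n0 : 0 < `|th| by rewrite normr_gt0.
apply: (via `|th|); last first.
 apply: (via (`|th| `^ b)); last by rewrite ler_peMl// ler1n.
 rewrite -[leLHS](powRr1 (ltW n0)) /powR gt_eqF// ler_expR; apply: ler_wnM2r => //.
 by apply: ln_le0; exact: ltW.
apply: le_sqr2 => //.
have -> : cmod (cis th - 1) ^+ 2 = c2 th.
 rewrite cmod_sqr ReD ImD ReN ImN /= subr0 /c2.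
 have := cos2Dsin2 th; lra.
by rewrite sqr_normr c2_le_sqr.
Qed.

Lemma dotpow_le x (b : R) : 0 <= b -> (dot x x) `^ b <= bracket (2 * b) x.
move=> b0; have e : 2 * b / 2 = b by field.
rewrite /bracket e.
have d0 := dot_ge0 x; apply: ge0_ler_powR; rewrite ?nnegrE ?lerDr//; exact: addr_ge0.
Qed.

Lemma inW_split g : inW s g -> inW (2 * aexp) g /\ inW sgm (wt (2 * aexp) g) /\ wt sgm (wt (2 * aexp) g) = wt s g.
move=> h; have /andP[a0 a1] := aexp01; have [h1 _] : inW (2 * aexp) g /\ nrm (wt (2 * aexp) g) <= nrm (wt s g).
 by apply: inW_le h; rewrite /aexp; have := s1; lra.
have e : {ae mu, forall x, (bracket s x)%:C * g x = (bracket sgm x)%:C * wt (2 * aexp) g x}.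
 apply: filterS (wt_ae h1) => x ->.
 by rewrite mulrA -realcM -bracketD; congr ((bracket _ x)%:C * _); rewrite /sgm /aexp; field.
have h2 : inW sgm (wt (2 * aexp) g).
 apply: (L2_ae e (inW_cmeas _ _)); exact: h.
split=> //; split=> //; apply: Lsq_ext; apply: filterS2 e (filterI (wt_ae h) (wt_ae h2)) => x e' [-> ->].
by [].
Qed.

Definition Ci m : R := `|m| * (2 * pi)^-1 * (2 * (`|m| / 2) `^ aexp * sqrt (Csg sgm)).
Definition Cp m : R := `|m| * (2 * pi)^-1 * sqrt (Csg s).

Lemma Ci_ge0 m : 0 <= Ci m.
rewrite /Ci; apply: mulr_ge0; first by rewrite mulr_ge0// invr_ge0 ltW// pi2_gt0.
by pos.
Qed.

Lemma Cp_ge0 m : 0 <= Cp m.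
by rewrite /Cp mulr_ge0// mulr_ge0// invr_ge0 ltW// pi2_gt0. Qed.

(* [phat m f] at [y] is the Fourier transform of [f] at [m y], up to the factor
  [m / i] of the asymptotics of the free evolution. *)
Definition phat m (f : plane R -> R[i]) y : R[i] := (0 +i* - m) * fh (-1) f (vscale m y).
Definition chirped m t (f : plane R -> R[i]) : plane R -> R[i] :=
 fun w => cis (chirp (m / (2 * t)) w) * f w.

Lemma phat_le m g y : inW s g -> cmod (phat m g y) <= Cp m * nrm (wt s g).
move=> h; have [gi le] := inW_int s1 h.
rewrite /phat cmodM cmod_im normrN /Cp -!mulrA; apply: ler_wpM2l => //.
apply: (letr (fh_le _ _ gi)); apply: ler_wpM2l => //.
by rewrite invr_ge0 ltW// pi2_gt0.
Qed.

Lemma chirped_cint1 m t g : cint1 mu g -> cint1 mu (chirped m t g).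
move=> gi; have mch : cmeas (fun w : plane R => cis (chirp (m / (2 * t)) w)).
 by apply: cmeas_cis; apply: measurable_funM => //; exact: measurable_sqnorm.
by apply: (cint1_bM mch _ gi (B := 1)) => w; rewrite cmod_cis.
Qed.

(** The chirp has phase m |x|^2 / (2 t); its difference from 1, estimated with exponent [aexp],
    trades 2 aexp powers of the weight for t^(-aexp). *)
Lemma phat_chirp m t g y : 0 < t -> inW s g ->
 cmod (phat m (chirped m t g) y - phat m g y) <= Ci m * t `^ (- aexp) * nrm (wt s g).
move=> t0 h; have [gi _] := inW_int s1 h; have [h1 [h2 e]] := inW_split h.
have [wi wle] := inW_int sgm1 h2; rewrite e in wle.
have /andP[a0 a1] := aexp01; have ci := chirped_cint1 m t gi.
have di : cint1 mu (fun x => chirped m t g x - g x) by exact: (cint1D ci (cint1N gi)).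
rewrite /phat -mulrBr -fhB// cmodM cmod_im normrN /Ci -!mulrA; apply: ler_wpM2l => //.
apply: (letr (fh_le _ _ di)); ml; pose c := 2 * ((`|m| / 2) `^ aexp * t `^ (- aexp)).
have c0 : 0 <= c by rewrite mulr_ge0// mulr_ge0 ?powR_ge0.
have ce : c = 2 * (`|m / (2 * t)|) `^ aexp.
 have -> : `|m / (2 * t)| = `|m| / 2 * t^-1.
  by rewrite normrM normfV normrM (gtr0_norm t0) (ger0_norm (ler0n R 2)) invfM mulrA.
 have tE : t `^ (- aexp) = (t^-1) `^ aexp by rewrite -powR_inv1 ?(ltW t0)// -powRrM mulN1r.
 by rewrite /c tE [in RHS]powRM// invr_ge0 ltW.
apply: (via (c * \int[mu]_x cmod (wt (2 * aexp) g x))).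
 rewrite -RintegralZl//; last exact: cint1_cmod.
 apply: fine_le.
 - exact: (integrable_fin_num measurableT (cint1_cmod di)).
 - by apply: integrable_fin_num => //; under eq_fun do rewrite EFinM; apply: integrableZl => //; exact: cint1_cmod.
 apply: ae_ge0_le_integral => //.
 - by move=> x _; rewrite lee_fin cmod_ge0.
 - by have /measurable_int := cint1_cmod di.
 - by move=> x _; rewrite lee_fin mulr_ge0 ?cmod_ge0.
 - by meas.
 apply: filterS (wt_ae h1) => x ex _; rewrite lee_fin ex.
 have -> : chirped m t g x - g x = (cis (chirp (m / (2 * t)) x) - 1) * g x by rewrite /chirped mulrBl mul1r.
 rewrite !cmodM mulrA; mr; apply: (letr (cis_sub1_le _ _ (b := aexp))); first by rewrite ltW.
 rewrite /chirp normrM powRM ?normr_ge0// mulrA -ce cmod_real (gtr0_norm (bracket_gt0 _ _)) (ger0_norm (dot_ge0 _)).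
 ml; exact: dotpow_le (ltW a0).
have -> : 2 * ((`|m| / 2) `^ aexp * (sqrt (Csg sgm) * (t `^ (- aexp) * nrm (wt s g)))) = c * (sqrt (Csg sgm) * nrm (wt s g)).
 by rewrite /c; ring.
exact: ler_wpM2l.
Qed.

Lemma dilateK (t : R) x : t != 0 -> dilate t (dilate t^-1 x) = x.
by move=> t0; rewrite /dilate /=; case: x => p q /=; rewrite !mulVKf. Qed.

Lemma dilate_ae t (P : plane R -> Prop) : 0 < t -> {ae mu, forall x, P x} <-> {ae mu, forall y, P (dilate t y)}.
move=> t0; split=> h; first by have [k k0 hk] := leb2_dilate t0; exact: (scales_ae hk).
have i0 : 0 < t^-1 by pos.
have [k k0 hk] := leb2_dilate i0; apply: filterS (scales_ae hk h) => x; rewrite dilateK// gt_eqF//.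
Qed.

(** The sup norm of the evolution at time t is therefore 1/t times that of the chirped profile, in
    both directions. *)
Lemma U_dilate m t g : m != 0 -> 0 < t -> inW s g ->
 {ae mu, forall y, U m t g (dilate t y) =
  cis (m * (t / 2 * dot y y)) * ((t^-1)%:C * phat m (chirped m t g) y)}.
move=> m0 t0 h; have [gi _] := inW_int s1 h.
apply: filterS (U_factor m0 t0 gi) => y ->; rewrite /phat /chirp -!mulrA; congr (cis _ * _).
rewrite [RHS]mulrA; congr (_ * _); apply: complex_eq; rewrite ?ReM ?ImM /=; field; by rewrite gt_eqF.
Qed.

Lemma Linf_phat m t g L : m != 0 -> 0 < t -> inW s g -> Linf L (U m t g) ->
 {ae mu, forall y, cmod (phat m (chirped m t g) y) <= t * L}.
move=> m0 t0 h hL; apply: filterS2 (U_dilate m0 t0 h) ((dilate_ae _ t0).1 hL) => y ->.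
rewrite cmodM cmod_cis mul1r cmodM cmod_real gtr0_norm ?invr_gt0// => h'.
by rewrite -ler_pdivrMl.
Qed.

Lemma phat_Linf m t g B : m != 0 -> 0 < t -> inW s g ->
 {ae mu, forall y, cmod (phat m (chirped m t g) y) <= B} -> Linf (B / t) (U m t g).
move=> m0 t0 h hB; apply/(dilate_ae _ t0); apply: filterS2 (U_dilate m0 t0 h) hB => y -> hy.
rewrite cmodM cmod_cis mul1r cmodM cmod_real gtr0_norm ?invr_gt0// mulrC ler_wpM2r//.
by pos.
Qed.

Section NonlinearProfile.
Variables (lam nu : 'I_3 -> R[i]) (m : 'I_3 -> R).
Hypothesis hm : m i1 + m i2 = m i3.
Hypothesis hm0 : forall j, m j != 0.

Lemma Fz_scale (c : R) (z : 'I_3 -> R[i]) j : 0 <= c ->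
 Fz lam nu (fun l => c%:C * z l) j = (c ^+ 2)%:C * Fz lam nu z j.
move=> c0; move: j; apply: I3P; rewrite /Fz /nonlin /= !mxE !cmodM cmod_real (ger0_norm c0) ?conjcM ?conjc_real !realcM;
 ring.
Qed.

(** Before the chirp is removed the profile equation is exact: the quadratic phases cancel by gauge
    invariance, and homogeneity of degree two leaves the factor 1/t. *)
Lemma NL_profile L t (g : 'I_3 -> Lsq R) j : 0 < t -> bdd m L t g -> (forall l, inW s (g l)) ->
 inW s (NL lam nu m t g j) ->
 {ae mu, forall y, phat (m j) (chirped (m j) t (NL lam nu m t g j)) y =
  (t^-1)%:C * Fz lam nu (fun l => phat (m l) (chirped (m l) t (g l)) y) j}.
move=> t0 hb hg hN; have h1 := U_dilate (hm0 j) t0 hN; rewrite {1}/NL UNK in h1.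
have h2 := (dilate_ae _ t0).1 (FL_ae lam nu hb j).
apply: filterS2 h1 (filterI h2 (ae_all3 (fun l => U_dilate (hm0 l) t0 (hg l)))) => y e1 [e2 e3].
move: e1; rewrite e2.
have -> : (fun l => U (m l) t (g l) (dilate t y)) =
  (fun l => cis (m l * (t / 2 * dot y y)) * ((t^-1)%:C * phat (m l) (chirped (m l) t (g l)) y)).
 by apply/funext => l; exact: e3.
rewrite Fz_gauge// Fz_scale ?invr_ge0 ?ltW//.
move: (phat (m j) _ y) (Fz _ _ _ _) => P F /(f_equal (fun w => cis (- (m j * (t / 2 * dot y y))) * w)).
rewrite !mulrA cisKN !mul1r expr2 realcM -mulrA => /(f_equal (fun w => t%:C * w)).
by rewrite !mulrA -!realcM mulfV ?gt_eqF// !mul1r => ->.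
Qed.

End NonlinearProfile.

End Profiles.

(** * Dissipation in one Euler step of the profile equation *)

Section ProfileStep.
Context {R : realType}.
Variables (lam mu : 'I_3 -> R[i]) (kap : 'I_3 -> R).
Hypothesis hdiss : forall j, Im (lam j) < 0.
Hypothesis kap0 : forall j, 0 < kap j.
Hypothesis hkap : (kap i1)%:C * mu i1 + (kap i2)%:C * mu i2 = (kap i3)%:C * conjc (mu i3).
Implicit Types (z w : 'I_3 -> R[i]).

Local Notation Fz := (Fz lam mu).
Local Notation KF := (KF lam mu).

Lemma cauchy3 (a b : 'I_3 -> R) : (\sum_j a j * b j) ^+ 2 <= (\sum_j a j ^+ 2) * (\sum_j b j ^+ 2).
rewrite !sum3.
have h1 := sqr_ge0 (a i1 * b i2 - a i2 * b i1); have h2 := sqr_ge0 (a i1 * b i3 - a i3 * b i1).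
have h3 := sqr_ge0 (a i2 * b i3 - a i3 * b i2); lra.
Qed.

Definition kn z : R := sqrt (\sum_j kap j * cmod (z j) ^+ 2).
Lemma kn_ge0 z : 0 <= kn z. Proof. exact: sqrtr_ge0. Qed.

Lemma kn_sqr z : kn z ^+ 2 = \sum_j kap j * cmod (z j) ^+ 2.
by rewrite /kn sqr_sqrtr// sumr_ge0// => j _; rewrite mulr_ge0 ?sqr_ge0// ltW.
Qed.

Lemma knD z w : kn (fun j => z j + w j) <= kn z + kn w.
apply: le_sqr2; first by rewrite addr_ge0 ?kn_ge0.
pose a j := sqrt (kap j) * cmod (z j); pose b j := sqrt (kap j) * cmod (w j).
have sk j : sqrt (kap j) ^+ 2 = kap j by rewrite sqr_sqrtr ?ltW.
have ea : \sum_j a j ^+ 2 = kn z ^+ 2.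
 by rewrite kn_sqr; apply: eq_bigr => j _; rewrite /a exprMn sk.
have eb : \sum_j b j ^+ 2 = kn w ^+ 2.
 by rewrite kn_sqr; apply: eq_bigr => j _; rewrite /b exprMn sk.
have ab : \sum_j a j * b j <= kn z * kn w.
 apply: le_sqr2; first by rewrite mulr_ge0 ?kn_ge0.
 by rewrite exprMn -ea -eb; exact: cauchy3.
have h : kn (fun j => z j + w j) ^+ 2 <= \sum_j (a j + b j) ^+ 2.
 rewrite kn_sqr; apply: ler_sum => j _; rewrite /a /b -mulrDr exprMn sk.
 ml; by apply: sqr_le2; [by []|exact: cmodD].
apply: (letr h); rewrite sqrrD -ea -eb.
move: ab; rewrite !sum3; lra.
Qed.

Lemma kn_bounds : exists2 C : R, 1 <= C &
 (forall z j, cmod (z j) <= C * kn z) /\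
 (forall z (e : R), 0 <= e -> (forall j, cmod (z j) <= e) -> kn z <= C * e).
pose S := \sum_j (kap j + (kap j)^-1).
have S1 j : kap j + (kap j)^-1 <= S.
 by apply: (le_sum3 (F := fun j => kap j + (kap j)^-1)) => i; rewrite addr_ge0 ?invr_ge0 ?ltW.
have S0 : 0 <= S by apply: sumr_ge0 => j _; rewrite addr_ge0 ?invr_ge0 ?ltW.
exists (1 + S); first by rewrite lerDl.
split=> [z j|z e e0 h].
 apply: le_sqr2; first by rewrite mulr_ge0 ?kn_ge0 ?addr_ge0.
 rewrite exprMn kn_sqr; have : kap j * cmod (z j) ^+ 2 <= \sum_j kap j * cmod (z j) ^+ 2.
  by apply: (le_sum3 (F := fun j => kap j * cmod (z j) ^+ 2)) => i; rewrite mulr_ge0 ?sqr_ge0// ltW.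
 move: (\sum_j kap j * _) => T hT; apply: (via ((kap j)^-1 * T)).
  by rewrite -(ler_pM2l (kap0 j)) mulVKf ?gt_eqF.
 apply: ler_wpM2r; first by apply: letr hT; rewrite mulr_ge0 ?sqr_ge0// ltW.
 have h1 := S1 j; have h2 := kap0 j.
 nra.
apply: le_sqr2; first by pos.
rewrite kn_sqr exprMn; apply: (via (S * e ^+ 2)); last first.
 nra.
rewrite mulr_suml; apply: ler_sum => j _; apply: ler_pM; [exact: ltW|exact: sqr_ge0| |by apply: sqr_le2; [by []|exact: h]].
by rewrite lerDl invr_ge0 ltW.
Qed.

Lemma min3 (f : 'I_3 -> R) : (forall j, 0 < f j) -> exists2 c : R, 0 < c & forall j, c <= f j.
move=> f0; exists (Num.min (f i1) (Num.min (f i2) (f i3))); first by rewrite !lt_min !f0.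
by apply: I3P; rewrite !ge_min lexx ?orbT.
Qed.

Lemma max3 (f : 'I_3 -> R) : exists j, forall i, f i <= f j.
have [h1|h1] := leP (f i1) (f i2); have [h2|h2] := leP (f i2) (f i3); have [h3|h3] := leP (f i1) (f i3);
 (try by (exists i3; apply: I3P; lra)); (try by (exists i2; apply: I3P; lra)); exists i1; apply: I3P; lra.
Qed.

(* The coupling terms cancel in the weighted energy. *)
Lemma energy_Im z : \sum_j kap j * Im (conjc (z j) * Fz z j) =
 \sum_j kap j * Im (lam j) * cmod (z j) ^+ 3.
have /(f_equal (@Re R)) := hkap; have /(f_equal (@Im R)) := hkap.
rewrite !sum3 /Fz /nonlin /= !mxE !exprSr expr0 !mul1r.
have E (w : R[i]) : cmod w * cmod w = Re w * Re w + Im w * Im w.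
 by have := cmod_sqr w; rewrite !expr2.
rewrite !E !ReD !ImD !ReM !ImM.
move: (cmod (z i1)) (cmod (z i2)) (cmod (z i3)) => M1 M2 M3.
move: (kap i1) (kap i2) (kap i3) => k1 k2 k3.
case: (z i1) (z i2) (z i3) => [a1 b1] [a2 b2] [a3 b3].
case: (mu i1) (mu i2) (mu i3) => [p1 q1] [p2 q2] [p3 q3].
case: (lam i1) (lam i2) (lam i3) => [l1 n1] [l2 n2] [l3 n3] /=.
rewrite !mul0r !mulr0 !addr0 !subr0 => e1 e2.
pose Zr := a1 * a2 * a3 - b1 * b2 * a3 + a1 * b2 * b3 + b1 * a2 * b3.
pose Zi := a1 * a2 * b3 - b1 * b2 * b3 - a1 * b2 * a3 - b1 * a2 * a3.
apply/eqP; rewrite -subr_eq0; apply/eqP.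
transitivity ((k1 * p1 + k2 * p2 - k3 * p3) * Zi + (k1 * q1 + k2 * q2 - k3 * - q3) * Zr).
 rewrite /Zr /Zi; ring.
by rewrite e1 e2 !subrr !mul0r addr0.
Qed.

Lemma energy_step z (h : R) : kn (fun j => z j - (0 +i* h) * Fz z j) ^+ 2 =
 kn z ^+ 2 + 2 * h * (\sum_j kap j * Im (lam j) * cmod (z j) ^+ 3) +
 h ^+ 2 * \sum_j kap j * cmod (Fz z j) ^+ 2.
rewrite -energy_Im !kn_sqr !mulr_sumr -!big_split; apply: eq_bigr => j _ /=.
move: (Fz z j) (z j) (kap j) => F w k; rewrite !cmod_sqr ReD ImD ReN ImN !ReM !ImM.
by case: F w => [a b] [c d] /=; ring.
Qed.

(** All summands have the same sign, so the largest component alone gives the bound, and it is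
    comparable to [kn z]. *)
Lemma dissipation : exists2 c : R, 0 < c &
 forall z, \sum_j kap j * Im (lam j) * cmod (z j) ^+ 3 <= - (c * kn z ^+ 3).
have [c c0 hc] : exists2 c : R, 0 < c & forall j, c <= kap j * - Im (lam j).
 by apply: min3 => j; rewrite mulr_gt0// oppr_gt0.
have [C C1 [_ hC]] := kn_bounds; have C0 : 0 < C := lt_le_trans ltr01 C1.
exists (c / C ^+ 3); first by pos.
move=> z; have [J hJ] := max3 (fun j => cmod (z j)).
have k3 : (kn z / C) ^+ 3 <= cmod (z J) ^+ 3.
 apply: lerXn2r; rewrite ?nnegrE ?cmod_ge0 ?divr_ge0 ?kn_ge0 ?(ltW C0)//.
 by rewrite ler_pdivrMr// mulrC; exact: hC (cmod_ge0 _) hJ.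
have t0 j : 0 <= kap j * - Im (lam j) * cmod (z j) ^+ 3.
 by rewrite mulr_ge0 ?exprn_ge0 ?cmod_ge0// (letr (ltW c0)).
rewrite -[leLHS]opprK lerN2 -sumrN.
under eq_bigr do rewrite -mulNr -mulrN.
apply: letr (le_sum3 J t0).
apply: (via (c * cmod (z J) ^+ 3)); last by rewrite ler_wpM2r ?exprn_ge0 ?cmod_ge0.
nra.
Qed.

(** In the squared energy, the dissipation of order h kn^3 must absorb the square of the explicit
    Euler increment, of order h^2 kn^4; this forces the restriction kn z <= d. Half of the
    dissipation survives. *)
Lemma kn_step : exists c d : R, [/\ 0 < c, 0 < d & forall z (h : R), 0 <= h <= 1 -> kn z <= d ->
 kn (fun j => z j - (0 +i* h) * Fz z j) <= kn z - c * h * kn z ^+ 2].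
have [c c0 hc] := dissipation; have [C C1 [hC1 hC2]] := kn_bounds.
have C0 : 0 < C := lt_le_trans ltr01 C1; have K0 := KF_ge0 lam mu.
pose D := (C * (6 * KF * C ^+ 2)) ^+ 2.
have D0 : 0 <= D by exact: sqr_ge0.
have FD z : \sum_j kap j * cmod (Fz z j) ^+ 2 <= D * kn z ^+ 4.
 rewrite -kn_sqr; have B j : cmod (Fz z j) <= 6 * KF * C ^+ 2 * kn z ^+ 2.
  apply: (letr (Fz_le lam mu j (hC1 z))).
  have S : \sum_l cmod (z l) <= 3 * (C * kn z).
   by rewrite sum3; have := hC1 z i1; have := hC1 z i2; have := hC1 z i3; lra.
  apply: (via (2 * KF * (C * kn z) * (3 * (C * kn z)))).
   by apply: ler_wpM2l => //; rewrite mulr_ge0 ?mulr_ge0 ?kn_ge0// ltW.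
  lra.
 have B0 : 0 <= 6 * KF * C ^+ 2 * kn z ^+ 2 by pos.
 apply: (via ((C * (6 * KF * C ^+ 2 * kn z ^+ 2)) ^+ 2)).
  by apply: sqr_le2; [exact: kn_ge0|exact: hC2].
 by rewrite le_eqVlt /D; apply/orP; left; apply/eqP; ring.
(* The first bound lets the dissipation absorb the squared increment, the second keeps the claimed
   right-hand side nonnegative before square roots are taken. *)
exists (c / 2), (Num.min (c / (D + 1)) (2 / (c + 1))); split.
- by pos.
- by rewrite lt_min; apply/andP; split; apply: divr_gt0 => //; lra.
move=> z h /andP[h0 h1]; rewrite le_min => /andP[d1 d2].
have y0 := kn_ge0 z.
have e1 : kn z * (D + 1) <= c by rewrite -ler_pdivlMr// ltr_wpDl.
have e2 : kn z * (c + 1) <= 2 by rewrite -ler_pdivlMr// addr_gt0.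
have hd := hc z; have hF := FD z; have E := energy_step z h.
have p0 : 0 <= kn z - c / 2 * h * kn z ^+ 2.
 have : c * kn z <= 2 by lra.
 have : 0 <= kn z * h by pos.
 have : kn z * h <= kn z by rewrite ler_piMr.
 move: (kn z) y0 => y y0 *; have : y * h * (c * y) <= y * h * 2 by apply: ler_wpM2l.
 by rewrite expr2; lra.
apply: le_sqr2 => //; rewrite E.
have t1 : h * (\sum_j kap j * Im (lam j) * cmod (z j) ^+ 3) <= h * - (c * kn z ^+ 3) by exact: ler_wpM2l.
have t2 : h ^+ 2 * \sum_j kap j * cmod (Fz z j) ^+ 2 <= h ^+ 2 * (D * kn z ^+ 4) by apply: ler_wpM2l => //; exact: sqr_ge0.
have t3 : h ^+ 2 * (D * kn z ^+ 4) <= h * (c * kn z ^+ 3).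
 have -> : h ^+ 2 * (D * kn z ^+ 4) = (h * kn z ^+ 3) * (h * (D * kn z)) by ring.
 have -> : h * (c * kn z ^+ 3) = (h * kn z ^+ 3) * (1 * c) by ring.
 ml; nra.
nra.
Qed.

End ProfileStep.

(** * Discrete decay like 1 / log t *)

Section DiscreteDecay.
Context {R : realType}.
Implicit Types (x t b c p q : R).

Lemma ln_le_sub1 x : 0 < x -> ln x <= x - 1.
by move=> x0; have := @le_ln1Dx R (x - 1); rewrite addrCA subrr addr0; apply; lra. Qed.

Lemma ln_ge_1subV x : 0 < x -> 1 - x^-1 <= ln x.
move=> x0; have h : 0 < x^-1 by pos.
by have := ln_le_sub1 h; rewrite lnV ?posrE//; lra.
Qed.

Lemma ln1D_ge x : 0 <= x <= 1 -> x / 2 <= ln (1 + x).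
move=> /andP[x0 x1]; have h : 0 < 1 + x by lra.
apply: letr (ln_ge_1subV h).
have -> : 1 - (1 + x)^-1 = x / (1 + x) by field; lra.
by ml; rewrite lef_pV2 ?posrE//; lra.
Qed.

Lemma expRN_le u : 0 <= u <= 1 -> expR (- u) <= 1 - u / 2 :> R.
move=> /andP[u0 u1]; have h := @expR_ge1Dx R u; rewrite expRN.
apply: (via (1 + u)^-1); first by rewrite lef_pV2 ?posrE ?expR_gt0//; lra.
by rewrite -[leLHS]mul1r ler_pdivrMr; nra.
Qed.

(** A discrete Gronwall factor: relative growth q h / (1 + t) per step is dominated by the power (1
    + t)^p. The factor 2 comes from ln (1 + x) >= x/2 on [0, 1]. *)
Lemma powR_growth t h p q : 0 <= t -> 0 <= h <= 1 -> 0 <= p -> 2 * q <= p ->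
 (1 + q * (h / (1 + t))) * (1 + t) `^ p <= (1 + (t + h)) `^ p.
move=> t0 /andP[h0 h1] p0 pq; have t1 : 0 < 1 + t by lra.
have x0 : 0 <= h / (1 + t) <= 1.
 by apply/andP; split; [rewrite divr_ge0// ltW|rewrite ler_pdivrMr//; lra].
have -> : 1 + (t + h) = (1 + h / (1 + t)) * (1 + t) by field; lra.
move: (h / (1 + t)) x0 => x x01; have := x01 => /andP[x0 x1].
rewrite powRM ?(ltW t1)//; last lra.
mr; rewrite {1}/powR gt_eqF; last lra.
apply: (via (1 + p * ln (1 + x))); last exact: expR_ge1Dx.
by have := ln1D_ge x01; nra.
Qed.

(** The left side is one step of a Riemann sum for the integral of t^(-1-b); the right side
    telescopes, so errors of this size have a sum bounded independently of the step. *)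
Lemma powRN_telescope t h b : 0 < h -> h <= t -> 0 < b <= 1 ->
 h * (t^-1 * t `^ (- b)) <= 4 / b * (t `^ (- b) - (t + h) `^ (- b)).
move=> h0 ht /andP[b0 b1]; have t0 : 0 < t := lt_le_trans h0 ht.
have x01 : 0 <= h / t <= 1.
 by apply/andP; split; [rewrite divr_ge0// ltW|rewrite ler_pdivrMr// mul1r].
have -> : t + h = (1 + h / t) * t by field; lra.
have -> : h * (t^-1 * t `^ (- b)) = h / t * t `^ (- b) by rewrite mulrA.
move: (h / t) x01 => x x01; have := x01 => /andP[x0 x1].
rewrite powRM ?(ltW t0)//; last lra.
have P0 := powR_ge0 t (- b).
have H : (1 + x) `^ (- b) <= 1 - b * x / 4.
 rewrite /powR gt_eqF; last lra.
 have u01 : 0 <= b * x / 2 <= 1 by apply/andP; split; nra.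
 have := expRN_le u01; have -> : b * x / 2 / 2 = b * x / 4 by field.
 apply: letr; rewrite ler_expR mulNr lerN2; have := ln1D_ge x01; nra.
have -> : t `^ (- b) - (1 + x) `^ (- b) * t `^ (- b) = (1 - (1 + x) `^ (- b)) * t `^ (- b) by ring.
rewrite mulrA; apply: ler_wpM2r => //.
rewrite mulrAC ler_pdivlMr//; lra.
Qed.

(** The inequality ln z <= z - 1, taken at z = (2 + t)^(b/2), trades the squared logarithm for a
    power. *)
Lemma ln_sqr_powR t b : 1 <= t -> 0 < b <= 1 -> ln (2 + t) ^+ 2 * t `^ (- b) <= 12 / b ^+ 2.
move=> t1 /andP[b0 b1]; have z0 : 0 < 2 + t by lra.
have l0 : 0 <= ln (2 + t) by apply: ln_ge0; lra.
have h : b / 2 * ln (2 + t) <= (2 + t) `^ (b / 2).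
 rewrite -ln_powR; apply: (letr (ln_le_sub1 _)); first by rewrite powR_gt0.
 lra.
have h2 : (b / 2 * ln (2 + t)) ^+ 2 <= (2 + t) `^ b.
 have -> : (2 + t) `^ b = ((2 + t) `^ (b / 2)) ^+ 2.
  by rewrite -powR_mulrn// -powRrM; congr (_ `^ _); field.
 by apply: sqr_le2 => //; rewrite mulr_ge0// divr_ge0// ltW.
have h3 : (2 + t) `^ b <= 3 * t `^ b.
 apply: (via ((3 * t) `^ b)).
  by apply: ge0_ler_powR; rewrite ?nnegrE; lra.
 rewrite powRM//; last lra.
 mr; by rewrite -[leRHS]powRr1//; apply: ler_powR => //; lra.
have tb : t `^ b * t `^ (- b) = 1.
 by rewrite -powRD ?subrr ?powRr0//; apply/implyP => _; rewrite gt_eqF//; lra.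
have tn : 0 <= t `^ (- b) by pos.
rewrite ler_pdivlMr ?exprn_gt0//.
nra.
Qed.

Lemma ln_ge23 (t : R) : 1 <= t -> 2 / 3 <= ln (2 + t).
move=> t1; have x0 : 0 < 2 + t by lra.
apply: letr (ln_ge_1subV x0); have : (2 + t)^-1 <= 3^-1 by rewrite lef_pV2 ?posrE; lra.
lra.
Qed.

(** One step of y' = - c y^2 / t + K t^(-1-b) preserves y ln (2 + t) <= M. If z l is at most M/2,
    the room left exceeds the possible increase; otherwise the quadratic damping beats both the
    error and the growth of the logarithm. *)
Lemma decay_step (c K M q T e l l' p z z1 : R) : 0 < c -> 0 <= K -> 0 < M -> 8 <= M * c -> 12 * K <= M -> q * K <= M ->
 1 <= T -> 0 < e -> e <= 1 -> 0 <= p -> p <= 1 -> l ^+ 2 * p <= q -> 2 / 3 <= l -> l <= l' -> l' <= l + e / (2 + T) ->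
 l <= 2 * T -> 0 <= z -> z * l <= M -> z1 <= z - c * (e / T) * z ^+ 2 + e / T * (K * p) -> z1 * l' <= M.
move=> c0 K0 M0 h3 M2 M4 T1 e0 e1 p0 p1 hl Ll ll' l'l lT z0 zl; set x := e / T => hz.
have x0 : 0 < x by rewrite divr_gt0//; lra.
have l0 : 0 < l by lra.
have l'0 : 0 <= l' by lra.
have e3 : e / (2 + T) <= 1 / 3 by rewrite ler_pdivrMr//; lra.
have [small|big] := leP (z * (2 * l)) M.
 have xl : x * l <= 2.
  rewrite /x mulrAC ler_pdivrMr; last lra.
  nra.
 have T' : z1 <= z + x * K.
  apply: (letr hz); have : 0 <= c * x * z ^+ 2 by pos.
  have : x * (K * p) <= x * (K * 1) by do 2 (apply: ler_wpM2l; rewrite ?(ltW x0)//).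
  lra.
 apply: (via ((z + x * K) * l')); first by apply: ler_wpM2r.
 apply: (via ((z + x * K) * (3 / 2 * l))).
  apply: ler_wpM2l; last lra.
  by pos.
 nra.
have ek : e / (2 + T) <= x.
 by rewrite /x; ml; rewrite lef_pV2 ?posrE; lra.
apply: (via ((z - c * x * z ^+ 2 + x * (K * p)) * l')); first by apply: ler_wpM2r.
(* From z l > M/2 the left side exceeds c M^2 / 4, which is at least 2 M because M c >= 8. *)
have key : c * z ^+ 2 * l ^+ 2 >= M + K * q.
 have h4 : (M / 2) ^+ 2 <= z ^+ 2 * l ^+ 2 by rewrite -exprMn; apply: sqr_le2; lra.
 nra.
have key2 : M + l ^+ 2 * (K * p) <= c * z ^+ 2 * l ^+ 2.
 nra.
have key3 : z + l * (K * p) <= c * z ^+ 2 * l.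
 nra.
set D := c * z ^+ 2 - K * p.
have Dz : z <= D * l by rewrite /D mulrBl; lra.
have D0 : 0 <= D by rewrite -(pmulr_lge0 _ l0); exact: letr z0 Dz.
have -> : z - c * x * z ^+ 2 + x * (K * p) = z - x * D by rewrite /D; ring.
rewrite mulrBl; have : x * D * l <= x * D * l' by apply: ler_wpM2l => //; rewrite mulr_ge0// ltW.
have : z * l' <= z * (l + x) by ml; lra.
have : x * z <= x * (D * l) by apply: ler_wpM2l => //; exact: ltW.
lra.
Qed.

Section Sequence.
Variables (c d b K Y eta : R) (y : nat -> R) (k0 n : nat).
Hypotheses (c0 : 0 < c) (b01 : 0 < b <= 1) (K0 : 0 <= K) (eta0 : 0 < eta) (eta1 : eta <= 1).
Hypothesis hk0 : k0%:R * eta = 1.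
Hypothesis y0 : forall k, 0 <= y k.
Hypothesis yY : y k0 <= Y.
Hypothesis Yd : Y + 4 / b * K <= d.

Local Notation t k := (k%:R * eta).
Hypothesis step : forall k, (k0 <= k < n)%N -> y k <= d ->
 y k.+1 <= y k - c * (eta / t k) * y k ^+ 2 + eta * K * ((t k)^-1 * (t k) `^ (- b)).
(** One summand per requirement: [2 * Y] covers the starting time 1, where ln 3 <= 2, and the other
    three are the lower bounds on M in [decay_step]. *)
Definition Mdecay : R := 2 * Y + 12 * K + 8 / c + 12 / b ^+ 2 * K.

Let b0 : 0 < b. Proof. by case/andP: b01. Qed.
Let tS k : t k.+1 = t k + eta. Proof. by rewrite -natr1 mulrDl mul1r. Qed.
Let t1 k : (k0 <= k)%N -> 1 <= t k.
by move=> h; rewrite -[leLHS]hk0 ler_wpM2r ?ler_nat// ltW. Qed.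
Let Y0 : 0 <= Y. Proof. exact: letr (y0 k0) yY. Qed.

(** The sum y_k + (4/b) K t_k^(-b) never increases, by telescoping. This keeps y_k below [d], where
    the step inequality is available. *)
Lemma seq_bounded k : (k0 <= k <= n)%N -> y k <= Y + 4 / b * K.
have B0 : 0 <= 4 / b * K by pos.
have H : (k0 <= k <= n)%N -> y k + 4 / b * K * (t k) `^ (- b) <= Y + 4 / b * K.
 elim: k => [|k IH] /andP[h1 h2].
  move: hk0; have -> : k0 = 0%N by apply/eqP; rewrite -leqn0.
  by rewrite mul0r => /eqP; rewrite eq_sym oner_eq0.
 move: h1; rewrite leq_eqVlt => /predU1P[<-|h1].
  by rewrite hk0 powR1 mulr1 lerD2r.
 have hk : (k0 <= k < n)%N by rewrite -ltnS h1.
 have hk' : (k0 <= k <= n)%N by rewrite -ltnS h1 ltnW.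
 have IH' := IH hk'; have P0 := powR_ge0 (t k) (- b).
 have yd : y k <= d.
  apply: letr Yd; apply: letr IH'; by rewrite lerDl mulr_ge0.
 have T := step hk yd; have kt := t1 (ltnSE h1).
 have E := powRN_telescope eta0 (letr eta1 kt) b01; rewrite -tS in E.
 have q0 : 0 <= c * (eta / t k) * y k ^+ 2.
  by pos.
 have : K * (eta * ((t k)^-1 * (t k) `^ (- b))) <= K * (4 / b * ((t k) `^ (- b) - (t k.+1) `^ (- b))).
  exact: ler_wpM2l.
 move: (c * _ * _) q0 T IH' => Q Q0 T IH' E'.
 lra.
move=> hk; apply: letr (H hk); by rewrite lerDl mulr_ge0// powR_ge0.
Qed.

Lemma seq_decay k : (k0 <= k <= n)%N -> y k <= Mdecay / ln (2 + t k).
have c0_ := c0; have K0_ := K0; have Y0_ := Y0; have b0_ := b0; have e0_ := eta0; have e1_ := eta1.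
have i1 : 0 <= 8 / c by pos.
have i2 : 0 <= 12 / b ^+ 2 * K by pos.
have [M1 M2 M3 M4] : [/\ 2 * Y <= Mdecay, 12 * K <= Mdecay, 8 / c <= Mdecay & 12 / b ^+ 2 * K <= Mdecay].
 by rewrite /Mdecay; move: (8 / c) (12 / b ^+ 2 * K) i1 i2 => p q *; split; lra.
have M0 : 0 < Mdecay by apply: lt_le_trans M3; rewrite divr_gt0.
elim: k => [|k IH] /andP[h1 h2].
 move: hk0; have -> : k0 = 0%N by apply/eqP; rewrite -leqn0.
 by rewrite mul0r => /eqP; rewrite eq_sym oner_eq0.
move: h1; rewrite leq_eqVlt => /predU1P[<-|h1].
  rewrite hk0; have L := ln_ge23 (lexx (1 : R)); have L0 : 0 < ln (2 + 1 : R) by apply: lt_le_trans L; rewrite divr_gt0.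
 have L2 : ln (2 + 1 : R) <= 2.
  by have := @ln_le_sub1 (2 + 1); rewrite addrK; apply; rewrite addr_gt0.
 rewrite ler_pdivlMr//; apply: letr M1; rewrite mulrC; apply: ler_pM => //; exact: ltW.
have hk : (k0 <= k < n)%N by rewrite -ltnS h1.
have hk' : (k0 <= k <= n)%N by rewrite -ltnS h1 ltnW.
have IH' := IH hk'; have kt := t1 (ltnSE h1).
have yd : y k <= d by apply: letr Yd; exact: seq_bounded.
have T := step hk yd.
have hl := ln_sqr_powR kt b01; have P0 := powR_ge0 (t k) (- b).
set l := ln (2 + t k) in IH' hl; set l' := ln (2 + t k.+1).
have hM : 8 <= Mdecay * c by rewrite -ler_pdivrMr.
have tk0 : 0 < t k by apply: lt_le_trans ltr01 kt.
have tt : 0 < 2 + t k by pos.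
have l'l : l' <= l + eta / (2 + t k).
 have e : 2 + t k.+1 = (2 + t k) * (1 + eta / (2 + t k)).
  by rewrite tS; move: (t k) tt => p tt; field; rewrite gt_eqF.
 have h0 : 0 < 1 + eta / (2 + t k) by rewrite ltr_wpDr// divr_ge0 ?ltW.
 rewrite /l' e lnM ?posrE// lerD2l; apply: (letr (ln_le_sub1 h0)).
 lra.
have ll' : l <= l' by rewrite /l /l' ler_ln ?posrE ?tS ?addrA ?lerDl ?addr_gt0// ltW.
have lt2 : l <= 2 * t k.
 apply: (letr (ln_le_sub1 tt)); move: (t k) kt => p kt; lra.
have Pb1 : (t k) `^ (- b) <= 1.
 by rewrite -[leRHS](powRr0 (t k)); apply: ler_powR => //; rewrite oppr_le0 ltW.
have Ll : 2 / 3 <= l by exact: ln_ge23.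
have L0 : 0 < l by apply: lt_le_trans Ll; rewrite divr_gt0.
have xe : eta * K * ((t k)^-1 * (t k) `^ (- b)) = eta / t k * (K * (t k) `^ (- b)).
 ring.
rewrite xe in T; rewrite ler_pdivlMr// in IH'; rewrite ler_pdivlMr; last exact: lt_le_trans ll'.
apply: (decay_step c0 K0 M0 hM M2 M4 kt eta0 eta1 P0 Pb1 hl Ll ll' l'l lt2 (y0 k) IH' T).
Qed.

End Sequence.
End DiscreteDecay.

(** * The Euler scheme for the profile *)

Section EulerScheme.
Context {R : realType}.
Variables (lam nu : 'I_3 -> R[i]) (m kap : 'I_3 -> R) (s : R).
Hypothesis hm : m i1 + m i2 = m i3.
Hypothesis hm0 : forall j, m j != 0.
Hypothesis hs : 1 < s < 2.
Implicit Types (g phi : 'I_3 -> Lsq R) (x y : plane R).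

Local Notation KF := (KF lam nu).
Local Notation NL := (NL lam nu m).
Local Notation W := (CW m s).
Local Notation a := (aexp s).
Local Notation b := (aexp s / 2).

Let s1 : 1 < s. Proof. by case/andP: hs. Qed.
Let W0 : 0 <= W. Proof. exact: letr ler01 (CW_ge1 m hs). Qed.

Fixpoint euler (eta : R) phi (k : nat) : 'I_3 -> Lsq R :=
 if k is k'.+1 then fun j => euler eta phi k' j - (0 +i* eta) *: NL (k'%:R * eta) (euler eta phi k') j
 else phi.

Definition Cim : R := \sum_l Ci s (m l).
Definition Cpm : R := \sum_l Cp s (m l).
Definition A1 : R := 2 * Cim * W.
(** 54 = 12 + 42: the chirp error inside the nonlinearity, through its Lipschitz bound, and the
    chirp error of the interaction term itself. *)
Definition A2 : R := 54 * KF * A1.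

Lemma Ci_le j : Ci s (m j) <= Cim.
by apply: (le_sum3 (F := fun l => Ci s (m l))) => i; exact: Ci_ge0. Qed.
Lemma Cp_le j : Cp s (m j) <= Cpm.
by apply: (le_sum3 (F := fun l => Cp s (m l))) => i; exact: Cp_ge0. Qed.

Lemma Cim_ge0 : 0 <= Cim. Proof. by apply: sumr_ge0 => i _; exact: Ci_ge0. Qed.
Lemma Cpm_ge0 : 0 <= Cpm. Proof. by apply: sumr_ge0 => i _; exact: Cp_ge0. Qed.
Lemma A1_ge0 : 0 <= A1. Proof. by rewrite /A1 mulr_ge0// mulr_ge0// Cim_ge0. Qed.
Lemma A2_ge0 : 0 <= A2. Proof. by rewrite /A2 mulr_ge0 ?A1_ge0// mulr_ge0 ?KF_ge0. Qed.

(** The growth exponent is taken to be half of [a], so that the chirp error t^(-a), multiplied by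
    the growth of the seminorms, still decays. *)
Lemma powR_split t : 1 <= t -> t `^ (- a) * (1 + t) `^ b <= 2 * t `^ (- b).
move=> t1; have /andP[a0 a1] := aexp01 hs.
have t0 : 0 < t := lt_le_trans ltr01 t1.
have h : (1 + t) `^ b <= 2 * t `^ b.
 apply: (via ((2 * t) `^ b)).
  by apply: ge0_ler_powR; rewrite ?nnegrE; lra.
 rewrite powRM ?(ltW t0)//; mr; by rewrite -[leRHS]powRr1//; apply: ler_powR; lra.
have e : t `^ (- b) = t `^ (- a) * t `^ b.
 rewrite -powRD; last by apply/implyP => _; rewrite gt_eqF.
 by congr (_ `^ _); field.
by rewrite e mulrCA; apply: ler_wpM2l => //; exact: powR_ge0.
Qed.

Lemma fh_step (c : R) (f g : Lsq R) (k : R[i]) x : cint1 mu f -> cint1 mu g ->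
 fh c (f - k *: g) x = fh c f x - k * fh c g x.
move=> fi gi; rewrite -fhZ// -fhB//; last exact: cint1Z.
have -> // : fh c (f - k *: g) = fh c (fun x => f x - k * g x).
apply: fh_ae; [|exact: fn_cmeas|]; last first.
 by meas.
by apply: filterS2 (fnB f (k *: g)) (fnZ k g) => z -> ->.
Qed.

Lemma phat_step (mj : R) (f g : Lsq R) (k : R[i]) x : inW s f -> inW s g ->
 phat mj (f - k *: g) x = phat mj f x - k * phat mj g x.
move=> hf hg; have [fi _] := inW_int s1 hf; have [gi _] := inW_int s1 hg.
by rewrite /phat fh_step//; move: (fh _ f _) (fh _ g _) => p q; ring.
Qed.

Lemma chirp_err (h : Lsq R) j (Z t : R) y : 1 <= t -> inW s h -> 0 <= Z -> nrm (wt s h) <= W * ((1 + t) `^ b * Z) ->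
 cmod (phat (m j) (chirped (m j) t h) y - phat (m j) h y) <= A1 * Z * t `^ (- b).
move=> t1 hh Z0 hZ; have t0 : 0 < t := lt_le_trans ltr01 t1.
have C0 := Cim_ge0; have Pa := powR_ge0 t (- a); have Pp := powR_ge0 (1 + t) b.
apply: (letr (phat_chirp hs (m j) y t0 hh)).
apply: (via (Cim * t `^ (- a) * (W * ((1 + t) `^ b * Z)))).
 apply: ler_pM => //; [by rewrite mulr_ge0// Ci_ge0|exact: nrm_ge0|].
 by mr; exact: Ci_le.
have -> : Cim * t `^ (- a) * (W * ((1 + t) `^ b * Z)) = Cim * W * Z * (t `^ (- a) * (1 + t) `^ b) by ring.
have -> : A1 * Z * t `^ (- b) = Cim * W * Z * (2 * t `^ (- b)) by rewrite /A1; ring.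
by ml; exact: powR_split.
Qed.

(** The exact equation holds for the chirped profiles [V], which are bounded by [rho] because the
    solution is bounded by rho/(1 + t). Removing the chirp from the argument of [Fz] and from the
    interaction term costs two errors of order t^(-1-b). *)
Lemma profile_estimates (rho eps t : R) g : 1 <= t -> 0 <= eps -> 0 <= rho -> A1 * eps <= rho ->
 inXe s (W * ((1 + t) `^ b * eps)) g -> bdd m (rho / (1 + t)) t g ->
 inXe s (W * (42 * KF * (rho / (1 + t)) * (1 + t) `^ b * eps)) (NL t g) ->
 {ae mu, forall y,
  (forall j, cmod (phat (m j) (chirped (m j) t (g j)) y - phat (m j) (g j) y) <= A1 * eps * t `^ (- b)) /\
  (forall j, cmod (phat (m j) (NL t g j) y - (t^-1)%:C * Fz lam nu (fun l => phat (m l) (g l) y) j) <=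
    A2 * rho * eps * (t^-1 * t `^ (- b)))}.
move=> t1 e0 r0 hr [X0 hX] hb [N0 hN]; have t0 : 0 < t := lt_le_trans ltr01 t1.
have K0 := KF_ge0 lam nu; have a0 := A1_ge0.
have hg l : inW s (g l) by have [] := hX l.
have hNw l : inW s (NL t g l) by have [] := hN l.
have P0 := powR_ge0 t (- b).
pose V l y := phat (m l) (chirped (m l) t (g l)) y.
have hV : {ae mu, forall y, forall l, cmod (V l y) <= rho}.
 apply: ae_all3 => l; apply: filterS (Linf_phat hs (hm0 l) t0 (hg l) (hb l)) => y h.
 apply: (letr h); rewrite mulrA ler_pdivrMr; last lra.
 lra.
have hNP := ae_all3 (fun j => NL_profile hs hm hm0 t0 hb hg (hNw j)).
apply: filterS2 hV hNP => y h1 h2.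
have d1 j : cmod (V j y - phat (m j) (g j) y) <= A1 * eps * t `^ (- b).
 by by have [h3 _ h4 _] := hX j; exact: chirp_err.
split=> // j.
have P1 : t `^ (- b) <= 1.
 have /andP[aa0 _] := aexp01 hs.
 by rewrite -[leRHS](powRr0 t); apply: ler_powR => //; lra.
have ha l : cmod (phat (m l) (g l) y) <= 2 * rho.
 have -> : phat (m l) (g l) y = V l y - (V l y - phat (m l) (g l) y) by rewrite opprB addrC subrK.
 apply: (letr (cmodB _ _)).
 have q : A1 * eps * t `^ (- b) <= A1 * eps * 1 by apply: ler_wpM2l => //; exact: mulr_ge0.
 by have := h1 l; have := d1 l; lra.
have hv l : cmod (V l y) <= 2 * rho by have := h1 l; lra.
have f1 : cmod (Fz lam nu (V^~ y) j - Fz lam nu (fun l => phat (m l) (g l) y) j) <= 2 * KF * (2 * rho) * (3 * (A1 * eps * t `^ (- b))).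
 apply: (letr (Fz_lip lam nu j hv ha)); ml; by rewrite sum3; have := d1 i1; have := d1 i2; have := d1 i3; lra.
pose Z := 42 * KF * (rho / (1 + t)) * eps.
have Zt : Z <= 42 * KF * rho * eps * t^-1.
 rewrite /Z -!mulrA; do 3 (apply: ler_wpM2l => //); rewrite mulrC; apply: ler_wpM2l => //.
 by rewrite lef_pV2 ?posrE//; lra.
have Z0 : 0 <= Z by rewrite /Z mulr_ge0// mulr_ge0 ?divr_ge0// ?mulr_ge0//; lra.
have f2 : cmod (phat (m j) (chirped (m j) t (NL t g j)) y - phat (m j) (NL t g j) y) <= A1 * Z * t `^ (- b).
 have [h3 _ h _] := hN j; apply: chirp_err => //; apply: (letr h).
 by apply: eq_ler; rewrite /Z; ring.
rewrite h2 in f2; move: (phat (m j) (NL t g j) y) (Fz _ _ (fun l => phat (m l) (g l) y) j) f1 f2 => N F f1 f2.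
have -> : N - (t^-1)%:C * F = - ((t^-1)%:C * Fz lam nu (V^~ y) j - N) + (t^-1)%:C * (Fz lam nu (V^~ y) j - F) by ring.
apply: (letr (cmodD _ _)); rewrite cmodN [cmod (_ * (_ - F))]cmodM cmod_real gtr0_norm ?invr_gt0//.
have i0 : 0 <= t^-1 by pos.
have g1 : A1 * Z * t `^ (- b) <= A1 * (42 * KF * rho * eps * t^-1) * t `^ (- b).
 by mr; exact: ler_wpM2l.
have g2 := ler_wpM2l i0 f1.
apply: (letr (lerD (letr f2 g1) g2)); rewrite le_eqVlt /A2; apply/orP; left; apply/eqP; ring.
Qed.

Lemma inW_phase th (f : Lsq R) : mfun th -> inW s f ->
 inW s (phase th f) /\ nrm (wt s (phase th f)) = nrm (wt s f).
move=> mth h; have e : {ae mu, forall x, cmod ((bracket s x)%:C * phase th f x) = cmod ((bracket s x)%:C * f x)}.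
 by apply: filterS (phase_ae f mth) => x ->; rewrite !cmodM cmod_cis mul1r.
have h' : inW s (phase th f).
 apply: (L2_le_ae (h := wt s f)); first exact: inW_cmeas.
 by apply: filterS2 e (wt_ae h) => x -> ->.
split=> //; apply/eqP; rewrite eq_le !nrm_le_ae//.
 by apply: filterS2 e (filterI (wt_ae h) (wt_ae h')) => x + [-> ->] => ->.
by apply: filterS2 e (filterI (wt_ae h) (wt_ae h')) => x + [-> ->] => ->.
Qed.

Definition Emb : R := (2 * pi)^-1 * sqrt (Csg s).

Lemma Emb_ge0 : 0 <= Emb.
by rewrite /Emb mulr_ge0// invr_ge0 ltW// pi2_gt0. Qed.
Hint Resolve Emb_ge0 : core.

Lemma bdd_embedding X t g : inXe s X g -> bdd m (Emb * X) t g.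
move=> [X0 hX] l; have [_ h _ hn] := hX l.
have [h1 h2] := inW_phase (measurable_symb (m l) t) h.
have e : Fhat (U (m l) t (g l)) = phase (symb (m l) t) (Fhat (g l)) by rewrite /U FinvK.
have := @Linf_embedding _ s s1 (U (m l) t (g l)); rewrite e => /(_ h1); apply: Linf_le.
rewrite h2 /Emb -mulrA; ml; by ml; by [].
Qed.

Lemma NL_inXe eps t L C g phi : inXe s eps phi -> 0 <= L -> 0 <= C -> bdd m L t g ->
 (forall i, qs m i g <= C * qs m i phi) -> inXe s (W * (42 * KF * L * C * eps)) (NL t g).
move=> hphi L0 C0 hb hq; have K0 := KF_ge0 lam nu.
have L0' : 0 <= 42 * KF * L by pos.
apply: (inXe_transfer hm0 hs _ hphi) => [|i]; first exact: mulr_ge0.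
apply: (letr (NL_qs lam nu hm hm0 i L0 hb)); rewrite -[leRHS]mulrA; exact: ler_wpM2l.
Qed.

(** One step multiplies the seminorm by at most 1 + 42 KF rho eta/(1 + t); smallness of [rho]
    relative to b lets [powR_growth] absorb this factor. *)
Lemma qs_growth (eta rho : R) phi k i : 0 <= eta <= 1 -> 0 <= rho -> 2 * (42 * KF * rho) <= b ->
 let t := k%:R * eta in bdd m (rho / (1 + t)) t (euler eta phi k) ->
 qs m i (euler eta phi k) <= (1 + t) `^ b * qs m i phi ->
 qs m i (euler eta phi k.+1) <= (1 + k.+1%:R * eta) `^ b * qs m i phi.
move=> he r0 hb t hbd hq; have K0 := KF_ge0 lam nu; have /andP[e0 e1] := he.
have t0 : 0 <= t by rewrite mulr_ge0.
have L0 : 0 <= rho / (1 + t) by pos.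
have b0 : 0 <= b by have /andP[h _] := aexp01 hs; rewrite divr_ge0// ltW.
have hN j := NL_qn lam nu hm hm0 i j L0 hbd.
apply: (via ((1 + 42 * KF * rho * (eta / (1 + t))) * qs m i (euler eta phi k))).
 have h j : qn m i j (euler eta phi k.+1 j) <= qn m i j (euler eta phi k j) + eta * (14 * KF * (rho / (1 + t)) * qs m i (euler eta phi k)).
  rewrite /= -scaleNr; apply: (letr (qnD _ _ _ _ _)); rewrite lerD2l qnZ cmodN cmod_im (ger0_norm e0).
  exact: ler_wpM2l.
 rewrite [leLHS]/qs; apply: (letr (ler_sum _ (fun j _ => h j))).
 rewrite big_split /= sumr_const card_ord -/(qs m i (euler eta phi k)) le_eqVlt; apply/orP; left; apply/eqP.
 ring.
have tS : k.+1%:R * eta = t + eta by rewrite -natr1 mulrDl mul1r.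
have f0 : 0 <= 1 + 42 * KF * rho * (eta / (1 + t)).
 by pos.
rewrite tS; apply: (letr (ler_wpM2l f0 hq)); rewrite [leLHS]mulrA; mr; exact: powR_growth.
Qed.

End EulerScheme.
#[local] Hint Resolve Emb_ge0 : core.

(** * Uniform bounds for the scheme *)

Section EulerBounds.
Context {R : realType}.
Variables (lam nu : 'I_3 -> R[i]) (m kap : 'I_3 -> R) (s : R).
Hypothesis hm : m i1 + m i2 = m i3.
Hypothesis hm0 : forall j, m j != 0.
Hypothesis hs : 1 < s < 2.
Hypothesis kap0 : forall j, 0 < kap j.
Implicit Types (g phi : 'I_3 -> Lsq R) (x y : plane R).

Local Notation KF := (KF lam nu).
Local Notation NL := (NL lam nu m).
Local Notation W := (CW m s).
Local Notation a := (aexp s).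
Local Notation b := (aexp s / 2).
Local Notation euler := (euler lam nu m).
Local Notation A1 := (A1 m s).
Local Notation A2 := (A2 lam nu m s).
Local Notation Cpm := (Cpm m s).

Let W0 : 0 <= W. Proof. exact: letr ler01 (CW_ge1 m hs). Qed.

Section LargeTime.
Variables (rho eps eta c d C : R) (phi : 'I_3 -> Lsq R) (k0 : nat).
Hypotheses (eta0 : 0 < eta) (eta1 : eta <= 1) (hk0 : k0%:R * eta = 1).
Hypotheses (eps0 : 0 <= eps) (rho0 : 0 <= rho) (rho1 : rho <= 1) (A1r : A1 * eps <= rho).
Hypotheses (c0 : 0 < c) (C1 : 1 <= C).
Hypothesis hstep : forall z (h : R), 0 <= h <= 1 -> kn kap z <= d ->
 kn kap (fun j => z j - (0 +i* h) * Fz lam nu z j) <= kn kap z - c * h * kn kap z ^+ 2.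
Hypothesis hC1 : forall z j, cmod (z j) <= C * kn kap z.
Hypothesis hC2 : forall z (e : R), 0 <= e -> (forall j, cmod (z j) <= e) -> kn kap z <= C * e.
Hypothesis hphi : inXe s eps phi.

Local Notation t k := (k%:R * eta).
Local Notation ge k := (euler eta phi k).

Variable k : nat.
Hypothesis k0k : (k0 <= k)%N.
Hypothesis hbd : forall i, (i < k)%N -> bdd m (rho / (1 + t i)) (t i) (ge i).
Hypothesis hq : forall i, (i <= k)%N -> forall q, qs m q (ge i) <= (1 + t i) `^ b * qs m q phi.

(** [Y0] bounds the energy norm of the profile at time 1 and [K1] is the coefficient of the
    integrable error. Both are linear in [eps], which makes the smallness condition [Yd]
    attainable. *)
Definition Y0 : R := 2 * C * Cpm * W * eps.
Definition K1 : R := C * A2 * eps.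
Hypothesis Yd : Y0 + 4 / b * K1 <= d.
Let b01 : 0 < b <= 1.
by have /andP[h1 h2] := aexp01 hs; apply/andP; split; lra. Qed.
Let K10 : 0 <= K1.
by rewrite /K1 mulr_ge0// mulr_ge0 ?A2_ge0// (letr ler01). Qed.
Let eX i : (i <= k)%N -> inXe s (W * ((1 + t i) `^ b * eps)) (ge i).
by move=> h; apply: (inXe_transfer hm0 hs (powR_ge0 _ _) hphi); exact: hq. Qed.
Let eW i l : (i <= k)%N -> inW s (ge i l).
by move=> /eX[_ /(_ l)[]]. Qed.

Let eN i : (i < k)%N -> inXe s (W * (42 * KF * (rho / (1 + t i)) * (1 + t i) `^ b * eps)) (NL (t i) (ge i)).
move=> h; have t0 : 0 <= t i by pos.
apply: (NL_inXe lam nu hm hm0 hs hphi _ _ (hbd h) (hq (ltnW h))); last exact: powR_ge0.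
by pos.
Qed.

Let t1 i : (k0 <= i)%N -> 1 <= t i.
by move=> h; rewrite -[leLHS]hk0 ler_wpM2r ?ler_nat// ltW. Qed.
Let al y i (j : 'I_3) : R[i] := phat (m j) (ge i j) y.

Let al0 y : kn kap (al y k0) <= Y0.
have C0 : 0 <= C := letr ler01 C1; have P0 := Cpm_ge0 m s.
rewrite /Y0 (_ : 2 * C * Cpm * W * eps = C * (2 * (Cpm * W * eps))); last by ring.
apply: hC2 => [|j]; first by pos.
have [_ /(_ j)[h _ hn _]] := eX k0k.
apply: (letr (phat_le hs (m j) y h)).
have -> : 2 * (Cpm * W * eps) = Cpm * (W * (2 * eps)) by ring.
apply: ler_pM; [exact: Cp_ge0|exact: nrm_ge0|exact: Cp_le|].
apply: (letr hn); rewrite hk0; ml; apply: ler_wpM2r => //.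
have /andP[b0 b1] := b01; rewrite -[leRHS]powRr1//; have -> : 1 + 1 = 2 :> R by ring.
by apply: ler_powR => //; rewrite ler1n.
Qed.

Let al_step y i : (k0 <= i < k)%N -> kn kap (al y i) <= d ->
 (forall j, cmod (phat (m j) (NL (t i) (ge i) j) y - ((t i)^-1)%:C * Fz lam nu (al y i) j) <=
    A2 * rho * eps * ((t i)^-1 * t i `^ (- b))) ->
 kn kap (al y i.+1) <= kn kap (al y i) - c * (eta / t i) * kn kap (al y i) ^+ 2 +
   eta * K1 * ((t i)^-1 * (t i) `^ (- b)).
move=> /andP[h1 h2] hd hN; have ti := t1 h1; have ti0 : 0 < t i := lt_le_trans ltr01 ti.
have C0 : 0 <= C := letr ler01 C1.
have h01 : 0 <= eta / t i <= 1.
 by rewrite divr_ge0 ?(ltW eta0) ?(ltW ti0)//= ler_pdivrMr// mul1r (letr eta1).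
(* A step of size eta for the profile is a step of size eta/t for the equation of alpha without its
   factor 1/t, perturbed by [e]. *)
pose e j := - (0 +i* eta) * (phat (m j) (NL (t i) (ge i) j) y - ((t i)^-1)%:C * Fz lam nu (al y i) j).
have -> : al y i.+1 = (fun j => (al y i j - (0 +i* (eta / t i)) * Fz lam nu (al y i) j) + e j).
 apply/funext => j; rewrite /al /= (phat_step hs); last 2 first.
 - by apply: eW; exact: ltnW.
 - by have [_ /(_ j)[]] := eN h2.
 rewrite /e -/(al y i j); move: (phat _ _ y) (al y i j) (Fz _ _ _ _) => N z F.
 have -> : 0 +i* (eta / t i) = (0 +i* eta) * ((t i)^-1)%:C.
  by apply: complex_eq; rewrite ?ReM ?ImM /=; ring.
 ring.
apply: (letr (knD kap0 _ _)); apply: lerD; first by exact: (hstep h01 hd).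
have P0 := powR_ge0 (t i) (- b); have i0 : 0 <= (t i)^-1 by pos.
have A20 := A2_ge0 lam nu m hs.
pose E := eta * (A2 * rho * eps * ((t i)^-1 * t i `^ (- b))).
apply: (via (C * E)).
 apply: hC2 => [|j].
  by rewrite /E; apply: mulr_ge0; [exact: ltW|apply: mulr_ge0; [rewrite mulr_ge0// mulr_ge0|exact: mulr_ge0]].
 rewrite /e cmodM cmodN cmod_im ger0_norm ?(ltW eta0)//; apply: ler_wpM2l (hN j); exact: ltW.
have -> : C * E = (C * A2 * eps * eta * ((t i)^-1 * t i `^ (- b))) * rho by rewrite /E; ring.
have -> : eta * K1 * ((t i)^-1 * t i `^ (- b)) = (C * A2 * eps * eta * ((t i)^-1 * t i `^ (- b))) * 1 by rewrite /K1; ring.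
apply: ler_wpM2l => //; apply: mulr_ge0; last exact: mulr_ge0.
by pos.
Qed.

Lemma large_time : {ae mu, forall y, forall j,
 cmod (phat (m j) (chirped (m j) (t k) (ge k j)) y) <= C * (Y0 + 4 / b * K1) + A1 * eps * t k `^ (- b) /\
 cmod (phat (m j) (chirped (m j) (t k) (ge k j)) y) <=
  C * (Mdecay c b K1 Y0 / ln (2 + t k)) + A1 * eps * t k `^ (- b)}.
have C0 : 0 <= C := letr ler01 C1.
(* One null set serves all steps i < k, so the recursion can be run at a fixed point y. *)
have hae : {ae mu, forall y, forall i, (k0 <= i < k)%N -> forall j,
  cmod (phat (m j) (NL (t i) (ge i) j) y - ((t i)^-1)%:C * Fz lam nu (al y i) j) <=
    A2 * rho * eps * ((t i)^-1 * t i `^ (- b))}.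
 apply/ae_foralln => i; have [/andP[h1 h2]|h] := boolP (k0 <= i < k)%N; last first.
  by apply: aeW => y.
 by apply: filterS (profile_estimates hm hm0 hs (t1 h1) eps0 rho0 A1r (eX (ltnW h2)) (hbd h2) (eN h2)) => y [_ hN] _.
apply: filterS hae => y hy j.
have hst i : (k0 <= i < k)%N -> kn kap (al y i) <= d ->
 kn kap (al y i.+1) <= kn kap (al y i) - c * (eta / t i) * kn kap (al y i) ^+ 2 +
   eta * K1 * ((t i)^-1 * (t i) `^ (- b)).
 by move=> h hd; apply: al_step => //; exact: hy.
have kk : (k0 <= k <= k)%N by rewrite k0k leqnn.
have B1 := @seq_bounded R c d b K1 Y0 eta (fun i => kn kap (al y i)) k0 k c0 b01 K10 eta0 eta1 hk0 (al0 y) Yd hst k kk.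
have B2 := @seq_decay R c d b K1 Y0 eta (fun i => kn kap (al y i)) k0 k c0 b01 K10 eta0 eta1 hk0 (fun i => kn_ge0 _ _) (al0 y) Yd hst k kk.
have [_ /(_ j)[h _ hn _]] := eX (leqnn k).
have D := chirp_err hs j y (t1 k0k) h eps0 hn.
have hz := hC1 (al y k) j.
have T : cmod (phat (m j) (chirped (m j) (t k) (ge k j)) y) <= C * kn kap (al y k) + A1 * eps * t k `^ (- b).
 have -> : phat (m j) (chirped (m j) (t k) (ge k j)) y = al y k j + (phat (m j) (chirped (m j) (t k) (ge k j)) y - al y k j).
  ring.
 apply: (letr (cmodD _ _)); exact: lerD.
nra.
Qed.

End LargeTime.
Hypothesis hdiss : forall j, Im (lam j) < 0.
Hypothesis hkap : (kap i1)%:C * nu i1 + (kap i2)%:C * nu i2 = (kap i3)%:C * conjc (nu i3).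

Let a01 := aexp01 hs.

Lemma small_constant (A B : R) : 0 <= A -> 0 < B -> exists2 e : R, 0 < e & forall p : R, p <= e -> 0 <= p -> A * p <= B.
move=> A0 B0; exists (B / (A + 1)); first by apply: divr_gt0 => //; lra.
move=> p; rewrite ler_pdivlMr ?ltr_wpDl// => h p0; apply: letr h.
lra.
Qed.

Lemma powR_small (t : R) : 0 <= t <= 1 -> (1 + t) `^ b <= 2.
move=> /andP[t0 t1]; have /andP[b0 b1] := a01.
apply: (via (2 `^ b)); last by rewrite -[leRHS]powRr1//; apply: ler_powR; lra.
by apply: ge0_ler_powR; rewrite ?nnegrE; lra.
Qed.

Lemma half_le (t r : R) : 0 <= r -> 0 <= t <= 1 -> r / 2 <= r / (1 + t).
by move=> r0 /andP[t0 t1]; ml; rewrite lef_pV2 ?posrE; lra. Qed.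
Lemma ln_le4 (t : R) : 0 <= t <= 1 -> ln (2 + t) <= 4.
by move=> /andP[t0 t1]; apply: (letr (ln_le_sub1 _)); lra. Qed.
Lemma quot_small (r t : R) : 0 <= r -> 1 <= t -> r / 2 / t <= r / (1 + t).
by move=> r0 t1; rewrite -mulrA; ml; rewrite -invfM lef_pV2 ?posrE; lra. Qed.

Lemma quot_ln1 (r C l t : R) : 0 <= r -> 0 <= C -> 0 < l -> 1 <= t ->
 C / l / t <= (4 * r + 2 * C) / ((1 + t) * l).
move=> r0 C0 l0 t1; have t0 : 0 < t by lra.
rewrite ler_pdivlMr; last by rewrite mulr_gt0//; lra.
have -> : C / l / t * ((1 + t) * l) = C * ((1 + t) / t) by field; rewrite !gt_eqF.
have : C * ((1 + t) / t) <= C * 2 by ml; rewrite ler_pdivrMr//; lra.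
lra.
Qed.

Lemma quot_ln0 (r C l t : R) : 0 <= r -> 0 <= C -> 0 < l <= 4 -> 0 <= t ->
 r / (1 + t) <= (4 * r + 2 * C) / ((1 + t) * l).
move=> r0 C0 /andP[l0 l4] t0; rewrite ler_pdivlMr; last by rewrite mulr_gt0//; lra.
have -> : r / (1 + t) * ((1 + t) * l) = r * l by field; lra.
nra.
Qed.

Lemma decay_const (C M A l p : R) : 0 <= A -> 0 <= p -> 0 < l -> 2 / 3 <= l -> l ^+ 2 * p <= 12 / b ^+ 2 ->
 C * (M / l) + A * p <= (C * M + A * (18 / b ^+ 2)) / l.
move=> A0 p0 l0 l23 hl; have /andP[b0 b1] := a01.
rewrite ler_pdivlMr//.
have -> : (C * (M / l) + A * p) * l = C * M + A * (l * p) by field; lra.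
(* As l >= 2/3, the product l p is at most 3/2 of l^2 p, which explains 18 in place of 12. *)
rewrite lerD2l; apply: ler_wpM2l => //.
nra.
Qed.

(** A discrete bootstrap: sup bounds before step k give the growth of the seminorms up to k, and
    growth together with the profile recursion returns the sup bound at step k with the same
    constant [K], fixed before [eps]. *)
Theorem euler_bounds : exists eps1 K : R, [/\ 0 < eps1, 0 < K & forall eps : R, 0 < eps <= eps1 ->
 exists2 C1 : R, 0 < C1 & forall phi, inXe s eps phi -> forall (eta : R) (k0 : nat),
  0 < eta <= 1 -> k0%:R * eta = 1 -> forall k, let t := k%:R * eta in
  [/\ bdd m (K * eps / (1 + t)) t (euler eta phi k),
    forall i, qs m i (euler eta phi k) <= (1 + t) `^ b * qs m i phi &
    bdd m (C1 / ((1 + t) * ln (2 + t))) t (euler eta phi k)]].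
have [c [d [c0 d0 hstep]]] := kn_step hdiss kap0 hkap; have [C C1 [hC1 hC2]] := kn_bounds kap0.
have C0 : 0 < C := lt_le_trans ltr01 C1.
have E0 := Emb_ge0 s; have P0 := Cpm_ge0 m s; have a10 := A1_ge0 m hs; have a20 := A2_ge0 lam nu m hs.
have K0 := KF_ge0 lam nu; have /andP[a0 a1] := a01.
have b0 : 0 < b by pos.
pose A3 := 2 * C * Cpm * W + 4 / b * (C * A2).
have A30 : 0 <= A3.
 rewrite /A3; apply: addr_ge0; first by pos.
 by pos.
(* The summand 4 Emb W serves times up to 1, [A1] the hypothesis A1 eps <= rho, and the last one the
   profile bound after time 1. Smallness of [eps] then gives rho <= 1, the bound A3 eps <= d and a
   growth exponent within b. *)
pose K := 1 + 4 * Emb s * W + A1 + 2 * (C * A3 + A1).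
have EW : 0 <= Emb s * W by pos.
have CA : 0 <= C * A3 by pos.
have Kge1 : 1 <= K by rewrite /K; lra.
have [ea ea0 hea] := @small_constant K 1 (letr ler01 Kge1) ltr01.
have [eb eb0 heb] := @small_constant A3 d A30 d0.
have [ec ec0 hec] := @small_constant (84 * KF * K) b (mulr_ge0 (mulr_ge0 (ler0n R 84) K0) (letr ler01 Kge1)) b0.
exists (Num.min ea (Num.min eb ec)), K; split; [by rewrite !lt_min ea0 eb0|exact: lt_le_trans Kge1|].
move=> eps; rewrite !le_min => /andP[eps0 /and3P[/hea ha /heb hb /hec hc]].
have {ha}ha := ha (ltW eps0); have {hb}hb := hb (ltW eps0); have {hc}hc := hc (ltW eps0).
pose rho := K * eps; pose yY := 2 * C * Cpm * W * eps; pose kK := C * A2 * eps.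
have rho0 : 0 < rho by rewrite mulr_gt0// (lt_le_trans ltr01).
have A1r : A1 * eps <= rho.
 by apply: ler_wpM2r; [exact: ltW|rewrite /K; lra].
have kK0 : 0 <= kK by rewrite mulr_ge0 ?(ltW eps0)// mulr_ge0// ltW.
have yY0 : 0 <= yY by rewrite mulr_ge0 ?(ltW eps0)// mulr_ge0// mulr_ge0// mulr_ge0// ltW.
have YE : yY + 4 / b * kK = A3 * eps by rewrite /yY /kK /A3; ring.
pose M := Mdecay c b kK yY.
have M0 : 0 <= M.
 have q1 : 0 <= 8 / c by pos.
 have q2 : 0 <= 12 / b ^+ 2 * kK by pos.
 by rewrite /M /Mdecay; move: (8 / c) (_ / _ * kK) q1 q2 => q1 q2 *; lra.
pose C2 := C * M + A1 * eps * (18 / b ^+ 2).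
have C20 : 0 <= C2.
 rewrite /C2; apply: addr_ge0; first by pos.
 by pos.
exists (4 * rho + 2 * C2); first by rewrite ltr_wpDr ?mulr_ge0// mulr_gt0.
move=> phi hphi eta k0 /andP[eta0 eta1] hk0.
have growth k := @qs_growth R lam nu m s hm hm0 hs eta rho phi k.
have e01 : 0 <= eta <= 1 by rewrite ltW.
have hc' : 2 * (42 * KF * rho) <= b by move: hc; rewrite /rho; lra.
have t0 k : 0 <= k%:R * eta by pos.
have lnpos (t : R) : 0 <= t -> 0 < ln (2 + t) by move=> h; apply: ln_gt0; lra.
(* The hypotheses are asymmetric on purpose: sup bounds strictly before k already give the seminorm
   growth at k, which the sup bound at k needs. *)
suff main k : (forall i, (i < k)%N -> bdd m (rho / (1 + i%:R * eta)) (i%:R * eta) (euler eta phi i)) ->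
  (forall i, (i <= k)%N -> forall q, qs m q (euler eta phi i) <= (1 + i%:R * eta) `^ b * qs m q phi) ->
  bdd m (rho / (1 + k%:R * eta)) (k%:R * eta) (euler eta phi k) /\
  bdd m ((4 * rho + 2 * C2) / ((1 + k%:R * eta) * ln (2 + k%:R * eta))) (k%:R * eta) (euler eta phi k).
 have all k : (forall i, (i < k)%N -> bdd m (rho / (1 + i%:R * eta)) (i%:R * eta) (euler eta phi i)) /\
   (forall i, (i <= k)%N -> forall q, qs m q (euler eta phi i) <= (1 + i%:R * eta) `^ b * qs m q phi).
  elim: k => [|k [h1 h2]].
   split=> // i; rewrite leqn0 => /eqP -> q.
   by rewrite mul0r addr0 powR1 mul1r.
  have h3 := (main k h1 h2).1.
  split=> i; first by rewrite ltnS leq_eqVlt => /predU1P[->//|]; exact: h1.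
  rewrite leq_eqVlt => /predU1P[-> q|]; last by rewrite ltnS; exact: h2.
  by apply: growth => //; [exact: ltW|exact: h2].
 by move=> k t; have [h1 h2] := all k; have [h3 h4] := main k h1 h2; split=> //; exact: h2.
move=> hbd hq; have tk0 := t0 k.
(* Up to time 1 the Sobolev embedding suffices; the profile argument needs t >= 1, since t^(-b) is
   singular at 0. *)
have [kk0|kk0] := leqP k k0.
 have t1 : k%:R * eta <= 1 by rewrite -[leRHS]hk0 ler_wpM2r ?ler_nat// ltW.
 have X : inXe s (W * (2 * eps)) (euler eta phi k).
  apply: (inXe_transfer hm0 hs _ hphi) => // i; apply: (letr (hq k (leqnn k) i)).
  apply: ler_wpM2r; first exact: qs_ge0.
  by apply: powR_small; rewrite tk0.
 have B := bdd_embedding m hs (k%:R * eta) X.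
 have le1 : Emb s * (W * (2 * eps)) <= rho / 2.
  have -> : Emb s * (W * (2 * eps)) = (4 * (Emb s * W)) * eps / 2 by field.
  apply: ler_wpM2r; first by pos.
  by apply: ler_wpM2r; [exact: ltW|rewrite /K; lra].
 have le2 : rho / 2 <= rho / (1 + k%:R * eta).
  by apply: half_le; [exact: ltW|rewrite tk0].
 split=> l; first by apply: Linf_le (B l); exact: letr le1 le2.
 apply: Linf_le (B l); apply: (letr le1); apply: (letr le2).
 have l0 := lnpos _ tk0; have l2 : ln (2 + k%:R * eta) <= 4 by apply: ln_le4; rewrite tk0.
 by apply: quot_ln0 => //; [exact: ltW|rewrite l0].
have k0k := ltnW kk0; have tk1 : 1 <= k%:R * eta by rewrite -[leLHS]hk0 ler_wpM2r ?ler_nat// ltW.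
have Yd : yY + 4 / b * kK <= d by rewrite YE.
have L := @large_time rho eps eta c d C phi k0 eta0 eta1 hk0 (ltW eps0) (ltW rho0) ha A1r c0 C1 hstep hC1 hC2 hphi k k0k hbd hq Yd.
have hW l : inW s (euler eta phi k l).
 by have [_ /(_ l)[]] := inXe_transfer hm0 hs (powR_ge0 _ _) hphi (hq k (leqnn k)).
have tpos : 0 < k%:R * eta := lt_le_trans ltr01 tk1.
have lt0 := lnpos _ tk0; have hl := ln_sqr_powR tk1 (_ : 0 < b <= 1).
have {hl}hl : ln (2 + k%:R * eta) ^+ 2 * (k%:R * eta) `^ (- b) <= 12 / b ^+ 2 by apply: hl; rewrite b0; lra.
have l23 : 2 / 3 <= ln (2 + k%:R * eta) by exact: ln_ge23.
have p0 := powR_ge0 (k%:R * eta) (- b).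
have p1 : (k%:R * eta) `^ (- b) <= 1.
 by rewrite -[leRHS](powRr0 (k%:R * eta)); apply: ler_powR => //; rewrite oppr_le0 ltW.
have B1 : {ae mu, forall y, forall l, cmod (phat (m l) (chirped (m l) (k%:R * eta) (euler eta phi k l)) y) <= rho / 2}.
 apply: filterS L => y hy l; have [h _] := hy l; apply: (letr h).
 rewrite /Y0 /K1 -/yY -/kK YE.
 have : A1 * eps * (k%:R * eta) `^ (- b) <= A1 * eps * 1 by apply: ler_wpM2l => //; rewrite mulr_ge0// ltW.
 have : 2 * (C * A3 + A1) * eps <= rho by mr; rewrite /K; lra.
 lra.
have B2 : {ae mu, forall y, forall l, cmod (phat (m l) (chirped (m l) (k%:R * eta) (euler eta phi k l)) y) <= C2 / ln (2 + k%:R * eta)}.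
 apply: filterS L => y hy l; have [_ h] := hy l; apply: (letr h).
 by rewrite /Y0 /K1 -/yY -/kK -/M; apply: decay_const => //; rewrite mulr_ge0// ltW.
split=> l.
- have h : {ae mu, forall y, cmod (phat (m l) (chirped (m l) (k%:R * eta) (euler eta phi k l)) y) <= rho / 2}.
  by apply: filterS B1 => y.
 apply: Linf_le (phat_Linf hs (hm0 l) tpos (hW l) h).
 by apply: quot_small => //; exact: ltW.
- have h : {ae mu, forall y, cmod (phat (m l) (chirped (m l) (k%:R * eta) (euler eta phi k l)) y) <= C2 / ln (2 + k%:R * eta)}.
  by apply: filterS B2 => y.
 apply: Linf_le (phat_Linf hs (hm0 l) tpos (hW l) h).
 by apply: quot_ln1 => //; exact: ltW.
Qed.

End EulerBounds.

(** * The L^2 distance of triples *)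

Section TripleDistance.
Context {R : realType}.
Implicit Types g h : 'I_3 -> Lsq R.

Definition td g h : R := \sum_l nrm (g l - h l).
Lemma td_ge0 g h : 0 <= td g h.
by apply: sumr_ge0 => l _; exact: nrm_ge0. Qed.
Lemma tdxx g : td g g = 0.
by apply: big1 => l _; rewrite subrr nrm0. Qed.
Lemma tdC g h : td g h = td h g.
by apply: eq_bigr => l _; rewrite nrmBC. Qed.

Lemma td_tri h g k : td g k <= td g h + td h k.
rewrite /td -big_split; apply: ler_sum => l _.
have -> : g l - k l = (g l - h l) + (h l - k l) by rewrite addrA subrK.
exact: nrmD.
Qed.

Lemma td_coord j g h : nrm (g j - h j) <= td g h.
by apply: (le_sum3 (F := fun l => nrm (g l - h l))) => l; by []. Qed.
Lemma td_le (B : R) g h : (forall l, nrm (g l - h l) <= B) -> td g h <= 3 * B.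
by move=> H; rewrite /td sum3; have := H i1; have := H i2; have := H i3; lra. Qed.

Lemma td_eq0 g h : td g h <= 0 -> g = h.
move=> H; apply/funext => l; apply/eqP; rewrite -subr_eq0; apply/eqP/nrm_eq0/eqP.
by rewrite eq_le nrm_ge0 andbT (letr (td_coord l g h)).
Qed.

End TripleDistance.

(** * Hölder continuity in time of the interaction term *)

Section TimeRegularity.
Context {R : realType}.
Variables (lam nu : 'I_3 -> R[i]) (m : 'I_3 -> R) (s : R).
Hypothesis hm : m i1 + m i2 = m i3.
Hypothesis hm0 : forall j, m j != 0.
Hypothesis hs : 1 < s < 2.
Implicit Types (g h : 'I_3 -> Lsq R) (a : Lsq R).

Local Notation KF := (KF lam nu).
Local Notation NL := (NL lam nu m).
Local Notation W := (CW m s).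

Let W0 : 0 <= W. Proof. exact: letr ler01 (CW_ge1 m hs). Qed.
Definition CU (mj : R) : R := 2 * sqrt (`|2 * mj|^-1).
Lemma CU_ge0 mj : 0 <= CU mj. Proof. by rewrite mulr_ge0. Qed.

(** The phases at two times differ by a multiple of (t - t')|xi|^2; estimating with exponent 1/2
    costs one power of the weight, which s > 1 affords. *)
Lemma U_holder (mj t t' : R) a : inW s (Fhat a) ->
 nrm (U mj t a - U mj t' a) <= CU mj * sqrt `|t - t'| * nrm (wt s (Fhat a)).
move=> h; pose b := Fhat a; rewrite -nrm_Fhat FhatB /U !FinvK -/b.
have s1 : 1 <= s by case/andP: hs => /ltW.
have [h1 le1] : inW 1 b /\ nrm (wt 1 b) <= nrm (wt s b) by exact: inW_le.
have c0 : 0 <= CU mj * sqrt `|t - t'| by rewrite mulr_ge0 ?CU_ge0.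
apply: letr (ler_wpM2l c0 le1).
have -> : CU mj * sqrt `|t - t'| * nrm (wt 1 b) = nrm ((CU mj * sqrt `|t - t'|)%:C *: wt 1 b).
 by rewrite nrmZ cmod_real (ger0_norm c0).
apply: nrm_le_ae.
apply: filterS2 (fnB (phase (symb mj t) b) (phase (symb mj t') b)) (filterI (fnZ (CU mj * sqrt `|t - t'|)%:C (wt 1 b))
 (filterI (wt_ae h1) (filterI (phase_ae b (measurable_symb mj t)) (phase_ae b (measurable_symb mj t'))))) => x -> [-> [-> [-> ->]]].
rewrite -mulrBl !cmodM mulrA; mr; have -> : cis (symb mj t x) - cis (symb mj t' x) = cis (symb mj t' x) * (cis (symb mj t x - symb mj t' x) - 1).
 by rewrite mulrBr mulr1 -cisD [symb mj t' x + _]addrC subrK.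
rewrite cmodM cmod_cis mul1r.
have h01 : 0 <= (2^-1 : R) <= 1 by lra.
apply: (letr (cis_sub1_le _ h01)).
rewrite !cmod_real (ger0_norm c0) (gtr0_norm (bracket_gt0 _ _)).
have -> : symb mj t x - symb mj t' x = - ((t - t') * (2 * mj)^-1 * dot x x) by rewrite /symb; ring.
rewrite normrN !normrM powR12_sqrt ?mulr_ge0// !sqrtrM ?mulr_ge0//.
rewrite /CU normfV [sqrt `|t - t'| * _]mulrC -!mulrA; do 3 (ml; try exact: sqrtr_ge0).
rewrite (ger0_norm (dot_ge0 x)) -powR12_sqrt//; have := @dotpow_le R x (2^-1); rewrite mulfV ?pnatr_eq0//.
by pos.
Qed.

Lemma NL_inXe1 X t g : inXe s X g -> inXe s (W * (42 * KF * (Emb s * X) * 1 * X)) (NL t g).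
move=> h; have [X0 _] := h; apply: (NL_inXe lam nu hm hm0 hs h _ ler01).
- by pos.
- exact: bdd_embedding.
- by move=> i; rewrite mul1r.
Qed.

Definition CN (X : R) : R := 6 * KF * (Emb s * X) * (1 + (\sum_l CU (m l)) * X) +
 (\sum_l CU (m l)) * (W * (42 * KF * (Emb s * X) * 1 * X)).

Lemma CN_ge0 X : 0 <= X -> 0 <= CN X.
move=> X0; have K0 := KF_ge0 lam nu; have E0 := Emb_ge0 s.
have S0 : 0 <= \sum_l CU (m l) by apply: sumr_ge0 => l _; exact: CU_ge0.
have EX : 0 <= Emb s * X by pos.
rewrite /CN; apply: addr_ge0.
 by apply: mulr_ge0; [apply: mulr_ge0 => //; exact: mulr_ge0|rewrite addr_ge0// mulr_ge0].
by apply: mulr_ge0 => //; apply: mulr_ge0 => //; rewrite mulr1; apply: mulr_ge0 => //; apply: mulr_ge0 => //; exact: mulr_ge0.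
Qed.

Lemma NL_holder X t t' g g' j : inXe s X g -> inXe s X g' ->
 nrm (NL t g j - NL t' g' j) <= CN X * (sqrt `|t - t'| + td g g').
move=> hg hg'; have [X0 hX'] := hg'; have K0 := KF_ge0 lam nu; have E0 := Emb_ge0 s.
have S0 : 0 <= \sum_l CU (m l) by apply: sumr_ge0 => l _; exact: CU_ge0.
pose L := Emb s * X; have L0 : 0 <= L by exact: mulr_ge0.
have b1 := bdd_embedding m hs t hg; have b2 := bdd_embedding m hs t hg'; have b3 := bdd_embedding m hs t' hg'.
have r0 : 0 <= sqrt `|t - t'| by pos.
have n1 : nrm (NL t g j - NL t g' j) <= 2 * KF * L * td g g' by exact: nrm_NL_lip.
have [_ /(_ j)[_ hN _ nN]] := NL_inXe1 t hg'.
set Z := W * _ in nN.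
have n2 : nrm (NL t g' j - U (m j) (t - t') (NL t g' j)) <= (\sum_l CU (m l)) * sqrt `|t - t'| * Z.
 rewrite nrmBC -{2}(U0 (m j) (NL t g' j)); apply: (letr (U_holder _ _ _ hN)); rewrite subr0.
 apply: ler_pM; rewrite ?nrm_ge0 ?mulr_ge0 ?CU_ge0//; apply: ler_wpM2r => //.
 by apply: (le_sum3 (F := fun l => CU (m l))) => l; exact: CU_ge0.
have n3 : nrm (U (m j) (t - t') (NL t g' j) - NL t' g' j) <= 2 * KF * L * ((\sum_l CU (m l)) * sqrt `|t - t'| * X).
 have -> : U (m j) (t - t') (NL t g' j) = U (m j) (- t') (FL lam nu (fun l => U (m l) t (g' l)) j).
  by rewrite (_ : NL t g' j = U (m j) (- t) (FL lam nu (fun l => U (m l) t (g' l)) j))// Uadd; congr U; ring.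
 rewrite -UB nrm_U; apply: (letr (nrm_FL_lip lam nu j L0 b2 b3)).
 ml; rewrite !mulr_suml; apply: ler_sum => l _; have [_ h _ hn] := hX' l.
 apply: (letr (U_holder _ _ _ h)); apply: ler_wpM2l => //.
 by rewrite mulr_ge0 ?CU_ge0.
(* Three changes in turn: of the profile, of the time in the outer propagator, of the time in the
   inner ones. *)
have -> : NL t g j - NL t' g' j = (NL t g j - NL t g' j) + ((NL t g' j - U (m j) (t - t') (NL t g' j)) + (U (m j) (t - t') (NL t g' j) - NL t' g' j)).
 by move: (NL _ _ _) (NL _ _ _) (NL _ _ _) (U _ _ _) => *; rewrite !addrA !subrK.
apply: (letr (nrmD _ _)); apply: (letr (lerD n1 (letr (nrmD _ _) (lerD n2 n3)))).
have d0 := td_ge0 g g'; rewrite /CN -/L -/Z.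
have Z0 : 0 <= Z by exact: letr (nrm_ge0 _) nN.
move: (\sum_l _) (sqrt _) (td g g') S0 r0 d0 {n1 n2 n3 hX' hg hg' b1 b2 b3 nN hN} => S r d S0 r0 d0.
have p1 : 0 <= KF * L by pos.
have p2 : 0 <= KF * L * d by pos.
have p3 : 0 <= KF * L * r by pos.
have p4 : 0 <= S * X * (KF * L * d) by pos.
have p5 : 0 <= S * X * (KF * L * r) by pos.
have p6 : 0 <= S * Z * d by pos.
lra.
Qed.

Lemma NL_bound X t g j : inXe s X g -> nrm (NL t g j) <= W * (42 * KF * (Emb s * X) * 1 * X).
by move=> h; have [_ /(_ j)[h1 _ h2 _]] := NL_inXe1 t h; apply: letr h2; exact: (nrm_wt hs). Qed.

End TimeRegularity.

(** * Geometric rates of convergence *)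

Section GeometricRates.
Context {R : realType}.

(** The interaction is only Hölder continuous of exponent 1/2 in time, so schemes with steps 2^-n
    converge at the rate sqrt (2^-n), which is qq^n. *)
Definition qq : R := sqrt 2^-1.
Lemma qq_gt0 : 0 < qq. Proof. by rewrite sqrtr_gt0. Qed.
Lemma qq_sqr : qq ^+ 2 = 2^-1. Proof. by rewrite sqr_sqrtr. Qed.

Lemma qq_lt1 : qq < 1.
rewrite ltNge; apply/negP => h; have := sqr_le2 ler01 h.
by rewrite qq_sqr expr1n; lra.
Qed.

Lemma qqn_gt0 n : 0 < qq ^+ n. Proof. by rewrite exprn_gt0// qq_gt0. Qed.
Lemma qqn_le1 n : qq ^+ n <= 1.
by apply: exprn_ile1; [exact: ltW qq_gt0|exact: ltW qq_lt1]. Qed.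
Lemma qqn_sqrt n : sqrt (2^-1 ^+ n) = qq ^+ n.
by rewrite -qq_sqr -exprM mulnC exprM sqrtr_sqr ger0_norm// ltW// qqn_gt0. Qed.
Lemma half_le_qqn n : 2^-1 ^+ n <= qq ^+ n.
by rewrite -qq_sqr -exprM mulnC exprM expr2 ler_piMr ?qqn_le1// ltW// qqn_gt0. Qed.

Lemma le_qqn_lim (x y K : R) : (forall n, x <= y + K * qq ^+ n) -> x <= y.
move=> h; have [//|lt] := leP x y.
have c : (fun n => K * qq ^+ n) @ \oo --> (0 : R).
 rewrite -[X in _ --> X](mulr0 K); apply: cvgM; first exact: cvg_cst.
 by apply: cvg_expr; rewrite ger0_norm ?qq_lt1// ltW// qq_gt0.
move/cvgrPdist_lt: c => /(_ (x - y)); rewrite subr_gt0 => /(_ lt)[n _ /(_ n (leqnn n))] /=.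
by rewrite sub0r normrN => h1; have := h n; have := ler_norm (K * qq ^+ n); lra.
Qed.

Lemma nrm_tri (b a c : Lsq R) : nrm (a - c) <= nrm (a - b) + nrm (b - c).
by have -> : a - c = (a - b) + (b - c); [rewrite addrA subrK|exact: nrmD]. Qed.
Lemma sub_rearrange (p r u v w : Lsq R) : p - (u + u) - (r - v - w) = (p - r) - ((u - v) + (u - w)).
by rewrite -(addrA r) (addrACA u (- v)) (opprD r) (opprD (u + u)) addrACA. Qed.

Lemma limit_rearrange (x1 x2 x3 x4 x5 x6 : Lsq R) :
 x1 - x2 + x6 = (x3 - x4 + x5) + ((x1 - x3) - (x2 - x4) - (x5 - x6)).
rewrite (_ : (x1 - x3) - (x2 - x4) = (x1 - x2) - (x3 - x4)); last first.
 by rewrite !opprB addrACA [in RHS]addrACA (addrC (- x3)).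
by move: (x1 - x2) (x3 - x4) => z y; rewrite opprB (addrACA z) -opprD [RHS]addrC subrK.
Qed.

Lemma geometric_cvgL2 (a_ : nat -> Lsq R) (K : R) : (forall n, nrm (a_ n.+1 - a_ n) <= K * qq ^+ n) ->
 exists2 a, cvgL2 a_ a & forall n, nrm (a_ n - a) <= K / (1 - qq) * qq ^+ n.
move=> h; have q0 := qq_gt0; have q1 : 0 < 1 - qq by have := qq_lt1; lra.
have K0 : 0 <= K by have := letr (nrm_ge0 _) (h 0%N); rewrite expr0 mulr1.
have S n i : nrm (a_ (n + i)%N - a_ n) <= K / (1 - qq) * qq ^+ n * (1 - qq ^+ i).
 elim: i => [|i IH]; first by rewrite addn0 subrr nrm0 expr0 subrr mulr0.
 have -> : a_ (n + i.+1)%N - a_ n = (a_ (n + i).+1 - a_ (n + i)%N) + (a_ (n + i)%N - a_ n).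
  by rewrite addnS addrA subrK.
 apply: (letr (nrmD _ _)); apply: (letr (lerD (h _) IH)).
 rewrite le_eqVlt exprD exprSr; apply/orP; left; apply/eqP; field; by rewrite gt_eqF.
have S' n i : nrm (a_ (n + i)%N - a_ n) <= K / (1 - qq) * qq ^+ n.
 apply: (letr (S n i)); rewrite ler_piMr//.
  by rewrite mulr_ge0 ?divr_ge0 ?(ltW q1)// ltW// qqn_gt0.
 by rewrite lerBlDr lerDl ltW// qqn_gt0.
have [e he|a ha] := @Lsq_complete _ a_.
 pose D := K / (1 - qq); have D0 : 0 <= D by rewrite divr_ge0// ltW.
 have [n hn] : exists n, D * qq ^+ n <= e / 2.
  apply: contrapT => /forallNP H; have : e / 2 <= 0; last by have := he; lra.
  apply: (@le_qqn_lim _ _ D) => n; rewrite add0r; have := H n => /negP; rewrite -ltNge => /ltW//.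
 exists n => i j hi hj; rewrite -(subnKC hi) -(subnKC hj).
 apply: (letr (nrm_tri (a_ n) _ _)).
 have := S' n (i - n)%N; have := S' n (j - n)%N; rewrite (nrmBC (a_ n)) -/D.
 by move: (nrm _) (nrm _) => u v; lra.
exists a => // n; apply: (le_qqn_lim (K := K / (1 - qq) * 0 + 1)) => i.
have [N hN] := ha _ (qqn_gt0 i).
apply: (letr (nrm_tri (a_ (n + N)%N) _ _)).
have := S' n N; rewrite (nrmBC (a_ n)); have := hN (n + N)%N (leq_addl _ _).
by move: (nrm _) (nrm _) => u v; lra.
Qed.

End GeometricRates.

(** * Convergence of Euler polygons with dyadic steps *)

Section EulerConvergence.
Context {R : realType}.
Implicit Types (g h : 'I_3 -> Lsq R).
Variables (N : R -> ('I_3 -> Lsq R) -> 'I_3 -> Lsq R) (phi : 'I_3 -> Lsq R) (e : nat -> nat -> 'I_3 -> Lsq R).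

Definition step n : R := 2^-1 ^+ n.
Hypothesis e0 : forall n, e n 0%N = phi.
Hypothesis eS : forall n k j, e n k.+1 j = e n k j - (0 +i* step n) *: N (k%:R * step n) (e n k) j.
Local Notation tm k n := (k%:R * step n).

Lemma step_gt0 n : 0 < step n. Proof. by rewrite exprn_gt0. Qed.
Lemma step_le1 n : step n <= 1. Proof. by apply: exprn_ile1 => //; lra. Qed.
Lemma stepS n : step n.+1 = step n / 2. Proof. by rewrite /step exprSr. Qed.

Definition gidx n (t : R) : nat := Num.truncn (t / step n).

Lemma gidx_itv n t : 0 <= t -> tm (gidx n t) n <= t < (gidx n t).+1%:R * step n.
move=> t0; have s0 := step_gt0 n; have h : 0 <= t / step n by pos.
by have := truncn_itv h; rewrite -/(gidx n t) ler_pdivlMr// ltr_pdivrMr.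
Qed.

Lemma gidx_le n t t' : 0 <= t -> t <= t' -> (gidx n t <= gidx n t')%N.
by move=> t0 h; apply: le_truncn; rewrite ler_pM2r// invr_gt0 step_gt0. Qed.
Lemma gidx0 n : gidx n 0 = 0%N. Proof. by rewrite /gidx mul0r truncn0. Qed.

Lemma gidxS n t : 0 <= t -> exists2 i, (i <= 1)%N & gidx n.+1 t = (2 * gidx n t + i)%N.
move=> t0; have /andP[h1 h2] := gidx_itv n t0; have /andP[h3 h4] := gidx_itv n.+1 t0.
move: h3 h4; rewrite stepS => h3 h4; have s0 := step_gt0 n.
set k := gidx n t in h1 h2 *; set k' := gidx n.+1 t in h3 h4 *.
have l1 : (2 * k < k'.+1)%N.
 rewrite -(ltr_nat R) -(ltr_pM2r (_ : 0 < step n / 2)) ?divr_gt0// (le_lt_trans _ h4)//.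
 by rewrite natrM; move: h1; lra.
have l2 : (k' < 2 * k.+1)%N.
 rewrite -(ltr_nat R) -(ltr_pM2r (_ : 0 < step n / 2)) ?divr_gt0// (le_lt_trans h3)//.
 by rewrite natrM; move: h2; lra.
exists (k' - 2 * k)%N; last by rewrite subnKC.
by rewrite leq_subLR -ltnS; move: l2; rewrite mulnS add2n addn1.
Qed.

(** The interpolation is piecewise constant: the value at the last grid point not after t. *)
Definition polygon n t := e n (gidx n t).
Definition glim t : 'I_3 -> Lsq R := fun j => xget 0 [set a | cvgL2 (fun n => polygon n t j) a].

(** * Estimates up to a fixed time, inside a region [P] where [N] is bounded and Hölder *)

Section Horizon.
Variables (T C : R) (P : ('I_3 -> Lsq R) -> Prop).
Hypotheses (T0 : 0 <= T) (C0 : 0 <= C).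
Hypothesis PE : forall n k, tm k n <= T -> P (e n k).
Hypothesis NH : forall g g' t t' j, P g -> P g' -> nrm (N t g j - N t' g' j) <= C * (sqrt `|t - t'| + td g g').
Hypothesis NB : forall g t j, P g -> nrm (N t g j) <= C.

Let s0 n : 0 < step n := step_gt0 n.
Let tle n k k' : (k <= k')%N -> tm k' n <= T -> tm k n <= T.
by move=> h; apply: letr; rewrite ler_pM2r// ler_nat. Qed.
Lemma nrm_im (c : R) (a : Lsq R) : 0 <= c -> nrm ((0 +i* c) *: a) = c * nrm a.
by move=> c0; rewrite nrmZ cmod_im ger0_norm. Qed.

Lemma e_lip n k i : tm (k + i) n <= T -> td (e n (k + i)) (e n k) <= 3 * C * (tm i n).
elim: i => [|i IH] h; first by rewrite addn0 tdxx mul0r mulr0.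
have h' : tm (k + i) n <= T by apply: tle h; rewrite addnS.
apply: (letr (td_tri (e n (k + i)) _ _)); 
have -> : 3 * C * (tm i.+1 n) = 3 * (C * step n) + 3 * C * (tm i n) by rewrite -natr1; ring.
apply: lerD; last exact: IH.
apply: td_le => l; rewrite addnS eS addrAC subrr add0r nrmN nrm_im ?(ltW (s0 n))//.
by rewrite [C * _]mulrC; ml; apply: NB; exact: PE.
Qed.

Lemma e_lip2 n k k' : tm k n <= T -> tm k' n <= T ->
 td (e n k) (e n k') <= 3 * C * `|tm k n - tm k' n|.
wlog kk : k k' / (k' <= k)%N.
 move=> H h h'; have [hk|/ltnW hk] := leqP k' k; first exact: H.
 by rewrite tdC distrC; exact: H.
move=> h _; have e' := subnKC kk; move: h; rewrite -e'; move: (k - k')%N => i h.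
apply: (letr (e_lip h)); have -> : tm (k' + i) n - tm k' n = tm i n by rewrite natrD; ring.
by rewrite ger0_norm// mulr_ge0// ltW.
Qed.

Definition Crate : R := 3 * C * (1 + 3 * C) * (T * expR (3 * C * T)).

(** A coarse step against two fine ones: the defect per step is of order step times qq^n, and the
    Lipschitz dependence on the state propagates it with a Gronwall exponential. *)
Lemma e_refine n k : tm k n <= T -> td (e n k) (e n.+1 (2 * k)) <= Crate * qq ^+ n.
have q0 : 0 < qq ^+ n :> R := qqn_gt0 n.
pose B := 3 * C * (1 + 3 * C) * qq ^+ n.
have B0 : 0 <= B by rewrite mulr_ge0 ?(ltW q0)// mulr_ge0 ?addr_ge0 ?mulr_ge0.
have H : tm k n <= T -> td (e n k) (e n.+1 (2 * k)) <= B * (tm k n * expR (3 * C * (tm k n))).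
 elim: k => [|k IH] h; first by rewrite muln0 !e0 tdxx !mul0r mulr0.
 have hk : tm k n <= T by apply: tle h.
 have IH' := IH hk.
 have h1 : tm (2 * k) n.+1 <= T by rewrite natrM stepS; apply: letr hk; apply: eq_ler; field.
 have h2 : tm (2 * k + 1) n.+1 <= T.
  apply: letr h; rewrite natrD natrM -natr1 stepS; have := s0 n; lra.
 set d := td (e n k) _ in IH'.
 have d0 : 0 <= d := td_ge0 _ _.
 have st : sqrt `|tm k n - tm (2 * k + 1) n.+1| <= qq ^+ n.
  rewrite -(qqn_sqrt n) -/(step n) ler_wsqrtr// natrD natrM stepS.
  have -> : tm k n - (2 * k%:R + 1) * (step n / 2) = - (step n / 2) by field.
  by rewrite normrN ger0_norm; have := s0 n; lra.
 have st0 : sqrt `|tm k n - tm (2 * k) n.+1| = 0.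
  by rewrite natrM stepS (_ : _ - _ = 0) ?normr0 ?sqrtr0//; field.
 have dd : td (e n k) (e n.+1 (2 * k + 1)) <= d + 3 * C * (step n / 2).
  apply: (letr (td_tri (e n.+1 (2 * k)) _ _)); rewrite lerD2l tdC.
  by have := e_lip h2; rewrite mul1r stepS.
 (* The first fine step starts at the coarse time; the second starts half a coarse step later, and
    this half step is what costs qq^n. *)
 have T1 j : nrm (e n k.+1 j - e n.+1 (2 * k.+1) j) <= nrm (e n k j - e n.+1 (2 * k) j) + step n / 2 * (C * d + C * (qq ^+ n + (d + 3 * C * (step n / 2)))).
  have -> : (2 * k.+1 = (2 * k + 1).+1)%N by rewrite mulnS addn1 add2n.
  have e2 : e n.+1 (2 * k + 1)%N j = e n.+1 (2 * k)%N j - (0 +i* step n.+1) *: N (tm (2 * k) n.+1) (e n.+1 (2 * k)%N) j.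
   by rewrite -eS addn1.
  rewrite !eS e2.
  have -> : e n k j - (0 +i* step n) *: N (tm k n) (e n k) j -
   (e n.+1 (2 * k) j - (0 +i* step n.+1) *: N (tm (2 * k) n.+1) (e n.+1 (2 * k)%N) j - (0 +i* step n.+1) *: N (tm (2 * k + 1) n.+1) (e n.+1 (2 * k + 1)%N) j) =
   (e n k j - e n.+1 (2 * k) j) + - ((0 +i* (step n / 2)) *: ((N (tm k n) (e n k) j - N (tm (2 * k) n.+1) (e n.+1 (2 * k)%N) j) + (N (tm k n) (e n k) j - N (tm (2 * k + 1) n.+1) (e n.+1 (2 * k + 1)%N) j))).
   rewrite stepS; have -> : (0 +i* step n) = (0 +i* (step n / 2)) + (0 +i* (step n / 2)) by apply: complex_eq; rewrite ?ReD ?ImD /=; field.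
   move: (N _ _ _) (N _ _ _) (N _ _ _) (e n k j) (e _ _ j) (0 +i* _) => u v w p r z.
   rewrite scalerDr !scalerBr scalerDl; move: (z *: u) (z *: v) (z *: w) => {}u {}v {}w.
   exact: sub_rearrange.
  apply: (letr (nrmD _ _)); rewrite lerD2l nrmN nrm_im; last by pos.
  ml; apply: (letr (nrmD _ _)); apply: lerD.
   by apply: (letr (NH _ _ _ (PE hk) (PE h1))); rewrite st0 add0r.
  apply: (letr (NH _ _ _ (PE hk) (PE h2))); ml; exact: lerD.
 have T2 : td (e n k.+1) (e n.+1 (2 * k.+1)) <= (1 + 3 * C * step n) * d + B * step n.
  rewrite {1}/td; apply: (letr (ler_sum _ (fun j _ => T1 j))).
  rewrite big_split /= -/(td _ _) -/d sumr_const card_ord.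
  have -> : (step n / 2 * (C * d + C * (qq ^+ n + (d + 3 * C * (step n / 2))))) *+ 3 =
   3 * C * step n * d + 3 / 2 * C * step n * (qq ^+ n + 3 * C * (step n / 2)) by rewrite -mulr_natr; field.
  have E0 : (1 + 3 * C * step n) * d = d + 3 * C * step n * d by ring.
  rewrite E0 -addrA !lerD2l.
  have -> : B * step n = 3 * C * step n * ((1 + 3 * C) * qq ^+ n) by rewrite /B; ring.
  have cs : 0 <= C * step n by pos.
  have hs := half_le_qqn (R := R) n; rewrite -/(step n) in hs.
  have : C * step n * (qq ^+ n + 3 * C * (step n / 2)) <= C * step n * (2 * ((1 + 3 * C) * qq ^+ n)).
   ml; have : C * step n <= C * qq ^+ n by exact: ler_wpM2l.
   have Cq0 : 0 <= C * qq ^+ n by rewrite mulr_ge0// ltW.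
   lra.
  lra.
 have E1 : (1 + 3 * C * step n) * expR (3 * C * (tm k n)) <= expR (3 * C * (tm k.+1 n)).
  have -> : 3 * C * (tm k.+1 n) = 3 * C * step n + 3 * C * (tm k n) by rewrite -natr1; ring.
  rewrite expRD; mr; exact: expR_ge1Dx.
 have E2 : 1 <= expR (3 * C * (tm k.+1 n)).
  by rewrite -[leLHS]expR0 ler_expR !mulr_ge0// ltW.
 have c1 : 0 <= 1 + 3 * C * step n by pos.
 apply: (letr T2); apply: (letr (lerD (ler_wpM2l c1 IH') (lexx _))).
 have -> : tm k.+1 n * expR (3 * C * (tm k.+1 n)) = tm k n * expR (3 * C * (tm k.+1 n)) + step n * expR (3 * C * (tm k.+1 n)).
  by rewrite -{1}natr1; ring.
 rewrite mulrDr; apply: lerD.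
  have -> : (1 + 3 * C * step n) * (B * (tm k n * expR (3 * C * (tm k n)))) =
   B * (tm k n * ((1 + 3 * C * step n) * expR (3 * C * (tm k n)))) by ring.
  ml; ml; by pos.
 by ml; rewrite ler_peMr// ltW.
move=> h; apply: (letr (H h)).
have -> : Crate * qq ^+ n = B * (T * expR (3 * C * T)) by rewrite /Crate /B; ring.
ml; apply: ler_pM; rewrite ?expR_ge0 ?mulr_ge0 ?(ltW (s0 n))//.
by rewrite ler_expR; apply: ler_wpM2l => //; exact: mulr_ge0.
Qed.

Lemma polygon_cauchy n t : 0 <= t <= T -> td (polygon n t) (polygon n.+1 t) <= (Crate + 3 * C) * qq ^+ n.
move=> /andP[t0 tT]; have /andP[h1 _] := gidx_itv n t0; have /andP[h3 _] := gidx_itv n.+1 t0.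
have [i i1 e'] := gidxS n t0; rewrite /polygon e' in h3 *.
apply: (letr (td_tri (e n.+1 (2 * gidx n t)%N) _ _)); rewrite mulrDl; apply: lerD.
 exact: e_refine (letr h1 tT).
rewrite tdC; apply: (letr (e_lip (letr h3 tT))).
ml; apply: (via (1 * step n)); last by rewrite mul1r; exact: half_le_qqn.
apply: ler_pM => //; [exact: ltW|by rewrite -[1]/(1%:R) ler_nat|].
by rewrite stepS; have := s0 n; lra.
Qed.

Definition Drate : R := 3 * ((Crate + 3 * C) / (1 - qq)).

Lemma glim_cvg t : 0 <= t <= T -> (forall j, cvgL2 (fun n => polygon n t j) (glim t j)) /\
 forall n, td (polygon n t) (glim t) <= Drate * qq ^+ n.
move=> tT; have H j : cvgL2 (fun n => polygon n t j) (glim t j) /\ forall n, nrm (polygon n t j - glim t j) <= (Crate + 3 * C) / (1 - qq) * qq ^+ n.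
 have [n|a ha hr] := @geometric_cvgL2 _ (fun n => polygon n t j) (Crate + 3 * C).
  by rewrite nrmBC; apply: letr (polygon_cauchy n tT); exact: td_coord.
 suff -> : glim t j = a by [].
 by apply: (cvgL2_unique _ ha); rewrite /glim; apply: (@xgetPex _ 0 [set a | cvgL2 (fun n => polygon n t j) a]); exists a.
split=> [j|n]; first exact: (H j).1.
by rewrite /Drate -mulrA; apply: td_le => l; exact: (H l).2.
Qed.

Lemma glim0 : glim 0 = phi.
have T00 : 0 <= (0 : R) <= T by rewrite lexx.
have [h _] := glim_cvg T00.
apply/funext => j; apply: (cvgL2_unique (h j)).
have -> : (fun n => polygon n 0 j) = (fun=> phi j) by apply/funext => n; rewrite /polygon gidx0 e0.
exact: cvgL2_cst.
Qed.

Let D0 : 0 <= Drate.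
have q1 := qq_lt1 (R := R); rewrite /Drate mulr_ge0// divr_ge0//; last lra.
by rewrite addr_ge0 ?mulr_ge0// ?addr_ge0 ?expR_ge0 ?mulr_ge0.
Qed.

Lemma gidx_dist n a b : 0 <= a -> a <= b -> `|((gidx n b)%:R - (gidx n a)%:R) * step n - (b - a)| <= step n.
move=> a0 ab; have /andP[h1 h2] := gidx_itv n a0; have /andP[h3 h4] := gidx_itv n (letr a0 ab).
rewrite mulrBl; move: h2 h4; rewrite -!natr1 !mulrDl !mul1r => h2 h4.
by rewrite ler_norml; apply/andP; split; lra.
Qed.

Lemma glim_lip a b : 0 <= a -> a <= b -> b <= T -> td (glim b) (glim a) <= 3 * C * (b - a).
move=> a0 ab bT; have b0 := letr a0 ab.
have aT : 0 <= a <= T by rewrite a0 (letr ab).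
have [_ ha] := glim_cvg aT.
have bT0 : 0 <= b <= T by rewrite b0.
have [_ hb] := glim_cvg bT0.
apply: (le_qqn_lim (K := 3 * C + 2 * Drate)) => n.
have /andP[h1 _] := gidx_itv n a0; have /andP[h2 _] := gidx_itv n b0.
apply: (letr (td_tri (polygon n b) _ _)); rewrite tdC.
have t1 := td_tri (polygon n a) (polygon n b) (glim a).
have t2 : td (polygon n b) (polygon n a) <= 3 * C * ((b - a) + step n).
 apply: (letr (e_lip2 (letr h2 bT) (letr h1 (letr ab bT)))).
 ml; have := gidx_dist n a0 ab; rewrite -mulrBl => h; rewrite -[X in `|X|](subrK (b - a)).
 by apply: (letr (ler_normD _ _)); rewrite addrC lerD// ger0_norm// subr_ge0.
have t3 : 3 * C * step n <= 3 * C * qq ^+ n by ml; exact: half_le_qqn.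
have := ha n; have := hb n; lra.
Qed.

Hypothesis PG : forall t, 0 <= t <= T -> P (glim t).

(** The integral equation in local form, with an arbitrary tag [c] in the interval. The error is of
    order (b - a)^(3/2), so it disappears when summed over any tagged partition of small mesh. *)
Lemma glim_local a c b j : 0 <= a -> a <= c -> c <= b -> b <= T ->
 nrm (glim b j - glim a j + (0 +i* (b - a)) *: N c (glim c) j) <= (b - a) * (C * (sqrt (b - a) + 3 * C * (b - a))).
move=> a0 ac cb bT; have ab := letr ac cb; have b0 := letr a0 ab; have c0 := letr a0 ac.
have cT : 0 <= c <= T by rewrite c0 (letr cb).
have aT : 0 <= a <= T by rewrite a0 (letr ab).
have [_ ha] := glim_cvg aT.
have bT0 : 0 <= b <= T by rewrite b0.
have [_ hb] := glim_cvg bT0.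
have [_ hc] := glim_cvg cT; have Pc := PG cT.
pose w := b - a; have w0 : 0 <= w by rewrite subr_ge0.
pose r := sqrt w; have r0 : 0 <= r by exact: sqrtr_ge0.
(* [om q] bounds the distance from the interaction at any grid point of the interval to its value at
   time c; [q] stands for the discretisation error qq^n, removed at the end. *)
pose om (q : R) := C * (r + q + (3 * C * (w + q) + Drate * q)).
have bound n : nrm (glim b j - glim a j + (0 +i* w) *: N c (glim c) j) <= (w + qq ^+ n) * om (qq ^+ n) + qq ^+ n * C + 2 * (Drate * qq ^+ n).
 have /andP[h1 h1'] := gidx_itv n a0; have /andP[h2 _] := gidx_itv n b0; have /andP[h3 h3'] := gidx_itv n c0.
 have kab := gidx_le n a0 ab; have q0 : 0 < qq ^+ n :> R := qqn_gt0 n.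
 have sq : step n <= qq ^+ n := half_le_qqn n.
 have hT k : (k <= gidx n b)%N -> tm k n <= T by move=> h; apply: tle h (letr h2 bT).
 have one k : (gidx n a <= k < gidx n b)%N -> nrm (N (tm k n) (e n k) j - N c (glim c) j) <= om (qq ^+ n).
  move=> /andP[k1 k2]; have kT := hT _ (ltnW k2).
  have k1' : tm (gidx n a) n <= tm k n by rewrite ler_pM2r ?s0// ler_nat.
  have k2' : tm k n <= tm (gidx n b) n by rewrite ler_pM2r ?s0// ler_nat ltnW.
  move: h1' h3'; rewrite -!natr1 !mulrDl !mul1r => h1' h3'.
  have d1 : `|tm k n - c| <= w + step n.
   by rewrite ler_norml /w; apply/andP; split; lra.
  have d2 : `|tm k n - tm (gidx n c) n| <= w + step n.
   have kac : tm (gidx n a) n <= tm (gidx n c) n by rewrite ler_pM2r ?s0// ler_nat gidx_le.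
   by rewrite ler_norml /w; apply/andP; split; lra.
  apply: (letr (NH _ _ _ (PE kT) Pc)); ml; apply: lerD.
   apply: (via (sqrt (w + step n))); first exact: ler_wsqrtr.
   apply: le_sqr2; first by rewrite addr_ge0// ltW.
   have sn0 := s0 n; rewrite sqr_sqrtr; last by pos.
   have rw : r ^+ 2 = w by rewrite /r sqr_sqrtr.
   have qs : (qq ^+ n) ^+ 2 = step n :> R by rewrite -(qqn_sqrt n) sqr_sqrtr// ltW.
   rewrite sqrrD rw qs; have : 0 <= r * qq ^+ n by rewrite mulr_ge0// ltW.
   lra.
  apply: (letr (td_tri (polygon n c) _ _)); apply: lerD; last exact: hc.
  apply: (letr (e_lip2 kT _)); first exact: letr h3 (letr cb bT).
  by ml; apply: (letr d2); rewrite lerD2l.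
 have om0 : 0 <= om (qq ^+ n).
  have q0' := ltW q0; rewrite /om; apply: mulr_ge0 => //; apply: addr_ge0; first exact: addr_ge0.
  by apply: addr_ge0; apply: mulr_ge0 => //; [exact: mulr_ge0|exact: addr_ge0].
 have sum i : (gidx n a + i <= gidx n b)%N ->
  nrm (e n (gidx n a + i)%N j - e n (gidx n a) j + (0 +i* (tm i n)) *: N c (glim c) j) <= tm i n * om (qq ^+ n).
  elim: i => [|i IH] hi.
   by rewrite addn0 subrr add0r !mul0r nrm_im// mul0r.
  have hi' : (gidx n a + i <= gidx n b)%N by apply: leq_trans hi; rewrite addnS.
  have h := one (gidx n a + i)%N; rewrite leq_addr -addnS hi in h; have {}h := h isT.
  have -> : e n (gidx n a + i.+1)%N j - e n (gidx n a) j + (0 +i* (tm i.+1 n)) *: N c (glim c) j =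
   (e n (gidx n a + i)%N j - e n (gidx n a) j + (0 +i* (tm i n)) *: N c (glim c) j) - (0 +i* step n) *: (N (tm (gidx n a + i) n) (e n (gidx n a + i)%N) j - N c (glim c) j).
   have -> : 0 +i* (tm i.+1 n) = (0 +i* (tm i n)) + (0 +i* step n).
    by apply: complex_eq; rewrite ?ReD ?ImD /= -?natr1; ring.
   rewrite addnS eS scalerDl scalerBr opprB.
   by rewrite -!addrA; congr (_ + _); rewrite [LHS]addrC -!addrA.
  apply: (letr (nrmD _ _)); rewrite nrmN nrm_im ?(ltW (s0 n))// -natr1 mulrDl mul1r mulrDl.
  by apply: lerD; [exact: IH|apply: ler_wpM2l; [exact: ltW|]].
 have S := sum (gidx n b - gidx n a)%N; rewrite subnKC// leqnn in S; have {}S := S isT.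
 rewrite natrB// in S; set Dn := ((gidx n b)%:R - (gidx n a)%:R) * step n in S.
 have Dw : `|Dn - w| <= step n by exact: gidx_dist.
 have Dn0 : 0 <= Dn by rewrite mulr_ge0 ?(ltW (s0 n))// subr_ge0 ler_nat.
 have -> : glim b j - glim a j + (0 +i* w) *: N c (glim c) j =
   (e n (gidx n b) j - e n (gidx n a) j + (0 +i* Dn) *: N c (glim c) j) + ((glim b j - polygon n b j) - (glim a j - polygon n a j) - (0 +i* (Dn - w)) *: N c (glim c) j).
  have -> : 0 +i* (Dn - w) = (0 +i* Dn) - (0 +i* w) by apply: complex_eq; rewrite ?ReD ?ImD ?ReN ?ImN /=; ring.
  by rewrite /polygon scalerBl; exact: limit_rearrange.
 have n1 : nrm ((glim b j - polygon n b j) - (glim a j - polygon n a j) - (0 +i* (Dn - w)) *: N c (glim c) j) <= 2 * (Drate * qq ^+ n) + qq ^+ n * C.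
  apply: (letr (nrmD _ _)); rewrite nrmN nrmZ cmod_im; apply: lerD.
   apply: (letr (nrmD _ _)); rewrite nrmN ![nrm (glim _ _ - _)]nrmBC.
   have := letr (td_coord j _ _) (ha n); have := letr (td_coord j _ _) (hb n); lra.
  by apply: ler_pM; rewrite ?nrm_ge0//; [exact: letr sq|exact: NB].
 apply: (letr (nrmD _ _)); apply: (letr (lerD S n1)).
 have : Dn * om (qq ^+ n) <= (w + qq ^+ n) * om (qq ^+ n).
  by mr; have := ler_norm (Dn - w); lra.
 lra.
apply: (le_qqn_lim (K := w * (C * (1 + 3 * C + Drate)) + C * (r + 1 + (3 * C * (w + 1) + Drate)) + C + 2 * Drate)) => n.
apply: (letr (bound n)); have q0 := qqn_gt0 (R := R) n; have q1 := qqn_le1 (R := R) n.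
rewrite -/w -/r; move: (qq ^+ n) q0 q1 => q q0 q1.
have : q * om q <= q * om 1.
 ml; rewrite /om; ml; apply: lerD; first by rewrite lerD2l.
 by apply: lerD; [ml; rewrite lerD2l|apply: ler_wpM2l].
rewrite /om mulr1; lra.
Qed.

End Horizon.
End EulerConvergence.

(** * Existence and decay of the profile *)

Section ProfileExistence.
Context {R : realType}.
Variables (lam nu : 'I_3 -> R[i]) (m kap : 'I_3 -> R) (s : R).
Hypothesis hm : m i1 + m i2 = m i3.
Hypothesis hm0 : forall j, m j != 0.
Hypothesis hs : 1 < s < 2.
Hypothesis kap0 : forall j, 0 < kap j.
Hypothesis hdiss : forall j, Im (lam j) < 0.
Hypothesis hkap : (kap i1)%:C * nu i1 + (kap i2)%:C * nu i2 = (kap i3)%:C * conjc (nu i3).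
Implicit Types (g phi : 'I_3 -> Lsq R).

Local Notation KF := (KF lam nu).
Local Notation NL := (NL lam nu m).
Local Notation W := (CW m s).
Local Notation b := (aexp s / 2).
Local Notation euler := (euler lam nu m).

Let W0 : 0 <= W. Proof. exact: letr ler01 (CW_ge1 m hs). Qed.
Let b0 : 0 <= b. Proof. by have /andP[h _] := aexp01 hs; rewrite divr_ge0// ltW. Qed.

Lemma nrm_gt2 th v (a : Lsq R) : mfun th -> nrm (gt2 th v a) <= 4 * nrm a.
move=> mth; rewrite /gt2; apply: (letr (nrmD _ _)); rewrite nrmN.
have h1 := nrmD (gt th v a) (gtV th v a); have h2 := nrmD a a.
rewrite (nrm_gt v mth) (nrm_gtV v mth) in h1; lra.
Qed.

Lemma nrm_qop i l (a : Lsq R) : nrm (qop m i l a) <= 4 * nrm a.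
case: i => [|v|k] /=; first by rewrite ler_peMl ?nrm_ge0// ler1n.
 exact: nrm_gt2 (measurable_cst _).
exact: nrm_gt2 (measurable_lin _).
Qed.

(** Each second difference is bounded on L^2, uniformly in the shift, so the growth bounds survive
    the L^2 limit of the scheme. *)
Lemma qs_lip i g g' : qs m i g <= qs m i g' + 4 * td g g'.
rewrite /qs /td mulr_sumr -big_split; apply: ler_sum => l _.
apply: (via (qn m i l (g' l + (g l - g' l)))); first by rewrite [g' l + _]addrC subrK.
apply: (letr (qnD _ _ _ _ _)); rewrite lerD2l; exact: nrm_qop.
Qed.

Lemma rate_cvgL2 (a_ : nat -> Lsq R) a (K : R) : (forall n, nrm (a_ n - a) <= K * qq ^+ n) -> cvgL2 a_ a.
move=> h e e0; have c : (fun n => K * qq ^+ n) @ \oo --> (0 : R).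
 rewrite -[X in _ --> X](mulr0 K); apply: cvgM; first exact: cvg_cst.
 by apply: cvg_expr; rewrite ger0_norm ?qq_lt1// ltW// qq_gt0.
move/cvgrPdist_le: c => /(_ e e0)[N _ HN]; exists N => i /HN /=.
rewrite sub0r normrN => h1; exact: letr (h i) (letr (ler_norm _) h1).
Qed.

Lemma step_pow n : (2 ^ n)%:R * step n = 1 :> R.
by rewrite natrX /step -exprMn mulfV ?pnatr_eq0// expr1n. Qed.

(** Carries the decay from the preceding grid point t' to t, with a factor 2 for 1 + t and a factor
    2 for the logarithm. *)
Lemma log_shift (C t t' : R) : 0 <= C -> 0 <= t' -> t' <= t -> t <= t' + 1 ->
 C / ((1 + t') * ln (2 + t')) <= 4 * C / ((1 + t) * ln (2 + t)).
move=> C0 t0 h1 h2; have l1 : 0 < ln (2 + t') by apply: ln_gt0; lra.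
have l2 : 0 < ln (2 + t) by apply: ln_gt0; lra.
have l3 : ln (2 + t) <= 2 * ln (2 + t').
 have -> : 2 * ln (2 + t') = ln ((2 + t') * (2 + t')) by rewrite lnM ?posrE; lra.
 by rewrite ler_ln ?posrE; nra.
have p1 : 0 < (1 + t') * ln (2 + t') by rewrite mulr_gt0//; lra.
have p2 : 0 < (1 + t) * ln (2 + t) by rewrite mulr_gt0//; lra.
rewrite ler_pdivrMr// mulrAC ler_pdivlMr//.
have : (1 + t) * ln (2 + t) <= 2 * (1 + t') * (2 * ln (2 + t')) by apply: ler_pM => //; lra.
move=> /(ler_wpM2l C0); lra.
Qed.

Lemma powR1_mono (t T : R) : 0 <= t -> t <= T -> (1 + t) `^ b <= (1 + T) `^ b.
by move=> t0 tT; apply: ge0_ler_powR => //; rewrite ?nnegrE; lra. Qed.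

Theorem profile_exists : exists2 eps1 : R, 0 < eps1 & forall eps : R, 0 < eps <= eps1 ->
 exists2 C1 : R, 0 < C1 & forall phi, inXe s eps phi -> exists g : R -> 'I_3 -> Lsq R,
 [/\ g 0 = phi,
   forall t, 0 <= t -> forall i, qs m i (g t) <= (1 + t) `^ b * qs m i phi,
   forall t, 0 <= t -> bdd m (C1 / ((1 + t) * ln (2 + t))) t (g t) &
   forall T, 0 <= T -> exists2 C : R, 0 <= C &
    (forall p q, 0 <= p -> p <= q -> q <= T -> td (g q) (g p) <= C * (q - p)) /\
    (forall p c q j, 0 <= p -> p <= c -> c <= q -> q <= T ->
     nrm (g q j - g p j + (0 +i* (q - p)) *: NL c (g c) j) <= C * (q - p) * sqrt (q - p))].
have [eps1 [K [e10 K0 H]]] := euler_bounds hm hm0 hs kap0 hdiss hkap.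
exists eps1 => // eps heps; have [C1 C10 {}H] := H eps heps.
exists (4 * C1); first by pos.
move=> phi hphi; pose e n := euler (step n) phi; pose g := glim e.
have eps0 : 0 <= eps by case/andP: heps => /ltW.
have bnd n k : [/\ bdd m (K * eps / (1 + k%:R * step n)) (k%:R * step n) (e n k),
  forall i, qs m i (e n k) <= (1 + k%:R * step n) `^ b * qs m i phi &
  bdd m (C1 / ((1 + k%:R * step n) * ln (2 + k%:R * step n))) (k%:R * step n) (e n k)].
 (* With [k0] equal to 2^n, time 1 is a grid point of the scheme of step 2^-n. *)
 by apply: (H phi hphi (step n) (2 ^ n)%N _ (step_pow n)); rewrite step_gt0 step_le1.
have tk0 n k : 0 <= k%:R * step n :> R by pos.
pose X T := W * ((1 + T) `^ b * eps).
have X0 T : 0 <= X T by rewrite /X mulr_ge0// mulr_ge0// powR_ge0.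
have mono t T : 0 <= t -> t <= T -> (1 + t) `^ b <= (1 + T) `^ b.
 exact: powR1_mono.
have fromqs (f : 'I_3 -> Lsq R) t T : 0 <= t -> t <= T -> (forall i, qs m i f <= (1 + t) `^ b * qs m i phi) -> inXe s (X T) f.
 move=> t0 tT hf; apply: (inXe_transfer hm0 hs (powR_ge0 _ _) hphi) => i.
 by apply: (letr (hf i)); mr; exact: mono.
pose CC T := CN lam nu m s (X T) + W * (42 * KF * (Emb s * X T) * 1 * X T).
have NB0 T : 0 <= W * (42 * KF * (Emb s * X T) * 1 * X T).
 have K0' := KF_ge0 lam nu; have E0 := Emb_ge0 s; have XT := X0 T; have p : 0 <= Emb s * X T by pos.
 by pos.
have CN0 T : 0 <= CN lam nu m s (X T) by exact: CN_ge0.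
have CC0 T : 0 <= CC T by exact: addr_ge0.
have PE T n k : k%:R * step n <= T -> inXe s (X T) (e n k).
 by move=> h; have [_ h2 _] := bnd n k; exact: fromqs h h2.
have NH T f f' t t' j : inXe s (X T) f -> inXe s (X T) f' -> nrm (NL t f j - NL t' f' j) <= CC T * (sqrt `|t - t'| + td f f').
 move=> h h'; apply: (letr (NL_holder lam nu hm hm0 hs t t' j h h')); apply: ler_wpM2r.
  by rewrite addr_ge0 ?sqrtr_ge0 ?td_ge0.
 by rewrite lerDl.
have NB T f t j : inXe s (X T) f -> nrm (NL t f j) <= CC T.
 by move=> h; apply: (letr (NL_bound lam nu hm hm0 hs t j h)); rewrite lerDr.
have ee0 n : e n 0%N = phi by [].
have eeS n k j : e n k.+1 j = e n k j - (0 +i* step n) *: NL (k%:R * step n) (e n k) j by [].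
have gc t (t0 : 0 <= t) : forall n, td (polygon e n t) (glim e t) <= Drate t (CC t) * qq ^+ n.
 have tt : 0 <= t <= t by rewrite t0 lexx.
 exact: (@glim_cvg R NL phi e ee0 eeS t (CC t) (fun f => inXe s (X t) f) (CC0 t) (@PE t) (@NH t) (@NB t) t tt).2.
have gqs t : 0 <= t -> forall i, qs m i (g t) <= (1 + t) `^ b * qs m i phi.
 move=> t0 i; have hr := gc t t0.
 apply: (le_qqn_lim (K := 4 * Drate t (CC t))) => n.
 apply: (letr (qs_lip i _ (polygon e n t))); apply: lerD.
  have [_ h _] := bnd n (gidx n t); apply: (letr (h i)); mr; by apply: mono => //; have /andP[] := gidx_itv n t0.
 by rewrite -mulrA; ml; rewrite tdC.
exists g; split=> //.
- exact: (@glim0 R NL phi e ee0 eeS 0 (CC 0) (fun f => inXe s (X 0) f) (lexx 0) (CC0 0) (@PE 0) (@NH 0) (@NB 0)).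
- move=> t t0 l; have hr := gc t t0.
 have [_ /(_ l)[_ hw _ hwn]] := fromqs (g t) t t t0 (lexx t) (gqs t t0).
 (* The scheme is bounded at its grid times and not at t; Hölder continuity of the free evolution
    moves the propagator from the grid time to t. *)
 apply: (cvgL2_Linf (a_ := fun n => U (m l) ((gidx n t)%:R * step n) (polygon e n t l))).
  apply: (rate_cvgL2 (K := Drate t (CC t) + CU (m l) * nrm (wt s (Fhat (g t l))))) => n.
  have /andP[h1 h2] := gidx_itv n t0.
  apply: (letr (nrm_tri (U (m l) ((gidx n t)%:R * step n) (g t l)) _ _)); rewrite mulrDl; apply: lerD.
   by rewrite -UB nrm_U; apply: letr (hr n); exact: td_coord.
  apply: (letr (U_holder hs _ _ _ hw)); rewrite mulrAC; apply: ler_wpM2l.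
   by rewrite mulr_ge0 ?CU_ge0 ?nrm_ge0.
  rewrite -(qqn_sqrt n); apply: ler_wsqrtr; rewrite distrC ger0_norm ?subr_ge0//.
  by move: h2; rewrite -natr1 mulrDl mul1r /step; lra.
 move=> n; have /andP[h1 h2] := gidx_itv n t0; have [_ _ h] := bnd n (gidx n t).
 apply: Linf_le (h l); apply: log_shift => //; first exact: ltW.
 by move: h2; have := step_le1 (R := R) n; rewrite -natr1 mulrDl mul1r; lra.
- move=> T T0; have p2 : 0 <= CC T * (1 + 3 * CC T * sqrt T).
  by pos.
 exists (3 * CC T + CC T * (1 + 3 * CC T * sqrt T)).
  by pos.
 split=> [p q p0 pq qT|p c q j p0 pc cq qT].
  apply: (letr (@glim_lip R NL phi e ee0 eeS T (CC T) (fun f => inXe s (X T) f) (CC0 T) (@PE T) (@NH T) (@NB T) p q p0 pq qT)).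
  nra.
 have PG t : 0 <= t <= T -> inXe s (X T) (g t).
  by move=> /andP[t0 tT]; exact: fromqs t0 tT (gqs t t0).
 apply: (letr (@glim_local R NL phi e ee0 eeS T (CC T) (fun f => inXe s (X T) f) T0 (CC0 T) (@PE T) (@NH T) (@NB T) PG p c q j p0 pc cq qT)).
 have w0 : 0 <= q - p by rewrite subr_ge0 (letr pc).
 have wT : q - p <= T by lra.
 have rT : sqrt (q - p) <= sqrt T by exact: ler_wsqrtr.
 have rr : q - p = sqrt (q - p) * sqrt (q - p) by rewrite -expr2 sqr_sqrtr.
 rewrite [in leRHS]mulrAC [in leRHS]mulrC; apply: ler_wpM2l => //.
 have c0 := CC0 T; have r0 := sqrtr_ge0 (q - p).
 have -> : CC T * (sqrt (q - p) + 3 * CC T * (q - p)) = CC T * (1 + 3 * CC T * sqrt (q - p)) * sqrt (q - p).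
  by rewrite [in 3 * _ * (q - p)]rr; ring.
 mr; apply: (via (CC T * (1 + 3 * CC T * sqrt T))); last first.
  lra.
 nra.
Qed.

End ProfileExistence.

(** * Weighted norms under a common dyadic majorant *)

Section WeightedFamilies.
Context {R : realType}.
Variable s : R.
Hypothesis hs : 1 < s < 2.
Implicit Types (a c : Lsq R).

Let rr0 k : 0 <= rr s ^+ k. Proof. by rewrite exprn_ge0// powR_ge0. Qed.

Lemma PP_le nu k a : PP nu k a <= 32 * nrm a ^+ 2.
have H (K : plane R) : nrm (Pd K a) ^+ 2 <= 16 * nrm a ^+ 2.
 have -> : 16 * nrm a ^+ 2 = (4 * nrm a) ^+ 2 by ring.
 apply: sqr_le2; first by [].
 have -> : 4 * nrm a = nrm (4%:C *: a) by rewrite nrmZ cmod_real ger0_norm.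
 apply: nrm_le_ae; apply: filterS2 (Pd_ae K a) (fnZ 4%:C a) => x -> ->.
 rewrite !cmodM cmodN !cmod_real; mr; by rewrite !ger0_norm ?c2_ge0// c2_le4.
by rewrite /PP; have := H (vscale (nu * 2^-1 ^+ k) e1); have := H (vscale (nu * 2^-1 ^+ k) e2); lra.
Qed.

Lemma PdB (K : plane R) a c : Pd K (a - c) = Pd K a - Pd K c.
apply: Lsq_ext; apply: filterS2 (Pd_ae K (a - c)) (filterI (Pd_ae K a) (filterI (Pd_ae K c) (filterI (fnB a c) (fnB (Pd K a) (Pd K c))))) => x -> [h1 [h2 [-> ->]]].
by rewrite h1 h2 mulrBr.
Qed.

Lemma PP_sub nu k a c : PP nu k (a - c) <= 2 * PP nu k a + 2 * PP nu k c.
have H (u v : Lsq R) : nrm (u - v) ^+ 2 <= 2 * nrm u ^+ 2 + 2 * nrm v ^+ 2.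
 apply: (via ((nrm u + nrm v) ^+ 2)).
  by apply: sqr_le2; [by []|rewrite -(nrmN v); exact: nrmD].
 by have := sqr_ge0 (nrm u - nrm v); rewrite sqrrB sqrrD; lra.
rewrite /PP !PdB; have := H (Pd (vscale (nu * 2^-1 ^+ k) e1) a) (Pd (vscale (nu * 2^-1 ^+ k) e1) c).
have := H (Pd (vscale (nu * 2^-1 ^+ k) e2) a) (Pd (vscale (nu * 2^-1 ^+ k) e2) c); lra.
Qed.

Variables (B : nat -> R) (Z : R).
Hypothesis B0 : forall k, 0 <= B k.
Hypothesis BZ : forall K, \sum_(k < K) rr s ^+ k * B k <= Z.

Lemma tail_small (e : R) : 0 < e -> exists K0, forall i, \sum_(k < i) rr s ^+ (K0 + k) * B (K0 + k) <= e.
move=> e0; pose S K := \sum_(k < K) rr s ^+ k * B k.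
have hs1 : has_sup [set S K | K in setT].
 by split; [exists (S 0%N), 0%N|exists Z => _ [K _ <-]; exact: BZ].
have [_ [K0 _ <-] hK] := sup_adherent e0 hs1.
exists K0 => i; have : S (K0 + i)%N <= sup [set S K | K in setT].
 by apply: sup_upper_bound => //; exists (K0 + i)%N.
rewrite {1}/S big_split_ord /= -/(S K0); lra.
Qed.

Lemma weighted_bound a : (forall k, PP 1 k a <= B k) ->
 inW s a /\ nrm (wt s a) ^+ 2 <= Cw s 1 * (nrm a ^+ 2 + Z).
move=> h; apply: W_low => // K; rewrite lerD2l; apply: letr (BZ K).
by apply: ler_sum => k _; apply: ler_wpM2l.
Qed.

(** A dominated convergence principle: the common majorant [B] makes the high dyadic levels
    uniformly small, and the finitely many others are controlled by the L^2 distance through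
    [PP_le]. Thus L^2 continuity upgrades to continuity in the weighted norm. *)
Lemma weighted_continuity (e : R) : 0 < e -> exists2 d : R, 0 < d & forall a c,
 (forall k, PP 1 k a <= B k) -> (forall k, PP 1 k c <= B k) -> nrm (a - c) <= d ->
 nrm (wt s (a - c)) <= e.
move=> e0; have c0 := Cw_ge0 s 1; pose e' := e ^+ 2 / (16 * (Cw s 1 + 1)).
have p0 : 0 < 16 * (Cw s 1 + 1) by lra.
have e'0 : 0 < e' by rewrite divr_gt0// exprn_gt0.
have [K0 hK] := tail_small e'0.
pose D := \sum_(k < K0) rr s ^+ k * 32.
have D0 : 0 <= D by apply: sumr_ge0 => k _; rewrite mulr_ge0.
pose M := (1 + D) * (Cw s 1 + 1); have M0 : 1 <= M.
 by rewrite /M -[leLHS]mul1r; apply: ler_pM => //; lra.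
exists (e / (2 * (1 + M))); first by rewrite divr_gt0// mulr_gt0//; lra.
move=> a c ha hc hac.
have A K : nrm (a - c) ^+ 2 + \sum_(k < K) rr s ^+ k * PP 1 k (a - c) <= (1 + D) * nrm (a - c) ^+ 2 + 4 * e'.
 rewrite mulrDl mul1r -addrA lerD2l.
 apply: (via (\sum_(k < K0 + K) rr s ^+ k * PP 1 k (a - c))).
  rewrite addnC big_split_ord /= lerDl sumr_ge0// => k _; by rewrite mulr_ge0// PP_ge0.
 rewrite big_split_ord /=; apply: lerD.
  rewrite /D mulr_suml; apply: ler_sum => k _; rewrite -mulrA; apply: ler_wpM2l => //; exact: PP_le.
 apply: (via (4 * \sum_(k < K) rr s ^+ (K0 + k) * B (K0 + k))); last by apply: ler_wpM2l.
 rewrite mulr_sumr; apply: ler_sum => k _; rewrite mulrCA; apply: ler_wpM2l => //.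
 apply: (letr (PP_sub _ _ _ _)); have := ha (K0 + k)%N; have := hc (K0 + k)%N; lra.
have [_ h] := W_low hs (oner_neq0 R) A.
apply: le_sqr2; first exact: ltW.
apply: (letr h); rewrite mulrDr.
have t1 : Cw s 1 * (4 * e') <= e ^+ 2 / 4.
 have -> : e ^+ 2 / 4 = (Cw s 1 + 1) * (4 * e') by rewrite /e'; field; lra.
 lra.
have t2 : Cw s 1 * ((1 + D) * nrm (a - c) ^+ 2) <= e ^+ 2 / 4.
 apply: (via (M * (e / (2 * (1 + M))) ^+ 2)).
  rewrite mulrA /M; apply: ler_pM; rewrite ?sqr_ge0//.
  - by pos.
  - lra.
  - by apply: sqr_le2 => //; by [].
 have -> : M * (e / (2 * (1 + M))) ^+ 2 = e ^+ 2 / 4 * (M / (1 + M) ^+ 2) by field; lra.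
 rewrite ler_piMr ?divr_ge0 ?sqr_ge0// ler_pdivrMr ?exprn_gt0//; nra.
nra.
Qed.

End WeightedFamilies.

(** * Phases and translations that commute up to a scalar *)

Section WeylOperators.
Context {R : realType}.
Implicit Types (a f : Lsq R).

Definition mulb (h : plane R -> R) a : Lsq R := cls (fun x => (h x)%:C * a x).

Lemma mulb_ae (h : plane R -> R) a (K : R) : mfun h -> (forall x, `|h x| <= K) ->
 {ae mu, forall x, mulb h a x = (h x)%:C * a x}.
move=> mh hK; apply: cls_ae; apply: (@L2Mb _ _ K _ (cmeas_real mh)); last exact: fn_L2.
by move=> x; rewrite cmod_real.
Qed.

Lemma realcB (p q : R) : (p - q)%:C = p%:C - q%:C :> R[i].
exact: (rmorphB (real_complex R)). Qed.

Lemma commutator_rearrange (p q r u c : Lsq R) : (p - q) - (r - c) = (u - r - (q - c)) + (p - u).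
by rewrite [RHS]addrC [RHS]addrA (addrA (p - u)) subrK !opprB addrACA [RHS]addrACA (addrC (- q)).
Qed.

Lemma weyl_rearrange (a p1 p2 p3 p4 p5 p6 : Lsq R) : p1 + p2 - (a + a) =
 ((p3 + p4 - (a + a)) + (p5 + p6 - (a + a))) + ((p1 - p3 - (p5 - a)) + (p2 - p6 - (p4 - a))).
have X'X : p3 + p5 + (p6 + p4) = p3 + p4 + (p5 + p6) by rewrite (addrC p6) addrACA.
have E1 : p1 - p3 - (p5 - a) = (p1 + a) - (p3 + p5) by rewrite opprB addrACA opprD.
have E2 : p2 - p6 - (p4 - a) = (p2 + a) - (p6 + p4) by rewrite opprB addrACA opprD.
rewrite E1 E2 (addrACA (p1 + a)) -opprD X'X (addrACA (p3 + p4)) -opprD.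
by rewrite [RHS]addrC [RHS]addrA subrK (addrACA p1) (opprD (a + a)) [RHS]addrA addrK.
Qed.

Lemma c2_lip (p q : R) : `|c2 p - c2 q| <= 2 * `|p - q|.
have e : (c2 p - c2 q) = 2 * (cos q - cos p) by rewrite /c2; ring.
rewrite e normrM ger0_norm//; apply: ler_wpM2l => //.
have h : cmod (cis q - cis p) <= `|p - q|.
 have -> : cis q - cis p = cis p * (cis (q - p) - 1) by rewrite mulrBr mulr1 -cisD [p + _]addrC subrK.
 rewrite cmodM cmod_cis mul1r distrC; apply: le_sqr2 => //.
 have -> : cmod (cis (q - p) - 1) ^+ 2 = c2 (q - p).
  by rewrite cmod_sqr ReD ImD ReN ImN /= subr0 /c2; have := cos2Dsin2 (q - p); lra.
 by rewrite sqr_normr c2_le_sqr.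
have := Re_le_cmod (cis q - cis p); rewrite ReD ReN /= => h'; exact: letr h' h.
Qed.

(** The first-order term carries sin p, which is itself controlled by the square root of [c2 p]
    through [sin_sqr_c2]; this gain makes the mixed term of the Weyl bound quadratic in second
    differences. *)
Lemma c2_shift (p th : R) : `|c2 (p - th) - c2 p| <= 2 * `|th| * `|sin p| + th ^+ 2.
have -> : c2 (p - th) - c2 p = cos p * c2 th - 2 * (sin p * sin th).
 by rewrite /c2 cosB; ring.
apply: (letr (ler_normB _ _)); rewrite addrC; apply: lerD.
 rewrite !normrM (ger0_norm (ler0n _ 2)) -mulrA [`|th| * _]mulrC; ml; apply: ler_wpM2l => //.
 apply: le_sqr2 => //; rewrite !sqr_normr; exact: sin_sqr_le.
rewrite normrM (ger0_norm (c2_ge0 _)); apply: letr (c2_le_sqr th).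
rewrite -[leRHS]mul1r; mr; by rewrite ler_norml cos_geN1 cos_le1.
Qed.

Lemma sin_sqr_c2 (p : R) : sin p ^+ 2 <= c2 p.
rewrite /c2; have := cos2Dsin2 p; have := sqr_ge0 (1 - cos p); rewrite sqrrB; lra. Qed.

(** The scalar part of the mixed term: [x] and [y] are norms of second differences, [p] and [q]
    norms of first differences, and the hypotheses on p^2 and q^2 are interpolation inequalities. *)
Lemma weyl_real (x y A t p q : R) : 0 <= x -> 0 <= y -> 0 <= A -> 0 <= p -> 0 <= q ->
 p ^+ 2 <= x * A -> q ^+ 2 <= y * A -> q <= 2 * A ->
 (x + 2 * `|t| * A) * y + (2 * `|t| * p + t ^+ 2 * A) * q <= x ^+ 2 + 2 * y ^+ 2 + 4 * (t ^+ 2 * A ^+ 2).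
move=> x0 y0 A0 p0 q0 hp hq qA; rewrite -(real_normK (num_real t)).
move: `|t| (normr_ge0 t) => u u0.
have xy0 : 0 <= x * y by pos.
have uA0 : 0 <= u * A by pos.
have uu0 : 0 <= u ^+ 2 by pos.
have h3 : 2 * u * p * q <= (u * A) ^+ 2 + x * y.
 apply: le_sqr2; first by pos; by [].
 have -> : (2 * u * p * q) ^+ 2 = 4 * u ^+ 2 * (p ^+ 2 * q ^+ 2) by ring.
 have q1 : p ^+ 2 * q ^+ 2 <= x * A * (y * A) by apply: ler_pM; rewrite ?sqr_ge0.
 apply: (via (4 * u ^+ 2 * (x * A * (y * A)))); first by apply: ler_wpM2l => //; exact: mulr_ge0.
 by have := sqr_ge0 ((u * A) ^+ 2 - x * y); rewrite !exprMn; lra.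
have h4 : u ^+ 2 * A * q <= u ^+ 2 * A * (2 * A) by apply: ler_wpM2l => //; exact: mulr_ge0.
have h5 := sqr_ge0 (u * A - y); have h6 := sqr_ge0 (x - y).
lra.
Qed.

Section Weyl.
Variables (th : plane R -> R) (v : plane R) (t : R) (a : Lsq R).
Hypothesis mth : mfun th.
Hypothesis hth : forall x, th (shift v x) = th x + t.

Let S f := phase th f.
Let S' f := phase (fun x => - th x) f.
Let T f := trans v f.
Let T' f := trans (vscale (-1) v) f.
Let mthN : mfun (fun x => - th x). Proof. exact: measurable_funN. Qed.
Let M := mulb (fun x => c2 (th x)).
Let M' := mulb (fun x => c2 (th x - t)).
Let f := T a - a.

Let c2b (p : R) : `|c2 p| <= 4. Proof. by rewrite ger0_norm ?c2_ge0// c2_le4. Qed.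
Let M_ae g : {ae mu, forall x, M g x = (c2 (th x))%:C * g x}.
by apply: (@mulb_ae _ _ 4) => //; exact: measurable_c2. Qed.
Let M'_ae g : {ae mu, forall x, M' g x = (c2 (th x - t))%:C * g x}.
by apply: (@mulb_ae _ _ 4) => //; apply: measurable_c2; exact: measurable_funB. Qed.
Let sn := mulb (fun x => sin (th x)) a.
Let sn_ae : {ae mu, forall x, sn x = (sin (th x))%:C * a x}.
apply: (@mulb_ae _ _ 1); last by move=> x; rewrite ler_norml sin_geN1 sin_le1.
by apply: measurableT_comp mth; apply: continuous_measurable_fun; exact: continuous_sin.
Qed.

Let A := nrm a.
Let X := nrm (M a).
Let Y := nrm (Td v a).
Let A0 : 0 <= A. Proof. exact: nrm_ge0. Qed.
Let X0 : 0 <= X. Proof. exact: nrm_ge0. Qed.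
Let Y0 : 0 <= Y. Proof. exact: nrm_ge0. Qed.

Let TK g : T' (T g) = g. Proof. exact: transK. Qed.
Let TK' g : T (T' g) = g.
by have := transK (vscale (-1) v) g; rewrite vscaleN1K. Qed.
Let Tip g h : ip (T g) (T h) = ip g h.
by apply: (isometry_ip (F := T)); [move=> *; exact: transD|move=> *; exact: nrm_trans]. Qed.
Let Tdef : Td v a = T a + T' a - (a + a).
by rewrite /Td /gt2 trans_gt0 trans_gtV0. Qed.

Let f_sqr : nrm f ^+ 2 <= Y * A.
have e : ip (Td v a) a = - nrm f ^+ 2.
 have h : ip (T' a) a = ip a (T a) by rewrite -Tip TK'.
 rewrite Tdef ipBl !ipDl h /f nrmB_sqr -nrm_sqr /A /T nrm_trans (ipC a); ring.
have := ip_CS_abs (Td v a) a; rewrite e normrN ger0_norm ?sqr_ge0//.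
Qed.

Let f_le : nrm f <= 2 * A.
by rewrite /f; apply: (letr (nrmD _ _)); rewrite nrmN /T nrm_trans -/A; lra. Qed.

Let sn_sqr : nrm sn ^+ 2 <= X * A.
apply: (via (ip (M a) a)); last exact: ip_CS.
rewrite nrm_sqr; apply: ip_le_ae; apply: filterS2 sn_ae (M_ae a) => x -> ->.
have -> : (sin (th x))%:C * a x * conjc ((sin (th x))%:C * a x) = ((sin (th x) ^+ 2) * (cmod (a x) ^+ 2))%:C.
 rewrite conjcM conjc_real realcM expr2 realcM -mul_conjc.
 ring.
have -> : (c2 (th x))%:C * a x * conjc (a x) = (c2 (th x) * cmod (a x) ^+ 2)%:C by rewrite realcM -mul_conjc mulrA.
rewrite /=; mr; exact: sin_sqr_c2.
Qed.

Let dM : nrm (M' a - M a) <= 2 * `|t| * nrm sn + t ^+ 2 * A.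
have t20 : 0 <= 2 * `|t| by pos.
have := @nrm_dom R bool (fun i : bool => if i then 2 * `|t| else t ^+ 2) (fun i : bool => if i then sn else a) (M' a - M a).
rewrite !big_bool /=; apply; first by case; rewrite ?sqr_ge0.
apply: filterS2 (fnB (M' a) (M a)) (filterI (M'_ae a) (filterI (M_ae a) sn_ae)) => x -> [-> [-> h1]].
rewrite big_bool; cbv beta iota; rewrite h1 -mulrBl !cmodM cmod_real [X in _ <= X + _]mulrA -[leRHS]mulrDl -realcB cmod_real; mr; exact: c2_shift.
Qed.

Let M'_le : nrm (M' a) <= X + 2 * `|t| * A.
have h : nrm (M' a - M a) <= 2 * `|t| * A.
 have t20 : 0 <= 2 * `|t| by pos.
 have -> : 2 * `|t| * A = nrm ((2 * `|t|)%:C *: a) by rewrite nrmZ cmod_real (ger0_norm t20).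
 apply: nrm_le_ae; apply: filterS2 (fnB (M' a) (M a)) (filterI (M'_ae a) (filterI (M_ae a) (fnZ (2 * `|t|)%:C a))) => x -> [-> [-> ->]].
 have -> : (c2 (th x - t))%:C * a x - (c2 (th x))%:C * a x = (c2 (th x - t) - c2 (th x))%:C * a x by rewrite realcB mulrBl.
 rewrite !cmodM !cmod_real (ger0_norm t20); mr; apply: (letr (c2_lip _ _)); by rewrite addrAC subrr add0r normrN.
rewrite -[X in nrm X](subrK (M a)) addrC; apply: (letr (nrmD _ _)); exact: lerD.
Qed.

(* [|(S - 1) (T - 1) a|^2 = <M (T - 1) a, (T - 1) a>], and [M T = T M']. *)
Let N3_sqr : nrm (S f - f) ^+ 2 <= X ^+ 2 + 2 * Y ^+ 2 + 4 * (t ^+ 2 * A ^+ 2).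
have e1 : nrm (S f - f) ^+ 2 = ip (M f) f.
 rewrite nrm_sqr; apply/eqP; rewrite eq_le; apply/andP.
 have H : {ae mu, forall x, Re ((S f - f) x * conjc ((S f - f) x)) = Re (M f x * conjc (f x))}.
  apply: filterS2 (fnB (S f) f) (filterI (phase_ae f mth) (M_ae f)) => x -> [-> ->].
  rewrite mul_conjc -mulrA mul_conjc -realcM /=.
  have -> : cis (th x) * f x - f x = (cis (th x) - 1) * f x by ring.
  rewrite cmodM exprMn; congr (_ * _).
  by rewrite cmod_sqr ReD ImD ReN ImN /= subr0 /c2; have := cos2Dsin2 (th x); lra.
 by split; apply: ip_le_ae; apply: filterS H => x ->.
have e2 : M f = (T (M' a) - M' a) + (M' a - M a).
 rewrite addrA subrK; apply: Lsq_ext.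
 apply: filterS2 (M_ae f) (filterI (fnB (T a) a) (filterI (fnB (T (M' a)) (M a)) (filterI (trans_ae v a) (filterI (trans_ae v (M' a))
  (filterI (scales_ae (leb2_shift v) (M'_ae a)) (M_ae a)))))) => x -> [h1 [-> [h2 [h3 [h4 ->]]]]].
 by rewrite /f h1 h2 h3 h4 hth addrK mulrBr.
have e3 : ip (T (M' a) - M' a) f = - ip (M' a) (Td v a).
 have h : ip (T (M' a)) a = ip (M' a) (T' a) by have := Tip (M' a) (T' a); rewrite TK'.
 rewrite Tdef /f ipBl !ipBr Tip h !ipDr; ring.
rewrite e1 e2 ipDl e3.
have h1 : - ip (M' a) (Td v a) <= (X + 2 * `|t| * A) * Y.
 have := ip_CS_abs (M' a) (Td v a); have := ler_norm (- ip (M' a) (Td v a)); rewrite normrN => q1 q2.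
 by apply: (letr q1); apply: (letr q2); apply: ler_wpM2r.
have h2 : ip (M' a - M a) f <= (2 * `|t| * nrm sn + t ^+ 2 * A) * nrm f.
 by apply: (letr (ip_CS _ _)); mr; exact: dM.
apply: (letr (lerD h1 h2)); apply: weyl_real => //; by [].
Qed.

Let N4_le : nrm (T' (S' a - a) - (S' a - a)) <= nrm (S f - f) + `|t| * A.
have TB p q : T (p - q) = T p - T q by exact: transB.
rewrite -(nrm_trans v) -/(T _) TB TK' nrmBC.
have -> : T (S' a - a) - (S' a - a) = (S' f - f) + (T (S' a) - S' (T a)).
 rewrite TB /f; have -> : S' (T a - a) = S' (T a) - S' a by exact: phaseB.
 exact: commutator_rearrange.
apply: (letr (nrmD _ _)); apply: lerD.
 apply: nrm_le_ae; apply: filterS2 (fnB (S' f) f) (filterI (fnB (S f) f) (filterI (phase_ae f mthN) (phase_ae f mth))) => x -> [-> [-> ->]].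
 have -> : cis (- th x) * f x - f x = - (cis (- th x) * (cis (th x) * f x - f x)).
  by rewrite mulrBr mulrA cisKN mul1r opprB.
 by rewrite cmodN cmodM cmod_cis mul1r.
have -> : `|t| * A = nrm (`|t|%:C *: T a) by rewrite nrmZ cmod_real normr_id /T nrm_trans.
apply: nrm_le_ae; apply: filterS2 (fnB (T (S' a)) (S' (T a))) (filterI (fnZ `|t|%:C (T a)) (filterI (trans_ae v (S' a)) (filterI (phase_ae (T a) mthN)
  (filterI (trans_ae v a) (scales_ae (leb2_shift v) (phase_ae a mthN)))))) => x -> [-> [-> [-> [h1 h2]]]].
rewrite h2 h1 -mulrBl !cmodM cmod_real normr_id; mr; rewrite hth opprD cisD -[X in _ - X]mulr1 -mulrBr cmodM cmod_cis mul1r.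
apply: le_sqr2 => //; rewrite sqr_normr.
have -> : cmod (cis (- t) - 1) ^+ 2 = c2 t.
 by rewrite cmod_sqr ReD ImD ReN ImN /= subr0 /c2 cosN sinN; have := cos2Dsin2 t; rewrite sqrrN; lra.
exact: c2_le_sqr.
Qed.

(** The second difference of S T is the sum of those of S and of T plus the mixed terms (S - 1)(T -
    1) and (T^-1 - 1)(S^-1 - 1). These are dominated by the pure second differences up to the scalar
    commutator, whence the term in t^2. *)
Lemma weyl_bound : nrm (gt2 th v a) ^+ 2 <=
 68 * (nrm (mulb (fun x => c2 (th x)) a) ^+ 2 + nrm (Td v a) ^+ 2 + t ^+ 2 * nrm a ^+ 2).
have e : gt2 th v a = (- M a + Td v a) + ((S f - f) + (T' (S' a - a) - (S' a - a))).
 have -> : - M a = S a + S' a - (a + a).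
  apply: Lsq_ext; apply: filterS2 (fnN (M a)) (filterI (fnB (S a + S' a) (a + a)) (filterI (fnD (S a) (S' a)) (filterI (fnD a a)
   (filterI (M_ae a) (filterI (phase_ae a mth) (phase_ae a mthN)))))) => x -> [-> [-> [-> [-> [-> ->]]]]].
  by rewrite -mulNr -cis_c2; ring.
 have -> : T' (S' a - a) = T' (S' a) - T' a by exact: transB.
 have -> : S f = S (T a) - S a by exact: phaseB.
 by rewrite Tdef; exact: weyl_rearrange.
have := nrm_ge0 (gt2 th v a); rewrite e.
set n3 := nrm (S f - f); set n4 := nrm (T' (S' a - a) - (S' a - a)).
have h4 : n4 <= n3 + `|t| * A by exact: N4_le.
have h3 : n3 ^+ 2 <= X ^+ 2 + 2 * Y ^+ 2 + 4 * (t ^+ 2 * A ^+ 2) by exact: N3_sqr.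
set G := nrm (_ + _) => G0.
have hG : G <= X + Y + 2 * n3 + `|t| * A.
 apply: (letr (nrmD _ _)); apply: (letr (lerD (nrmD _ _) (nrmD _ _))); rewrite nrmN.
 rewrite -/X -/Y -/n3 -/n4; lra.
apply: (via ((X + Y + 2 * n3 + `|t| * A) ^+ 2)); first exact: sqr_le2.
have tA : (`|t| * A) ^+ 2 = t ^+ 2 * A ^+ 2 by rewrite exprMn sqr_normr.
rewrite -/X -/Y -/A; move: tA h3; move: (`|t| * A) (t ^+ 2 * A ^+ 2) => q Q <- h3.
have := sqr_ge0 (X - Y); have := sqr_ge0 (X - 2 * n3); have := sqr_ge0 (X - q); have := sqr_ge0 (Y - 2 * n3).
have := sqr_ge0 (Y - q); have := sqr_ge0 (2 * n3 - q); have := sqr_ge0 X; have := sqr_ge0 Y; have := sqr_ge0 q.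
by pos.
Qed.

End Weyl.
End WeylOperators.

(** * Weights of the solution, uniform on bounded time intervals *)

Section UniformWeights.
Context {R : realType}.
Variables (m : 'I_3 -> R) (s : R).
Hypothesis hm0 : forall j, m j != 0.
Hypothesis hs : 1 < s < 2.
Implicit Types (g phi : 'I_3 -> Lsq R) (a : Lsq R) (K v : plane R).

Let rr0 k : 0 <= rr s ^+ k. Proof. by rewrite exprn_ge0// powR_ge0. Qed.
Lemma nrm_Pd_Fhat_U (mj t : R) K a : nrm (Pd K (Fhat (U mj t a))) = nrm (Pd K (Fhat a)).
by rewrite -!nrm_Td Td_U nrm_U. Qed.

(** A frequency shift of the solution is a Galilean operator on the profile; the Weyl bound
    separates it into a frequency shift by [K] and a position shift by t K / m_j. The phase [f]
    differs from [dot K x] by th/2, which [c2_lip] removes; 204 is 3 times 68. *)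
Lemma Pd_U j t K a : nrm (Pd K (U (m j) t a)) ^+ 2 <=
 204 * (nrm (Pd K a) ^+ 2 + nrm (Td (vscale (t / m j) K) a) ^+ 2 + (t / m j * dot K K) ^+ 2 * nrm a ^+ 2).
pose th := t / m j * dot K K; rewrite -/th.
pose kp := vscale (m j)^-1 K; have eK : K = vscale (m j) kp.
 by rewrite /kp /vscale /= !mulVKf//; case: {+}K.
pose f := mth_ m (gal kp (- t)) j.
have mf : mfun f by apply: measurable_mth; exact: measurable_gal.
have ev : vscale (- - t) kp = vscale (t / m j) K by rewrite opprK /kp /vscale /= !mulrA.
have e1 : nrm (Pd K (U (m j) t a)) = nrm (gt2 f (vscale (t / m j) K) a).
 by rewrite -(nrm_U (m j) (- t)) [in LHS]eK U_Pd// ev UK.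
have hf x : f (shift (vscale (t / m j) K) x) = f x + th.
 by rewrite /f /mth_ /gal /kp /th /shift /vscale /dot /=; field.
have fx x : f x = dot K x + th / 2.
 by rewrite /f /mth_ /gal /kp /th /vscale /dot /=; field.
have w := weyl_bound a mf hf; rewrite -e1 in w.
have h1 : nrm (mulb (fun x => c2 (f x)) a) <= nrm (Pd K a) + `|th| * nrm a.
 have := @nrm_dom R bool (fun i : bool => if i then 1 else `|th|) (fun i : bool => if i then Pd K a else a) (mulb (fun x => c2 (f x)) a).
 rewrite !big_bool /= mul1r; apply; first by case.
 have mb : {ae mu, forall x, mulb (fun x => c2 (f x)) a x = (c2 (f x))%:C * a x}.
  apply: (@mulb_ae _ _ _ 4); first exact: measurable_c2.
  by move=> x; rewrite ger0_norm ?c2_ge0// c2_le4.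
 apply: filterS2 mb (Pd_ae K a) => x -> h; rewrite big_bool; cbv beta iota; rewrite h mul1r.
 change (cmod ((c2 (f x))%:C * a x) <= cmod (- (c2 (dot K x))%:C * a x) + `|th| * cmod (a x)).
 rewrite !cmodM cmodN !cmod_real -mulrDl; mr; rewrite -[c2 (f x)](subrK (c2 (dot K x))) addrC; apply: (letr (ler_normD _ _)); rewrite lerD2l.
 apply: (letr (c2_lip _ _)); rewrite fx addrAC subrr add0r normrM [X in _ * (_ * X)]ger0_norm ?invr_ge0//; lra.
have h2 : nrm (mulb (fun x => c2 (f x)) a) ^+ 2 <= 2 * nrm (Pd K a) ^+ 2 + 2 * (th ^+ 2 * nrm a ^+ 2).
 apply: (letr (sqr_le2 (nrm_ge0 _) h1)).
 have := sqr_ge0 (nrm (Pd K a) - `|th| * nrm a).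
 have e2 : (`|th| * nrm a) ^+ 2 = th ^+ 2 * nrm a ^+ 2 by rewrite exprMn sqr_normr.
 by pos.
nra.
Qed.

Lemma qs_sqr i phi : qs m i phi ^+ 2 <= 3 * \sum_l qn m i l (phi l) ^+ 2.
exact: sum3_sqr. Qed.

(** A single scale [L] above all ratios of masses and all t / m_j: by monotonicity of [psi], second
    differences at scale [L] dominate all that occur. *)
Lemma mass_bound T : 0 <= T -> exists2 L : R, 1 <= L & (forall j l, `|m l / m j| <= L) /\
 forall j t, 0 <= t <= T -> `|t / m j| <= L.
move=> T0; pose S := \sum_j `|(m j)^-1|; pose S2 := \sum_l `|m l|.
have S0 : 0 <= S by apply: sumr_ge0.
have S20 : 0 <= S2 by apply: sumr_ge0.
have hS j : `|(m j)^-1| <= S by apply: (le_sum3 (F := fun j => `|(m j)^-1|)).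
have hS2 j : `|m j| <= S2 by apply: (le_sum3 (F := fun j => `|m j|)).
exists (1 + S2 * S + T * S); first by rewrite -addrA lerDl addr_ge0// mulr_ge0.
have p1 : 0 <= S2 * S by pos.
have p2 : 0 <= T * S by pos.
split=> [j l|j t /andP[t0 tT]].
 rewrite normrM; have : `|m l| * `|(m j)^-1| <= S2 * S by apply: ler_pM.
 lra.
rewrite normrM (ger0_norm t0); have : t * `|(m j)^-1| <= T * S by apply: ler_pM.
lra.
Qed.

(** The majorant [B] depends neither on the time in [0, T] nor on [g], only on the growth constant.
    It gives both membership in the weighted spaces and continuity in time. *)
Lemma uniform_weights T G eps phi : 0 <= T -> 0 <= G -> inXe s eps phi -> exists (B : nat -> R) (Z : R),
 [/\ forall k, 0 <= B k, forall n, \sum_(k < n) rr s ^+ k * B k <= Z &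
  forall g, (forall i, qs m i g <= G * qs m i phi) -> forall t, 0 <= t <= T -> forall j k,
   PP 1 k (U (m j) t (g j)) <= B k /\ PP 1 k (Fhat (U (m j) t (g j))) <= B k].
move=> T0 G0 [eps0 hphi]; have [L L1 [Lm Lt]] := mass_bound T0.
have L0 : 0 <= L := letr ler01 L1; have nL : `|L| = L by rewrite ger0_norm.
pose Q1 k := \sum_l QQ L k (phi l); pose Q2 k := \sum_l QQ L k (Fhat (phi l)).
have Q10 k : 0 <= Q1 k by apply: sumr_ge0 => l _; exact: QQ_ge0.
have Q20 k : 0 <= Q2 k by apply: sumr_ge0 => l _; exact: QQ_ge0.
pose q := qs m (S0 (R := R)) phi; have q0 : 0 <= q by exact: qs_ge0.
(* The commutator contributes |K|^4, that is 16^-k, which is summable against [rr s ^+ k] because s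
   < 2. *)
pose D k := 2 * (L ^+ 2 * q ^+ 2) * (16^-1) ^+ k.
have D0 k : 0 <= D k by rewrite /D; apply: mulr_ge0; [apply: mulr_ge0 => //; apply: mulr_ge0; exact: sqr_ge0|by []].
pose B k := 204 * G ^+ 2 * (3 * Q1 k + 3 * Q2 k + D k).
have B0 k : 0 <= B k.
 rewrite /B; apply: mulr_ge0; first by pos; by [].
 by pos.
have [r16 r0] : rr s / 16 < 1 /\ 0 <= rr s / 16.
 by have := rr_lt16 hs; have := powR_ge0 4 s; rewrite -/(rr s) => r0 r1; split; [rewrite ltr_pdivrMr//; lra|rewrite divr_ge0].
pose Z := 204 * G ^+ 2 * (3 * \sum_l Cup s L * nrm (wt s (phi l)) ^+ 2 + 3 * \sum_l Cup s L * nrm (wt s (Fhat (phi l))) ^+ 2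
  + 2 * (L ^+ 2 * q ^+ 2) * (1 - rr s / 16)^-1).
have sumQ (f : 'I_3 -> Lsq R) n : (forall l, inW s (f l)) -> \sum_(k < n) rr s ^+ k * (3 * \sum_l QQ L k (f l)) <= 3 * \sum_l Cup s L * nrm (wt s (f l)) ^+ 2.
 move=> hf; have -> : \sum_(k < n) rr s ^+ k * (3 * \sum_l QQ L k (f l)) = 3 * \sum_l \sum_(k < n) rr s ^+ k * QQ L k (f l).
  rewrite exchange_big mulr_sumr; apply: eq_bigr => k _; rewrite mulrCA; congr (_ * _); by rewrite mulr_sumr.
 by ml; apply: ler_sum => l _; exact: W_up.
have sumD n : \sum_(k < n) rr s ^+ k * D k <= 2 * (L ^+ 2 * q ^+ 2) * (1 - rr s / 16)^-1.
 have -> : \sum_(k < n) rr s ^+ k * D k = 2 * (L ^+ 2 * q ^+ 2) * \sum_(k < n) (rr s / 16) ^+ k.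
  by rewrite mulr_sumr; apply: eq_bigr => k _; rewrite /D exprMn; ring.
 apply: ler_wpM2l; first by pos; apply: mulr_ge0; by [].
 have GS i : \sum_(k < i) (rr s / 16) ^+ k = (1 - (rr s / 16) ^+ i) / (1 - rr s / 16).
  elim: i => [|i IH]; first by rewrite big_ord0 expr0 subrr mul0r.
  rewrite big_ord_recr /= IH exprS; move: (rr s / 16) r16 (_ ^+ i) => p p1 z; field; lra.
 have d0 : 0 < 1 - rr s / 16 by pos.
 by rewrite GS -[leRHS]mul1r; apply: ler_wpM2r; rewrite ?invr_ge0 ?(ltW d0)// lerBlDr lerDl exprn_ge0.
exists B, Z; split=> // [n|g hg t ht j k].
 have -> : \sum_(k < n) rr s ^+ k * B k = 204 * G ^+ 2 * (\sum_(k < n) rr s ^+ k * (3 * Q1 k) + \sum_(k < n) rr s ^+ k * (3 * Q2 k) + \sum_(k < n) rr s ^+ k * D k).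
  by rewrite -!big_split mulr_sumr; apply: eq_bigr => i _ /=; rewrite /B; ring.
 rewrite /Z; apply: ler_wpM2l; first by pos; by [].
 apply: lerD => //; apply: lerD; apply: sumQ => l; by have [] := hphi l.
have sq i l : qn m i l (g l) ^+ 2 <= G ^+ 2 * (3 * \sum_l' qn m i l' (phi l') ^+ 2).
 apply: (via ((G * qs m i phi) ^+ 2)).
  apply: sqr_le2; first by [].
  by apply: letr (hg i); apply: (le_sum3 (F := fun l => qn m i l (g l))) => l'; by [].
 by rewrite exprMn; ml; exact: qs_sqr.
have PPe (nu' : R) (a : Lsq R) : PP nu' k a = \sum_(d : bool) nrm (Pd (vscale (nu' * 2^-1 ^+ k) (if d then e1 else e2)) a) ^+ 2.
 by rewrite big_bool.
pose K d := vscale (1 * 2^-1 ^+ k) (if d then e1 else e2) : plane R.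
have hST (c : R) l (d : bool) : nrm (Td (vscale c (K d)) (g l)) ^+ 2 <= G ^+ 2 * (3 * \sum_l' nrm (Pd (vscale (c * 2^-1 ^+ k) (if d then e1 else e2)) (Fhat (phi l'))) ^+ 2).
 apply: (letr (sq (ST (vscale c (K d))) l)); ml; ml; apply: ler_sum => l' _; rewrite /qn /= nrm_Td.
 by have -> : vscale c (K d) = vscale (c * 2^-1 ^+ k) (if d then e1 else e2) by rewrite /K mul1r /vscale /= !mulrA.
have hST2 (c : R) l : `|c| <= L -> \sum_(d : bool) nrm (Td (vscale c (K d)) (g l)) ^+ 2 <= G ^+ 2 * (3 * Q2 k).
 move=> cL; apply: (letr (ler_sum _ (fun d _ => hST c l d))).
 rewrite -!mulr_sumr exchange_big /=; ml; ml; apply: ler_sum => l' _; rewrite -PPe; apply: PP_QQ; by rewrite nL.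
split; last first.
 have -> : PP 1 k (Fhat (U (m j) t (g j))) = \sum_(d : bool) nrm (Td (vscale 1 (K d)) (g j)) ^+ 2.
  rewrite PPe; apply: eq_bigr => d _; rewrite nrm_Pd_Fhat_U -nrm_Td.
  by congr (nrm (Td _ _) ^+ 2); rewrite /K /vscale /= !mul1r.
 apply: (letr (hST2 1 j _)); first by rewrite normr1.
 have -> : B k = G ^+ 2 * (204 * (3 * Q1 k + 3 * Q2 k + D k)) by rewrite /B; ring.
 ml; by have := Q10 k; have := Q20 k; have := D0 k; lra.
rewrite PPe; apply: (letr (ler_sum _ (fun d _ => @Pd_U j t (K d) (g j)))).
rewrite -mulr_sumr !big_split /=.
have hSP : \sum_(d : bool) nrm (Pd (K d) (g j)) ^+ 2 <= G ^+ 2 * (3 * Q1 k).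
 have h d : nrm (Pd (K d) (g j)) ^+ 2 <= G ^+ 2 * (3 * \sum_l' nrm (Pd (vscale (m l' / m j * 2^-1 ^+ k) (if d then e1 else e2)) (phi l')) ^+ 2).
  have eK : K d = vscale (m j) (vscale (m j)^-1 (K d)) by rewrite /vscale /= !mulVKf//; case: (K d).
  rewrite [in leLHS]eK; apply: (letr (sq (SP (vscale (m j)^-1 (K d))) j)).
  ml; ml; apply: ler_sum => l' _; rewrite /qn /=.
  by have -> : vscale (m l') (vscale (m j)^-1 (K d)) = vscale (m l' / m j * 2^-1 ^+ k) (if d then e1 else e2) by rewrite /K mul1r /vscale /= !mulrA.
 apply: (letr (ler_sum _ (fun d _ => h d))).
 rewrite -!mulr_sumr exchange_big /=; ml; ml; apply: ler_sum => l' _; rewrite -PPe; apply: PP_QQ; by rewrite nL.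
have hT := hST2 (t / m j) j (Lt j t ht).
have gq : nrm (g j) <= G * q.
 by apply: letr (hg (S0 (R := R))); apply: (le_sum3 (F := fun l => nrm (g l))) => l'; by [].
have hth : \sum_(d : bool) (t / m j * dot (K d) (K d)) ^+ 2 * nrm (g j) ^+ 2 <= G ^+ 2 * D k.
 have one d : (t / m j * dot (K d) (K d)) ^+ 2 * nrm (g j) ^+ 2 <= L ^+ 2 * 16^-1 ^+ k * (G * q) ^+ 2.
  apply: ler_pM; [exact: sqr_ge0|exact: sqr_ge0| |by apply: sqr_le2 => //; by []].
  rewrite exprMn; apply: ler_pM; [exact: sqr_ge0|exact: sqr_ge0| |].
   by rewrite -(real_normK (num_real (t / m j))); apply: sqr_le2 => //; exact: Lt.
  have -> : dot (K d) (K d) = (2^-1 ^+ k) ^+ 2.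
   by rewrite /K mul1r /dot /vscale; case: d => /=; rewrite ?mulr1 ?mulr0 ?mul0r ?addr0 ?add0r expr2.
  have -> : (16^-1 : R) = (2^-1) ^+ 4 by field.
  by rewrite -!exprM [(4 * k)%N]mulnC -mulnA.
 apply: (letr (ler_sum _ (fun d _ => one d))).
 rewrite sumr_const card_bool mulr2n /D; move: (16^-1 ^+ k) => z; apply: eq_ler; ring.
have -> : B k = 204 * (G ^+ 2 * (3 * Q1 k) + G ^+ 2 * (3 * Q2 k) + G ^+ 2 * D k) by rewrite /B; ring.
lra.
Qed.

End UniformWeights.

(** * The Duhamel equation for L^2 classes *)

Section ClassSolutions.
Context {R : realType}.
Variables (lam nu : 'I_3 -> R[i]) (m : 'I_3 -> R) (s : R).
Implicit Types (g phi : 'I_3 -> Lsq R) (a : Lsq R) (u v : R -> 'I_3 -> Lsq R).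

Local Notation KF := (KF lam nu).
Local Notation FL := (FL lam nu).

Definition tagged_part (t delta : R) (n : nat) (p c : nat -> R) : Prop :=
 [/\ p 0%N = 0, p n = t &
   forall k, (k < n)%N -> [/\ p k <= c k, c k <= p k.+1 & p k.+1 - p k < delta]].

Definition riemann u t j (n : nat) (p c : nat -> R) : Lsq R :=
 \sum_(k < n) (p k.+1 - p k)%:C *: U (m j) (t - c k) (FL (u (c k)) j).

(** The statement's notion of solution read on classes, where equality almost everywhere is
    equality; [global_solutionP] proves the equivalence. *)
Definition class_solution phi u : Prop :=
 [/\ forall t, 0 <= t -> forall j, inW s (u t j) /\ inW s (Fhat (u t j)),
   forall t0, 0 <= t0 -> forall e : R, 0 < e -> exists2 d : R, 0 < d & forall t, 0 <= t -> `|t - t0| < d ->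
    forall j, nrm (wt s (u t j - u t0 j)) <= e /\ nrm (wt s (Fhat (u t j - u t0 j))) <= e &
   forall t, 0 <= t -> forall j, exists2 h, u t j = U (m j) t (phi j) - 'i *: h &
    forall e : R, 0 < e -> exists2 d : R, 0 < d & forall n p c, tagged_part t d n p c ->
     nrm (riemann u t j n p c - h) < e].

Lemma tagged_part_mono t d n p c : tagged_part t d n p c -> forall k, (k <= n)%N -> 0 <= p k <= t.
move=> [p0 pn hp] k kn; apply/andP; split.
 elim: k kn => [|k IH] kn; first by rewrite p0.
 by have [h1 h2 _] := hp k kn; apply: (letr (IH (ltnW kn))); exact: letr h1 h2.
have H i : (i <= n)%N -> p (n - i)%N <= t.
 elim: i => [|i IH] iN; first by rewrite subn0 pn.
 have [|h1 h2 _] := hp (n - i.+1)%N; first by rewrite subnSK// leq_subr.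
 by apply: letr (IH (ltnW iN)); rewrite -(subnSK iN); exact: letr h1 h2.
by have := H (n - k)%N (leq_subr _ _); rewrite subKn.
Qed.

Lemma U_sum (I : Type) (r : seq I) (F : I -> Lsq R) mj t : U mj t (\sum_(i <- r) F i) = \sum_(i <- r) U mj t (F i).
apply: (big_morph (U mj t)); first by move=> x y; exact: UD.
by have := UZ mj t 0 0; rewrite !scale0r.
Qed.

(** Subtracting the telescoped increment of the profile turns a Riemann sum into a sum of local
    errors, to which the local form of the equation applies. *)
Lemma telescope_local (n : nat) (p : nat -> R) (x y : nat -> Lsq R) :
 \sum_(k < n) (p k.+1 - p k)%:C *: y k - 'i *: (x n - x 0%N) =
 \sum_(k < n) (- 'i) *: (x k.+1 - x k + (0 +i* (p k.+1 - p k)) *: y k).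
have -> : x n - x 0%N = \sum_(k < n) (x k.+1 - x k) by rewrite -(big_mkord xpredT (fun k => x k.+1 - x k)) telescope_sumr.
rewrite scaler_sumr -sumrB; apply: eq_bigr => k _; rewrite [RHS]scalerDr [RHS]addrC (scaleNr 'i (x k.+1 - x k)) scalerA; congr (_ *: _ - _).
by apply: complex_eq => /=; ring.
Qed.

Lemma cmod_Ni : cmod (- 'i : R[i]) = 1.
by rewrite cmodN cmod_im normr1. Qed.

Section Existence.
Hypothesis hm0 : forall j, m j != 0.
Hypothesis hs : 1 < s < 2.
Variables (phi : 'I_3 -> Lsq R) (g : R -> 'I_3 -> Lsq R) (eps b : R).
Hypothesis hphi : inXe s eps phi.
Hypothesis b0 : 0 <= b.
Hypothesis g0 : g 0 = phi.
Hypothesis hq : forall t, 0 <= t -> forall i, qs m i (g t) <= (1 + t) `^ b * qs m i phi.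
Hypothesis hloc : forall T, 0 <= T -> exists2 C : R, 0 <= C &
 (forall p q, 0 <= p -> p <= q -> q <= T -> td (g q) (g p) <= C * (q - p)) /\
 (forall p c q j, 0 <= p -> p <= c -> c <= q -> q <= T ->
   nrm (g q j - g p j + (0 +i* (q - p)) *: NL lam nu m c (g c) j) <= C * (q - p) * sqrt (q - p)).

Let u t j := U (m j) t (g t j).

Let qT T t : 0 <= t <= T -> forall i, qs m i (g t) <= (1 + T) `^ b * qs m i phi.
move=> /andP[t0 tT] i; apply: (letr (hq t0 i)); mr; by apply: ge0_ler_powR => //; rewrite ?nnegrE; lra.
Qed.

Lemma evolved_weights T : 0 <= T -> forall t, 0 <= t <= T -> forall j, inW s (u t j) /\ inW s (Fhat (u t j)).
move=> T0; have G0 : 0 <= (1 + T) `^ b by pos.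
have [B [Z [B0 BZ H]]] := uniform_weights hm0 hs T0 G0 hphi.
by move=> t ht j; split; apply: (proj1 (weighted_bound hs BZ _)) => k; have [] := H (g t) (qT ht) t ht j k.
Qed.

(** In L^2 the solution moves at most like sqrt |t - t0|: the profile is Lipschitz and the free
    evolution Hölder continuous. The common majorant on [0, t0 + 1] upgrades this to the weighted
    norms. *)
Lemma evolved_continuous t0 : 0 <= t0 -> forall e : R, 0 < e -> exists2 d : R, 0 < d & forall t, 0 <= t -> `|t - t0| < d ->
 forall j, nrm (wt s (u t j - u t0 j)) <= e /\ nrm (wt s (Fhat (u t j - u t0 j))) <= e.
move=> t00 e e0; pose T := t0 + 1; have T0 : 0 <= T by rewrite /T; lra.
have G0 : 0 <= (1 + T) `^ b by pos.
have [B [Z [B0 BZ H]]] := uniform_weights hm0 hs T0 G0 hphi.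
have [d d0 hd] := weighted_continuity hs BZ e0.
have [C C0 [hC _]] := hloc T0.
have [X0 hX] := inXe_transfer hm0 hs G0 hphi (qT (T := T) (t := t0) ltac:(rewrite /T t00; lra)).
move: X0 hX; set X := CW m s * _ => X0 hX.
pose S := \sum_j CU (m j); have CUS j : CU (m j) <= S by apply: (le_sum3 (F := fun j => CU (m j))) => l; exact: CU_ge0.
have S0 : 0 <= S by apply: sumr_ge0 => l _; exact: CU_ge0.
pose K := C + S * X + 1; have SX : 0 <= S * X by pos.
have K0 : 0 < K by rewrite /K; lra.
exists (Num.min 1 ((d / K) ^+ 2)); first by rewrite lt_min ltr01 exprn_gt0// divr_gt0.
move=> t t0' ; rewrite lt_min => /andP[h1 h2] j.
have tT : 0 <= t <= T by rewrite t0' /T; move: h1; rewrite ltr_norml; lra.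
have t0T : 0 <= t0 <= T by rewrite t00 /T; lra.
have Pt i := H (g t) (qT tT) t tT j i; have Pt0 i := H (g t0) (qT t0T) t0 t0T j i.
have sq1 : `|t - t0| <= sqrt `|t - t0|.
 rewrite -{1}[`|_|]sqr_sqrtr// expr2 ler_piMl//.
 by apply: le_sqr2 => //; rewrite sqr_sqrtr// expr1n ltW.
have sqd : sqrt `|t - t0| <= d / K.
 by apply: le_sqr2; [rewrite divr_ge0// ltW|rewrite sqr_sqrtr// ltW].
have D : nrm (u t j - u t0 j) <= d.
 apply: (via (K * sqrt `|t - t0|)); last by rewrite -(divfK (lt0r_neq0 K0) d) mulrC; apply: ler_wpM2r => //; exact: ltW.
 apply: (letr (nrm_tri (U (m j) t (g t0 j)) _ _)); rewrite -UB nrm_U.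
 have h3 : nrm (g t j - g t0 j) <= C * sqrt `|t - t0|.
  apply: (letr (td_coord j (g t) (g t0))); apply: (via (C * `|t - t0|)); last exact: ler_wpM2l.
  have [le|/ltW le] := leP t0 t.
   by rewrite ger0_norm ?subr_ge0//; apply: hC => //; case/andP: tT.
  by rewrite tdC distrC ger0_norm ?subr_ge0//; apply: hC => //; case/andP: t0T.
 have [_ w1 _ w2] := hX j.
 have h4 := U_holder hs (m j) t t0 w1.
 have h5 : CU (m j) * sqrt `|t - t0| * nrm (wt s (Fhat (g t0 j))) <= S * sqrt `|t - t0| * X.
  apply: ler_pM => //; [by apply: mulr_ge0; [exact: CU_ge0|by []]|exact: nrm_ge0|].
  by mr; by [].
 have h6 := sqrtr_ge0 `|t - t0|; rewrite /K !mulrDl mul1r; lra.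
split.
 by apply: hd => // k; [have [] := Pt k|have [] := Pt0 k].
rewrite FhatB; apply: hd => [k|k|]; [by have [] := Pt k|by have [] := Pt0 k|].
by rewrite -FhatB nrm_Fhat.
Qed.

Lemma evolved_riemann t j : 0 <= t -> forall e : R, 0 < e -> exists2 d : R, 0 < d & forall n p c, tagged_part t d n p c ->
 nrm (riemann u t j n p c - 'i *: (u t j - U (m j) t (phi j))) < e.
move=> t0 e e0; have [C C0 [_ hC]] := hloc t0; pose K := C * t + 1.
have Ct : 0 <= C * t by pos.
have K0 : 0 < K by rewrite /K; lra.
(* Below this mesh, local errors of order (mesh)^(3/2) add up to at most C t e / (2 K), which is
   less than e. *)
exists ((e / (2 * K)) ^+ 2); first by pos.
move=> n p c P; have M := tagged_part_mono P; have [p0 pn hp] := P.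
have -> : riemann u t j n p c - 'i *: (u t j - U (m j) t (phi j)) =
  U (m j) t (\sum_(k < n) (p k.+1 - p k)%:C *: NL lam nu m (c k) (g (c k)) j - 'i *: (g (p n) j - g (p 0%N) j)).
 rewrite p0 pn UB UZ UB g0 U_sum; congr (_ - _); apply: eq_bigr => k _.
 by rewrite UZ /NL Uadd.
rewrite nrm_U (telescope_local n p (fun k => g (p k) j) (fun k => NL lam nu m (c k) (g (c k)) j)).
apply: (le_lt_trans (nrm_sum _ _ _)).
apply: (@le_lt_trans _ _ (\sum_(k < n) C * (e / (2 * K)) * (p k.+1 - p k))).
 apply: ler_sum => k _; rewrite nrmZ cmod_Ni mul1r; have [h1 h2 h3] := hp k (ltn_ord k).
 have /andP[m1 _] := M k (ltnW (ltn_ord k)); have /andP[_ m2] := M k.+1 (ltn_ord k).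
 apply: (letr (hC _ _ _ j m1 h1 h2 m2)); rewrite mulrAC; apply: ler_wpM2r; first by rewrite subr_ge0; exact: letr h1 h2.
 ml; apply: le_sqr2; first by pos.
 rewrite sqr_sqrtr; [exact: ltW|rewrite subr_ge0; exact: letr h1 h2].
rewrite -mulr_sumr -(big_mkord xpredT (fun k => p k.+1 - p k)) telescope_sumr// p0 pn subr0.
rewrite mulrAC mulrCA gtr_pMr// ltr_pdivrMr; last by pos.
by rewrite /K; lra.
Qed.

Lemma evolved_solution : class_solution phi u.
split; first by move=> t t0; apply: (evolved_weights t0); rewrite t0 lexx.
 exact: evolved_continuous.
move=> t t0 j; exists ('i *: (u t j - U (m j) t (phi j))); last exact: evolved_riemann.
rewrite scalerA (_ : 'i * 'i = -1 :> R[i]); last by apply: complex_eq => /=; ring.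
by rewrite scaleN1r opprK addrC subrK.
Qed.

End Existence.
End ClassSolutions.

(** * Uniqueness by contraction in an exponentially weighted distance *)

Section ClassUniqueness.
Context {R : realType}.
Variables (lam nu : 'I_3 -> R[i]) (m : 'I_3 -> R) (s : R).
Hypothesis hs : 1 < s < 2.
Implicit Types (g phi : 'I_3 -> Lsq R) (a : Lsq R) (u v : R -> 'I_3 -> Lsq R).

Local Notation KF := (KF lam nu).
Local Notation FL := (FL lam nu).
Local Notation class_solution := (class_solution lam nu m s).

Definition sz g : R := \sum_j (nrm (wt s (g j)) + nrm (wt s (Fhat (g j)))).

Lemma dist_nrm a (c : Lsq R) : `|nrm a - nrm c| <= nrm (a - c).
have h1 := nrm_tri c a 0; have h2 := nrm_tri a c 0; rewrite !subr0 (nrmBC c) in h1 h2.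
by rewrite ler_norml; lra.
Qed.

(** The weighted norms are continuous on the compact interval [0, T]; no smallness of the solution
    is involved, so any competitor is covered. *)
Lemma class_solution_bounded phi u T : class_solution phi u -> 0 <= T ->
 exists X : R, forall t, 0 <= t <= T -> inXe s X (u t).
move=> [hW hc _] T0; pose f t := sz (u t).
have cf : {within `[0, T], continuous f}.
 apply/subspace_continuousP => t0; rewrite /= in_itv /= => /andP[t00 t0T].
 apply/cvgrPdist_le => e e0; have e6 : 0 < e / 6 by pos.
 have [d d0 hd] := hc t0 t00 _ e6.
 apply/nbhs_ballP; exists d => //= t; rewrite /ball /= => ht; rewrite in_itv /= => /andP[t0' _].
 have {}hd := hd t t0'; rewrite distrC in ht; have {}hd := hd ht.
 rewrite /f /sz -sumrB; apply: (letr (ler_norm_sum _ _ _)).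
 apply: (via (\sum_(j < 3) (e / 3))); last by rewrite sumr_const card_ord -mulr_natr; lra.
 apply: ler_sum => j _; have [h1 h2] := hd j; have [w1 w2] := hW t t0' j; have [w3 w4] := hW t0 t00 j.
 have [_ e1] := inWB w1 w3; rewrite e1 in h1.
 rewrite FhatB in h2; have [_ e2'] := inWB w2 w4; rewrite e2' in h2.
 rewrite opprD addrACA; apply: (letr (ler_normD _ _)).
 have h3 := dist_nrm (wt s (u t0 j)) (wt s (u t j)); have h4 := dist_nrm (wt s (Fhat (u t0 j))) (wt s (Fhat (u t j))).
 rewrite nrmBC in h3; rewrite nrmBC in h4; lra.
have [c hc' hmax] := EVT_max T0 cf.
exists (f c) => t ht; have fc : f t <= f c by apply: hmax; rewrite in_itv.
have n0 j : 0 <= nrm (wt s (u t j)) + nrm (wt s (Fhat (u t j))) by pos.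
have fj j : nrm (wt s (u t j)) + nrm (wt s (Fhat (u t j))) <= f c.
 by apply: letr fc; apply: (le_sum3 (F := fun j => nrm (wt s (u t j)) + nrm (wt s (Fhat (u t j))))).
split; first exact: letr (n0 i1) (fj i1).
move=> l; have [w1 w2] := hW t (proj1 (andP ht)) l; have := fj l.
have := nrm_ge0 (wt s (u t l)); have := nrm_ge0 (wt s (Fhat (u t l))) => a1 a2 a3.
by split => //; lra.
Qed.

(** Left endpoints make the Riemann sum of an increasing exponential smaller than its primitive,
    without any error term. *)
Lemma exp_riemann_sum (l h : R) n : 0 <= l -> 0 <= h -> \sum_(k < n) l * h * expR (l * (k%:R * h)) <= expR (l * (n%:R * h)).
move=> l0 h0; elim: n => [|n IH]; first by rewrite big_ord0.
rewrite big_ord_recr /= -natr1 mulrDl mul1r mulrDr expRD.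
have h1 := expR_ge1Dx (l * h); have h2 := expR_gt0 (l * (n%:R * h)).
nra.
Qed.

Lemma uniform_partition (t d : R) : 0 <= t -> 0 < d -> exists n : nat, exists2 h : R, 0 <= h &
 [/\ n%:R * h = t, h < d & tagged_part t d n (fun k => k%:R * h) (fun k => k%:R * h)].
move=> t0 d0; pose n := (Num.truncn (t / d)).+1; pose h := t / n%:R.
have n0 : 0 < n%:R :> R by rewrite ltr0n.
have hd : h < d.
 by rewrite /h ltr_pdivrMr// mulrC -ltr_pdivrMr//; have /andP[] := truncn_itv (divr_ge0 t0 (ltW d0)).
have h0 : 0 <= h by rewrite divr_ge0// ltW.
have e : n%:R * h = t by rewrite /h mulrC divfK// lt0r_neq0.
exists n, h => //; split=> //; split=> // [|k _]; first by rewrite mul0r.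
rewrite lexx -natr1 mulrDl mul1r lerDl; split=> //; by rewrite addrAC subrr add0r.
Qed.

(** The Lipschitz constant 2 KF L, summed over three components and divided by l > 12 KF L, is below
    1/2. The Duhamel integrals are compared through Riemann sums on one uniform partition fine
    enough for both solutions. *)
Lemma duhamel_contraction phi u v (T L M l : R) : class_solution phi u -> class_solution phi v ->
 0 <= L -> 0 <= M -> l = 12 * KF * L + 1 ->
 (forall t, 0 <= t <= T -> forall j, Linf L (u t j) /\ Linf L (v t j)) ->
 (forall t, 0 <= t <= T -> td (u t) (v t) <= M * expR (l * t)) ->
 forall t, 0 <= t <= T -> td (u t) (v t) <= M / 2 * expR (l * t).
move=> [_ _ hu] [_ _ hv] L0 M0 el hL hM t /andP[t0 tT]; have K0 := KF_ge0 lam nu.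
have KL : 0 <= KF * L by pos.
have l0 : 0 < l by rewrite el -mulrA; lra.
apply: (via (3 * (M / 6 * expR (l * t)))); last by lra.
apply: td_le => j; apply/ler_addgt0Pr => e e0; have e2 : 0 < e / 2 by pos.
have [h eu /(_ _ e2)[d d0 hd]] := hu t t0 j; have [h' ev /(_ _ e2)[d' d'0 hd']] := hv t t0 j.
have dd : 0 < Num.min d d' by rewrite lt_min d0.
have [n [eta eta0 [en ed [P0 Pn Pk]]]] := uniform_partition t0 dd; move: ed; rewrite lt_min => /andP[ed ed'].
pose p k := k%:R * eta; have pS k : p k.+1 - p k = eta by rewrite /p -natr1 mulrDl mul1r addrAC subrr add0r.
have P x : eta < x -> tagged_part t x n p p.
 by move=> hx; split=> // k kn; have [h1 h2 _] := Pk k kn; rewrite pS.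
have {}hd := hd n p p (P d ed); have {}hd' := hd' n p p (P d' ed').
move: hd hd'; set S := riemann _ _ _ u _ _ _ _ _; set S' := riemann _ _ _ v _ _ _ _ _ => hd hd'.
have -> : u t j - v t j = - 'i *: (h - h').
 by rewrite eu ev scaleNr scalerBr !opprD !opprK addrACA subrr add0r.
rewrite nrmZ cmod_Ni mul1r.
have hS : nrm (S - S') <= M / 6 * expR (l * t).
 rewrite /S /S' /riemann -sumrB; apply: (letr (nrm_sum _ _ _)).
 apply: (via (\sum_(k < n) 2 * KF * L * M / l * (l * eta * expR (l * (k%:R * eta))))).
  apply: ler_sum => k _; rewrite -scalerBr -UB nrmZ nrm_U pS cmod_real (ger0_norm eta0).
  have kT : 0 <= p k <= T.
   rewrite mulr_ge0//=; apply: letr tT; rewrite -en; mr; rewrite ler_nat ltnW//.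
  have lu i : Linf L (u (p k) i) by have [] := hL _ kT i.
  have lv i : Linf L (v (p k) i) by have [] := hL _ kT i.
  have h1 := nrm_FL_lip lam nu j L0 lu lv.
  have h2 := hM _ kT; rewrite -/(p k).
  have -> : 2 * KF * L * M / l * (l * eta * expR (l * p k)) = eta * (2 * KF * L * (M * expR (l * p k))).
   by field; rewrite lt0r_neq0.
  apply: ler_wpM2l => //; apply: (letr h1); apply: ler_wpM2l => //; rewrite -mulrA; exact: mulr_ge0.
 have c0 : 0 <= 2 * KF * L * M / l.
  by pos.
 rewrite -mulr_sumr; apply: (letr (ler_wpM2l c0 (exp_riemann_sum n (ltW l0) eta0))).
 rewrite en; mr; rewrite ler_pdivrMr// el; have := mulr_ge0 KL M0; lra.
have t1 := nrm_tri S h h'; have t2 := nrm_tri S' S h'; rewrite (nrmBC h S) in t1; lra.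
Qed.

Lemma class_solution_unique phi u v : class_solution phi u -> class_solution phi v ->
 forall t, 0 <= t -> u t = v t.
move=> hu hv T T0; have [X hX] := class_solution_bounded hu T0; have [Y hY] := class_solution_bounded hv T0.
have TT : 0 <= T <= T by rewrite T0 lexx.
have X0 : 0 <= X by case: (hX T TT).
have Y0 : 0 <= Y by case: (hY T TT).
have E0 := Emb_ge0 s; pose L := Emb s * X + Emb s * Y.
have EX : 0 <= Emb s * X by pos.
have EY : 0 <= Emb s * Y by pos.
have L0 : 0 <= L by rewrite /L; lra.
have hL t : 0 <= t <= T -> forall j, Linf L (u t j) /\ Linf L (v t j).
 move=> ht j; have h1 := bdd_embedding m hs 0 (hX t ht) j; have h2 := bdd_embedding m hs 0 (hY t ht) j.
 by rewrite !U0 in h1 h2; split; [apply: Linf_le h1|apply: Linf_le h2]; rewrite /L; lra.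
pose l := 12 * KF * L + 1; pose M0 := 3 * (X + Y).
have M00 : 0 <= M0 by rewrite /M0; lra.
have l0 : 0 <= l by have := mulr_ge0 (KF_ge0 lam nu) L0; rewrite /l -mulrA; lra.
have H n t : 0 <= t <= T -> td (u t) (v t) <= M0 * 2^-1 ^+ n * expR (l * t).
 elim: n t => [|n IH] t ht.
  rewrite expr0 mulr1; apply: (via M0).
   apply: td_le => j; apply: (letr (nrmD _ _)); rewrite nrmN.
   have [_ /(_ j)[w1 _ w2 _]] := hX t ht; have [_ /(_ j)[w3 _ w4 _]] := hY t ht.
   by apply: lerD; [apply: letr w2|apply: letr w4]; exact: (nrm_wt hs).
  rewrite ler_peMr//; apply: letr (expR_ge1Dx _); rewrite lerDl mulr_ge0//; by case/andP: ht.
 have Mn : 0 <= M0 * 2^-1 ^+ n by pos.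
 by rewrite exprSr mulrA; exact: (duhamel_contraction hu hv L0 Mn erefl hL IH).
apply: td_eq0; apply: (@le_qqn_lim _ _ 0 (M0 * expR (l * T))) => n; rewrite add0r.
apply: (letr (H n T TT)); rewrite mulrAC; apply: ler_wpM2l; last exact: half_le_qqn.
by pos.
Qed.

End ClassUniqueness.

(** * Translation of the function spaces into conditions on classes *)

Section SobolevNorms.
Context {R : realType}.
Implicit Types (f h : plane R -> R[i]) (w : plane R -> @C3 R).

Lemma inW_cls r f : L2 f -> (inW r (cls f) <-> L2 (fun x => (bracket r x)%:C * f x)) /\
 (inW r (cls f) -> cls (fun x => (bracket r x)%:C * f x) = wt r (cls f)).
move=> f2; have mf : cmeas (fun x => (bracket r x)%:C * f x) by apply: cmeasM; [exact: cmeas_bracket|exact: L2_cmeas].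
have e : {ae mu, forall x, (bracket r x)%:C * cls f x = (bracket r x)%:C * f x} by apply: filterS (cls_ae f2) => x ->.
have i : inW r (cls f) <-> L2 (fun x => (bracket r x)%:C * f x).
 by split=> H; [exact: L2_ae e mf H|apply: L2_ae (inW_cmeas _ _) H; apply: filterS e => x ->].
split=> // H; apply: cls_eq => //; first exact/i.
by apply: filterS e => x ->.
Qed.

Lemma fourier_weight r f : L2 f ->
 (inW r (Fhat (cls f)) <-> L2 (fun xi => (bracket r xi)%:C * fourier f xi)) /\
 (inW r (Fhat (cls f)) -> L2 (bessel r f) /\ cls (bessel r f) = Finv (wt r (Fhat (cls f)))).
move=> f2; have [F2 eF] := fourierE f2; have [h1 h2] := inW_cls r F2; rewrite eF in h1 h2.
split=> [|H]; first exact: h1.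
have [h3 h4] := inv_fourierE (proj1 h1 H); split; first exact: h3.
by rewrite /bessel /fourier_mult h4 h2.
Qed.

Lemma propagator_cls m t f : L2 f -> L2 (propagator m t f) /\ cls (propagator m t f) = U m t (cls f).
move=> f2; have [F2 eF] := fourierE f2; have ms := measurable_symb m t.
have L : L2 (fun xi => cis (symb m t xi) * fourier f xi).
 by apply: (@L2Mb _ _ 1) => //; [exact: cmeas_cis|move=> x; rewrite cmod_cis].
have [h1 h2] := inv_fourierE L; split; first exact: h1.
rewrite /propagator /fourier_mult h2 /U -eF; congr Finv; apply: cls_eqP => //.
by apply: filterS2 (phase_ae (cls (fourier f)) ms) (cls_ae F2) => x -> ->.
Qed.

Definition cl w (j : 'I_3) : Lsq R := cls (entry w j).

Lemma in_XP s w : in_X s w <-> forall j, [/\ L2 (entry w j), inW s (cl w j) & inW s (Fhat (cl w j))].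
split=> [[h1 h2] j|h].
 have [e2 e3 _] := h1 j; have [_ _ e4] := h2 j.
 have [b1 b2] := fourier_weight s e2; have [c1 c2] := fourier_weight 0 e2.
 have [d1 d2] := c2 (proj1 (inW0 _)).
 split=> //; last exact/b1.
 have [d3 _] := inW_cls s d1; move/d3: e4; by rewrite d2 (proj2 (inW0 _)) FhatK.
split=> j; have [e2 e3 e4] := h j; have [b1 b2] := fourier_weight s e2; have [c1 c2] := fourier_weight 0 e2.
 have [d1 d2] := b2 e4; split=> //; first exact/b1.
 by have [d3 _] := inW_cls 0 d1; apply/d3; exact: (proj1 (inW0 _)).
have [d1 d2] := c2 (proj1 (inW0 _)); split=> //; first by apply/c1; exact: (proj1 (inW0 _)).
have [d3 _] := inW_cls s d1; apply/d3; by rewrite d2 (proj2 (inW0 _)) FhatK.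
Qed.

Lemma weighted_enorm r (b : 'I_3 -> plane R -> R[i]) : (forall j, L2 (fun x => (bracket r x)%:C * b j x)) ->
 ('N[mu]_2%:E[EFin \o (fun x => bracket r x * enorm (\row_j b j x))%R])%E =
 (sqrt (\sum_j nrm (cls (fun x => (bracket r x)%:C * b j x)) ^+ 2))%:E.
move=> hb; rewrite Lnorm2E.
rewrite (_ : (\int[mu]_x ((bracket r x * enorm (\row_j b j x)) ^+ 2)%:E =
 (\sum_j nrm (cls (fun x => (bracket r x)%:C * b j x)) ^+ 2)%:E)%E).
 by rewrite poweR_EFin powR12_sqrt// sumr_ge0// => j _; exact: sqr_ge0.
rewrite -sumEFin; under [RHS]eq_bigr do rewrite (nrm_sqr_int (hb _) (cls_ae (hb _))).
rewrite -ge0_integral_sum//; first last.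
- by pos.
- by move=> j; apply: measurable_cmod_sqr; exact: L2_cmeas (hb j).
apply: eq_integral => x _; rewrite sumEFin; congr EFin.
rewrite exprMn sqr_sqrtr; last by pos; by [].
rewrite mulr_sumr; apply: eq_bigr => j _.
by rewrite mxE cmodM cmod_real exprMn sqr_normr.
Qed.

Lemma HnormE s w : in_X s w ->
 Hnorm s 0 w = (sqrt (\sum_j nrm (wt s (Fhat (cl w j))) ^+ 2))%:E /\
 Hnorm 0 s w = (sqrt (\sum_j nrm (wt s (cl w j)) ^+ 2))%:E.
move=> hw; have [h1 h2] := hw; move/in_XP: hw => hw; split.
 rewrite /Hnorm weighted_enorm; last by move=> j; have [] := h1 j.
 congr (sqrt _)%:E; apply: eq_bigr => j _; have [e2 e3 e4] := hw j.
 have [_ /(_ e4)[d1 d2]] := fourier_weight s e2.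
 have [_ ->] := inW_cls 0 d1; last exact: (proj1 (inW0 _)).
 by rewrite (proj2 (inW0 _)) d2 nrm_Finv.
rewrite /Hnorm weighted_enorm; last by move=> j; have [] := h2 j.
congr (sqrt _)%:E; apply: eq_bigr => j _; have [e2 e3 e4] := hw j.
have [_ /(_ (proj1 (inW0 _)))[d1 d2]] := fourier_weight 0 e2.
rewrite (proj2 (inW0 _)) FhatK in d2.
by have [_] := inW_cls s d1; rewrite d2 => ->.
Qed.

Lemma sqrt_sum_le (x : 'I_3 -> R) (e : R) : (forall j, 0 <= x j <= e) -> sqrt (\sum_j x j ^+ 2) <= 2 * e.
move=> h; have e0 : 0 <= e by have /andP[] := h i1; exact: letr.
apply: le_sqr2; first exact: mulr_ge0.
rewrite sqr_sqrtr ?sum3; last by apply: addr_ge0; [apply: addr_ge0|]; exact: sqr_ge0.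
have S j : x j ^+ 2 <= e ^+ 2 by have /andP[] := h j; exact: sqr_le2.
by have := S i1; have := S i2; have := S i3; have := sqr_ge0 e; lra.
Qed.

Lemma le_sqrt_sum (x : 'I_3 -> R) j : 0 <= x j -> x j <= sqrt (\sum_j x j ^+ 2).
move=> h; apply: le_sqr2; first by [].
rewrite sqr_sqrtr; last by pos; by [].
by apply: (le_sum3 (F := fun l => x l ^+ 2)) => l; exact: sqr_ge0.
Qed.

Lemma in_X_sub s w w' : in_X s w -> in_X s w' ->
 in_X s (fun x => w x - w' x) /\ forall j, cl (fun x => w x - w' x) j = cl w j - cl w' j.
move=> /in_XP hw /in_XP hw'.
have e j : entry (fun x => w x - w' x) j = fun x => entry w j x - entry w' j x.
 by apply/funext => x; rewrite /entry !mxE.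
have ec j : cl (fun x => w x - w' x) j = cl w j - cl w' j.
 by rewrite /cl e clsB//; [have [] := hw j|have [] := hw' j].
split=> //; apply/in_XP => j; have [a1 a2 a3] := hw j; have [b1 b2 b3] := hw' j.
rewrite ec FhatB; split; first by rewrite e; exact: L2B.
 exact: (proj1 (inWB a2 b2)).
exact: (proj1 (inWB a3 b3)).
Qed.

Definition class_continuous s (u : R -> 'I_3 -> Lsq R) :=
 forall t0, 0 <= t0 -> forall e : R, 0 < e -> exists2 d : R, 0 < d & forall t, 0 <= t -> `|t - t0| < d ->
  forall j, nrm (wt s (u t j - u t0 j)) <= e /\ nrm (wt s (Fhat (u t j - u t0 j))) <= e.

Lemma continuous_XP s (u : R -> plane R -> C3) : (forall t, 0 <= t -> in_X s (u t)) ->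
 (continuous_X s u <-> class_continuous s (fun t => cl (u t))).
move=> hX; pose N t t0 := sqrt (\sum_j nrm (wt s (Fhat (cl (u t) j - cl (u t0) j))) ^+ 2) +
 sqrt (\sum_j nrm (wt s (cl (u t) j - cl (u t0) j)) ^+ 2).
have E t t0 : 0 <= t -> 0 <= t0 -> Xnorm s (fun x => u t x - u t0 x) = (N t t0)%:E.
 move=> t0' t00; have [h1 h2] := in_X_sub (hX t t0') (hX t0 t00); have [h3 h4] := HnormE h1.
 by rewrite /Xnorm h3 h4 -EFinD; congr (sqrt _ + sqrt _)%:E; apply: eq_bigr => j _; rewrite h2.
have N0 t t0 : 0 <= N t t0 by rewrite addr_ge0//.
split=> [[_ h] t0 t00 e e0|h]; last split=> // t0 t00.
 have := h t0 t00 => /fine_cvgP[_ /cvgr0Pnorm_le/(_ _ e0)] /nbhs_ballP[d d0 hd].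
 exists d => // t t0' td j; have := hd t; rewrite /ball /= distrC => /(_ td t0').
 rewrite E//= ger0_norm// => le.
 have h1 := @le_sqrt_sum (fun j => nrm (wt s (Fhat (cl (u t) j - cl (u t0) j)))) j (nrm_ge0 _).
 have h2 := @le_sqrt_sum (fun j => nrm (wt s (cl (u t) j - cl (u t0) j))) j (nrm_ge0 _).
 have := sqrtr_ge0 (\sum_j nrm (wt s (Fhat (cl (u t) j - cl (u t0) j))) ^+ 2).
 have := sqrtr_ge0 (\sum_j nrm (wt s (cl (u t) j - cl (u t0) j)) ^+ 2).
 move: le h1 h2; rewrite /N /= => le h1 h2 h3 h4; split; lra.
apply/fine_cvgP; split.
 by apply/nbhs_ballP; exists 1 => //= t _ t0'; rewrite E.
apply/cvgr0Pnorm_le => e e0; have [d d0 hd] := h t0 t00 (e / 4) (divr_gt0 e0 (ltr0n _ 4)).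
apply/nbhs_ballP; exists d => //= t; rewrite /ball /= distrC => td t0'.
rewrite E//= ger0_norm// /N.
have h1 := @sqrt_sum_le (fun j => nrm (wt s (Fhat (cl (u t) j - cl (u t0) j)))) (e / 4).
have h2 := @sqrt_sum_le (fun j => nrm (wt s (cl (u t) j - cl (u t0) j))) (e / 4).
have {}hd := hd t t0' td.
have -> : e = 2 * (e / 4) + 2 * (e / 4) by field.
by apply: lerD; [apply: h1|apply: h2] => j; rewrite nrm_ge0; have [] := hd j.
Qed.

End SobolevNorms.

(** * Equivalence of the two notions of solution, and conclusion *)

Section Solutions.
Context {R : realType}.
Variables (lam nu : 'I_3 -> R[i]) (m : 'I_3 -> R) (s : R).
Hypothesis hs : 1 < s < 2.
Implicit Types (phi : plane R -> @C3 R) (u : R -> plane R -> @C3 R).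

Lemma nonlin_cls (w : plane R -> C3) L j : (forall l, L2 (entry w l)) -> (forall l, Linf L (cl w l)) ->
 L2 (fun x => nonlin lam nu (w x) j) /\ cls (fun x => nonlin lam nu (w x) j) = FL lam nu (cl w) j.
move=> w2 hL; have F2 := FL_L2 lam nu hL j.
have e : {ae mu, forall x, Fz lam nu (fun l => cl w l x) j = nonlin lam nu (w x) j}.
 apply: filterS (ae_all3 (fun l => cls_ae (w2 l))) => x hx.
 by rewrite /Fz; congr nonlin; apply/rowP => l; rewrite mxE /cl hx.
have mN : cmeas (fun x => nonlin lam nu (w x) j).
 have -> : (fun x => nonlin lam nu (w x) j) = fun x => Fz lam nu (fun l => entry w l x) j.
  by apply/funext => x; rewrite /Fz; congr nonlin; apply/rowP => l; rewrite mxE.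
 by apply: Fz_cmeas => l; exact: L2_cmeas (w2 l).
split; first exact: L2_ae e mN F2.
apply: cls_eq => //; first exact: L2_ae e mN F2.
by apply: filterS e => x ->.
Qed.

Definition riem u (t : R) j (n : nat) (p c : nat -> R) : plane R -> R[i] :=
 fun x => \sum_(k < n) (p k.+1 - p k)%:C * propagator (m j) (t - c k) (fun y => nonlin lam nu (u (c k) y) j) x.

(** The Sobolev embedding bounds [u (c k)], so the nonlinearity is in L^2 and the propagator acts on
    it as [U] acts on its class. *)
Lemma riem_cls u t j n p c d : (forall t, 0 <= t -> in_X s (u t)) -> tagged_part t d n p c ->
 L2 (riem u t j n p c) /\ cls (riem u t j n p c) = riemann lam nu m (fun t => cl (u t)) t j n p c.
move=> hX P; have M := tagged_part_mono P; have [_ _ hp] := P.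
rewrite /riem /riemann.
have H k : (k < n)%N -> L2 (propagator (m j) (t - c k) (fun y => nonlin lam nu (u (c k) y) j)) /\
  cls (propagator (m j) (t - c k) (fun y => nonlin lam nu (u (c k) y) j)) = U (m j) (t - c k) (FL lam nu (cl (u (c k))) j).
 move=> kn; have [h1 _ _] := hp k kn; have /andP[h2 _] := M k (ltnW kn).
 have /in_XP hw := hX (c k) (letr h2 h1).
 pose L l := (2 * pi)^-1 * (sqrt (Csg s) * nrm (wt s (Fhat (cl (u (c k)) l)))).
 have s1 : 1 < s by case/andP: hs.
 have L0 l : 0 <= L l by rewrite mulr_ge0 ?mulr_ge0 ?sqrtr_ge0 ?nrm_ge0// invr_ge0 mulr_ge0// pi_ge0.
 have hL l : Linf (\sum_l L l) (cl (u (c k)) l).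
  have [_ _ w3] := hw l; apply: Linf_le (Linf_embedding s1 w3).
  exact: (le_sum3 (F := L)).
 have [n1 n2] := nonlin_cls j (fun l => let: And3 a _ _ := hw l in a) hL.
 by have [n3 n4] := propagator_cls (m j) (t - c k) n1; rewrite n4 n2.
elim: n {P M hp} H => [|n IH] H.
 rewrite big_ord0 (_ : (fun x => _) = fun=> 0); last by apply/funext => x; rewrite big_ord0.
 split; first exact: L2_0.
 by apply: cls_eqP; [exact: L2_0|apply: filterS (fn0 (R := R)) => x ->].
have [h1 h2] := IH (fun k kn => H k (ltnW kn)); have [h3 h4] := H n (ltnSn n).
rewrite (_ : (fun x => _) = fun x => (\sum_(k < n) (p k.+1 - p k)%:C * propagator (m j) (t - c k) (fun y => nonlin lam nu (u (c k) y) j) x) +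
 (p n.+1 - p n)%:C * propagator (m j) (t - c n) (fun y => nonlin lam nu (u (c n) y) j) x); last first.
 by apply/funext => x; rewrite big_ord_recr.
split; first by apply: L2D => //; exact: L2Z.
by rewrite clsD// ?clsZ// ?h2 ?h4 ?big_ord_recr//; exact: L2Z.
Qed.

Lemma global_solutionP phi u : in_X s phi -> (forall t, 0 <= t -> in_X s (u t)) ->
 (global_solution s m lam nu phi u <-> class_solution lam nu m s (cl phi) (fun t => cl (u t))).
move=> /in_XP hphi hX.
have hW t : 0 <= t -> forall j, inW s (cl (u t) j) /\ inW s (Fhat (cl (u t) j)).
 by move=> t0 j; have /in_XP/(_ j)[] := hX t t0.
have e2 t j : 0 <= t -> L2 (entry (u t) j) by move=> t0; have /in_XP/(_ j)[] := hX t t0.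
have p2 j : L2 (entry phi j) by have [] := hphi j.
split=> [[hc hd]|[_ hc hd]].
 split=> //; first exact/continuous_XP.
 move=> t t0 j; have [h [h2 hI] he] := hd t t0 j; exists (cls h).
  have [q1 q2] := propagator_cls (m j) t (p2 j).
  rewrite /cl -q2 -clsZ// -clsB//; last exact: L2Z.
  by apply: cls_eq => //; [exact: e2|apply: L2B => //; exact: L2Z].
 move=> e e0; have [d d0 hP] := hI e e0; exists d => // n p c P; have [P0 Pn Pk] := P.
 have [r1 <-] := riem_cls j hX P.
 have := hP n p c P0 Pn Pk; rewrite -/(riem u t j n p c) -clsB// -lte_fin -L2norm_nrm//; exact: L2B.
split; first exact/continuous_XP.
move=> t t0 j; have [h eh hI] := hd t t0 j; exists (fn h).
 split; first exact: fn_L2.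
 move=> e e0; have [d d0 hP] := hI e e0; exists d => // n p c P0 Pn Pk.
 have P : tagged_part t d n p c by [].
 have [r1 r2] := riem_cls j hX P; rewrite -/(riem u t j n p c).
 rewrite L2norm_nrm; last by apply: L2B => //; exact: fn_L2.
 by rewrite clsB ?cls_fn ?r2 ?lte_fin//; [exact: hP|exact: fn_L2].
have [q1 q2] := propagator_cls (m j) t (p2 j).
have := cls_ae (e2 t j t0); rewrite -/(cl (u t) j) eh /cl -q2 => H.
apply: filterS2 H (filterI (fnB (cls (propagator (m j) t (entry phi j))) ('i *: h)) (filterI (fnZ 'i h) (cls_ae q1))) => x <- [-> [-> ->]].
by [].
Qed.

Lemma Linfnorm_le (w : plane R -> C3) (L : R) : 0 <= L -> (forall l, {ae mu, forall x, cmod (w x 0 l) <= L}) ->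
 (Linfnorm w <= (2 * L)%:E)%E.
move=> L0 h; rewrite /Linfnorm unlock; case: ifPn => _; last by pos.
apply/ess_sup_inf.ess_supP; apply: filterS (ae_all3 h) => x hx; rewrite /= lee_fin ger0_norm ?sqrtr_ge0//.
by apply: sqrt_sum_le => j; rewrite cmod_ge0 hx.
Qed.

End Solutions.

Theorem theorem1p1 (R : realType) (m : 'I_3 -> R) (lambda mu : 'I_3 -> R[i])
    (s : R)
    (hm : forall j, m j != 0)
    (hlambda : forall j, lambda j != 0)
    (hmu : forall j, mu j != 0)
    (hmass : m i1 + m i2 = m i3)
    (hdiss : forall j, complex.Im (lambda j) < 0)
    (hkappa : exists kappa : 'I_3 -> R, (forall j, 0 < kappa j) /\
      (kappa i1)%:C * mu i1 + (kappa i2)%:C * mu i2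
        = (kappa i3)%:C * conjc (mu i3))
    (hs : 1 < s < 2) :
  exists2 eps0 : R, 0 < eps0 &
    forall phi : plane R -> C3,
      in_X s phi ->
      (Hnorm s 0 phi + Hnorm 0 s phi <= eps0%:E)%E ->
      exists u : R -> plane R -> C3,
        [/\ global_solution s m lambda mu phi u,
            forall v : R -> plane R -> C3,
              global_solution s m lambda mu phi v ->
              forall t : R, 0 <= t -> {ae leb2, forall x, v t x = u t x} &
            exists2 C1 : R, 0 < C1 &
              forall t : R, 0 <= t ->
                (Linfnorm (u t) <= (C1 / ((1 + t) * ln (2 + t)))%:E)%E].
Proof.
have [kap [kap0 hk]] := hkappa.
have [eps e0 H] := profile_exists hmass hm hs kap0 hdiss hk.
have [C1 C10 {}H] := H eps (introT andP (conj e0 (lexx _))).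
exists eps => // phi hphi hn.
have hi : inXe s eps (cl phi).
  split=> [|l]; first exact: ltW.
  move: hn; have [-> ->] := HnormE hphi; rewrite -EFinD lee_fin => le.
  have h1 := @le_sqrt_sum R (fun j => nrm (wt s (Fhat (cl phi j)))) l (nrm_ge0 _).
  have h2 := @le_sqrt_sum R (fun j => nrm (wt s (cl phi j))) l (nrm_ge0 _).
  have h3 := sqrtr_ge0 (\sum_j nrm (wt s (Fhat (cl phi j))) ^+ 2).
  have h4 := sqrtr_ge0 (\sum_j nrm (wt s (cl phi j)) ^+ 2).
  have /in_XP/(_ l)[_ w1 w2] := hphi.
  move: h1 h2 => /= h1 h2; split=> //; lra.
have [g [g0 hq hb hl]] := H (cl phi) hi.
have b0 : 0 <= aexp s / 2 by have /andP[h _] := aexp01 hs; rewrite divr_ge0// ltW.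
have sol := evolved_solution hm hs hi b0 g0 hq hl.
pose uc t j := U (m j) t (g t j).
(* The vectors are assembled from the chosen representatives, so that each [entry (u t) j] is
   literally the class [uc t j]. *)
pose u (t : R) : plane R -> C3 := fun x => \row_j uc t j x.
have eu t j : entry (u t) j = uc t j by apply/funext => x; rewrite /entry /u mxE.
have ecl t : cl (u t) = uc t by apply/funext => j; rewrite /cl eu cls_fn.
have eclf : (fun t => cl (u t)) = uc by apply/funext.
have hX t : 0 <= t -> in_X s (u t).
  move=> t0; apply/in_XP => j; rewrite ecl eu; have [hW _ _] := sol; have [w1 w2] := hW t t0 j.
  by split=> //; exact: fn_L2.
exists u; split.
- by apply/(global_solutionP lambda mu m hs hphi hX); rewrite eclf.
- move=> v hv t t0; have hXv : forall t, 0 <= t -> in_X s (v t) by case: hv => -[].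
  have /(global_solutionP _ _ _ hs hphi hXv) solv := hv.
  have e := class_solution_unique hs solv sol t0.
  have v2 j : L2 (entry (v t) j) by have /in_XP/(_ j)[] := hXv t t0.
  apply: filterS (ae_all3 (fun j => cls_ae (v2 j))) => x hx.
  by apply/rowP => j; rewrite -[LHS]hx -/(cl (v t) j) (congr1 (fun f => f j) e) /u mxE.
(* The factor 2 bounds sqrt 3, the passage from components to the Euclidean norm of C^3. *)
exists (2 * C1) => [|t t0]; first exact: mulr_gt0.
rewrite -mulrA; apply: Linfnorm_le.
  by rewrite divr_ge0 ?(ltW C10)// mulr_ge0 ?ln_ge0//; lra.
by move=> l; apply: filterS (hb t t0 l) => x; rewrite mxE.
Qed.
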